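(* Suppose $\alpha\in(0,1]$, let $I$ be an open subinterval of $\mathbb{R}$ containing $0$, and let $(\varphi_\tau)_{\tau\in I}$ be a real-analytic family of potentials in $C^\alpha(\mathbb{R})$ having a phase transition at $0$, that is, such that the function $\tau\mapsto P(\varphi_\tau)$ fails to be real-analytic at $0$. Then $\varphi_0$ undergoes a phase transition in temperature and its phase transition parameter $\beta_{\mathrm{crit},\alpha}(\varphi_0)$ is equal to $1$.
   Context: Let $\alpha\in(0,+\infty)$ and let $f\colon[0,1]\to[0,1]$ be the intermittent map given by $f(x)=x(1+x^{\alpha})$ if $x(1+x^{\alpha})\le 1$, and $f(x)=x(1+x^{\alpha})-1$ otherwise. Let $\mathscr{M}$ be the set of Borel probability measures on $[0,1]$ invariant by $f$; for $\nu\in\mathscr{M}$ let $h_\nu$ be its measure-theoretic entropy. For $\gamma\in(0,1]$, $C^{\gamma}(\mathbb{R})$ (resp. $C^\gamma(\mathbb{C})$) is the Banach space of real-valued (resp. complex-valued) $\gamma$-Hölder continuous functions on $[0,1]$ with norm $\|\varphi\|_\gamma=\sup_{[0,1]}|\varphi|+\sup_{x\ne y}|\varphi(x)-\varphi(y)|/|x-y|^\gamma$. For a continuous $\varphi\colon[0,1]\to\mathbb{R}$ (a potential), the pressure is $P(\varphi)=\sup\{h_\nu+\int\varphi\,d\nu:\nu\in\mathscr{M}\}$. A family $(\varphi_\tau)_{\tau\in I}$ in $C^\gamma(\mathbb{R})$ is real-analytic if the map $\tau\mapsto\varphi_\tau$ extends to a holomorphic map from an open subset of $\mathbb{C}$ containing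 $I$ to $C^\gamma(\mathbb{C})$, holomorphic meaning complex-differentiable in the norm $\|\cdot\|_\gamma$ at every point. A Hölder continuous potential $\varphi$ undergoes a phase transition in temperature if the function $\beta\mapsto P(\beta\varphi)$ fails to be real-analytic on $(0,+\infty)$; in that case there is a unique point of $(0,+\infty)$ at which this function fails to be real-analytic, called the phase transition parameter of $\varphi$. For $\varphi\in C^\gamma(\mathbb{R})$, $\beta_{\mathrm{crit},\gamma}(\varphi)\in(0,+\infty]$ is the phase transition parameter of $\varphi$ if $\varphi$ undergoes a phase transition in temperature, and $+\infty$ otherwise. *)

(* Defs.v *)
From HB Require Import structures.
From mathcomp Require Import all_boot all_order all_algebra.
From mathcomp Require Import all_classical all_reals all_analysis.
From mathcomp Require Import complex.
Set Implicit Arguments.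
Unset Strict Implicit.
Unset Printing Implicit Defensive.
Import Order.TTheory GRing.Theory Num.Theory.
Import numFieldNormedType.Exports.
Local Open Scope classical_set_scope.
Local Open Scope ring_scope.
Local Open Scope complex_scope.

(* Functions and measures on the unit interval are encoded as functions and
   Borel measures on R: functions are only ever looked at on the unit interval, and the
   measures considered give full mass to it. *)

Definition unit_itv (R : realType) : set R := `[0, 1]%classic.
Arguments unit_itv : clear implicits.

(* Only meant for 0 < alpha; then 0 `^ alpha = 0, so 0 is a fixed point. *)
Definition intermittent (R : realType) (alpha : R) (x : R) : R :=
  let y := x * (1 + x `^ alpha) in if y <= 1 then y else y - 1.

Definition invariant_probability (R : realType) (f : R -> R)
    (nu : probability (measurableTypeR R) R) : Prop :=
  nu (unit_itv R) = 1%E /\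
  forall A : set (measurableTypeR R), measurable A ->
    nu (unit_itv R `&` f @^-1` A) = nu A.

(* A finite measurable partition is given by its labelling function
   xi : R -> 'I_k; empty cells are allowed. *)
Definition measurable_labelling (R : realType) (k : nat) (xi : R -> 'I_k) :
    Prop :=
  forall i : 'I_k, measurable (xi @^-1` [set i] : set (measurableTypeR R)).

(* The cell, in the join of the preimages under f^0, ..., f^(n-1) of the
   partition xi, of the points with itinerary w. *)
Definition join_cell (R : realType) (f : R -> R) (k n : nat) (xi : R -> 'I_k)
    (w : {ffun 'I_n -> 'I_k}) : set R :=
  [set x | unit_itv R x /\ forall j : 'I_n, xi (iter j f x) = w j].

(* The convention 0 ln 0 = 0 holds since ln is a total function. *)
Definition join_entropy (R : realType) (f : R -> R)
    (nu : probability (measurableTypeR R) R) (k : nat) (xi : R -> 'I_k)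
    (n : nat) : R :=
  - \sum_(w : {ffun 'I_n -> 'I_k})
      let p := fine (nu (join_cell f xi w)) in p * ln p.

(* For an invariant nu the limit exists, the join entropies being subadditive. *)
Definition partition_entropy (R : realType) (f : R -> R)
    (nu : probability (measurableTypeR R) R) (k : nat) (xi : R -> 'I_k) : R :=
  limn (fun n => join_entropy f nu xi n / n%:R).

Definition measure_entropy (R : realType) (f : R -> R)
    (nu : probability (measurableTypeR R) R) : \bar R :=
  ereal_sup [set h | exists (k : nat) (xi : R -> 'I_k),
    measurable_labelling xi /\ h = (partition_entropy f nu xi)%:E].

Definition pressure_ereal (R : realType) (f : R -> R) (phi : R -> R) : \bar R :=
  ereal_sup [set p | exists nu : probability (measurableTypeR R) R,
    invariant_probability f nu /\
    p = (measure_entropy f nu + \int[nu]_(x in unit_itv R) (phi x)%:E)%E].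

(* For the intermittent map and a continuous potential the supremum is finite:
   the entropy of an invariant measure is at most ln 2. *)
Definition pressure (R : realType) (f : R -> R) (phi : R -> R) : R :=
  fine (pressure_ereal f phi).

(* Valued in \bar R, so that a function that is not Hoelder continuous has
   norm +oo. *)
Definition holder_norm (R : realType) (V : normedZmodType R) (gamma : R)
    (phi : R -> V) : \bar R :=
  (ereal_sup [set `|phi x|%:E | x in unit_itv R] +
   ereal_sup [set (`|phi xy.1 - phi xy.2| / `|xy.1 - xy.2| `^ gamma)%:E |
     xy in [set xy : R * R | [/\ unit_itv R xy.1,
                                 unit_itv R xy.2 & xy.1 != xy.2]]])%E.

Definition holder (R : realType) (V : normedZmodType R) (gamma : R)
    (phi : R -> V) : Prop :=
  (holder_norm gamma phi < +oo)%E.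

(* The topology of the complex plane is the one of R[i] as a numFieldType; the
   modulus with values in R is the norm of its alias Rcomplex R. *)
Definition cplx (R : realType) : numFieldType := R[i].

Definition holomorphic_holder (R : realType) (gamma : R) (U : set (cplx R))
    (Phi : cplx R -> R -> Rcomplex R) : Prop :=
  forall z, U z -> holder gamma (Phi z) /\
  exists2 D : R -> Rcomplex R, holder gamma D &
    holder_norm gamma
      (fun x => (Phi w x - Phi z x) / (w - z) - D x : Rcomplex R)
      @[w --> z^'] --> 0%E.

Definition real_analytic_family (R : realType) (gamma : R) (I : set R)
    (phi : R -> R -> R) : Prop :=
  (forall tau, I tau -> holder gamma (phi tau)) /\
  exists (U : set (cplx R)) (Phi : cplx R -> R -> Rcomplex R),
    [/\ open U,
        forall tau : R, I tau -> U tau%:C,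
        holomorphic_holder gamma U Phi &
        forall tau x : R, I tau -> unit_itv R x ->
          Phi tau%:C x = (phi tau x)%:C].

Definition real_analytic_at (R : realType) (g : R -> R) (t : R) : Prop :=
  exists a : R^nat, exists2 r : R, 0 < r &
    forall h : R, `|h| < r -> pseries a h @ \oo --> g (t + h).

Definition pressure_temp (R : realType) (f phi : R -> R) (beta : R) : R :=
  pressure f (fun x => beta * phi x).

Definition phase_transition_in_temperature (R : realType) (f phi : R -> R) :
    Prop :=
  ~ (forall beta : R, 0 < beta ->
       real_analytic_at (pressure_temp f phi) beta).

Definition is_phase_transition_parameter (R : realType) (f phi : R -> R)
    (b : R) : Prop :=
  [/\ 0 < b,
      ~ real_analytic_at (pressure_temp f phi) b &
      forall b' : R, 0 < b' ->
        ~ real_analytic_at (pressure_temp f phi) b' -> b' = b].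

(* The Hoelder exponent of the space in which phi is taken plays no role in the
   value, hence is not an argument. The default value 0 of xget is not a
   possible phase transition parameter. *)
Definition beta_crit (R : realType) (f phi : R -> R) : \bar R :=
  if `[< phase_transition_in_temperature f phi >]
  then (xget 0 [set b | is_phase_transition_parameter f phi b])%:E
  else +oo%E.

(* Main.v *)
(** The pressure of a Hoelder potential [phi] is the exponential growth rate of the partition
    sums over the inverse branches [g_0], [g_1]: Gibbs' inequality bounds it from above, block
    Bernoulli measures approach it from below.

    Inducing on the right branch gives the operators [M] with weights
    [exp (sum_(j <= k) phi (g_0^j g_1 x) - p (k + 1))], which decay exponentially in [k] when
    [p > phi 0].  On Hoelder functions [1 - Q], where [Q u = M u - kap (M u)(0) 1] for a small
    [kap > 0], is invertible, and [F = kap (M (1 - Q)^-1 1)(0) - 1] vanishes at [p = P(phi)], is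
    complex differentiable in the potential and in [p], and has a nonzero derivative in [p].  By
    the implicit function theorem and Goursat's theorem, [tau |-> P(phi_tau)] is analytic at [0]
    as soon as [P(phi_0) > phi_0 0].

    Hence a transition at [0] forces [P(phi_0) = phi_0 0].  If [P(b phi_0) = b phi_0 0] held for
    some [b < 1], then [P(phi_tau) = phi_tau 0] for all [phi_tau] close to [phi_0]: the growth of
    the partition sums for [b phi_0] controls the Birkhoff sums of a perturbation, because
    lengthening the excursions near [0] yields many words with comparable sums.  That would make
    [tau |-> P(phi_tau)] analytic at [0].  So [P(b phi_0) > b phi_0 0] for [b < 1] while
    [P(b phi_0) = b phi_0 0] for [b >= 1]: the pressure is analytic away from [1], and at [1] the
    identity theorem for power series excludes analyticity. *)

From HB Require Import structures.
Require Import Defs.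
From mathcomp Require Import all_boot all_order all_algebra.
From mathcomp Require Import all_classical all_reals all_analysis.
From mathcomp Require Import measurable_realfun complex.
From mathcomp Require Import ring lra zify.
Set Implicit Arguments.
Unset Strict Implicit.
Unset Printing Implicit Defensive.
Import Order.TTheory GRing.Theory Num.Theory.
Import numFieldNormedType.Exports.
Local Open Scope classical_set_scope.
Local Open Scope ring_scope.
Local Open Scope complex_scope.
Local Notation Re := complex.Re.
Local Notation Im := complex.Im.

(** * Complex numbers *)

Section complex_numbers.
Context {R : realType}.
Local Notation K := R[i]%C.
Implicit Types (z w : K) (x y : R).

Definition rc (x : R) : K := Complex x 0.
Definition ic : K := Complex 0 1.

Lemma ReE_add z w : Re (z + w) = Re z + Re w. Proof. by case: z w => [a b] [c d]. Qed.
Lemma ImE_add z w : Im (z + w) = Im z + Im w. Proof. by case: z w => [a b] [c d]. Qed.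
Lemma ReE_opp z : Re (- z) = - Re z. Proof. by case: z. Qed.
Lemma ImE_opp z : Im (- z) = - Im z. Proof. by case: z. Qed.
Lemma ReE_mul z w : Re (z * w) = Re z * Re w - Im z * Im w.
Proof. by case: z w => [a b] [c d]. Qed.
Lemma ImE_mul z w : Im (z * w) = Re z * Im w + Im z * Re w.
Proof. by case: z w => [a b] [c d]. Qed.
Definition ReIm := (ReE_add, ImE_add, ReE_opp, ImE_opp, ReE_mul, ImE_mul).

Lemma complex_ext z w : Re z = Re w -> Im z = Im w -> z = w.
Proof. by case: z w => [a b] [c d] /= -> ->. Qed.

Lemma rcD x y : rc (x + y) = rc x + rc y.
Proof. by apply: complex_ext; rewrite !ReIm /= ?addr0. Qed.
Lemma rcN x : rc (- x) = - rc x.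
Proof. by apply: complex_ext; rewrite !ReIm /= ?oppr0. Qed.
Lemma rcB x y : rc (x - y) = rc x - rc y.
Proof. by rewrite rcD rcN. Qed.
Lemma rcM x y : rc (x * y) = rc x * rc y.
Proof. by apply: complex_ext; rewrite !ReIm /=; ring. Qed.
Lemma rc0 : rc 0 = 0. Proof. by []. Qed.
Lemma rc1 : rc 1 = 1. Proof. by []. Qed.

Definition cn (z : K) : R := Num.sqrt (Re z ^+ 2 + Im z ^+ 2).

Lemma cn_Rcomplex z : cn z = `|z : Rcomplex R|.
Proof. by case: z. Qed.
Lemma cnM z w : cn (z * w) = cn z * cn w.
Proof. by rewrite !cn_Rcomplex; exact: (ComplexField.Normc.normcM z w). Qed.
Lemma cnD z w : cn (z + w) <= cn z + cn w.
Proof. by rewrite !cn_Rcomplex; exact: (ler_normD (z : Rcomplex R) w). Qed.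
Lemma cnN z : cn (- z) = cn z.
Proof. by rewrite !cn_Rcomplex; exact: (normrN (z : Rcomplex R)). Qed.
Lemma cn_ge0 z : 0 <= cn z.
Proof. exact: sqrtr_ge0. Qed.
Lemma cn_rc x : cn (rc x) = `|x|.
Proof. by rewrite /cn /= expr0n /= addr0 sqrtr_sqr. Qed.
Lemma cn0 : cn 0 = 0.
Proof. by rewrite -rc0 cn_rc normr0. Qed.
Lemma cn1 : cn 1 = 1.
Proof. by rewrite -rc1 cn_rc normr1. Qed.
Lemma cn_ic : cn ic = 1.
Proof. by rewrite /cn /= expr0n /= add0r expr1n sqrtr1. Qed.
Lemma cn_eq0 z : (cn z == 0) = (z == 0).
Proof. by rewrite cn_Rcomplex; exact: (normr_eq0 (z : Rcomplex R)). Qed.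
Lemma cn_gt0 z : (0 < cn z) = (z != 0).
Proof. by rewrite lt_neqAle cn_ge0 andbT eq_sym cn_eq0. Qed.
Lemma cnB z w : cn (z - w) <= cn z + cn w.
Proof. by rewrite (le_trans (cnD _ _))// cnN. Qed.
Lemma cn_distC z w : cn (z - w) = cn (w - z).
Proof. by rewrite -cnN opprB. Qed.
Lemma cnX z n : cn (z ^+ n) = cn z ^+ n.
Proof. by elim: n => [|n IH]; rewrite ?expr0 ?cn1// !exprS cnM IH. Qed.
Lemma cnV z : cn z^-1 = (cn z)^-1.
Proof.
have [->|z0] := eqVneq z 0; first by rewrite invr0 cn0 invr0.
have zn0 : cn z != 0 by rewrite cn_eq0.
by apply: (mulfI zn0); rewrite -cnM divff// divff// cn1.
Qed.
Lemma cn_sum (I : Type) (r : seq I) (P : pred I) (F : I -> K) :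
  cn (\sum_(i <- r | P i) F i) <= \sum_(i <- r | P i) cn (F i).
Proof.
elim/big_ind2 : _ => //; first by rewrite cn0.
by move=> x1 x2 y1 y2 h1 h2; exact: le_trans (cnD _ _) (lerD h1 h2).
Qed.

Lemma Re_le_cn z : `|Re z| <= cn z.
Proof.
rewrite -[leLHS]sqrtr_sqr ler_sqrt ?addr_ge0 ?sqr_ge0//.
by rewrite lerDl sqr_ge0.
Qed.
Lemma Im_le_cn z : `|Im z| <= cn z.
Proof.
rewrite -[leLHS]sqrtr_sqr ler_sqrt ?addr_ge0 ?sqr_ge0//.
by rewrite lerDr sqr_ge0.
Qed.
Lemma ReIm_decomp z : z = rc (Re z) + ic * rc (Im z).
Proof. by apply: complex_ext; rewrite !ReIm /=; ring. Qed.
Lemma cn_le_ReIm z : cn z <= `|Re z| + `|Im z|.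
Proof.
rewrite {1}(ReIm_decomp z) (le_trans (cnD _ _))//.
by rewrite cnM cn_ic mul1r !cn_rc.
Qed.

End complex_numbers.

(** * Goursat's theorem and power series *)

Section segment_integrals.
Context {R : realType}.
Local Notation K := R[i].
Local Notation mu := (@lebesgue_measure R).

Definition rint (a b : R) (h : R -> R) : R := (\int[mu]_(x in `[a, b]) h x)%R.
Definition rcont_on (a b : R) (h : R -> R) :=
  forall x, a <= x <= b -> {for x, continuous h}.

Lemma rcont_integrable a b h : rcont_on a b h ->
  mu.-integrable `[a, b] (EFin \o h).
Proof.
move=> hc; apply: continuous_compact_integrable; first exact: segment_compact.
apply: continuous_in_subspaceT => x; rewrite inE /= in_itv /=; exact: hc.
Qed.

Lemma rintD a b f g : rcont_on a b f -> rcont_on a b g ->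
  rint a b (fun x => f x + g x) = rint a b f + rint a b g.
Proof. by move=> cf cg; rewrite /rint RintegralD//; exact: rcont_integrable. Qed.

Lemma rintZ a b f c : rcont_on a b f ->
  rint a b (fun x => c * f x) = c * rint a b f.
Proof. by move=> cf; rewrite /rint RintegralZl//; exact: rcont_integrable. Qed.

Lemma rint_cst a b c : a <= b -> rint a b (fun=> c) = c * (b - a).
Proof.
move=> ab; rewrite /rint Rintegral_cst//; congr (_ * _).
have := @lebesgue_measure_itv R `[a, b]; rewrite /= lte_fin => ->.
have [->|ab'] := eqVneq a b; first by rewrite ltxx subrr.
by rewrite lt_neqAle ab' ab.
Qed.

Lemma rint_le_bound a b f (M : R) : a <= b -> rcont_on a b f ->
  (forall x, a <= x <= b -> `|f x| <= M) -> `|rint a b f| <= M * (b - a).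
Proof.
move=> ab cf fM; rewrite -(rint_cst M ab).
apply: le_trans (le_normr_Rintegral _ (rcont_integrable cf)) _ => //.
apply: le_Rintegral => //.
- by apply: (@rcont_integrable _ _ (fun x => `|f x|)) => x /cf fx; exact: cvg_norm.
- by apply: (@rcont_integrable _ _ (fun=> M)) => x _; exact: cst_continuous.
Qed.

Lemma rint_split a b c f : a <= b -> b <= c -> rcont_on a c f ->
  rint a c f = rint a b f + rint b c f.
Proof.
move=> ab bc cf.
have itf := rcont_integrable cf.
have /= := @Rintegral_itvB _ f (BLeft a) (BRight c) b itf.
rewrite !bnd_simp => /(_ ab bc) E.
rewrite /rint addrC; apply/eqP; rewrite -subr_eq; apply/eqP; rewrite E.
apply: Rintegral_itv_obnd_cbnd.
apply: integrableS itf => //; apply: subset_itvr.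
by rewrite bnd_simp.
Qed.

Lemma rint_FTC a b (F f : R -> R) : a <= b -> rcont_on a b f ->
  (forall x : R, is_derive x (1 : R) F (f x)) -> rint a b f = F b - F a.
Proof.
rewrite le_eqVlt => /predU1P[<-|ab] cf dF.
  by rewrite subrr /rint set_itv1 Rintegral_set1.
have cF : continuous F.
  move=> x; apply: differentiable_continuous; apply/derivable1_diffP.
  by have [] := dF x.
rewrite /rint /Rintegral (@continuous_FTC2 _ f F)//.
- apply: continuous_in_subspaceT => x; rewrite inE /= in_itv /=; exact: cf.
- split; first by move=> x _; have [] := dF x.
  + by apply: cvg_at_right_filter; exact: cF.
  + by apply: cvg_at_left_filter; exact: cF.
- by move=> x _; rewrite derive1E; have [] := dF x.
Qed.

Lemma rint_id a b : a <= b -> rint a b id = (b ^+ 2 - a ^+ 2) / 2.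
Proof.
move=> ab.
have D (x : R) : is_derive x (1 : R) ((2^-1 : R) \*: ((id : R -> R) ^+ 2)) x.
  by apply: is_derive_eq; rewrite /GRing.scale /=; field.
rewrite (rint_FTC ab _ D); last by move=> x _; exact: cvg_id.
by rewrite /= /GRing.scale /= !exprfctE; field.
Qed.

Definition cont_at (h : R -> K) (x : R) := forall e : R, 0 < e ->
  exists2 d : R, 0 < d & forall y, `|y - x| < d -> cn (h y - h x) < e.
Definition cont_on (a b : R) (h : R -> K) := forall x, a <= x <= b -> cont_at h x.
Definition cint (a b : R) (h : R -> K) : K :=
  Complex (rint a b (fun x => Re (h x))) (rint a b (fun x => Im (h x))).

Lemma cont_on_Re a b h : cont_on a b h -> rcont_on a b (fun x => Re (h x)).
Proof.
move=> ch x /ch cx; apply/cvgrPdist_lt => e e0.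
have [d d0 hd] := cx _ e0.
apply/nbhs_ballP; exists d => //= y; rewrite /ball /= distrC => /hd xy.
by rewrite distrC -ReE_opp -ReE_add; apply: le_lt_trans (Re_le_cn _) xy.
Qed.

Lemma cont_on_Im a b h : cont_on a b h -> rcont_on a b (fun x => Im (h x)).
Proof.
move=> ch x /ch cx; apply/cvgrPdist_lt => e e0.
have [d d0 hd] := cx _ e0.
apply/nbhs_ballP; exists d => //= y; rewrite /ball /= distrC => /hd xy.
by rewrite distrC -ImE_opp -ImE_add; apply: le_lt_trans (Im_le_cn _) xy.
Qed.

Lemma cont_onS a b c d h : a <= c -> d <= b -> cont_on a b h -> cont_on c d h.
Proof.
move=> ac db ch x /andP[cx xd]; apply: ch.
by rewrite (le_trans ac cx) (le_trans xd db).
Qed.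

Lemma cont_on_cst a b (c : K) : cont_on a b (fun=> c).
Proof. by move=> x _ e e0; exists 1 => // y _; rewrite subrr cn0. Qed.

Lemma cont_onD a b f g : cont_on a b f -> cont_on a b g ->
  cont_on a b (fun x => f x + g x).
Proof.
move=> cf cg x xab e e0.
have e20 : 0 < e / 2 by rewrite divr_gt0.
have [d1 d10 h1] := cf x xab _ e20; have [d2 d20 h2] := cg x xab _ e20.
exists (Num.min d1 d2); first by rewrite lt_min d10.
move=> y; rewrite lt_min => /andP[/h1 y1 /h2 y2].
rewrite opprD addrACA; apply: le_lt_trans (cnD _ _) _.
by rewrite (splitr e) ltrD.
Qed.

Lemma cont_onZ a b (c : K) f : cont_on a b f -> cont_on a b (fun x => c * f x).
Proof.
move=> cf x xab e e0.
have c10 : 0 < cn c + 1 by rewrite ltr_wpDl ?cn_ge0.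
have [d d0 h] := cf x xab _ (divr_gt0 e0 c10).
exists d => // y /h; rewrite ltr_pdivlMr// => {}h.
rewrite -mulrBr cnM; apply: le_lt_trans h.
by rewrite mulrC ler_wpM2l ?cn_ge0// lerDl.
Qed.

Lemma cintD a b f g : cont_on a b f -> cont_on a b g ->
  cint a b (fun x => f x + g x) = cint a b f + cint a b g.
Proof.
move=> cf cg; apply: complex_ext; rewrite !ReIm /=.
  rewrite -rintD; [|exact: cont_on_Re..].
  by congr rint; apply/funext => x; rewrite ReIm.
rewrite -rintD; [|exact: cont_on_Im..].
by congr rint; apply/funext => x; rewrite ReIm.
Qed.

Lemma cintZ a b (c : K) f : cont_on a b f ->
  cint a b (fun x => c * f x) = c * cint a b f.
Proof.
move=> cf; have cR := cont_on_Re cf; have cI := cont_on_Im cf.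
have cZ (k : R) h : rcont_on a b h -> rcont_on a b (fun x => k * h x).
  by move=> ch x /ch hx; apply: cvgM => //; exact: cvg_cst.
apply: complex_ext; rewrite !ReIm /= -!rintZ//.
  rewrite -mulN1r -!rintZ//; last exact: cZ.
  rewrite -rintD; [|exact: cZ|exact: (cZ _ _ (cZ _ _ cI))].
  by congr rint; apply/funext => x; rewrite ReIm mulN1r.
rewrite -rintD; [|exact: cZ..].
by congr rint; apply/funext => x; rewrite ReIm.
Qed.

Lemma cint_bound a b f (M : R) : a <= b -> cont_on a b f ->
  (forall x, a <= x <= b -> cn (f x) <= M) -> cn (cint a b f) <= 2 * M * (b - a).
Proof.
move=> ab cf fM; apply: le_trans (cn_le_ReIm _) _.
rewrite mulrDl mul1r mulrDl /=; apply: lerD.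
  apply: rint_le_bound ab (cont_on_Re cf) _ => x /fM; exact: le_trans (Re_le_cn _).
apply: rint_le_bound ab (cont_on_Im cf) _ => x /fM; exact: le_trans (Im_le_cn _).
Qed.

Lemma cint_split a b c f : a <= b -> b <= c -> cont_on a c f ->
  cint a c f = cint a b f + cint b c f.
Proof.
move=> ab bc cf; apply: complex_ext; rewrite !ReIm /= -?rint_split//.
- exact: cont_on_Re.
- exact: cont_on_Im.
Qed.

Lemma cint_cst a b (c : K) : a <= b -> cint a b (fun=> c) = c * rc (b - a).
Proof. by move=> ab; apply: complex_ext; rewrite !ReIm /= rint_cst//; ring. Qed.

Lemma cont_on_rc a b : cont_on a b rc.
Proof. by move=> x _ e e0; exists e => // y ; rewrite -rcB cn_rc. Qed.

Lemma cint_rc a b : a <= b -> cint a b rc = rc ((b ^+ 2 - a ^+ 2) / 2).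
Proof.
move=> ab; rewrite /cint /= rint_cst// mul0r; congr (Complex _ _).
exact: rint_id.
Qed.

Lemma cint_point c (h : R -> K) : cint c c h = 0.
Proof. by apply: complex_ext; rewrite /= /rint set_itv1 Rintegral_set1. Qed.

End segment_integrals.
Opaque cint.

Section goursat.
Context {R : realType}.
Local Notation K := R[i].
Implicit Types (u : R -> R -> K) (a b c d s t : R).

Lemma nested_segments (p q : nat -> R) :
  (forall n, p n <= p n.+1) -> (forall n, q n.+1 <= q n) ->
  (forall n, p n <= q n) -> exists s, forall n, p n <= s <= q n.
Proof.
move=> pS qS pq.
have /nondecreasing_seqP pm := pS.
have /nonincreasing_seqP qm := qS.
have pqmn m n : p m <= q n.
  apply: le_trans (pm _ _ (leq_maxl m n)) _.
  exact: le_trans (pq _) (qm _ _ (leq_maxr m n)).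
have ub n : ubound (range p) (q n) by move=> _ [m _ <-].
exists (sup (range p)) => n; apply/andP; split.
  by apply: ub_le_sup; [exists (q 0%N); exact: ub|exists n].
by apply: ge_sup; [exists (p 0%N), 0%N|exact: ub].
Qed.

Definition cdiff2 u s t := exists d : K, forall e : R, 0 < e ->
  exists2 del : R, 0 < del & forall s' t', `|s' - s| < del -> `|t' - t| < del ->
    cn (u s' t' - u s t - d * (rc (s' - s) + ic * rc (t' - t)))
      <= e * (`|s' - s| + `|t' - t|).

Lemma cdiff2_cont u s t : cdiff2 u s t ->
  forall e : R, 0 < e -> exists2 del : R, 0 < del & forall s' t',
    `|s' - s| < del -> `|t' - t| < del -> cn (u s' t' - u s t) < e.
Proof.
case=> d hd e e0; have [del del0 h] := hd 1 ltr01.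
pose M := 2 * (cn d + 1) + 1.
have cd0 := cn_ge0 d.
have M0 : 0 < M by rewrite /M; nra.
exists (Num.min del (e / M)); first by rewrite lt_min del0 divr_gt0.
move=> s' t'; rewrite !lt_min => /andP[s1 s2] /andP[t1 t2].
have {}h := h _ _ s1 t1; rewrite !ltr_pdivlMr// in s2 t2.
set v := d * _ in h.
have vle : cn v <= cn d * (`|s' - s| + `|t' - t|).
  rewrite cnM ler_wpM2l// (le_trans (cnD _ _))// cnM cn_ic mul1r !cn_rc//.
have -> : u s' t' - u s t = (u s' t' - u s t - v) + v by rewrite subrK.
apply: le_lt_trans (cnD _ _) _; apply: le_lt_trans (lerD h vle) _.
move: s2 t2; rewrite /M; set x := `|_|; set y := `|_| => s2 t2.
have x0 : 0 <= x by exact: normr_ge0.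
have y0 : 0 <= y by exact: normr_ge0.
nra.
Qed.

Definition rcont2 u a b c d :=
  (forall t, c <= t <= d -> cont_on a b (fun s => u s t)) /\
  (forall s, a <= s <= b -> cont_on c d (u s)).

Lemma rcont2S u a b c d a' b' c' d' : a <= a' -> b' <= b -> c <= c' -> d' <= d ->
  rcont2 u a b c d -> rcont2 u a' b' c' d'.
Proof.
move=> aa bb cc dd [h1 h2]; split.
  move=> t /andP[ct td]; apply: (cont_onS aa bb); apply: h1.
  by rewrite (le_trans cc ct) (le_trans td dd).
move=> s /andP[ct td]; apply: (cont_onS cc dd); apply: h2.
by rewrite (le_trans aa ct) (le_trans td bb).
Qed.

Lemma cdiff2_rcont2 u a b c d :
  (forall s t, a <= s <= b -> c <= t <= d -> cdiff2 u s t) -> rcont2 u a b c d.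
Proof.
move=> h; split.
  move=> t ct s sab e e0; have [del del0 hd] := cdiff2_cont (h _ _ sab ct) e0.
  by exists del => // y ys; apply: hd => //; rewrite subrr normr0.
move=> s sab t ct e e0; have [del del0 hd] := cdiff2_cont (h _ _ sab ct) e0.
by exists del => // y ys; apply: hd => //; rewrite subrr normr0.
Qed.

Definition crect u a b c d : K :=
  cint a b (fun s => u s c) + ic * cint c d (u b)
  - cint a b (fun s => u s d) - ic * cint c d (u a).

Lemma crect_split1 u a m b c d : a <= m -> m <= b -> c <= d ->
  rcont2 u a b c d -> crect u a b c d = crect u a m c d + crect u m b c d.
Proof.
move=> am mb cd [h1 h2]; rewrite /crect.
rewrite (@cint_split _ a m b (fun s => u s c)) //; last by apply: h1; rewrite lexx.
rewrite (@cint_split _ a m b (fun s => u s d)) //; last by apply: h1; rewrite lexx andbT.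
by ring.
Qed.

Lemma crect_split2 u a b c m d : c <= m -> m <= d -> a <= b ->
  rcont2 u a b c d -> crect u a b c d = crect u a b c m + crect u a b m d.
Proof.
move=> am mb cd [h1 h2]; rewrite /crect.
rewrite (@cint_split _ c m d (u a)) //; last by apply: h2; rewrite lexx.
rewrite (@cint_split _ c m d (u b)) //; last by apply: h2; rewrite lexx andbT.
by ring.
Qed.

Lemma crect_bound u a b c d (M : R) : a <= b -> c <= d -> rcont2 u a b c d ->
  (forall s t, a <= s <= b -> c <= t <= d -> cn (u s t) <= M) ->
  cn (crect u a b c d) <= 4 * M * ((b - a) + (d - c)).
Proof.
move=> ab cd [h1 h2] hM; rewrite /crect.
have cc : c <= c <= d by rewrite lexx.
have dd : c <= d <= d by rewrite lexx andbT.
have aa : a <= a <= b by rewrite lexx.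
have bb : a <= b <= b by rewrite lexx andbT.
have B1 := cint_bound ab (h1 _ cc) (fun s hs => hM s c hs cc).
have B2 := cint_bound ab (h1 _ dd) (fun s hs => hM s d hs dd).
have B3 := cint_bound cd (h2 _ aa) (fun s hs => hM a s aa hs).
have B4 := cint_bound cd (h2 _ bb) (fun s hs => hM b s bb hs).
set p := cint a b _ in B1 *; set q := cint a b _ in B2 *.
set r := cint c d _ in B3 *; set v := cint c d _ in B4 *.
have E1 := cnB (p + ic * v - q) (ic * r).
have E2 := cnB (p + ic * v) q.
have E3 := cnD p (ic * v).
move: E1 E3; rewrite !cnM !cn_ic !mul1r => E1 E3; lra.
Qed.

Lemma crect_affine a b c d s t (A D : K) : a <= b -> c <= d ->
  crect (fun s' t' => A + D * (rc (s' - s) + ic * rc (t' - t))) a b c d = 0.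
Proof.
move=> ab cd.
have cintA a' b' (A' D' : K) : a' <= b' ->
    cint a' b' (fun x => A' + D' * rc x) =
    A' * rc (b' - a') + D' * rc ((b' ^+ 2 - a' ^+ 2) / 2).
  move=> ab'; rewrite cintD; [|exact: cont_on_cst|exact/cont_onZ/cont_on_rc].
  by rewrite cint_cst// cintZ ?cint_rc//; exact: cont_on_rc.
have E1 t' : (fun s' => A + D * (rc (s' - s) + ic * rc (t' - t))) =
    (fun s' => (A + D * (ic * rc (t' - t) - rc s)) + D * rc s').
  by apply/funext => s'; rewrite rcB; ring.
have E2 s' : (fun t' => A + D * (rc (s' - s) + ic * rc (t' - t))) =
    (fun t' => (A + D * (rc (s' - s) - ic * rc t)) + (D * ic) * rc t').
  by apply/funext => t'; rewrite !rcB; ring.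
rewrite /crect !E1 !E2 !cintA//.
rewrite !(rcB b a, rcB d c, rcB b s, rcB a s, rcB c t, rcB d t).
by move: (rc (_ / 2)) (rc (_ / 2)) => p q; ring.
Qed.

Lemma crectB u v a b c d : rcont2 u a b c d -> rcont2 v a b c d ->
  a <= b -> c <= d ->
  crect (fun s t => u s t + v s t) a b c d = crect u a b c d + crect v a b c d.
Proof.
move=> [u1 u2] [v1 v2] ab cd; rewrite /crect !cintD; first by ring.
- by apply: u2; rewrite lexx.
- by apply: v2; rewrite lexx.
- by apply: u1; rewrite lexx andbT.
- by apply: v1; rewrite lexx andbT.
- by apply: u2; rewrite lexx andbT.
- by apply: v2; rewrite lexx andbT.
- by apply: u1; rewrite lexx.
- by apply: v1; rewrite lexx.
Qed.

Lemma crect_quarter u a b c d (m := (a + b) / 2) (n := (c + d) / 2) :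
  a <= b -> c <= d -> rcont2 u a b c d ->
  exists Q : (R * R) * (R * R),
   [/\ Q.1 = (a, m) \/ Q.1 = (m, b), Q.2 = (c, n) \/ Q.2 = (n, d) &
    cn (crect u a b c d) <= 4 * cn (crect u Q.1.1 Q.1.2 Q.2.1 Q.2.2)].
Proof.
move=> ab cd uc.
have am : a <= m by rewrite /m; lra.
have mb : m <= b by rewrite /m; lra.
have cn' : c <= n by rewrite /n; lra.
have nd : n <= d by rewrite /n; lra.
have [//|h1] := pselect (exists Q : (R * R) * (R * R),
   [/\ Q.1 = (a, m) \/ Q.1 = (m, b), Q.2 = (c, n) \/ Q.2 = (n, d) &
    cn (crect u a b c d) <= 4 * cn (crect u Q.1.1 Q.1.2 Q.2.1 Q.2.2)]).
have lt p q : p = (a, m) \/ p = (m, b) -> q = (c, n) \/ q = (n, d) ->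
    4 * cn (crect u p.1 p.2 q.1 q.2) < cn (crect u a b c d).
  move=> hp hq; rewrite ltNge; apply/negP => hle.
  by apply: h1; exists (p, q).
have E : crect u a b c d = (crect u a m c n + crect u a m n d) +
    (crect u m b c n + crect u m b n d).
  rewrite (crect_split1 am mb cd uc); congr (_ + _); apply: crect_split2 => //.
    by apply: rcont2S uc.
  by apply: rcont2S uc.
have aux (M x1 x2 x3 x4 y1 y2 : R) : 4 * x1 < M -> 4 * x2 < M -> 4 * x3 < M ->
  4 * x4 < M -> M <= y1 + y2 -> y1 <= x1 + x2 -> y2 <= x3 + x4 -> False by clear; lra.
exfalso; have hE := cnD (crect u a m c n + crect u a m n d)
  (crect u m b c n + crect u m b n d).
rewrite -E in hE; apply: aux hE (cnD _ _) (cnD _ _).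
- exact: (lt (a, m) (c, n) (or_introl erefl) (or_introl erefl)).
- exact: (lt (a, m) (n, d) (or_introl erefl) (or_intror erefl)).
- exact: (lt (m, b) (c, n) (or_intror erefl) (or_introl erefl)).
- exact: (lt (m, b) (n, d) (or_intror erefl) (or_intror erefl)).
Qed.

Lemma crect0E u a b c d : crect u a b c d = cint a b (fun s => u s c) +
  ic * cint c d (u b) - cint a b (fun s => u s d) - ic * cint c d (u a).
Proof. by []. Qed.

Lemma goursat u a b c d : a <= b -> c <= d ->
  (forall s t, a <= s <= b -> c <= t <= d -> cdiff2 u s t) ->
  crect u a b c d = 0.
Proof.
move=> ab cd du; apply/eqP; rewrite -cn_eq0; apply/eqP.
have uc := cdiff2_rcont2 du.
pose good (Q : (R * R) * (R * R)) :=
  [/\ Q.1.1 <= Q.1.2, Q.2.1 <= Q.2.2 & rcont2 u Q.1.1 Q.1.2 Q.2.1 Q.2.2].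
pose sub (Q Q' : (R * R) * (R * R)) := good Q -> [/\ good Q',
  Q.1.1 <= Q'.1.1 /\ Q'.1.2 <= Q.1.2, Q.2.1 <= Q'.2.1 /\ Q'.2.2 <= Q.2.2,
  Q'.1.2 - Q'.1.1 = (Q.1.2 - Q.1.1) / 2 /\ Q'.2.2 - Q'.2.1 = (Q.2.2 - Q.2.1) / 2 &
  cn (crect u Q.1.1 Q.1.2 Q.2.1 Q.2.2) <= 4 * cn (crect u Q'.1.1 Q'.1.2 Q'.2.1 Q'.2.2)].
have /choice[step hstep] : forall Q, exists Q', sub Q Q'.
  move=> [[p q] [r s]]; have [gQ|nQ] := pselect (good ((p, q), (r, s))); last by exists ((p, q), (r, s)).
  have [/= pq rs cQ] := gQ.
  have [[[p' q'] [r' s']] /= [e1 e2 le]] := crect_quarter pq rs cQ.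
  exists ((p', q'), (r', s')) => _ /=.
  have [? ? ? ?] : [/\ p <= p', q' <= q, p' <= q' & q' - p' = (q - p) / 2].
    by case: e1 => -[-> ->]; split; lra.
  have [? ? ? ?] : [/\ r <= r', s' <= s, r' <= s' & s' - r' = (s - r) / 2].
    by case: e2 => -[-> ->]; split; lra.
  split => //; split => //=; exact: rcont2S cQ.
pose Q n := iter n step ((a, b), (c, d)).
have gQ n : good (Q n).
  by elim: n => [|n IH]; [|have [] := hstep _ IH].
have hQ n := hstep _ (gQ n).
have QS n : Q n.+1 = step (Q n) by [].
have [s hs] : exists s, forall n, (Q n).1.1 <= s <= (Q n).1.2.
  apply: nested_segments => n; rewrite ?QS.
  - by have [_ []] := hQ n.
  - by have [_ []] := hQ n.
  - by have [] := gQ n.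
have [t ht] : exists s, forall n, (Q n).2.1 <= s <= (Q n).2.2.
  apply: nested_segments => n; rewrite ?QS.
  - by have [_ _ []] := hQ n.
  - by have [_ _ []] := hQ n.
  - by have [] := gQ n.
pose L := (b - a) + (d - c).
have len n : (Q n).1.2 - (Q n).1.1 = (b - a) / 2 ^+ n /\
    (Q n).2.2 - (Q n).2.1 = (d - c) / 2 ^+ n.
  elim: n => [|n [IH1 IH2]]; first by rewrite expr0 !divr1.
  have [_ _ _ [h1 h2] _] := hQ n.
  rewrite QS h1 h2 IH1 IH2 exprS invfM; split; ring.
have big n : cn (crect u a b c d) <=
    4 ^+ n * cn (crect u (Q n).1.1 (Q n).1.2 (Q n).2.1 (Q n).2.2).
  elim: n => [|n IH]; first by rewrite expr0 mul1r.
  apply: le_trans IH _; rewrite exprSr -mulrA ler_wpM2l ?exprn_ge0//.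
  by have [] := hQ n.
have [D hD] := du s t (hs 0%N) (ht 0%N).
have L0 : 0 <= L by rewrite /L; lra.
have key e : 0 < e -> cn (crect u a b c d) <= 4 * e * L ^+ 2.
  move=> e0; have [del del0 h] := hD _ e0.
  have [n hn] : exists n, L / 2 ^+ n < del.
    have /cvgrPdist_lt/(_ _ del0) [n _ hn] : (fun n => L * (2^-1) ^+ n) @ \oo --> (0 : R).
      rewrite -[X in _ --> X](mulr0 L); apply: cvgM; first exact: cvg_cst.
      by apply: cvg_expr; rewrite ger0_norm// invf_lt1// ltr1n.
    exists n; have := hn n (leqnn n); rewrite /= sub0r normrN -exprVn ger0_norm//.
    by rewrite mulr_ge0// exprn_ge0.
  have [len1 len2] := len n.
  have [le1 le2 cQ] := gQ n.
  apply: le_trans (big n) _.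
  move: le1 le2 cQ len1 len2 (hs n) (ht n).
  move: (Q n) => [[p q] [r v]] /= pq rv cQ len1 len2 /andP[ps sq] /andP[rt tv].
  pose A := u s t.
  pose w s' t' := u s' t' + (- A + (- D) * (rc (s' - s) + ic * rc (t' - t))).
  pose aff s' t' : K := - A + (- D) * (rc (s' - s) + ic * rc (t' - t)).
  have caff : rcont2 aff p q r v.
    apply: cdiff2_rcont2 => s1 t1 _ _; exists (- D) => e' e'0; exists 1 => // s2 t2 _ _.
    rewrite [X in cn X](_ : _ = 0) ?cn0; first by rewrite mulr_ge0 ?addr_ge0// ltW.
    by rewrite /aff !rcB; ring.
  have Ew : crect u p q r v = crect w p q r v.
    by rewrite (@crectB u aff)// crect_affine// addr0.
  have cw : rcont2 w p q r v.
    case: cQ caff => [c1 c2] [c3 c4]; split=> x hx.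
      by apply: cont_onD; [exact: c1|exact: c3].
    by apply: cont_onD; [exact: c2|exact: c4].
  rewrite Ew.
  have Ln : (q - p) + (v - r) = L / 2 ^+ n by rewrite len1 len2 -mulrDl.
  have := @crect_bound w p q r v (e * (L / 2 ^+ n)) pq rv cw.
  rewrite Ln => hb.
  have {}hb : cn (crect w p q r v) <= 4 * (e * (L / 2 ^+ n)) * (L / 2 ^+ n).
    apply: hb => s1 t1 /andP[ps1 s1q] /andP[rt1 t1v].
    have n1 : `|s1 - s| <= q - p by rewrite ler_norml; lra.
    have n2 : `|t1 - t| <= v - r by rewrite ler_norml; lra.
    have -> : w s1 t1 = u s1 t1 - u s t - D * (rc (s1 - s) + ic * rc (t1 - t)).
      by rewrite /w /A; ring.
    apply: le_trans (h _ _ _ _) _.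
    - by apply: le_lt_trans n1 _; lra.
    - by apply: le_lt_trans n2 _; lra.
    - rewrite ler_pM2l// -Ln; lra.
  apply: le_trans (ler_wpM2l _ hb) _; first exact: exprn_ge0.
  have E4 : (4 : R) ^+ n = 2 ^+ n * 2 ^+ n by rewrite -exprMn; congr (_ ^+ _); ring.
  have p20 : (2 : R) ^+ n != 0 by rewrite expf_neq0.
  rewrite le_eqVlt; apply/orP; left; apply/eqP; rewrite E4; field.
  exact: p20.
apply/eqP; rewrite eq_le cn_ge0 andbT leNgt; apply/negP => M0.
pose M := cn (crect u a b c d).
have := key (M / (8 * (L ^+ 2 + 1))).
have L2 : 0 < 8 * (L ^+ 2 + 1) by rewrite mulr_gt0// ltr_wpDl// sqr_ge0.
move=> /(_ (divr_gt0 M0 L2)); apply/negP; rewrite -ltNge -/M.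
have -> : 4 * (M / (8 * (L ^+ 2 + 1))) * L ^+ 2 = M * (4 * L ^+ 2 / (8 * (L ^+ 2 + 1))).
  by ring.
rewrite -[ltRHS]mulr1 ltr_pM2l// ltr_pdivrMr// mul1r.
have := sqr_ge0 L; lra.
Qed.

End goursat.
Opaque crect.

Section complex_exponential.
Context {R : realType}.
Local Notation K := R[i].
Implicit Types (x y s t : R) (z w v : K).

Lemma sin_lip y : `|sin y| <= `|y|.
Proof.
wlog y0 : y / 0 <= y.
  move=> h; have [/h//|/ltW y0] := leP 0 y.
  by have := h (- y); rewrite sinN !normrN oppr_ge0; exact.
move: y0; rewrite le_eqVlt => /predU1P[<-|y0]; first by rewrite sin0.
have [c _] := @MVT R sin cos 0 y y0 (fun x _ => is_derive_sin x)
  (continuous_subspaceT (@continuous_sin R)).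
rewrite sin0 !subr0 => ->; rewrite normrM ler_piMl// ler_norml.
by rewrite cos_geN1 cos_le1.
Qed.

Lemma cos_sub1_le y : `|cos y - 1| <= y ^+ 2.
Proof.
wlog y0 : y / 0 <= y.
  move=> h; have [/h//|/ltW y0] := leP 0 y.
  by have := h (- y); rewrite cosN sqrrN oppr_ge0; exact.
move: y0; rewrite le_eqVlt => /predU1P[<-|y0]; first by rewrite cos0 subrr normr0 expr0n.
have [c /[!in_itv]/= /andP[c0 cy]] := @MVT R cos (fun x => - sin x) 0 y y0
  (fun x _ => is_derive_cos x) (continuous_subspaceT (@continuous_cos R)).
rewrite cos0 subr0 => ->; rewrite normrM normrN expr2 ler_pM//.
  by rewrite (le_trans (sin_lip _))// gtr0_norm// ltW.
by rewrite gtr0_norm.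
Qed.

Lemma sin_sub_le y : `|sin y - y| <= `|y| ^+ 3.
Proof.
wlog y0 : y / 0 <= y.
  move=> h; have [/h//|/ltW y0] := leP 0 y.
  by have := h (- y); rewrite sinN -opprD !normrN oppr_ge0; exact.
move: y0; rewrite le_eqVlt => /predU1P[<-|y0].
  by rewrite sin0 subrr normr0 expr0n.
have d x : is_derive x (1 : R) (sin - id) (cos x - 1).
  exact: is_deriveB.
have [c /[!in_itv]/= /andP[c0 cy]] := @MVT R (sin - id) (fun x => cos x - 1) 0 y y0
  (fun x _ => d x) (continuous_subspaceT (fun x => cvgB (@continuous_sin R x) (@cvg_id _ _))).
rewrite !fctE sin0 !subr0 => ->; rewrite normrM exprSr ler_pM//.
by rewrite (le_trans (cos_sub1_le _))// gtr0_norm// lerXn2r// ?nnegrE ltW.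
Qed.

Lemma expR_sub1_le x : `|expR x - 1| <= `|x| * expR `|x|.
Proof.
have [x0|/ltW x0] := leP 0 x.
  rewrite ger0_norm ?subr_ge0 -?expR0 ?ler_expR// (ger0_norm x0) expR0.
  have := expR_ge1Dx (- x); rewrite expRN => h.
  have e0 := expR_gt0 x.
  have : (1 - x) * expR x <= 1 by rewrite -ler_pdivlMr// div1r.
  by rewrite mulrBl; lra.
rewrite ler0_norm ?subr_le0 ?expR_le1// (ler0_norm x0).
have h := expR_ge1Dx x.
have : 1 <= expR (- x) by rewrite -expR0 ler_expR oppr_ge0.
nra.
Qed.

Lemma expR_sub1D_le x : `|expR x - 1 - x| <= x ^+ 2 * expR `|x|.
Proof.
rewrite ger0_norm; last by have := expR_ge1Dx x; lra.
have h : expR x - 1 <= x * expR x.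
  have := expR_ge1Dx (- x); rewrite expRN => h.
  have : (1 - x) * expR x <= 1 by rewrite -ler_pdivlMr ?expR_gt0// div1r.
  by rewrite mulrBl; lra.
apply: (@le_trans _ _ (x * (expR x - 1))); first by rewrite mulrBr mulr1; lra.
rewrite (le_trans (ler_norm _))// normrM expr2 -mulrA.
rewrite -[x * (x * _)]ger0_norm; last first.
  by rewrite mulrA mulr_ge0 ?expR_ge0// -expr2 sqr_ge0.
rewrite !normrM ler_wpM2l// (le_trans (expR_sub1_le x))// ler_wpM2l//.
exact: ler_norm.
Qed.

Definition cis t : K := Complex (cos t) (sin t).
Definition cexp z : K := rc (expR (Re z)) * cis (Im z).

Lemma cn_cis t : cn (cis t) = 1.
Proof. by rewrite /cn /= cos2Dsin2 sqrtr1. Qed.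
Lemma cisD s t : cis (s + t) = cis s * cis t.
Proof. by apply: complex_ext; rewrite !ReIm /= ?cosD ?sinD; ring. Qed.
Lemma cis0 : cis 0 = 1.
Proof. by rewrite /cis cos0 sin0. Qed.
Lemma cexpD z w : cexp (z + w) = cexp z * cexp w.
Proof. by rewrite /cexp !ReIm expRD cisD rcM; ring. Qed.
Lemma cexp0 : cexp 0 = 1.
Proof. by rewrite /cexp /= expR0 cis0 mulr1. Qed.
Lemma cn_cexp z : cn (cexp z) = expR (Re z).
Proof. by rewrite /cexp cnM cn_cis mulr1 cn_rc ger0_norm// expR_ge0. Qed.
Lemma cexp_neq0 z : cexp z != 0.
Proof. by rewrite -cn_gt0 cn_cexp expR_gt0. Qed.
Lemma cexp_rc x : cexp (rc x) = rc (expR x).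
Proof. by rewrite /cexp /= cis0 mulr1. Qed.
Lemma cexpN z : cexp (- z) = (cexp z)^-1.
Proof.
apply: (mulfI (cexp_neq0 z)); rewrite -cexpD subrr cexp0 divff//.
exact: cexp_neq0.
Qed.

Lemma cexp_bound2 v : cn (cexp v - 1 - v) <= 5 * cn v ^+ 2 * expR (cn v).
Proof.
set x := Re v; set y := Im v.
have -> : cexp v - 1 - v = rc (expR x) * (cis y - 1 - ic * rc y)
    + (rc (expR x) - 1) * (ic * rc y) + rc (expR x - 1 - x).
  by rewrite {2}(ReIm_decomp v) /cexp -/x -/y !rcB rc1; ring.
have hx : `|x| <= cn v := Re_le_cn v.
have hy : `|y| <= cn v := Im_le_cn v.
have ex : expR `|x| <= expR (cn v) by rewrite ler_expR.
have x0 := normr_ge0 x; have y0 := normr_ge0 y.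
have x2 : x ^+ 2 <= cn v ^+ 2.
  by rewrite -real_normK ?num_real// lerXn2r// ?nnegrE// cn_ge0.
have y2 : y ^+ 2 <= cn v ^+ 2.
  by rewrite -[y ^+ 2]real_normK ?num_real// lerXn2r// ?nnegrE// cn_ge0.
have E0 := expR_gt0 (cn v).
have b1 : cn (cis y - 1 - ic * rc y) <= 3 * cn v ^+ 2.
  apply: le_trans (cn_le_ReIm _) _.
  rewrite (_ : Re _ = cos y - 1); last by rewrite !ReIm /=; ring.
  rewrite (_ : Im _ = sin y - y); last by rewrite !ReIm /=; ring.
  have := cos_sub1_le y => c1.
  have s1 : `|sin y - y| <= 2 * y ^+ 2.
    have [y1|/ltW y1] := leP `|y| 1.
      apply: le_trans (sin_sub_le y) _; rewrite exprS real_normK ?num_real//.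
      by rewrite ler_wpM2r ?sqr_ge0// (le_trans y1)// ler1n.
    apply: le_trans (ler_normB _ _) _; apply: le_trans (lerD (sin_lip _) (lexx _)) _.
    rewrite -[y ^+ 2]real_normK ?num_real// -mulr2n -[_ *+ 2]mulr_natl expr2.
    by rewrite ler_wpM2l// ler_peMl.
  lra.
apply: le_trans (cnD _ _) _.
apply: le_trans (lerD (cnD _ _) (lexx _)) _; rewrite !cnM cn_ic mul1r -rc1 -rcB !cn_rc.
have a1 : `|expR x| * cn (cis y - rc 1 - ic * rc y) <= 3 * cn v ^+ 2 * expR (cn v).
  rewrite rc1 mulrC ler_pM ?cn_ge0// ger0_norm ?expR_ge0// (le_trans _ ex)//.
  by rewrite ler_expR ler_norm.
have a2 : `|expR x - 1| * `|y| <= cn v ^+ 2 * expR (cn v).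
  apply: (@le_trans _ _ ((`|x| * expR `|x|) * `|y|)).
    by rewrite ler_wpM2r// expR_sub1_le.
  rewrite mulrAC ler_pM ?mulr_ge0 ?expR_ge0// expr2 ler_pM//.
have a3 : `|expR x - 1 - x| <= cn v ^+ 2 * expR (cn v).
  apply: le_trans (expR_sub1D_le x) _.
  by rewrite ler_pM ?sqr_ge0 ?expR_ge0.
apply: le_trans (lerD (lerD a1 a2) a3) _.
by rewrite -!mulrA; lra.
Qed.

Lemma cexp_bound1 v : cn (cexp v - 1) <= 5 * cn v * expR (cn v).
Proof.
set x := Re v; set y := Im v.
have -> : cexp v - 1 = rc (expR x) * (cis y - 1) + rc (expR x - 1).
  by rewrite /cexp -/x -/y rcB rc1; ring.
have hx : `|x| <= cn v := Re_le_cn v.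
have hy : `|y| <= cn v := Im_le_cn v.
have ex : expR `|x| <= expR (cn v) by rewrite ler_expR.
have b1 : cn (cis y - 1) <= 3 * cn v.
  apply: le_trans (cn_le_ReIm _) _; rewrite !ReIm /= subr0.
  have s1 := sin_lip y.
  suff c1 : `|cos y - 1| <= 2 * `|y| by lra.
  have [y1|/ltW y1] := leP `|y| 1.
    apply: le_trans (cos_sub1_le y) _; rewrite -[y ^+ 2]real_normK ?num_real//.
    by rewrite expr2 ler_wpM2r// (le_trans y1)// ler1n.
  apply: le_trans (ler_normB _ _) _; rewrite normr1.
  have := cos_le1 y; have := cos_geN1 y => h1 h2.
  have : `|cos y| <= 1 by rewrite ler_norml h1 h2.
  lra.
apply: le_trans (cnD _ _) _; rewrite cnM !cn_rc.
have a1 : `|expR x| * cn (cis y - 1) <= 3 * cn v * expR (cn v).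
  rewrite mulrC ler_pM ?cn_ge0// ger0_norm ?expR_ge0// (le_trans _ ex)//.
  by rewrite ler_expR ler_norm.
have a3 : `|expR x - 1| <= cn v * expR (cn v).
  apply: le_trans (expR_sub1_le x) _.
  by rewrite ler_pM ?expR_ge0.
apply: le_trans (lerD a1 a3) _.
have := mulr_ge0 (cn_ge0 v) (expR_ge0 (cn v)); lra.
Qed.

End complex_exponential.

Section complex_derivative.
Context {R : realType}.
Local Notation K := R[i].
Implicit Types (x y s t : R) (z w v : K) (f g : K -> K).

Lemma ratio_le (k e c : R) : 0 < k -> 0 <= e -> 0 <= c ->
  e / (k * (c + 1)) * c <= e / k.
Proof.
move=> k0 e0 c0; have c1 : 0 < c + 1 by rewrite ltr_wpDl.
have -> : e / (k * (c + 1)) * c = (e / k) * (c / (c + 1)) by rewrite invfM; ring.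
by rewrite ler_piMr ?divr_ge0 ?(ltW k0)// ler_pdivrMr// mul1r lerDl.
Qed.

Definition cderiv f z := exists d : K, forall e : R, 0 < e ->
  exists2 del : R, 0 < del & forall w, cn (w - z) < del ->
    cn (f w - f z - d * (w - z)) <= e * cn (w - z).

Lemma cderiv_lip f z : cderiv f z -> exists L del : R, [/\ 0 < L, 0 < del &
  forall w, cn (w - z) < del -> cn (f w - f z) <= L * cn (w - z)].
Proof.
case=> d hd; have [del del0 h] := hd 1 ltr01.
exists (cn d + 1), del; split => //; first by rewrite ltr_wpDl ?cn_ge0.
move=> w /h {}h; rewrite -[f w - f z](subrK (d * (w - z))).
by apply: le_trans (cnD _ _) _; rewrite cnM mulrDl addrC lerD2l mul1r -[leRHS]mul1r.
Qed.

Lemma cderiv_cont f z : cderiv f z -> forall e : R, 0 < e ->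
  exists2 del : R, 0 < del & forall w, cn (w - z) < del -> cn (f w - f z) < e.
Proof.
move=> /cderiv_lip[L [del [L0 del0 h]]] e e0.
exists (Num.min del (e / L)); first by rewrite lt_min del0 divr_gt0.
move=> w; rewrite lt_min => /andP[/h {}h]; rewrite ltr_pdivlMr// => hw.
by apply: le_lt_trans h _; rewrite mulrC.
Qed.

Lemma cderiv_id z : cderiv id z.
Proof.
exists 1 => e e0; exists 1 => // w _.
by rewrite mul1r subrr cn0 mulr_ge0 ?cn_ge0// ltW.
Qed.

Lemma cderiv_cst v z : cderiv (fun=> v) z.
Proof.
exists 0 => e e0; exists 1 => // w _.
by rewrite mul0r !subrr cn0 mulr_ge0 ?cn_ge0// ltW.
Qed.

Lemma cderivD f g z : cderiv f z -> cderiv g z -> cderiv (fun w => f w + g w) z.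
Proof.
move=> [d hd] [d' hd']; exists (d + d') => e e0.
have e2 : 0 < e / 2 by rewrite divr_gt0.
have [r r0 h] := hd _ e2; have [r' r'0 h'] := hd' _ e2.
exists (Num.min r r'); first by rewrite lt_min r0.
move=> w; rewrite lt_min => /andP[/h {}h /h' {}h'].
rewrite (_ : _ - _ - _ = (f w - f z - d * (w - z)) + (g w - g z - d' * (w - z))); last by ring.
by apply: le_trans (cnD _ _) _; rewrite (splitr e) mulrDl lerD.
Qed.

Lemma cderivM f g z : cderiv f z -> cderiv g z -> cderiv (fun w => f w * g w) z.
Proof.
move=> df dg; have [d hd] := df; have [d' hd'] := dg.
have [L [r1 [L0 r10 h1]]] := cderiv_lip df.
exists (d * g z + d' * f z) => e e0.
have g0 := cn_ge0 (g z); have f0 := cn_ge0 (f z).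
pose e1 := e / (3 * (cn (g z) + 1)); pose e2 := e / (3 * (cn (f z) + 1)).
have e10 : 0 < e1 by rewrite divr_gt0// mulr_gt0// ltr_wpDl.
have e20 : 0 < e2 by rewrite divr_gt0// mulr_gt0// ltr_wpDl.
have e30 : 0 < e / (3 * L) by rewrite divr_gt0// mulr_gt0.
have [r2 r20 h2] := hd _ e10; have [r3 r30 h3] := hd' _ e20.
have [r4 r40 h4] := cderiv_cont dg e30.
exists (Num.min (Num.min r1 r2) (Num.min r3 r4)); first by rewrite !lt_min r10 r20 r30.
move=> w; rewrite !lt_min => /andP[/andP[/h1 {}h1 /h2 {}h2] /andP[/h3 {}h3 /h4 {}h4]].
rewrite (_ : _ - _ - _ = (f w - f z - d * (w - z)) * g z
  + f z * (g w - g z - d' * (w - z)) + (f w - f z) * (g w - g z)); last by ring.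
have W := cn_ge0 (w - z).
apply: le_trans (cnD _ _) _; apply: le_trans (lerD (cnD _ _) (lexx _)) _; rewrite !cnM.
have a1 : cn (f w - f z - d * (w - z)) * cn (g z) <= e / 3 * cn (w - z).
  apply: le_trans (ler_wpM2r g0 h2) _; rewrite mulrAC ler_wpM2r//.
  by apply: ratio_le => //; exact: ltW.
have a2 : cn (f z) * cn (g w - g z - d' * (w - z)) <= e / 3 * cn (w - z).
  rewrite mulrC; apply: le_trans (ler_wpM2r f0 h3) _; rewrite mulrAC ler_wpM2r//.
  by apply: ratio_le => //; exact: ltW.
have a3 : cn (f w - f z) * cn (g w - g z) <= e / 3 * cn (w - z).
  apply: (@le_trans _ _ (L * cn (w - z) * (e / (3 * L)))).
    by rewrite ler_pM ?cn_ge0// ltW.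
  rewrite le_eqVlt; apply/orP; left; apply/eqP; field.
  by rewrite gt_eqF.
have -> : e * cn (w - z) = e / 3 * cn (w - z) + e / 3 * cn (w - z) + e / 3 * cn (w - z).
  by field.
by rewrite !lerD.
Qed.

Lemma cderiv_comp f g z : cderiv f z -> cderiv g (f z) -> cderiv (fun w => g (f w)) z.
Proof.
move=> df [d' hd']; have [d hd] := df; have [L [r1 [L0 r10 h1]]] := cderiv_lip df.
exists (d' * d) => e e0; have d'0 := cn_ge0 d'.
have e10 : 0 < e / (2 * L) by rewrite divr_gt0// mulr_gt0.
have e20 : 0 < e / (2 * (cn d' + 1)) by rewrite divr_gt0// mulr_gt0// ltr_wpDl.
have [r2 r20 h2] := hd' _ e10; have [r3 r30 h3] := hd _ e20.
have [r4 r40 h4] := cderiv_cont df r20.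
exists (Num.min r1 (Num.min r3 r4)); first by rewrite !lt_min r10 r30.
move=> w; rewrite !lt_min => /andP[/h1 {}h1 /andP[/h3 {}h3 /h4/h2 {}h2]].
rewrite (_ : _ - _ - _ = (g (f w) - g (f z) - d' * (f w - f z))
  + d' * (f w - f z - d * (w - z))); last by ring.
have W := cn_ge0 (w - z).
apply: le_trans (cnD _ _) _; rewrite cnM (splitr e) mulrDl lerD//.
  apply: le_trans h2 _; rewrite mulrC -ler_pdivlMr//; apply: le_trans h1 _.
  rewrite le_eqVlt; apply/orP; left; apply/eqP; field.
  by rewrite !gt_eqF.
apply: le_trans (ler_wpM2l d'0 h3) _; rewrite mulrA ler_wpM2r//.
by rewrite mulrC; apply: ratio_le => //; exact: ltW.
Qed.

Lemma cderiv_inv z : z != 0 -> cderiv (fun w => w^-1) z.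
Proof.
move=> z0; have c0 : 0 < cn z by rewrite cn_gt0.
exists (- (z * z)^-1) => e e0.
have p : 0 < e * cn z ^+ 3 / 2 by rewrite !mulr_gt0 ?exprn_gt0 ?invr_gt0.
exists (Num.min (cn z / 2) (e * cn z ^+ 3 / 2)); first by rewrite lt_min p divr_gt0.
move=> w; rewrite lt_min => /andP[h1 h2].
have hw : cn z / 2 <= cn w.
  have := cnD w (z - w); rewrite addrC subrK cn_distC; lra.
have w0 : w != 0 by rewrite -cn_gt0; apply: lt_le_trans hw; rewrite divr_gt0.
rewrite (_ : _ - _ - _ = (w - z) * (w - z) / (w * z * z)); last first.
  by field; rewrite z0 w0.
rewrite !cnM cnV !cnM mulrAC ler_wpM2r ?cn_ge0//.
rewrite ler_pdivrMr ?mulr_gt0 ?cn_gt0//.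
apply: le_trans (ltW h2) _.
have -> : e * cn z ^+ 3 / 2 = e * (cn z / 2 * (cn z * cn z)) by ring.
by rewrite -(mulrA (cn w)) ler_pM2l// ler_wpM2r// mulr_ge0 ?cn_ge0.
Qed.

Lemma cderiv_cexp z : cderiv cexp z.
Proof.
exists (cexp z) => e e0.
pose C := 5 * cn (cexp z) * expR 1 + 1.
have C0 : 0 < C by rewrite ltr_wpDl// !mulr_ge0 ?cn_ge0 ?expR_ge0.
exists (Num.min 1 (e / C)); first by rewrite lt_min ltr01 divr_gt0.
move=> w; rewrite lt_min => /andP[w1 w2].
rewrite (_ : _ - _ - _ = cexp z * (cexp (w - z) - 1 - (w - z))); last first.
  rewrite -[in cexp w](subrKC z w) (cexpD z (w - z)); ring.
rewrite cnM; apply: le_trans (ler_wpM2l (cn_ge0 _) (cexp_bound2 _)) _.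
rewrite ltr_pdivlMr// in w2.
have W := cn_ge0 (w - z).
apply: (@le_trans _ _ (C * cn (w - z) * cn (w - z))); last first.
  by rewrite ler_wpM2r// mulrC ltW.
have ex : expR (cn (w - z)) <= expR 1 by rewrite ler_expR ltW.
have h := ler_wpM2l (mulr_ge0 (cn_ge0 (cexp z)) (sqr_ge0 (cn (w - z)))) ex.
have -> : cn (cexp z) * (5 * cn (w - z) ^+ 2 * expR (cn (w - z))) =
  5 * (cn (cexp z) * cn (w - z) ^+ 2 * expR (cn (w - z))) by ring.
have -> : C * cn (w - z) * cn (w - z) =
  5 * (cn (cexp z) * cn (w - z) ^+ 2 * expR 1) + cn (w - z) ^+ 2 by rewrite /C; ring.
have := sqr_ge0 (cn (w - z)); lra.
Qed.

Lemma cdiff2_of_cderiv f s t : cderiv f (rc s + ic * rc t) ->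
  cdiff2 (fun s t => f (rc s + ic * rc t)) s t.
Proof.
case=> d hd; exists d => e e0; have [r r0 h] := hd e e0.
exists (r / 2) => [|s' t' hs ht]; first by rewrite divr_gt0.
have E : rc s' + ic * rc t' - (rc s + ic * rc t) = rc (s' - s) + ic * rc (t' - t).
  by rewrite !rcB; ring.
have le : cn (rc (s' - s) + ic * rc (t' - t)) <= `|s' - s| + `|t' - t|.
  by apply: le_trans (cnD _ _) _; rewrite cnM cn_ic mul1r !cn_rc.
have := h (rc s' + ic * rc t'); rewrite E => {}h.
apply: le_trans (h _) _; last by rewrite ler_wpM2l// ltW.
by apply: le_lt_trans le _; rewrite (splitr r) ltrD.
Qed.

End complex_derivative.

Section power_series_expansion.
Context {R : realType}.
Local Notation K := R[i].
Implicit Types (x y s t : R) (z w v : K).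

Lemma crect_degenerate1 (u : R -> R -> K) a c d : crect u a a c d = 0.
Proof. by rewrite crect0E !cint_point add0r subr0 subrr. Qed.

Lemma crect_degenerate2 (u : R -> R -> K) a b c : crect u a b c c = 0.
Proof. by rewrite crect0E !cint_point mulr0 !subr0 addr0 subrr. Qed.

Lemma goursat_except (u : R -> R -> K) (a b c d s0 t0 M : R) :
  a <= b -> c <= d -> rcont2 u a b c d ->
  (forall s t, a <= s <= b -> c <= t <= d -> cn (u s t) <= M) ->
  (forall s t, a <= s <= b -> c <= t <= d -> ~ (s = s0 /\ t = t0) ->
     cdiff2 u s t) ->
  crect u a b c d = 0.
Proof.
move=> ab cd uc uM du.
have [[/andP[as0 sb] /andP[ct td]]|out] := pselect (a <= s0 <= b /\ c <= t0 <= d); last first.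
  apply: goursat => // s t hs ht; apply: du => // -[? ?]; subst s0 t0.
  by apply: out.
have zero (p q r v : R) : a <= p -> p <= q -> q <= b -> c <= r -> r <= v -> v <= d ->
    [\/ p = q, r = v | (s0 < p \/ q < s0) \/ (t0 < r \/ v < t0)] -> crect u p q r v = 0.
  move=> ap pq qb cr rv vd [->|->|h].
  - exact: crect_degenerate1.
  - exact: crect_degenerate2.
  - apply: goursat => // s t /andP[ps sq] /andP[rt tv]; apply: du.
    + by rewrite (le_trans ap ps) (le_trans sq qb).
    + by rewrite (le_trans cr rt) (le_trans tv vd).
    + move=> [? ?]; subst s t; case: h => [[]|[]]; rewrite ltNge.
      * by rewrite ps.
      * by rewrite sq.
      * by rewrite rt.
      * by rewrite tv.
have key (e : R) : 0 < e -> cn (crect u a b c d) <= 4 * M * (4 * e).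
  move=> e0.
  pose p := Num.max a (s0 - e); pose q := Num.min b (s0 + e).
  pose r := Num.max c (t0 - e); pose v := Num.min d (t0 + e).
  have ap : a <= p by rewrite le_max lexx.
  have ps : p <= s0 by rewrite ge_max as0 /= gerBl ltW.
  have sq : s0 <= q by rewrite le_min sb /= lerDl ltW.
  have qb : q <= b by rewrite ge_min lexx.
  have cr : c <= r by rewrite le_max lexx.
  have rt : r <= t0 by rewrite ge_max ct /= gerBl ltW.
  have tv : t0 <= v by rewrite le_min td /= lerDl ltW.
  have vd : v <= d by rewrite ge_min lexx.
  have pe : s0 - e <= p by rewrite le_max lexx orbT.
  have qe : q <= s0 + e by rewrite ge_min lexx orbT.
  have re : t0 - e <= r by rewrite le_max lexx orbT.
  have ve : v <= t0 + e by rewrite ge_min lexx orbT.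
  have pE : a = p \/ p < s0.
    rewrite /p; case: (leP a (s0 - e)) => h; [right; lra|by left].
  have qE : q = b \/ s0 < q.
    rewrite /q; case: (leP b (s0 + e)) => h; [by left|right; lra].
  have rE : c = r \/ r < t0.
    rewrite /r; case: (leP c (t0 - e)) => h; [right; lra|by left].
  have vE : v = d \/ t0 < v.
    rewrite /v; case: (leP d (t0 + e)) => h; [by left|right; lra].
  have pq : p <= q := le_trans ps sq.
  have rv : r <= v := le_trans rt tv.
  have pb := le_trans pq qb.
  have rd := le_trans rv vd.
  rewrite (crect_split1 ap pb cd uc) (@zero a p c d)//; last first.
    by case: pE => [->|h]; [constructor 1|constructor 3; left; right].
  have uc1 : rcont2 u p b c d by apply: rcont2S uc.
  rewrite add0r (crect_split1 pq qb cd uc1) (@zero q b c d)//; last first.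
  - by case: qE => [->|h]; [constructor 1|constructor 3; left; left].
  - exact: le_trans ap pq.
  have uc2 : rcont2 u p q c d by apply: rcont2S uc.
  rewrite addr0 (crect_split2 cr rd pq uc2) (@zero p q c r)//; last first.
    by case: rE => [->|h]; [constructor 2|constructor 3; right; right].
  have uc3 : rcont2 u p q r d by apply: rcont2S uc.
  rewrite add0r (crect_split2 rv vd pq uc3) (@zero p q v d)//; last first.
  - by case: vE => [->|h]; [constructor 2|constructor 3; right; left].
  - exact: le_trans cr rv.
  have uc4 : rcont2 u p q r v by apply: rcont2S uc.
  rewrite addr0; apply: le_trans (crect_bound (M := M) pq rv uc4 _) _.
    move=> s t /andP[ps' sq'] /andP[rt' tv']; apply: uM.
      by rewrite (le_trans ap ps') (le_trans sq' qb).
    by rewrite (le_trans cr rt') (le_trans tv' vd).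
  have M0 : 0 <= M.
    by apply: le_trans (cn_ge0 _) (uM s0 t0 _ _); rewrite ?as0 ?ct.
  rewrite ler_wpM2l ?mulr_ge0//; lra.
apply/eqP; rewrite -cn_eq0 eq_le cn_ge0 andbT leNgt; apply/negP => C0.
have M0 : 0 <= M.
  by apply: le_trans (cn_ge0 _) (uM s0 t0 _ _); rewrite ?as0 ?ct.
have M1 : 0 < 32 * (M + 1) by rewrite mulr_gt0// ltr_wpDl.
have := key _ (divr_gt0 C0 M1); apply/negP; rewrite -ltNge.
have -> : 4 * M * (4 * (cn (crect u a b c d) / (32 * (M + 1)))) =
  cn (crect u a b c d) * (16 * M / (32 * (M + 1))) by ring.
rewrite gtr_pMr// ltr_pdivrMr//; lra.
Qed.

Definition ccont (f : K -> K) z := forall e : R, 0 < e ->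
  exists2 del : R, 0 < del & forall w, cn (w - z) < del -> cn (f w - f z) < e.

Lemma ccont_comp (f g : K -> K) z : ccont f z -> ccont g (f z) ->
  ccont (fun w => g (f w)) z.
Proof.
move=> cf cg e e0; have [r r0 h] := cg _ e0; have [r' r'0 h'] := cf _ r0.
by exists r' => // w /h'/h.
Qed.

Lemma ccontM (f g : K -> K) z : ccont f z -> ccont g z ->
  ccont (fun w => f w * g w) z.
Proof.
move=> cf cg e e0.
have e1 : 0 < e / 3 / (cn (g z) + 1) by rewrite !divr_gt0// ltr_wpDl ?cn_ge0.
have e2 : 0 < e / 3 / (cn (f z) + 1) by rewrite !divr_gt0// ltr_wpDl ?cn_ge0.
have [r r0 h] := cf _ e1; have [r' r'0 h'] := cg _ e2.
have [r2 r20 h2] := cf _ ltr01.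
exists (Num.min (Num.min r r2) r'); first by rewrite !lt_min r0 r20.
move=> w; rewrite !lt_min => /andP[/andP[/h {}h /h2 {}h2] /h' {}h'].
rewrite (_ : f w * g w - _ = (f w - f z) * g z + f w * (g w - g z)); last by ring.
apply: le_lt_trans (cnD _ _) _; rewrite !cnM.
have f0 := cn_ge0 (f z); have g0 := cn_ge0 (g z).
have hw : cn (f w) <= cn (f z) + 1.
  have := cnD (f w - f z) (f z); rewrite subrK; lra.
rewrite ltr_pdivlMr ?ltr_wpDl// in h; rewrite ltr_pdivlMr ?ltr_wpDl// in h'.
have h3 := ler_wpM2r (cn_ge0 (g w - g z)) hw.
have := cn_ge0 (f w - f z); have := cn_ge0 (g w - g z); nra.
Qed.

Lemma cdiff2_ccont (f : K -> K) s : forall t, ccont f (rc s + ic * rc t) ->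
  cont_at (fun s => f (rc s + ic * rc t)) s /\ cont_at (fun t => f (rc s + ic * rc t)) t.
Proof.
move=> t cf; split=> e e0; have [r r0 h] := cf e e0; exists r => // y hy; apply: h.
  by rewrite (_ : _ - _ = rc (y - s)) ?cn_rc// rcB; ring.
by rewrite (_ : _ - _ = ic * rc (y - t)) ?cnM ?cn_ic ?mul1r ?cn_rc// rcB; ring.
Qed.

Lemma cderiv_ext (f g : K -> K) z :
  (exists2 del : R, 0 < del & forall w, cn (w - z) < del -> f w = g w) ->
  cderiv f z -> cderiv g z.
Proof.
move=> [r r0 fg] [d hd]; exists d => e e0; have [r' r'0 h] := hd e e0.
exists (Num.min r r'); first by rewrite lt_min r0.
move=> w; rewrite lt_min => /andP[hr /h].
by rewrite !fg// subrr cn0.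
Qed.

Definition polar s t : K := cexp (rc s + ic * rc t).

Lemma polarE s t : polar s t = rc (expR s) * cis t.
Proof. by rewrite /polar /cexp !ReIm /= !(mul0r, mul1r, mulr0, addr0, add0r, subr0). Qed.
Lemma cn_polar s t : cn (polar s t) = expR s.
Proof. by rewrite polarE cnM cn_cis mulr1 cn_rc ger0_norm// expR_ge0. Qed.

Lemma polar_real_up x : exists s0 t0, forall s t, 0 <= t <= pi ->
  polar s t = rc x -> s = s0 /\ t = t0.
Proof.
exists (ln `|x|), (if 0 < x then 0 else pi) => s t /andP[t0 tpi] E.
have Es : expR s = `|x| by rewrite -(cn_polar s t) E cn_rc.
split; first by rewrite -Es expRK.
have es := expR_gt0 s.
have st0 : sin t = 0.
  move: E; rewrite polarE => /(congr1 (@complex.Im R)); rewrite !ReIm /= mul0r addr0.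
  by move/eqP; rewrite mulf_eq0 gt_eqF//= => /eqP.
have ct : expR s * cos t = x.
  by move: E; rewrite polarE => /(congr1 (@complex.Re R)); rewrite !ReIm /= mul0r subr0.
move: t0; rewrite le_eqVlt => /predU1P[tE|t0].
  by rewrite -ct -tE cos0 mulr1 es.
move: tpi; rewrite le_eqVlt => /predU1P[tE|tpi].
  by rewrite -ct tE cospi mulrN1 oppr_gt0 ltNge ltW.
have : 0 < sin t by apply: sin_gt0_pi; rewrite t0.
by rewrite st0 ltxx.
Qed.

Lemma polar_real_down x : exists s0 t0, forall s t, - pi <= t <= 0 ->
  polar s t = rc x -> s = s0 /\ t = t0.
Proof.
have [s0 [t0 h]] := polar_real_up x; exists s0, (- t0) => s t ht E.
have [||-> <-] := h s (- t); last by rewrite opprK.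
- by rewrite oppr_ge0 lerNl andbC.
move: E; rewrite !polarE => E; apply: complex_ext.
  by have := congr1 (@complex.Re R) E; rewrite !ReIm /= cosN !mul0r.
have := congr1 (@complex.Im R) E; rewrite !ReIm /= sinN !mul0r !addr0.
by rewrite mulrN => ->; rewrite oppr0.
Qed.

Lemma polar_period s : polar s (- pi) = polar s pi.
Proof. by rewrite !polarE /cis cosN sinN sinpi oppr0. Qed.

Lemma pi0 : - pi <= (0 : R).
Proof. by rewrite oppr_le0 pi_ge0. Qed.

Lemma addKsub_eq (V : zmodType) (p q r : V) : p + q - p - r = 0 -> q = r.
Proof. by rewrite (addrC p) addrK => /eqP; rewrite subr_eq0 => /eqP. Qed.

Lemma circle_integral_const (H : K -> K) (x a b M : R) : a <= b ->
  (forall z, cn z <= expR b -> ccont H z) ->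
  (forall z, cn z <= expR b -> z != 0 -> z != rc x -> cderiv H z) ->
  (forall z, cn z <= expR b -> cn (H z) <= M) ->
  cint (- pi) pi (fun t => H (polar a t)) = cint (- pi) pi (fun t => H (polar b t)).
Proof.
move=> ab cH dH HM.
pose u s t := H (polar s t).
have le s t : a <= s <= b -> cn (polar s t) <= expR b.
  by move=> /andP[_ sb]; rewrite cn_polar ler_expR.
have uc : rcont2 u a b (- pi) pi.
  have cc s t : a <= s <= b -> ccont (fun v => H (cexp v)) (rc s + ic * rc t).
    move=> hs; apply: ccont_comp; first exact: (cderiv_cont (cderiv_cexp _)).
    exact: cH (le s t hs).
  by split=> [t _ s hs|s hs t _]; have [] := cdiff2_ccont (cc s t hs).
have du s t : a <= s <= b -> polar s t != rc x -> cdiff2 u s t.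
  move=> hs hx; apply: (@cdiff2_of_cderiv R (fun v => H (cexp v))).
  apply: cderiv_comp; first exact: cderiv_cexp.
  by apply: dH => //; [exact: le|exact: cexp_neq0].
have ppi := @pi_ge0 R; have p0 := pi0.
have E1 : crect u a b (- pi) 0 = 0.
  have [s0 [t0 h]] := polar_real_down x.
  apply: (@goursat_except u a b _ _ s0 t0 M) => //.
  - by apply: rcont2S uc.
  - by move=> s t hs _; apply: HM; exact: le.
  - move=> s t hs ht ne; apply: du => //; apply/eqP => E; apply: ne; exact: h.
have E2 : crect u a b 0 pi = 0.
  have [s0 [t0 h]] := polar_real_up x.
  apply: (@goursat_except u a b _ _ s0 t0 M) => //.
  - by apply: rcont2S uc.
  - by move=> s t hs _; apply: HM; exact: le.
  - move=> s t hs ht ne; apply: du => //; apply/eqP => E; apply: ne; exact: h.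
have := crect_split2 p0 ppi ab uc.
rewrite E1 E2 addr0 crect0E.
have -> : (fun s => u s (- pi)) = (fun s => u s pi).
  by apply/funext => s; rewrite /u polar_period.
move=> /addKsub_eq E.
have i0 : ic != 0 :> K by rewrite -cn_gt0 cn_ic.
exact: (mulfI i0 (esym E)).
Qed.

Lemma cint_sum (N : nat) (F : nat -> R -> K) a b :
  (forall k, cont_on a b (F k)) ->
  cint a b (fun t => \sum_(k < N) F k t) = \sum_(k < N) cint a b (F k) /\
  cont_on a b (fun t => \sum_(k < N) F k t).
Proof.
move=> cF; elim: N => [|N [IH1 IH2]].
  split.
    rewrite big_ord0 -[RHS](mul0r (cint a b (fun=> 0))) -cintZ; last exact: cont_on_cst.
    by congr cint; apply/funext => t; rewrite big_ord0 mul0r.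
  move=> x _ e e0; exists 1 => // y _; by rewrite !big_ord0 subrr cn0.
have E : (fun t => \sum_(k < N.+1) F k t) = (fun t => \sum_(k < N) F k t + F N t).
  by apply/funext => t; rewrite big_ord_recr.
rewrite E; split; last exact: cont_onD.
by rewrite big_ord_recr /= cintD// IH1.
Qed.

Lemma cont_onM a b (f g : R -> K) : cont_on a b f -> cont_on a b g ->
  cont_on a b (fun t => f t * g t).
Proof.
move=> cf cg x xab e e0.
have e1 : 0 < e / 3 / (cn (g x) + 1) by rewrite !divr_gt0// ltr_wpDl ?cn_ge0.
have e2 : 0 < e / 3 / (cn (f x) + 1) by rewrite !divr_gt0// ltr_wpDl ?cn_ge0.
have [r r0 h] := cf _ xab _ e1; have [r' r'0 h'] := cg _ xab _ e2.
have [r2 r20 h2] := cf _ xab _ ltr01.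
exists (Num.min (Num.min r r2) r'); first by rewrite !lt_min r0 r20.
move=> w; rewrite !lt_min => /andP[/andP[/h {}h /h2 {}h2] /h' {}h'].
rewrite (_ : f w * g w - _ = (f w - f x) * g x + f w * (g w - g x)); last by ring.
apply: le_lt_trans (cnD _ _) _; rewrite !cnM.
have f0 := cn_ge0 (f x); have g0 := cn_ge0 (g x).
have hw : cn (f w) <= cn (f x) + 1.
  have := cnD (f w - f x) (f x); rewrite subrK; lra.
rewrite ltr_pdivlMr ?ltr_wpDl// in h; rewrite ltr_pdivlMr ?ltr_wpDl// in h'.
have h3 := ler_wpM2r (cn_ge0 (g w - g x)) hw.
have := cn_ge0 (f w - f x); have := cn_ge0 (g w - g x); nra.
Qed.

Lemma ccont_circle (H : K -> K) s : (forall t, ccont H (polar s t)) ->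
  forall a b, cont_on a b (fun t => H (polar s t)).
Proof.
move=> cH a b t _.
have [] := @cdiff2_ccont (fun v => H (cexp v)) s t _ => //.
apply: ccont_comp; first exact: (cderiv_cont (cderiv_cexp _)).
exact: cH.
Qed.

Lemma circle_power s k : (0 < k)%N ->
  cint (- pi) pi (fun t => (polar s t)^-1 ^+ k) = 0.
Proof.
move=> k0.
have dp v : cderiv (fun v => (cexp v)^-1 ^+ k) v.
  have d1 : cderiv (fun v => (cexp v)^-1 : K) v.
    by apply: (cderiv_comp (cderiv_cexp v)); apply: cderiv_inv; exact: cexp_neq0.
  elim: (k) => [|n IH]; first exact: cderiv_cst.
  rewrite (_ : (fun v => _) = fun v => (cexp v)^-1 * (cexp v)^-1 ^+ n).
    exact: (cderivM d1 IH).
  by apply/funext => y; rewrite exprS.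
pose u s t := (polar s t)^-1 ^+ k : K.
have du s' t' : cdiff2 u s' t' by exact: (cdiff2_of_cderiv (dp _)).
have ppi := @pi_ge0 R.
have pp : - pi <= (pi : R) by exact: le_trans pi0 ppi.
have E0 a b : a <= b -> cint (- pi) pi (u a) = cint (- pi) pi (u b).
  move=> ab; have := goursat ab pp (fun s t _ _ => du s t); rewrite crect0E.
  have -> : (fun s => u s (- pi)) = (fun s => u s pi).
    by apply/funext => s'; rewrite /u polar_period.
  move=> /addKsub_eq E.
  have i0 : ic != 0 :> K by rewrite -cn_gt0 cn_ic.
  exact: (mulfI i0 (esym E)).
have Es a : u a = fun t => rc (expR (- a) ^+ k) * u 0 t.
  apply/funext => t; rewrite /u !polarE expR0 rc1 mul1r invfM exprMn; congr (_ * _).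
  rewrite expRN -!cexp_rc -cexpN; elim: (k) => [|n IH]; first by rewrite !expr0.
  by rewrite !exprS IH rcM -rcN cexp_rc expRN.
have cu a : cont_on (- pi) pi (u a) by have [_] := cdiff2_rcont2 (fun s' t' (_ : a <= s' <= a) (_ : -pi <= t' <= pi) => du s' t'); apply; rewrite lexx.
have Z0 : cint (- pi) pi (u 0) = 0.
  have := E0 0 1 ler01; rewrite (Es 1) cintZ// => /eqP.
  rewrite -subr_eq0 -{1}[cint _ _ _]mul1r -mulrBl mulf_eq0 -rc1 -rcB.
  rewrite -cn_eq0 cn_rc normr_eq0 subr_eq0 eq_sym.
  rewrite -expRM_natr => /orP[|/eqP//].
  by rewrite lt_eqF// expR_lt1 mulN1r oppr_lt0 ltr0n.
by change (cint (- pi) pi (u s) = 0); rewrite Es cintZ// Z0 mulr0.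
Qed.

Lemma cint_circle_geometric (g : R -> K) (r s x M : R) (w := rc x) (c := polar s) (N : nat) :
  r = expR s -> `|x| < r -> 0 <= M -> cont_on (- pi) pi g -> (forall t, cn (g t) <= M) ->
  cn (cint (- pi) pi (fun t => g t * (c t / (c t - w))) -
      \sum_(k < N) w ^+ k * cint (- pi) pi (fun t => g t * (c t)^-1 ^+ k))
  <= 4 * pi * (M * (r / (r - `|x|))) * (`|x| / r) ^+ N.
Proof.
move=> rE xr M0 cg gM.
have ppi := @pi_ge0 R.
have pp : - pi <= (pi : R) by exact: le_trans pi0 ppi.
have r0 : 0 < r by rewrite rE expR_gt0.
have cc t : cn (c t) = r by rewrite cn_polar rE.
have c0 t : c t != 0 by rewrite -cn_gt0 cc.
have rx : 0 < r - `|x| by rewrite subr_gt0.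
have cw t : r - `|x| <= cn (c t - w).
  have := cnD (c t - w) w; rewrite subrK cc cn_rc; lra.
have cwn0 t : c t - w != 0 by rewrite -cn_gt0; apply: lt_le_trans rx (cw t).
have cont1 k : cont_on (- pi) pi (fun t => (c t)^-1 ^+ k).
  elim: k => [|k IH]; first exact: cont_on_cst.
  rewrite (_ : (fun t => _) = fun t => (c t)^-1 * (c t)^-1 ^+ k).
    apply: cont_onM IH; apply: (@ccont_circle (fun z => z^-1)) => t.
    by apply: cderiv_cont; exact: cderiv_inv.
  by apply/funext => t; rewrite exprS.
have contA : cont_on (- pi) pi (fun t => c t / (c t - w)).
  apply: (@ccont_circle (fun z => z / (z - w))) => t; apply: cderiv_cont.
  apply: cderivM; first exact: cderiv_id.
  apply: (@cderiv_comp R (fun z => z - w) (fun z => z^-1)); last exact: cderiv_inv.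
  by apply: cderivD; [exact: cderiv_id|exact: cderiv_cst].
have contgk k : cont_on (- pi) pi (fun t => g t * (c t)^-1 ^+ k) by exact: cont_onM.
have [Es cs] := @cint_sum N (fun k t => w ^+ k * (g t * (c t)^-1 ^+ k)) (- pi) pi
  (fun k => cont_onZ _ (contgk k)).
have -> : \sum_(k < N) w ^+ k * cint (- pi) pi (fun t => g t * (c t)^-1 ^+ k) =
    \sum_(k < N) cint (- pi) pi (fun t => w ^+ k * (g t * (c t)^-1 ^+ k)).
  by apply: eq_bigr => k _; rewrite cintZ.
rewrite -Es.
have E t : g t * (c t / (c t - w)) = \sum_(k < N) w ^+ k * (g t * (c t)^-1 ^+ k) +
    g t * (w ^+ N * (c t)^-1 ^+ N * (c t / (c t - w))).
  elim: N {Es cs} => [|N IH]; first by rewrite big_ord0 !expr0 add0r !mul1r.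
  rewrite IH big_ord_recr /= -addrA; congr (_ + _); rewrite !exprSr.
  by field; rewrite c0 cwn0.
have contR : cont_on (- pi) pi (fun t => g t * (w ^+ N * (c t)^-1 ^+ N * (c t / (c t - w)))).
  by apply: cont_onM => //; apply: cont_onM => //; exact: cont_onZ.
have -> : cint (- pi) pi (fun t => g t * (c t / (c t - w))) =
  cint (- pi) pi (fun t => \sum_(k < N) w ^+ k * (g t * (c t)^-1 ^+ k)) +
  cint (- pi) pi (fun t => g t * (w ^+ N * (c t)^-1 ^+ N * (c t / (c t - w)))).
  rewrite -cintD//; congr cint; apply/funext => t; exact: E.
rewrite addrAC subrr add0r.
apply: le_trans (cint_bound (M := M * ((`|x| / r) ^+ N * (r / (r - `|x|)))) pp contR _) _.
  move=> t _; have := gM t; have := cw t; have := cc t.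
  move: (c t) (g t) => z y zr zw yM; rewrite !cnM !cnX !cnV zr cn_rc -exprMn.
  rewrite ler_pM ?cn_ge0 ?mulr_ge0 ?exprn_ge0 ?mulr_ge0 ?invr_ge0 ?cn_ge0 ?(ltW r0)//.
  rewrite ler_wpM2l ?exprn_ge0 ?divr_ge0 ?(ltW r0)// ler_wpM2l ?(ltW r0)//.
  by rewrite lef_pV2 ?posrE// (lt_le_trans rx).
rewrite le_eqVlt; apply/orP; left; apply/eqP; ring.
Qed.

Lemma cderiv_power_series (f : K -> K) (rho : R) : 0 < rho ->
  (forall z, cn z < rho -> cderiv f z) ->
  exists a : nat -> K, exists2 r : R, 0 < r &
    forall x, `|x| < r -> exists C q : R, [/\ 0 <= q, q < 1 &
      forall N : nat, cn (f (rc x) - \sum_(k < N) a k * rc x ^+ k) <= C * q ^+ N].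
Proof.
move=> rho0 df.
have c0rho : cn (0 : K) < rho by rewrite cn0.
have [r1 r10 h1] := cderiv_cont (df 0 c0rho) ltr01.
pose r := Num.min (rho / 2) (r1 / 2).
have r0 : 0 < r by rewrite lt_min !divr_gt0.
have rrho : r < rho by rewrite gt_min ltr_pdivrMr// ltr_pMr// ltr1n.
pose Mf := cn (f 0) + 1.
have fM z : cn z <= r -> cn (f z) <= Mf.
  move=> zr; have := cnD (f z - f 0) (f 0); rewrite subrK.
  have : cn (z - 0) < r1.
    rewrite subr0; apply: le_lt_trans zr _.
    by rewrite gt_min [r1 / 2 < _]ltr_pdivrMr// ltr_pMr// ltr1n orbT.
  by move/h1; rewrite /Mf; lra.
have Mf0 : 0 <= Mf by rewrite addr_ge0 ?cn_ge0.
pose s := ln r; have rE : r = expR s by rewrite lnK.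
pose c := polar s.
have cc t : cn (c t) = r by rewrite cn_polar rE.
pose I (g : R -> K) := cint (- pi) pi g.
have ppi := @pi_gt0 R.
have pp : - pi <= (pi : R) by exact: le_trans pi0 (ltW ppi).
have cf : cont_on (- pi) pi (fun t => f (c t)).
  by apply: ccont_circle => t; apply/cderiv_cont/df; rewrite cc.
exists (fun k => rc ((2 * pi)^-1) * I (fun t => f (c t) * (c t)^-1 ^+ k)).
exists r => // x xr; pose w := rc x.
exists (4 * pi * (Mf * (r / (r - `|x|))) / (2 * pi)), (`|x| / r).
split; [by rewrite divr_ge0// ltW|by rewrite ltr_pdivrMr ?mul1r|move=> N].
pose A t := c t / (c t - w).
(* the Cauchy kernel has mean value 1 on the circle *)
have IA : I A = rc (2 * pi).
  have B (n : nat) : cn (I A - rc (2 * pi)) <= 4 * pi * (1 * (r / (r - `|x|))) * (`|x| / r) ^+ n.+1.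
    have := @cint_circle_geometric (fun=> 1) r s x 1 n.+1 rE xr ler01 (@cont_on_cst _ _ _ _) _.
    rewrite big_ord_recl /= big1 ?addr0.
      rewrite !expr0 mul1r (_ : (fun=> 1 * 1) = (fun=> 1 : K)).
        rewrite cint_cst// mul1r opprK -mulr2n -[pi *+ 2]mulr_natl (_ : (fun t => _) = A).
          by move=> h; apply: h => t; rewrite cn1.
        by apply/funext => t; rewrite mul1r.
      by apply/funext => t; rewrite mulr1.
    move=> k _; rewrite (_ : (fun t => _) = fun t => (polar s t)^-1 ^+ k.+1).
      by rewrite circle_power// mulr0.
    by apply/funext => t; rewrite mul1r.
  apply/eqP; rewrite -subr_eq0 -cn_eq0 eq_le cn_ge0 andbT.
  have l : (fun n : nat => 4 * pi * (1 * (r / (r - `|x|))) * (`|x| / r) ^+ n.+1) @ \oo --> (0 : R).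
    rewrite -[X in _ --> X](mulr0 (4 * pi * (1 * (r / (r - `|x|))))).
    apply: cvgM; first exact: cvg_cst.
    rewrite (cvg_shiftS (fun n => (`|x| / r) ^+ n)); apply: cvg_expr.
    by rewrite normrM normr_id normfV (gtr0_norm r0) ltr_pdivrMr ?mul1r.
  rewrite -(cvg_lim (@Rhausdorff R) l).
  apply: limr_ge; first by apply/cvg_ex; exists 0.
  by near=> n.
have wrho : cn w < rho by rewrite cn_rc (lt_trans xr).
have [d hd] := df w wrho.
pose q z := if z == w then d else (f z - f w) / (z - w).
pose H z := z * q z.
have [L [del [L0 del0 hL]]] := cderiv_lip (df w wrho).
pose Bq := L + 2 * Mf / del + cn d.
have qB z : cn z <= r -> cn (q z) <= Bq.
  have p0 : 0 <= 2 * Mf / del by rewrite divr_ge0 ?mulr_ge0// ltW.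
  rewrite /q; case: eqP => [_ _|/eqP zw zr]; first by rewrite /Bq; lra.
  have zw0 : 0 < cn (z - w) by rewrite cn_gt0 subr_eq0.
  rewrite cnM cnV; have d0 := cn_ge0 d; have [zd|zd] := ltP (cn (z - w)) del.
    apply: (@le_trans _ _ L); last by rewrite /Bq; lra.
    by rewrite ler_pdivrMr//; exact: hL.
  apply: (@le_trans _ _ (2 * Mf / del)); last by rewrite /Bq; lra.
  rewrite ler_pM ?cn_ge0 ?invr_ge0 ?cn_ge0//; last by rewrite lef_pV2.
  have := fM z zr; have := fM w _; rewrite cn_rc => /(_ (ltW xr)).
  have := cnB (f z) (f w); lra.
have dq z : cn z < rho -> z != w -> cderiv q z.
  move=> zr zw; apply: (@cderiv_ext (fun z => (f z - f w) / (z - w))).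
    exists (cn (z - w)); first by rewrite cn_gt0 subr_eq0.
    move=> y hy; rewrite /q; case: eqP => // yw.
    by move: hy; rewrite yw cn_distC ltxx.
  apply: cderivM; first by apply: cderivD; [exact: df|exact: cderiv_cst].
  apply: (@cderiv_comp R (fun z => z - w) (fun z => z^-1)).
    by apply: cderivD; [exact: cderiv_id|exact: cderiv_cst].
  by apply: cderiv_inv; rewrite subr_eq0.
have cq : ccont q w.
  move=> e e0; have e20 : 0 < e / 2 by rewrite divr_gt0.
  have [r2 r20 h2] := hd _ e20; exists r2 => // z /h2.
  rewrite /q eqxx; case: eqP => [_ _|/eqP zw h]; first by rewrite subrr cn0.
  have zw0 : z - w != 0 by rewrite subr_eq0.
  rewrite (_ : _ - d = (f z - f w - d * (z - w)) / (z - w)); last by field.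
  rewrite cnM cnV; apply: (@le_lt_trans _ _ (e / 2)).
    by rewrite ler_pdivrMr ?cn_gt0.
  by rewrite ltr_pdivrMr// ltr_pMr// ltr1n.
have cH z : cn z <= r -> ccont H z.
  move=> zr; apply: ccontM; first exact: (cderiv_cont (cderiv_id z)).
  have [->//|zw] := eqVneq z w; apply: cderiv_cont; apply: dq => //.
  exact: le_lt_trans zr _.
have dH z : cn z <= r -> z != w -> cderiv H z.
  move=> zr zw; apply: cderivM; first exact: cderiv_id.
  by apply: dq => //; exact: le_lt_trans zr _.
have HB z : cn z <= r -> cn (H z) <= r * Bq.
  by move=> zr; rewrite cnM ler_pM ?cn_ge0// qB.
have IH0 : I (fun t => H (c t)) = 0.
  have B (a : R) : a <= s -> cn (I (fun t => H (c t))) <= 2 * (expR a * Bq) * (pi - - pi).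
    move=> as_; rewrite /I -(@circle_integral_const H x a s (r * Bq))//.
    - apply: cint_bound => //.
        apply: ccont_circle => t; apply: cH.
        by rewrite cn_polar rE ler_expR.
      move=> t _; rewrite cnM cn_polar ler_wpM2l ?expR_ge0// qB// cn_polar rE.
      by rewrite ler_expR.
    - by move=> z; rewrite -rE; exact: cH.
    - by move=> z; rewrite -rE => h _; exact: dH.
    - by move=> z; rewrite -rE; exact: HB.
  apply/eqP; rewrite -cn_eq0 eq_le cn_ge0 andbT leNgt; apply/negP => I0.
  have Bq0 : 0 <= Bq by apply: le_trans (cn_ge0 _) (qB w _); rewrite cn_rc ltW.
  pose k := cn (I (fun t => H (c t))) / (8 * pi * (Bq + 1)).
  have D0 : 0 < 8 * pi * (Bq + 1) by rewrite !mulr_gt0// ltr_wpDl.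
  have k0 : 0 < k by rewrite divr_gt0.
  have := B (Num.min s (ln k)); rewrite ge_min lexx => /(_ isT).
  apply/negP; rewrite -ltNge.
  have ek : expR (Num.min s (ln k)) <= k.
    by rewrite -[leRHS]lnK// ler_expR ge_min lexx orbT.
  have h2 : 2 * (expR (Num.min s (ln k)) * Bq) * (pi - - pi) <= 4 * pi * (k * Bq).
    have := ler_wpM2r Bq0 ek; have := ltW ppi; move: (expR _ * Bq) (k * Bq) => p1 p2; nra.
  apply: le_lt_trans h2 _.
  have -> : 4 * pi * (k * Bq) = cn (I (fun t => H (c t))) * (4 * pi * Bq / (8 * pi * (Bq + 1))).
    by rewrite /k; ring.
  rewrite gtr_pMr// ltr_pdivrMr// mul1r; nra.
have cwn0 t : c t != w.
  by apply/eqP => E; move: (cc t); rewrite E cn_rc => /eqP; rewrite lt_eqF.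
have contA : cont_on (- pi) pi A.
  apply: (@ccont_circle (fun z => z / (z - w))) => t; apply: cderiv_cont.
  apply: cderivM; first exact: cderiv_id.
  apply: (@cderiv_comp R (fun z => z - w) (fun z => z^-1)).
    by apply: cderivD; [exact: cderiv_id|exact: cderiv_cst].
  by apply: cderiv_inv; rewrite subr_eq0.
have Ef : I (fun t => f (c t) * A t) = f w * rc (2 * pi).
  rewrite -IA /I -cintZ//; apply/eqP; rewrite -subr_eq0; apply/eqP.
  rewrite -[RHS]IH0 -[X in _ - X]mul1r -mulNr -cintZ; last exact: cont_onZ.
  rewrite -cintD; [|exact: cont_onM|by do 2 apply: cont_onZ].
  rewrite /I; congr cint; apply/funext => t.
  rewrite /H /q (negbTE (cwn0 t)) /A; ring.
have pi2 : 2 * pi != 0 :> R by rewrite mulf_neq0// gt_eqF.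
have fwE : f w = rc ((2 * pi)^-1) * I (fun t => f (c t) * A t).
  by rewrite Ef mulrCA -rcM mulVf// mulr1.
have -> : f (rc x) - \sum_(k < N) rc ((2 * pi)^-1) * I (fun t => f (c t) * (c t)^-1 ^+ k) * rc x ^+ k
  = rc ((2 * pi)^-1) * (I (fun t => f (c t) * A t) -
     \sum_(k < N) w ^+ k * I (fun t => f (c t) * (c t)^-1 ^+ k)).
  rewrite mulrBr -fwE; congr (_ - _); rewrite mulr_sumr; apply: eq_bigr => k _.
  by rewrite -mulrA [X in _ * X]mulrC.
rewrite cnM cn_rc ger0_norm ?invr_ge0 ?mulr_ge0 ?(ltW ppi)//.
rewrite mulrAC mulrC ler_wpM2r ?invr_ge0 ?mulr_ge0 ?(ltW ppi)//.
by apply: cint_circle_geometric => // t; apply: fM; rewrite cc.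
Unshelve. all: by end_near. Qed.

Lemma cderiv_real_analytic_at (f : K -> K) (g : R -> R) (rho : R) : 0 < rho ->
  (forall z, cn z < rho -> cderiv f z) ->
  (forall x, `|x| < rho -> f (rc x) = rc (g x)) -> real_analytic_at g 0.
Proof.
move=> rho0 df fg; have [a [r r0 h]] := cderiv_power_series rho0 df.
exists (fun k => Re (a k)), (Num.min r rho); first by rewrite lt_min r0.
move=> x; rewrite lt_min => /andP[/h[C [q [q0 q1 hN]]] xrho]; rewrite add0r.
apply/cvgrPdist_le => e e0.
have l : (fun n => C * q ^+ n) @ \oo --> (0 : R).
  rewrite -[X in _ --> X](mulr0 C); apply: cvgM; first exact: cvg_cst.
  by apply: cvg_expr; rewrite ger0_norm.
move/cvgrPdist_le : l => /(_ e e0); apply: filterS => n.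
rewrite sub0r normrN => hn; apply: le_trans (le_trans (ler_norm _) hn).
apply: le_trans (hN n); rewrite fg//.
have -> : g x - pseries (fun k => Re (a k)) x n = Re (rc (g x) - \sum_(k < n) a k * rc x ^+ k).
  rewrite !ReIm /=; congr (_ - _); rewrite /pseries /series /= big_mkord.
  elim: n {hn} => [|n IH]; first by rewrite !big_ord0.
  rewrite !big_ord_recr /= IH !ReIm; congr (_ + _).
  have -> : rc x ^+ n = rc (x ^+ n).
    by elim: (n) => [|m IHm]; rewrite ?expr0// !exprS IHm rcM.
  by rewrite /= mulr0 subr0.
exact: Re_le_cn.
Qed.

End power_series_expansion.

(** * The intermittent map and its inverse branches *)

Section power_inequalities.
Context {R : realType}.
Implicit Types (x y d alpha : R).

Lemma pow1D_ge y d : 0 <= y <= 1 -> 0 <= d -> 1 + d * y / 2 <= (1 + y) `^ d.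
Proof.
move=> /andP[y0 y1] d0.
have y10 : 0 < 1 + y by rewrite ltr_pwDl.
rewrite /powR gt_eqF//; apply: le_trans (expR_ge1Dx _).
rewrite lerD2l -mulrA ler_wpM2l//.
have t : -1 < - (y / (1 + y)).
  by rewrite ltrN2 ltr_pdivrMr// mul1r ltrDr.
have := le_ln1Dx t.
have -> : 1 + - (y / (1 + y)) = (1 + y)^-1 by field; rewrite gt_eqF.
rewrite lnV ?posrE// lerN2 => h; apply: le_trans h.
by rewrite ler_wpM2l// lef_pV2 ?posrE//; lra.
Qed.

Lemma powR_le x y d : 0 <= d -> 0 <= x -> x <= y -> x `^ d <= y `^ d.
Proof.
move=> d0 x0 xy; apply: (ge0_ler_powR d0) => //; rewrite nnegrE//.
exact: le_trans x0 xy.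
Qed.

Lemma powR_le1 x d : 0 <= d -> 0 <= x -> x <= 1 -> x `^ d <= 1.
Proof. by move=> d0 x0 x1; rewrite (le_trans (powR_le d0 x0 x1))// powR1. Qed.

Lemma powR_subadd x y alpha : 0 <= x -> 0 <= y -> 0 < alpha <= 1 ->
  (x + y) `^ alpha <= x `^ alpha + y `^ alpha.
Proof.
move=> x0 y0 /andP[a0 a1].
move: x0; rewrite le_eqVlt => /predU1P[<-|x0].
  by rewrite add0r lerDr powR_ge0.
move: y0; rewrite le_eqVlt => /predU1P[<-|y0].
  by rewrite addr0 lerDl powR_ge0.
have xy0 : 0 < x + y by rewrite addr_gt0.
have E z : 0 < z -> z `^ alpha = z * z `^ (alpha - 1).
  by move=> z0; rewrite mulr_powRB1// ltW.
have le z : 0 < z -> z <= x + y -> (x + y) `^ (alpha - 1) <= z `^ (alpha - 1).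
  move=> z0 zxy; have -> : alpha - 1 = - (1 - alpha) by ring.
  rewrite !powRN lef_pV2 ?posrE ?powR_gt0//.
  by apply: powR_le; rewrite ?subr_ge0// ltW.
rewrite !E// mulrDl lerD// ler_wpM2l ?(ltW x0) ?(ltW y0)//; apply: le => //.
  by rewrite lerDl ltW.
by rewrite lerDr ltW.
Qed.

Lemma powR_holder x y alpha : 0 <= x -> 0 <= y -> 0 < alpha <= 1 ->
  `|x `^ alpha - y `^ alpha| <= `|x - y| `^ alpha.
Proof.
wlog xy : x y / x <= y.
  move=> h x0 y0 ha; have [xy|/ltW xy] := leP x y; first exact: h.
  by rewrite distrC [X in _ <= X `^ _]distrC; exact: h.
move=> x0 y0 ha; rewrite distrC [X in _ <= X `^ _]distrC.
rewrite [X in _ <= X `^ _]ger0_norm ?subr_ge0// ger0_norm; last first.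
  by rewrite subr_ge0 powR_le// ltW//; case/andP: ha.
rewrite lerBlDr; apply: le_trans (powR_subadd _ x0 ha); first by rewrite subrK.
by rewrite subr_ge0.
Qed.

Lemma powR_lt_eps (e alpha : R) : 0 < e -> 0 < alpha ->
  exists2 del : R, 0 < del & forall x, 0 <= x < del -> x `^ alpha < e.
Proof.
move=> e0 a0; exists (e `^ alpha^-1); first by rewrite powR_gt0.
move=> x /andP[x0 xd].
have := gt0_ltr_powR a0 _ _ xd; rewrite !nnegrE x0 powR_ge0 => /(_ isT isT).
by rewrite -powRrM mulVf ?gt_eqF// powRr1// ltW.
Qed.

End power_inequalities.

Section intermittent_branches.
Context {R : realType} (alpha : R).
Hypothesis alpha01 : 0 < alpha <= 1.
Implicit Types (x y a b : R).

Let alpha0 : 0 < alpha. Proof. by case/andP: alpha01. Qed.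

Definition lift_map x := x * (1 + x `^ alpha).
Local Notation T := lift_map.

Lemma lift_map0 : T 0 = 0. Proof. by rewrite /T mul0r. Qed.
Lemma lift_map1 : T 1 = 2. Proof. by rewrite /T powR1 mul1r. Qed.

Lemma lift_map_expand a b : 0 <= a <= b -> (b - a) * (1 + a `^ alpha) <= T b - T a.
Proof.
move=> /andP[a0 ab].
have h : a `^ alpha <= b `^ alpha.
  by apply: powR_le => //; exact: ltW.
have := ler_wpM2l (le_trans a0 ab) h; rewrite /T; lra.
Qed.

Lemma lift_map_super a b : 0 <= a <= b -> T (b - a) <= T b - T a.
Proof.
move=> /andP[a0 ab].
have ba0 : 0 <= b - a by rewrite subr_ge0.
have b0 : 0 <= b := le_trans a0 ab.
have h1 : a `^ alpha <= b `^ alpha.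
  by apply: powR_le => //; exact: ltW.
have h2 : (b - a) `^ alpha <= b `^ alpha.
  by apply: powR_le => //; [exact: ltW|rewrite gerBl].
have k1 := ler_wpM2l a0 h1; have k2 := ler_wpM2l ba0 h2.
rewrite /T; lra.
Qed.

Lemma lift_map_incr a b : 0 <= a <= b -> b - a <= T b - T a.
Proof.
move=> ab; apply: le_trans (lift_map_expand ab).
by rewrite ler_peMr ?lerDl ?powR_ge0// subr_ge0; case/andP: ab.
Qed.

Lemma lift_map_le a b : 0 <= a -> 0 <= b -> (T a <= T b) = (a <= b).
Proof.
move=> a0 b0; apply/idP/idP => h; last first.
  have := lift_map_incr (_ : 0 <= a <= b); rewrite a0 h => /(_ isT); lra.
rewrite leNgt; apply/negP => ba.
have := lift_map_incr (_ : 0 <= b <= a); rewrite b0 (ltW ba) => /(_ isT); lra.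
Qed.

Lemma lift_map_surj y : 0 <= y <= 2 -> exists x, 0 <= x <= 1 /\ T x = y.
Proof.
move=> hy; have [||c] := @IVT R T 0 1 y ler01.
- apply/subspace_continuousP => x /=; rewrite in_itv /= => /andP[x0 x1].
  have cp : (fun y => y `^ alpha) @ within [set` `[0, 1]] (nbhs x) --> x `^ alpha.
    apply/cvgrPdist_lt => e e0; have [d d0 hd] := powR_lt_eps e0 alpha0.
    rewrite near_withinE; apply/nbhs_ballP; exists d => //= z xz.
    rewrite in_itv /= => /andP[z0 z1]; apply: le_lt_trans (powR_holder x0 z0 alpha01) _.
    by apply: hd; rewrite normr_ge0.
  have ci : id @ within [set` `[0, 1]] (nbhs x) --> x.
    exact: (@within_continuous_withinNx _ _ id) || apply: cvg_within.
  apply: cvgM; first exact: ci.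
  by apply: cvgD => //; exact: cvg_cst.
- rewrite lift_map0 lift_map1 min_l ?max_r//; lra.
- by rewrite in_itv /= => c01 <-; exists c.
Qed.

Definition lift_inv y := xget 0 [set x | 0 <= x <= 1 /\ T x = y].
Local Notation G := lift_inv.

Lemma lift_invP y : 0 <= y <= 2 -> 0 <= G y <= 1 /\ T (G y) = y.
Proof.
move=> hy; have [x hx] := lift_map_surj hy.
by rewrite /lift_inv; case: xgetP => [z _ //|/(_ x)].
Qed.

Lemma lift_inv01 y : 0 <= y <= 2 -> 0 <= G y <= 1.
Proof. by case/lift_invP. Qed.

Lemma lift_map_inj a b : 0 <= a -> 0 <= b -> T a = T b -> a = b.
Proof.
move=> a0 b0 E; apply/eqP.
by rewrite eq_le -(lift_map_le a0 b0) -(lift_map_le b0 a0) E lexx.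
Qed.

Lemma lift_map_ran x : 0 <= x <= 1 -> 0 <= T x <= 2.
Proof.
by move=> /andP[x0 x1]; rewrite -{1}lift_map0 -lift_map1 !lift_map_le// x0.
Qed.

Lemma lift_mapK x : 0 <= x <= 1 -> G (T x) = x.
Proof.
move=> x01; have [/andP[g0 g1] E] := lift_invP (lift_map_ran x01).
by apply: lift_map_inj => //; case/andP: x01.
Qed.

Lemma lift_inv_dist x y : 0 <= x -> x <= y -> y <= 2 ->
  [/\ G x <= G y, G y - G x <= y - x & G y - G x <= G (y - x)].
Proof.
move=> x0 xy y2.
have hx : 0 <= x <= 2 by rewrite x0 (le_trans xy).
have hy : 0 <= y <= 2 by rewrite y2 (le_trans x0).
have hd : 0 <= y - x <= 2 by lra.
have [/andP[a _] E] := lift_invP hx; have [/andP[b _] F] := lift_invP hy.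
have [/andP[c _] H] := lift_invP hd.
have le : G x <= G y by rewrite -lift_map_le ?E ?F.
have ge : 0 <= G x <= G y by rewrite a.
split => //; first by have := lift_map_incr ge; rewrite E F.
have := lift_map_super ge; rewrite E F -{1}H lift_map_le//.
by rewrite subr_ge0.
Qed.

Lemma lift_inv0 : G 0 = 0.
Proof. by rewrite -{1}lift_map0 lift_mapK// lexx ler01. Qed.

Lemma lift_inv_gt0 y : 0 < y -> y <= 2 -> 0 < G y.
Proof.
move=> y0 y2; have hy : 0 <= y <= 2 by rewrite ltW.
have [/andP[a _] E] := lift_invP hy.
rewrite lt_neqAle a andbT; apply/eqP => G0.
by move: y0; rewrite -E -G0 lift_map0 ltxx.
Qed.

Definition cut_point := G 1.

Lemma cut_point01 : 0 < cut_point < 1.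
Proof.
have h : 0 <= (1 : R) <= 2 by lra.
have [/andP[a b] E] := lift_invP h.
rewrite lift_inv_gt0 ?ltr01 ?ler1n//= lt_neqAle b andbT; apply/eqP => G1.
by move: E; rewrite -/cut_point G1 lift_map1; lra.
Qed.

Definition cut_rate := (1 + cut_point `^ alpha)^-1.

Lemma cut_rate01 : 0 < cut_rate < 1.
Proof.
have /andP[p0 p1] := cut_point01.
have h : 0 < cut_point `^ alpha by rewrite powR_gt0.
by rewrite invr_gt0 addr_gt0//= invf_lt1 ?addr_gt0// ltrDl.
Qed.

Lemma lift_inv_contract x y : 1 <= x -> x <= y -> y <= 2 ->
  G y - G x <= cut_rate * (y - x).
Proof.
move=> x1 xy y2.
have hx : 0 <= x <= 2 by rewrite (le_trans xy) ?(le_trans ler01).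
have hy : 0 <= y <= 2 by rewrite y2 (le_trans _ xy)// (le_trans ler01).
have [/andP[a _] E] := lift_invP hx; have [/andP[b _] F] := lift_invP hy.
have [le _ _] := lift_inv_dist (le_trans ler01 x1) xy y2.
have [le1 _ _] := lift_inv_dist ler01 x1 (le_trans xy y2).
have ge : 0 <= G x <= G y by rewrite a.
have /andP[p0 p1] := cut_point01.
have h : 0 < cut_point `^ alpha by rewrite powR_gt0.
rewrite mulrC ler_pdivlMr ?addr_gt0//.
have := lift_map_expand ge; rewrite E F; apply: le_trans.
rewrite ler_wpM2l ?subr_ge0// lerD2l; apply: powR_le => //; exact: ltW.
Qed.

Definition zero_orbit n := iter n G 1.
Local Notation xs := zero_orbit.

Lemma zero_orbit01 n : 0 < xs n <= 1.
Proof.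
elim: n => [|n /andP[x0 x1]]; first by rewrite ltr01 lexx.
have x2 : xs n <= 2 by rewrite (le_trans x1)// ler1n.
have hx : 0 <= xs n <= 2 by rewrite ltW.
by rewrite /= lift_inv_gt0//=; have /andP[] := lift_inv01 hx.
Qed.

Lemma zero_orbitE n : T (xs n.+1) = xs n.
Proof.
have /andP[x0 x1] := zero_orbit01 n.
have hx : 0 <= xs n <= 2 by rewrite ltW//= (le_trans x1)// ler1n.
by have [] := lift_invP hx.
Qed.

Lemma zero_orbitS n : xs n = xs n.+1 * (1 + xs n.+1 `^ alpha).
Proof. by rewrite -{1}zero_orbitE. Qed.

Lemma zero_orbit_pow n : xs n `^ alpha <= 4 / alpha / n.+1%:R.
Proof.
have al1 : alpha <= 1 by case/andP: alpha01.
have y01 k : 0 < xs k `^ alpha <= 1.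
  have /andP[x0 x1] := zero_orbit01 k; rewrite powR_gt0//=.
  by rewrite powR_le1 ?(ltW x0) ?(ltW alpha0).
have step k : (xs k `^ alpha)^-1 + alpha / 4 <= (xs k.+1 `^ alpha)^-1.
  have /andP[x0 x1] := zero_orbit01 k.+1.
  have := y01 k.+1; set y := xs k.+1 `^ alpha => /andP[y0 y1].
  have E : xs k `^ alpha = y * (1 + y) `^ alpha.
    rewrite zero_orbitS powRM ?(ltW x0)//; by rewrite addr_ge0// ltW.
  have h1 : 1 + alpha * y / 2 <= (1 + y) `^ alpha.
    by apply: pow1D_ge; rewrite ?(ltW y0) ?(ltW alpha0).
  have h2 : (1 + y) `^ alpha <= 2.
    apply: (@le_trans _ _ (1 + y)); last lra.
    by apply: ler1_powR => //; rewrite lerDl ltW.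
  set q := (1 + y) `^ alpha in E h1 h2 *.
  have ay : 0 < alpha * y by rewrite mulr_gt0.
  have q0 : 0 < q by apply: lt_le_trans h1; lra.
  rewrite E -subr_ge0.
  have -> : y^-1 - ((y * q)^-1 + alpha / 4) = (q - 1 - alpha / 4 * (y * q)) / (y * q).
    by field; rewrite !gt_eqF.
  apply: divr_ge0; last by rewrite mulr_ge0// ltW.
  have := ler_wpM2l (ltW y0) h2; have := alpha0; nra.
have ind k : (alpha / 4) * k.+1%:R <= (xs k `^ alpha)^-1.
  elim: k => [|k IH]; first by rewrite mulr1 /= powR1 invr1; lra.
  by rewrite -[k.+2%:R]natr1 mulrDr mulr1; apply: le_trans (step k); rewrite lerD2r.
have /andP[y0 _] := y01 n.
have E : 4 / alpha / n.+1%:R = (alpha / 4 * n.+1%:R)^-1.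
  by rewrite invfM invf_div.
rewrite E -[leLHS]invrK lef_pV2 ?posrE ?invr_gt0// mulr_gt0// divr_gt0//.
Qed.

Lemma zero_orbit_series (d : R) n : 0 < d <= 1 ->
  \sum_(j < n) xs j.+1 `^ (alpha + d) <= 2 / d.
Proof.
move=> /andP[d0 d1].
have step j : xs j.+1 `^ (alpha + d) <= 2 / d * (xs j `^ d - xs j.+1 `^ d).
  have /andP[x0 x1] := zero_orbit01 j.+1.
  have x0' := ltW x0.
  have y0 : 0 <= xs j.+1 `^ alpha by exact: powR_ge0.
  have y1 : xs j.+1 `^ alpha <= 1.
    by rewrite powR_le1 ?(ltW x0) ?(ltW alpha0).
  have h : 1 + d * (xs j.+1 `^ alpha) / 2 <= (1 + xs j.+1 `^ alpha) `^ d.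
    by apply: pow1D_ge; rewrite ?y0 ?y1 ?(ltW d0).
  rewrite (zero_orbitS j) powRM ?addr_ge0// powRD; last by rewrite gt_eqF ?addr_gt0.
  have p0 : 0 <= xs j.+1 `^ d by exact: powR_ge0.
  have -> : 2 / d * (xs j.+1 `^ d * (1 + xs j.+1 `^ alpha) `^ d - xs j.+1 `^ d) =
    xs j.+1 `^ d * (2 / d * ((1 + xs j.+1 `^ alpha) `^ d - 1)) by ring.
  rewrite mulrC ler_wpM2l// mulrC -ler_pdivrMr ?divr_gt0// invf_div; lra.
apply: (@le_trans _ _ (\sum_(j < n) (2 / d * (xs j `^ d - xs j.+1 `^ d)))).
  exact: ler_sum.
rewrite -mulr_sumr ler_piMr ?divr_ge0 ?(ltW d0)//.
have -> : \sum_(j < n) (xs j `^ d - xs j.+1 `^ d) = xs 0 `^ d - xs n `^ d.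
  elim: n => [|n IH]; first by rewrite big_ord0 subrr.
  by rewrite big_ord_recr /= IH; ring.
by rewrite /= powR1 gerBl powR_ge0.
Qed.

End intermittent_branches.

Section words.

Fixpoint words n : seq (seq bool) :=
  if n is n'.+1 then [seq false :: u | u <- words n'] ++ [seq true :: u | u <- words n']
  else [:: [::]].

Lemma mem_words n u : (u \in words n) = (size u == n).
Proof.
elim: n u => [|n IH] [|b u] //=.
  by rewrite mem_cat; apply/negbTE; rewrite negb_or; apply/andP; split;
    apply/negP => /mapP[].
rewrite mem_cat eqSS -IH; case: b.
  rewrite [X in X || _](_ : _ = false).
    by rewrite mem_map// => ? ? [].
  by apply/negbTE/negP => /mapP[? _].
rewrite [X in _ || X](_ : _ = false) ?orbF.
  by rewrite mem_map// => ? ? [].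
by apply/negbTE/negP => /mapP[? _].
Qed.

Lemma words_uniq n : uniq (words n).
Proof.
elim: n => //= n IH; rewrite cat_uniq !map_inj_uniq//; [|by move=> ? ? []..].
rewrite IH andbT /=; apply/hasPn => u /mapP[v _ ->].
by apply/negP => /mapP[? _].
Qed.

Section sums.
Context (V : nmodType).
Implicit Types (F : seq bool -> V).

Lemma sum_words0 F : \sum_(u <- words 0) F u = F [::].
Proof. by rewrite /= big_seq1. Qed.

Lemma sum_wordsS n F : \sum_(u <- words n.+1) F u =
  \sum_(u <- words n) F (false :: u) + \sum_(u <- words n) F (true :: u).
Proof. by rewrite /= big_cat !big_map. Qed.

Lemma sum_words_cat m n F : \sum_(u <- words (m + n)) F u =
  \sum_(u <- words m) \sum_(v <- words n) F (u ++ v).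
Proof.
elim: m F => [|m IH] F; first by rewrite sum_words0.
by rewrite addSn !sum_wordsS !IH.
Qed.

Lemma sum_words_rcons n F : \sum_(u <- words n.+1) F u =
  \sum_(u <- words n) (F (rcons u false) + F (rcons u true)).
Proof.
rewrite -addn1 sum_words_cat; apply: eq_bigr => u _.
by rewrite sum_wordsS !sum_words0 !cats1.
Qed.

End sums.
End words.

Section unit_interval_branches.
Context {R : realType} (alpha : R).
Hypothesis alpha01 : 0 < alpha <= 1.
Let alpha0 : 0 < alpha. Proof. by case/andP: alpha01. Qed.
Local Notation G := (lift_inv alpha).
Local Notation xs := (zero_orbit alpha).
Local Notation kappa := (cut_rate alpha).

Definition I01 := {x : R | 0 <= x <= 1}.
Implicit Types (x y : I01) (b : bool) (u v : seq bool).

Lemma I01_ge0 x : 0 <= val x. Proof. by case/andP: (valP x). Qed.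
Lemma I01_le1 x : val x <= 1. Proof. by case/andP: (valP x). Qed.

Lemma branch_dom x b : 0 <= val x + b%:R <= 2.
Proof. by have := I01_ge0 x; have := I01_le1 x; case: b => /= ? ?; lra. Qed.

Definition branch b x : I01 := exist _ (G (val x + b%:R)) (lift_inv01 alpha01 (branch_dom x b)).

Lemma unit0P : 0 <= (0 : R) <= 1. Proof. by rewrite lexx ler01. Qed.
Lemma unit1P : 0 <= (1 : R) <= 1. Proof. by rewrite lexx ler01. Qed.
Definition I01_0 : I01 := exist _ 0 unit0P.
Definition I01_1 : I01 := exist _ 1 unit1P.

Definition dist x y := `|val x - val y|.

Lemma dist_sym x y : dist x y = dist y x. Proof. exact: distrC. Qed.
Lemma dist_ge0 x y : 0 <= dist x y. Proof. exact: normr_ge0. Qed.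
Lemma dist_le1 x y : dist x y <= 1.
Proof.
have := I01_ge0 x; have := I01_le1 x; have := I01_ge0 y; have := I01_le1 y.
by rewrite /dist ler_norml; lra.
Qed.

Lemma lift_map_branch b x : lift_map alpha (val (branch b x)) = val x + b%:R.
Proof. by have [] := lift_invP alpha01 (branch_dom x b). Qed.

Lemma branch_le b x y : val x <= val y -> val (branch b x) <= val (branch b y).
Proof.
move=> xy; have /andP[x0 x2] := branch_dom x b; have /andP[y0 y2] := branch_dom y b.
by have [] // := lift_inv_dist alpha01 x0 _ y2; rewrite lerD2r.
Qed.

Lemma branch_dist b x y :
  dist (branch b x) (branch b y) <= dist x y /\ dist (branch b x) (branch b y) <= G (dist x y).
Proof.
wlog xy : x y / val y <= val x.
  move=> h; have [/h//|/ltW/h] := leP (val y) (val x).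
  by rewrite dist_sym [dist y x]dist_sym.
have /andP[x0 x2] := branch_dom x b; have /andP[y0 y2] := branch_dom y b.
have := lift_inv_dist alpha01 y0 _ x2; rewrite lerD2r => /(_ xy)[le].
rewrite /dist /= !ger0_norm ?subr_ge0//.
have -> : val x + b%:R - (val y + b%:R) = val x - val y by ring.
by [].
Qed.

Lemma branch1_dist x y : dist (branch true x) (branch true y) <= kappa * dist x y.
Proof.
wlog xy : x y / val y <= val x.
  move=> h; have [/h//|/ltW/h] := leP (val y) (val x).
  by rewrite dist_sym [dist y x]dist_sym.
have /andP[x0 x2] := branch_dom x true; have /andP[y0 y2] := branch_dom y true.
have := lift_inv_contract alpha01 _ _ x2 => /(_ (val y + true%:R)).
rewrite lerD2r => /(_ _ xy); rewrite lerDr I01_ge0 => /(_ isT).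
have := branch_le true xy.
rewrite /dist => le; rewrite !ger0_norm ?subr_ge0//.
by have -> : val x + true%:R - (val y + true%:R) = val x - val y by ring.
Qed.

Definition word_map u x := foldr branch x u.

Lemma word_map_cat u v x : word_map (u ++ v) x = word_map u (word_map v x).
Proof. exact: foldr_cat. Qed.

Lemma lift_inv_iter_le n (s t : R) : 0 <= s -> s <= t -> t <= 1 ->
  0 <= iter n G s /\ iter n G s <= iter n G t /\ iter n G t <= 1.
Proof.
move=> s0 st t1; elim: n => [//|n [h1 [h2 h3]]] /=.
have h4 : iter n G t <= 2 by rewrite (le_trans h3)// ler1n.
have [? _ _] := lift_inv_dist alpha01 h1 h2 h4.
have hs : 0 <= iter n G s <= 2 by rewrite h1 (le_trans h2).
have ht : 0 <= iter n G t <= 2 by rewrite h4 (le_trans h1).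
have /andP[? _] := lift_inv01 alpha01 hs.
by have /andP[] := lift_inv01 alpha01 ht.
Qed.

Lemma word_map_dist u x y : dist (word_map u x) (word_map u y) <= xs (size u).
Proof.
suff h : dist (word_map u x) (word_map u y) <= iter (size u) G (dist x y).
  apply: le_trans h _.
  by have [_ [+ _]] := lift_inv_iter_le (size u) (dist_ge0 x y) (dist_le1 x y) (lexx 1).
elim: u => //= b u IH; have [_ h] := branch_dist b (word_map u x) (word_map u y).
apply: le_trans h _.
have [_ [_ h1]] := lift_inv_iter_le (size u) (dist_ge0 x y) (dist_le1 x y) (lexx 1).
have [h2 [_ h3]] := lift_inv_iter_le (size u) (dist_ge0 x y) (lexx (dist x y)) (dist_le1 x y).
by have [] // := lift_inv_dist alpha01 (dist_ge0 _ _) IH (le_trans h3 (ler1n _ 2)).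
Qed.

Lemma word_map_le u x y : val x <= val y -> val (word_map u x) <= val (word_map u y).
Proof. by elim: u => //= b u IH /IH; exact: branch_le. Qed.

Fixpoint birkhoff (V : nmodType) (phi : I01 -> V) u x : V :=
  if u is b :: u' then phi (word_map u x) + birkhoff phi u' x else 0.

Lemma birkhoff_cat (V : nmodType) (phi : I01 -> V) u v x :
  birkhoff phi (u ++ v) x = birkhoff phi u (word_map v x) + birkhoff phi v x.
Proof.
elim: u => [|b u IH] /=; first by rewrite add0r.
by rewrite IH word_map_cat addrA.
Qed.

Definition rholder (A : R) (phi : I01 -> R) :=
  forall x y, `|phi x - phi y| <= A * dist x y `^ alpha.

Definition orbit_sum n := \sum_(j < n) xs j.+1 `^ alpha.

Lemma orbit_sum_sublinear (e : R) : 0 < e -> exists C : R, forall n, orbit_sum n <= e * n%:R + C.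
Proof.
move=> e0; pose c := 4 / alpha.
have c0 : 0 < c by rewrite divr_gt0.
pose J := (Num.truncn (c / e)).+1.
exists J%:R => n; have xs1 j : xs j.+1 `^ alpha <= 1.
  by have /andP[/ltW x0 x1] := zero_orbit01 alpha01 j.+1; rewrite powR_le1// ltW.
have step j : xs j.+1 `^ alpha <= e + (j < J)%:R.
  have [jJ|jJ] := ltnP j J; first by rewrite (le_trans (xs1 j))// lerDr ltW.
  rewrite addr0; apply: le_trans (zero_orbit_pow alpha01 j.+1) _.
  rewrite -/c ler_pdivrMr// -ler_pdivrMl// mulrC.
  have h : c / e < J%:R by rewrite truncnS_gt.
  by apply: le_trans (ltW h) _; rewrite ler_nat (leq_trans jJ)// leqW.
apply: (@le_trans _ _ (\sum_(j < n) (e + (j < J)%:R))); first exact: ler_sum.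
rewrite big_split /= sumr_const card_ord -[e *+ n]mulr_natr lerD2l.
suff -> : \sum_(j < n) (j < J)%:R = (minn n J)%:R :> R by rewrite ler_nat geq_minr.
elim: n => [|n IH]; first by rewrite big_ord0 min0n.
rewrite big_ord_recr /= IH -natrD; congr (_%:R); have [nJ|Jn] := ltnP n J.
  by rewrite (minn_idPl nJ) addn1.
by rewrite addn0 (minn_idPr (leqW Jn)).
Qed.

Lemma birkhoff_var (A : R) phi u x y : 0 <= A -> rholder A phi ->
  `|birkhoff phi u x - birkhoff phi u y| <= A * orbit_sum (size u).
Proof.
move=> A0 hphi; elim: u => [|b u IH] /=.
  by rewrite subrr normr0 mulr_ge0// sumr_ge0// => j _; exact: powR_ge0.
rewrite opprD addrACA (le_trans (ler_normD _ _))//.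
rewrite /orbit_sum big_ord_recr /= mulrDr [leRHS]addrC lerD//.
apply: le_trans (hphi _ _) _; rewrite ler_wpM2l// powR_le ?(ltW alpha0)//.
  exact: dist_ge0.
exact: (word_map_dist (b :: u)).
Qed.

Definition partition_sum (phi : I01 -> R) n x :=
  \sum_(u <- words n) expR (birkhoff phi u x).

Lemma partition_sumS phi n x : partition_sum phi n.+1 x =
  expR (phi (branch false x)) * partition_sum phi n (branch false x) +
  expR (phi (branch true x)) * partition_sum phi n (branch true x).
Proof.
rewrite /partition_sum sum_words_rcons big_split /= !mulr_sumr.
by congr (_ + _); apply: eq_bigr => u _; rewrite -cats1 birkhoff_cat /= addr0 expRD mulrC.
Qed.

Lemma partition_sum_gt0 phi n x : 0 < partition_sum phi n x.
Proof.
elim: n x => [|n IH] x; first by rewrite /partition_sum sum_words0 /= expR0.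
by rewrite partition_sumS addr_gt0// mulr_gt0 ?expR_gt0.
Qed.

Lemma partition_sum_ge_word phi u x : expR (birkhoff phi u x) <= partition_sum phi (size u) x.
Proof.
by rewrite /partition_sum (big_rem u) ?mem_words//= lerDl sumr_ge0.
Qed.

(* Excursions: the inverse branch of the first return to the right half
   indexed by the number [k] of iterations spent in the left half. *)
Definition excursion k x := iter k (branch false) (branch true x).

Lemma excursion_word k x : excursion k x = word_map (rcons (nseq k false) true) x.
Proof. by elim: k => //= k; rewrite /excursion /= => ->. Qed.

Lemma excursion_contract k x y : dist (excursion k x) (excursion k y) <= kappa * dist x y.
Proof.
elim: k => [|k]; first exact: branch1_dist.
by apply: le_trans; have [] := branch_dist false (excursion k x) (excursion k y).
Qed.

Lemma excursion_range k x : xs k.+1 <= val (excursion k x) <= xs k.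
Proof.
elim: k => [|k /andP[h1 h2]]; rewrite /excursion /=.
  have /andP[x0 x2] := branch_dom x true.
  have [] // := lift_inv_dist alpha01 ler01 _ x2; first by rewrite lerDr I01_ge0.
  move=> -> _ _ /=; by have /andP[] := lift_inv01 alpha01 (branch_dom x true).
have /andP[a0 a1] := zero_orbit01 alpha01 k.+1.
have /andP[b0 b1] := zero_orbit01 alpha01 k.
have e1 := I01_le1 (excursion k x); have e0 := I01_ge0 (excursion k x).
rewrite addr0; apply/andP; split.
  have [] // := lift_inv_dist alpha01 (ltW a0) h1; exact: le_trans e1 (ler1n _ 2).
have [] // := lift_inv_dist alpha01 e0 h2; exact: le_trans b1 (ler1n _ 2).
Qed.

Definition dexp := alpha ^+ 2 / 2.
Definition eta := alpha ^+ 2 / (2 * (1 + alpha)).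
Definition eta_dist x y := dist x y `^ eta.

Lemma eta_gt0 : 0 < eta.
Proof. by rewrite /eta divr_gt0 ?exprn_gt0// mulr_gt0// addr_gt0. Qed.

Lemma eta_dist_nonneg x y : 0 <= eta_dist x y. Proof. exact: powR_ge0. Qed.
Lemma eta_dist_le1 x y : eta_dist x y <= 1.
Proof. by rewrite powR_le1 ?dist_ge0 ?dist_le1// ltW// eta_gt0. Qed.
Lemma eta_dist_sym x y : eta_dist x y = eta_dist y x.
Proof. by rewrite /eta_dist dist_sym. Qed.

Definition eta_rate := kappa `^ eta.
Lemma eta_rate01 : 0 < eta_rate < 1.
Proof.
have /andP[k0 k1] := cut_rate01 alpha01; rewrite powR_gt0//=.
have := gt0_ltr_powR eta_gt0 (_ : kappa \in Num.nneg) (_ : 1 \in Num.nneg) k1.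
by rewrite powR1; apply; rewrite nnegrE ?ler01// ltW.
Qed.

Lemma eta_dist_excursion k x y : eta_dist (excursion k x) (excursion k y) <= eta_rate * eta_dist x y.
Proof.
have /andP[/ltW k0 k1] := cut_rate01 alpha01.
rewrite -powRM ?dist_ge0// powR_le ?(ltW eta_gt0) ?dist_ge0//.
exact: excursion_contract.
Qed.

Lemma excursion_distortion k x y :
  \sum_(j < k.+1) dist (excursion j x) (excursion j y) `^ alpha <= 2 / dexp * eta_dist x y.
Proof.
have al1 : alpha <= 1 by case/andP: alpha01.
have a10 : 0 < 1 + alpha by rewrite addr_gt0.
have ea : eta <= alpha.
  rewrite /eta ler_pdivrMr ?mulr_gt0//; have := sqr_ge0 alpha; have := alpha0; lra.
have d01 : 0 < dexp <= 1.
  rewrite /dexp divr_gt0 ?exprn_gt0//= ler_pdivrMr// mul1r.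
  by rewrite (le_trans (exprn_ile1 _ _ _))// ?ltW// ltr1n.
have step j : dist (excursion j x) (excursion j y) `^ alpha <=
    eta_dist x y * xs j.+1 `^ (alpha + dexp).
  have d0 := dist_ge0 (excursion j x) (excursion j y).
  have -> : dist (excursion j x) (excursion j y) `^ alpha =
    dist (excursion j x) (excursion j y) `^ eta *
    dist (excursion j x) (excursion j y) `^ (alpha - eta).
    rewrite -powRD ?subrKC// [alpha == 0]gt_eqF//.
  have /andP[x0 x1] := zero_orbit01 alpha01 j.+1.
  rewrite ler_pM ?powR_ge0//.
    rewrite powR_le ?(ltW eta_gt0)//; apply: le_trans (excursion_contract j x y) _.
    have /andP[/ltW k0 /ltW k1] := cut_rate01 alpha01.
    by rewrite ler_piMl ?dist_ge0.
  have dle : dist (excursion j x) (excursion j y) <= xs j.+1 `^ (1 + alpha).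
    have /andP[p1 p2] := excursion_range j x; have /andP[q1 q2] := excursion_range j y.
    rewrite powRD ?powRr1 ?(ltW x0)//; last by rewrite gt_eqF.
    have := zero_orbitS alpha01 j; rewrite mulrDr mulr1 => E.
    by rewrite /dist ler_norml; lra.
  apply: le_trans (powR_le _ d0 dle) _; first by rewrite subr_ge0.
  rewrite -powRrM (_ : (1 + alpha) * (alpha - eta) = alpha + dexp)//.
  by rewrite /eta /dexp; field; rewrite gt_eqF.
apply: (@le_trans _ _ (\sum_(j < k.+1) (eta_dist x y * xs j.+1 `^ (alpha + dexp)))).
  exact: ler_sum.
rewrite -mulr_sumr mulrC ler_wpM2r ?eta_dist_nonneg//.
exact: zero_orbit_series.
Qed.

End unit_interval_branches.

(** * The variational principle: upper bound *)

Section probability_of_sets.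
Context {R : realType} (nu : probability (measurableTypeR R) R).
Implicit Types A B : set (measurableTypeR R).

Definition prob A : R := fine (nu A).

Lemma prob_fin A : measurable A -> nu A \is a fin_num.
Proof. by move=> mA; exact: fin_num_measure. Qed.
Lemma prob_ge0 A : 0 <= prob A. Proof. by rewrite fine_ge0. Qed.
Lemma probE A : measurable A -> nu A = (prob A)%:E.
Proof. by move=> mA; rewrite /prob fineK// prob_fin. Qed.
Lemma prob_le A B : measurable A -> measurable B -> A `<=` B -> prob A <= prob B.
Proof.
move=> mA mB AB; rewrite -lee_fin -!probE//.
by apply: le_measure; rewrite ?inE.
Qed.
Lemma prob_setT : prob setT = 1. Proof. by rewrite /prob probability_setT. Qed.
Lemma prob_le1 A : measurable A -> prob A <= 1.
Proof. by move=> mA; rewrite -prob_setT prob_le. Qed.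
Lemma probU A B : measurable A -> measurable B -> A `&` B = set0 ->
  prob (A `|` B) = prob A + prob B.
Proof.
move=> mA mB AB; apply: EFin_inj; rewrite EFinD -!probE//; last exact: measurableU.
exact: measureU.
Qed.
Lemma probU_le A B : measurable A -> measurable B -> prob (A `|` B) <= prob A + prob B.
Proof.
move=> mA mB; rewrite -lee_fin EFinD -!probE//; last exact: measurableU.
exact: measureU2.
Qed.
Lemma prob_split A B : measurable A -> measurable B ->
  prob A = prob (A `&` B) + prob (A `&` ~` B).
Proof.
move=> mA mB; rewrite -probU ?setIUr -?setIUr ?setUv ?setIT//.
- exact: measurableI.
- by apply: measurableI => //; exact: measurableC.
- by rewrite setIACA setICr setI0.
Qed.
Lemma prob_setC A : measurable A -> prob (~` A) = 1 - prob A.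
Proof.
move=> mA; have := prob_split measurableT mA.
by rewrite !setTI prob_setT => ->; rewrite addrC addKr.
Qed.
Lemma prob0 : prob set0 = 0. Proof. by rewrite /prob measure0. Qed.

End probability_of_sets.

Section coding.
Context {R : realType} (alpha : R).
Hypothesis alpha01 : 0 < alpha <= 1.
Let alpha0 : 0 < alpha. Proof. by case/andP: alpha01. Qed.
Local Notation G := (lift_inv alpha).
Local Notation T := (lift_map alpha).
Local Notation xs := (zero_orbit alpha).
Local Notation f := (intermittent alpha).
Local Notation br := (branch alpha01).
Local Notation wm := (word_map alpha01).
Implicit Types (x y : R) (b : bool) (u v : seq bool) (X : @I01 R).

Definition label x : bool := cut_point alpha < x.

Lemma intermittentE x : f x = if T x <= 1 then T x else T x - 1.
Proof. by []. Qed.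

Lemma lift_le1 x : 0 <= x <= 1 -> (T x <= 1) = ~~ label x.
Proof.
move=> /andP[x0 x1].
have h : 0 <= (1 : R) <= 2 by lra.
have [/andP[c0 _] E] := lift_invP alpha01 h.
by rewrite -{1}E lift_map_le// -leNgt.
Qed.

Lemma intermittent01 x : 0 <= x <= 1 -> 0 <= f x <= 1.
Proof.
move=> x01; have /andP[a b] := lift_map_ran alpha01 x01.
by rewrite intermittentE; case: ifPn => [|/negP/negP]; rewrite ?a// -ltNge => ?; lra.
Qed.

Definition shift_map X : @I01 R := exist _ (f (val X)) (intermittent01 (valP X)).

Lemma branch_label X : br (label (val X)) (shift_map X) = X.
Proof.
case: X => x x01; apply: val_inj => /=; rewrite intermittentE (lift_le1 x01).
by case: (label x) => /=; rewrite ?subrK ?addr0 lift_mapK.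
Qed.

Definition itin n x : seq bool := mkseq (fun j => label (iter j f x)) n.

Lemma size_itin n x : size (itin n x) = n. Proof. exact: size_mkseq. Qed.

Lemma itinS n x : itin n.+1 x = label x :: itin n (f x).
Proof.
rewrite /itin /mkseq /= -[1%N]addn0 iotaDl -map_comp; congr (_ :: _).
by apply: eq_map => j; rewrite /comp add1n iterSr.
Qed.

Lemma itinSr n x : itin n.+1 x = rcons (itin n x) (label (iter n f x)).
Proof. exact: mkseqS. Qed.

Lemma itin_cat m n x : itin (m + n) x = itin m x ++ itin n (iter m f x).
Proof. by elim: m x => [//|m IH x]; rewrite addSn !itinS IH iterSr. Qed.

Lemma word_map_itin n X : wm (itin n (val X)) (iter n shift_map X) = X.
Proof.
elim: n X => [//|n IH X]; rewrite itinS iterSr.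
exact: etrans (congr1 (br (label (val X))) (IH (shift_map X))) (branch_label X).
Qed.

Lemma measurable_lift_map : measurable_fun [set: R] T.
Proof.
apply: measurable_funM; first exact: measurable_id.
by apply: measurable_funD; [exact: measurable_cst|exact: measurable_powR].
Qed.

Lemma measurable_intermittent :
  measurable_fun [set: measurableTypeR R] (f : measurableTypeR R -> measurableTypeR R).
Proof.
have mT := measurable_lift_map.
have : measurable_fun [set: R] f.
  apply: (@measurable_fun_ifT _ _ _ _ _ _ (fun x => T x <= 1)); last 2 first.
  - exact: mT.
  - by apply: measurable_funB; [exact: mT|exact: measurable_cst].
  - by apply: measurable_fun_ler; [exact: mT|exact: measurable_cst].
exact.
Qed.

Lemma measurable_iter n :
  measurable_fun [set: measurableTypeR R] (iter n f : measurableTypeR R -> measurableTypeR R).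
Proof.
elim: n => [|n IH]; first exact: measurable_id.
by rewrite (_ : iter n.+1 f = f \o iter n f)//; apply: measurableT_comp => //;
  exact: measurable_intermittent.
Qed.

Lemma measurable_itin n (B : seq bool -> bool) :
  measurable ([set x | B (itin n x)] : set (measurableTypeR R)).
Proof.
elim: n B => [|n IH] B.
  have [h|h] := boolP (B [::]).
    by rewrite (_ : [set _ | _] = setT)//; apply/seteqP; split.
  by rewrite (_ : [set _ | _] = set0)//; apply/seteqP; split => // x /=; rewrite (negbTE h).
pose L : set (measurableTypeR R) := [set x | label (iter n f x)].
have mL : measurable L.
  have := @measurable_iter n measurableT `]cut_point alpha, +oo[%classic.
  rewrite setTI (_ : _ @^-1` _ = L); first by apply; exact: measurable_itv.
  by apply/seteqP; split => x /=; rewrite in_itv /= andbT.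
rewrite (_ : [set x | _] = ([set x | B (rcons (itin n x) true)] `&` L) `|`
   ([set x | B (rcons (itin n x) false)] `&` ~` L)).
  apply: measurableU; apply: measurableI => //.
  - exact: (IH (fun u => B (rcons u true))).
  - exact: (IH (fun u => B (rcons u false))).
  - exact: measurableC.
apply/seteqP; split => x /=.
  rewrite itinSr /L /=; case: (label _) => h; [by left|by right].
by rewrite itinSr /L /=; case: (label _) => -[[h l]|[h l]].
Qed.

Lemma measurable_unit : measurable (unit_itv R : set (measurableTypeR R)).
Proof. exact: measurable_itv. Qed.

Definition coded n (B : seq bool -> bool) : set (measurableTypeR R) :=
  unit_itv R `&` [set x | B (itin n x)].

Lemma zero_orbit_small (e : R) : 0 < e -> exists n, xs n < e.
Proof.
move=> e0; pose d := e `^ alpha; have d0 : 0 < d by rewrite powR_gt0.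
pose n := Num.truncn (4 / alpha / d); exists n.
have /andP[/ltW x0 _] := zero_orbit01 alpha01 n.
have h : xs n `^ alpha < d.
  apply: le_lt_trans (zero_orbit_pow alpha01 n) _.
  by rewrite ltr_pdivrMr// -ltr_pdivrMl// mulrC truncnS_gt.
rewrite ltNge; apply/negP => ex.
move: h; apply/negP; rewrite -leNgt; exact: powR_le (ltW alpha0) (ltW e0) ex.
Qed.

Lemma unit_ray a : unit_itv R `&` `]a, +oo[ =
  \bigcup_n coded n (fun u => a < val (wm u I01_0)).
Proof.
apply/seteqP; split => x.
  move=> [ux /=]; rewrite in_itv /= andbT => ax.
  move: (ux); rewrite /unit_itv /= in_itv /= => x01.
  have [n hn] : exists n, xs n < x - a by apply: zero_orbit_small; rewrite subr_gt0.
  exists n => //; split => //=.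
  pose X : @I01 R := exist _ x x01.
  have := word_map_dist alpha01 (itin n x) (iter n shift_map X) I01_0.
  have := word_map_itin n X; rewrite /= => ->; rewrite size_itin /dist /= ler_norml; lra.
move=> [n _ [ux /= h]]; split => //=; rewrite in_itv /= andbT.
move: (ux); rewrite /unit_itv /= in_itv /= => x01.
pose X : @I01 R := exist _ x x01.
apply: lt_le_trans h _.
rewrite -[leRHS](congr1 val (word_map_itin n X)).
by apply: word_map_le; exact: I01_ge0.
Qed.

Variables nu1 nu2 : probability (measurableTypeR R) R.
Implicit Types A : set (measurableTypeR R).

Definition symdiff n (B : seq bool -> bool) A : set (measurableTypeR R) :=
  unit_itv R `&` ((A `&` ~` [set x | B (itin n x)]) `|` (~` A `&` [set x | B (itin n x)])).

Definition approximable A := measurable A /\ forall e : R, 0 < e ->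
  exists n B, prob nu1 (symdiff n B A) < e /\ prob nu2 (symdiff n B A) < e.

Lemma measurable_symdiff n B A : measurable A -> measurable (symdiff n B A).
Proof.
move=> mA; apply: measurableI; first exact: measurable_unit.
have mB := measurable_itin n B.
by apply: measurableU; apply: measurableI => //; exact: measurableC.
Qed.

Lemma approximable_coded n (B : seq bool -> bool) : approximable [set x | B (itin n x)].
Proof.
split; first exact: measurable_itin.
move=> e e0; exists n, B; rewrite /symdiff.
by rewrite setICr [X in _ `|` X]setIC setICr setU0 setI0 !prob0.
Qed.

Lemma approximable0 : approximable set0.
Proof.
have := approximable_coded 0 (fun=> false); rewrite (_ : [set _ | _] = set0)//.
by apply/seteqP; split.
Qed.

Lemma approximableC A : approximable A -> approximable (~` A).
Proof.
move=> [mA h]; split; first exact: measurableC.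
move=> e /h[n [B hB]]; exists n, (fun u => ~~ B u).
rewrite (_ : symdiff _ _ _ = symdiff n B A)//; rewrite /symdiff; congr (_ `&` _).
apply/seteqP; split => x /=.
  by case=> -[h1 /negP]; rewrite ?negbK => h2; [right|left]; split => //; exact: contrapT.
by case=> -[h1 h2]; [right|left]; split => //; [exact/negP|exact/negP/negPn].
Qed.

Lemma take_itin m n x : (m <= n)%N -> take m (itin n x) = itin m x.
Proof.
by move=> mn; rewrite -(subnKC mn) itin_cat take_cat size_itin ltnn subnn take0 cats0.
Qed.

Lemma approximableU A A' : approximable A -> approximable A' -> approximable (A `|` A').
Proof.
move=> [mA h] [mA' h']; split; first exact: measurableU.
move=> e e0; have e20 : 0 < e / 2 by rewrite divr_gt0.
have [n [B [hB1 hB2]]] := h _ e20; have [n' [B' [hB1' hB2']]] := h' _ e20.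
exists (maxn n n'), (fun u => B (take n u) || B' (take n' u)).
have sub : symdiff (maxn n n') (fun u => B (take n u) || B' (take n' u)) (A `|` A') `<=`
    symdiff n B A `|` symdiff n' B' A'.
  move=> x [ux]; rewrite /= !take_itin ?leq_maxl ?leq_maxr//.
  case=> [[[Ax|Ax] /negP]|[nA /orP[h1|h1]]].
  - rewrite negb_or => /andP[h1 h2]; left; split => //; left; split => //; exact/negP.
  - rewrite negb_or => /andP[h1 h2]; right; split => //; left; split => //; exact/negP.
  - by left; split => //; right; split => // Ax; apply: nA; left.
  - by right; split => //; right; split => // Ax; apply: nA; right.
have key (nu : probability (measurableTypeR R) R) :
    prob nu (symdiff n B A) < e / 2 -> prob nu (symdiff n' B' A') < e / 2 ->
    prob nu (symdiff (maxn n n') (fun u => B (take n u) || B' (take n' u)) (A `|` A')) < e.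
  move=> k1 k2; apply: le_lt_trans (prob_le nu _ _ sub) _.
  - by apply: measurable_symdiff; exact: measurableU.
  - by apply: measurableU; exact: measurable_symdiff.
  apply: le_lt_trans (probU_le nu _ _) _; [exact: measurable_symdiff..|].
  by rewrite (splitr e) ltrD.
by split; exact: key.
Qed.

Lemma approximable_bigcup (F : nat -> set (measurableTypeR R)) :
  (forall i, approximable (F i)) -> approximable (\bigcup_i F i).
Proof.
move=> hF; have mF i : measurable (F i) by case: (hF i).
split; first exact: bigcupT_measurable.
pose H n := \big[setU/set0]_(i < n) F i.
have aH n : approximable (H n).
  elim: n => [|n IH]; rewrite /H; last by rewrite big_ord_recr; exact: approximableU.
  by rewrite big_ord0; exact: approximable0.
have mH n : measurable (H n) by case: (aH n).
move=> e e0; have e20 : 0 < e / 2 by rewrite divr_gt0.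
have cvgH (nu : probability (measurableTypeR R) R) :
    exists N, forall n, (N <= n)%N -> prob nu (\bigcup_i F i `&` ~` H n) < e / 2.
  have c : nu (H n) @[n --> \oo] --> nu (\bigcup_i F i).
    rewrite (_ : \bigcup_i F i = \bigcup_n H n); last first.
      apply/seteqP; split => x [n _].
        by move=> Fx; exists n.+1 => //; rewrite /H -bigcup_mkord; exists n => /=.
      by rewrite /H -bigcup_mkord => -[i _ Fi]; exists i.
    apply: nondecreasing_cvg_mu => //; first exact: bigcupT_measurable.
    by apply/nondecreasing_seqP => n; rewrite /H big_ord_recr; apply/subsetPset; exact: subsetUl.
  have c' : prob nu (H n) @[n --> \oo] --> prob nu (\bigcup_i F i).
    apply: fine_cvg; rewrite -probE//; exact: bigcupT_measurable.
  move/cvgrPdist_lt : c' => /(_ _ e20)[N _ hN]; exists N => n Nn.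
  have mU : measurable (\bigcup_i F i) by exact: bigcupT_measurable.
  have := hN n Nn; rewrite /= {1}(prob_split nu mU (mH n)).
  have -> : \bigcup_i F i `&` H n = H n.
    by apply/setIidr; rewrite /H -bigcup_mkord; exact: bigcup_subset.
  by rewrite addrC addKr ger0_norm// prob_ge0.
have [N1 h1] := cvgH nu1; have [N2 h2] := cvgH nu2.
pose N := maxn N1 N2.
have [_ /(_ _ e20)[n [B [hB1 hB2]]]] := aH N.
exists n, B.
have mU : measurable (\bigcup_i F i) by exact: bigcupT_measurable.
have sub : symdiff n B (\bigcup_i F i) `<=` symdiff n B (H N) `|` (\bigcup_i F i `&` ~` H N).
  move=> x [ux] [[Fx nB]|[nF Bx]].
    have [Hx|nHx] := pselect (H N x); last by right.
    by left; split => //; left.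
  left; split => //; right; split => // Hx; apply: nF.
  by move: Hx; rewrite /H -bigcup_mkord => -[i _ Fi]; exists i.
have key (nu : probability (measurableTypeR R) R) :
    prob nu (symdiff n B (H N)) < e / 2 -> prob nu (\bigcup_i F i `&` ~` H N) < e / 2 ->
    prob nu (symdiff n B (\bigcup_i F i)) < e.
  move=> k1 k2; have mD : measurable (\bigcup_i F i `&` ~` H N).
    by apply: measurableI => //; exact: measurableC.
  apply: le_lt_trans (prob_le nu _ _ sub) _.
  - exact: measurable_symdiff.
  - by apply: measurableU => //; exact: measurable_symdiff.
  apply: le_lt_trans (probU_le nu _ _) _ => //; first exact: measurable_symdiff.
  by rewrite (splitr e) ltrD.
split; apply: key => //; [apply: h1|apply: h2].
  exact: leq_maxl.
exact: leq_maxr.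
Qed.

Lemma measurable_approximable A : measurable A -> approximable A.
Proof.
have eqm A' A'' : measurable A'' -> unit_itv R `&` A' = unit_itv R `&` A'' ->
    approximable A' -> approximable A''.
  move=> m'' E [m' h]; split => // e /h[n [B hB]]; exists n, B.
  rewrite (_ : symdiff n B A'' = symdiff n B A')//.
  apply/seteqP; split => x [ux] hx; split => //.
    have e1 : A' x <-> A'' x.
      have := congr1 (fun S => S x) E; rewrite /= /setI /= => E'.
      by split => ax; [have : A'' x by move: (conj ux ax); rewrite E' => -[]
        |have : A' x by move: (conj ux ax); rewrite -E' => -[]].
    by case: hx => -[h1 h2]; [left|right]; split => //; [apply/e1|move=> /e1].
  have e1 : A' x <-> A'' x.
    have := congr1 (fun S => S x) E; rewrite /= /setI /= => E'.
    by split => ax; [have : A'' x by move: (conj ux ax); rewrite E' => -[]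
      |have : A' x by move: (conj ux ax); rewrite -E' => -[]].
  by case: hx => -[h1 h2]; [left|right]; split => //; [apply/e1|move=> /e1].
move: A; have -> : @measurable _ (measurableTypeR R) = <<s @RGenOInfty.G R >>.
  exact: RGenOInfty.measurableE.
apply: smallest_sub.
  split.
  - exact: approximable0.
  - by move=> A hA; rewrite setTD; exact: approximableC.
  - exact: approximable_bigcup.
move=> A [a ->].
apply: (eqm (\bigcup_n [set x | (fun u => a < val (wm u I01_0)) (itin n x)])).
- exact: measurable_itv.
- by rewrite unit_ray setI_bigcupr.
- by apply: approximable_bigcup => n; exact: (@approximable_coded n (fun u => a < val (wm u I01_0))).
Qed.

End coding.

Section expectation.
Context {R : realType} (nu : probability (measurableTypeR R) R).
Local Notation Om := (measurableTypeR R).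
Implicit Types (h g : Om -> R) (A B : set Om).

Definition meas_fun h := measurable_fun [set: Om] h.
Definition bounded_by (M : R) h := forall x, `|h x| <= M.
Definition expect h : R := (\int[nu]_x h x)%R.

Lemma bounded_integrable h M : meas_fun h -> bounded_by M h ->
  nu.-integrable setT (EFin \o h).
Proof.
move=> mh bh; apply: measurable_bounded_integrable => //.
  by rewrite -ge0_fin_numE// fin_num_measure.
exists M; split; first exact: num_real.
by move=> z Mz x _ /=; apply: le_trans (bh x) (ltW Mz).
Qed.

Lemma expectD h g M N : meas_fun h -> bounded_by M h -> meas_fun g -> bounded_by N g ->
  expect (fun x => h x + g x) = expect h + expect g.
Proof.
by move=> mh bh mg bg; rewrite /expect RintegralD//; exact: bounded_integrable.
Qed.

Lemma expectZ h M c : meas_fun h -> bounded_by M h ->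
  expect (fun x => c * h x) = c * expect h.
Proof. by move=> mh bh; rewrite /expect RintegralZl//; exact: bounded_integrable. Qed.

Lemma bounded_byD h g M N : bounded_by M h -> bounded_by N g ->
  bounded_by (M + N) (fun x => h x + g x).
Proof. by move=> bh bg x; rewrite (le_trans (ler_normD _ _))// lerD. Qed.

Lemma bounded_byZ h M c : bounded_by M h -> bounded_by (`|c| * M) (fun x => c * h x).
Proof. by move=> bh x; rewrite normrM ler_wpM2l. Qed.

Lemma expect_cst c : expect (fun=> c) = c.
Proof.
rewrite /expect Rintegral_cst// -[RHS]mulr1; congr (_ * _).
exact: prob_setT.
Qed.

Lemma expect_indic A : measurable A -> expect (\1_A) = prob nu A.
Proof. by move=> mA; rewrite /expect /Rintegral integral_indic// setIT. Qed.

Lemma expect_sum (I : eqType) (s : seq I) (F : I -> Om -> R) (M : R) :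
  (forall i, meas_fun (F i)) -> (forall i, bounded_by M (F i)) ->
  [/\ expect (fun x => \sum_(i <- s) F i x) = \sum_(i <- s) expect (F i),
     meas_fun (fun x => \sum_(i <- s) F i x) &
     bounded_by (M *+ size s) (fun x => \sum_(i <- s) F i x)].
Proof.
move=> mF bF; elim: s => [|i s [IH1 IH2 IH3]].
  have E : (fun x : Om => \sum_(i <- [::]) F i x) = fun=> 0 by apply/funext => x; rewrite big_nil.
  rewrite E big_nil; split; [exact: expect_cst|exact: measurable_cst|].
  by move=> x; rewrite normr0.
have E : (fun x : Om => \sum_(j <- i :: s) F j x) = fun x => F i x + \sum_(j <- s) F j x.
  by apply/funext => x; rewrite big_cons.
rewrite E big_cons -IH1; split.
- exact: (expectD (mF i) (bF i) IH2 IH3).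
- exact: (measurable_funD (mF i) IH2).
- by rewrite /= mulrS; exact: (bounded_byD (bF i) IH3).
Qed.

Definition meas_code (I : eqType) (c : Om -> I) := forall i, measurable (c @^-1` [set i]).

Lemma expect_code (I : eqType) (s : seq I) (c : Om -> I) (g : I -> R) :
  uniq s -> (forall x, c x \in s) -> meas_code c ->
  expect (fun x => g (c x)) = \sum_(i <- s) prob nu (c @^-1` [set i]) * g i /\
  meas_fun (fun x => g (c x)).
Proof.
move=> us cs mc.
have E : (fun x => g (c x)) = fun x => \sum_(i <- s) g i * \1_(c @^-1` [set i]) x.
  apply/funext => x; rewrite (big_rem (c x))//= indicE mem_set// mulr1 big1_seq ?addr0//.
  move=> i /andP[_]; rewrite mem_rem_uniq// inE => /andP[/= ic _].
  rewrite indicE memNset ?mulr0// => /= ci; by rewrite ci eqxx in ic.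
pose M := \sum_(i <- s) `|g i|.
have m1 i : meas_fun (\1_(c @^-1` [set i]) : Om -> R) by exact: measurable_indic.
have b1 i : bounded_by 1 (\1_(c @^-1` [set i])).
  by move=> x; rewrite indicE; case: (_ \in _); rewrite ?normr0 ?normr1.
pose F i x := if i \in s then g i * \1_(c @^-1` [set i]) x else 0.
have mF i : meas_fun (F i).
  rewrite /F; case: (i \in s); last exact: measurable_cst.
  by apply: measurable_funM; [exact: measurable_cst|exact: m1].
have bF i : bounded_by M (F i).
  rewrite /F => x; case: ifP => si; last by rewrite normr0 sumr_ge0.
  rewrite normrM (le_trans (ler_wpM2l _ (b1 i x)))// mulr1 /M (big_rem i)//= lerDl.
  by rewrite sumr_ge0.
have EF : (fun x => g (c x)) = fun x => \sum_(i <- s) F i x.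
  by rewrite E; apply/funext => x; apply: eq_big_seq => i si; rewrite /F si.
have [e1 e2 _] := expect_sum s mF bF.
rewrite EF; split => //; rewrite e1; apply: eq_big_seq => i si.
rewrite (_ : F i = fun x => g i * \1_(c @^-1` [set i]) x); last by apply/funext => x; rewrite /F si.
by rewrite (expectZ _ (m1 i) (b1 i)) expect_indic// mulrC.
Qed.

Lemma expect_le D h g M N : measurable D -> prob nu D = 1 ->
  meas_fun h -> bounded_by M h -> meas_fun g -> bounded_by N g ->
  (forall x, D x -> h x <= g x) -> expect h <= expect g.
Proof.
move=> mD D1 mh bh mg bg hg.
have on k K : meas_fun k -> bounded_by K k -> expect k = (\int[nu]_(x in D) k x)%R.
  move=> mk bk; have ik := bounded_integrable mk bk.
  have mC : measurable (~` D) by exact: measurableC.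
  rewrite /expect -[X in (\int[nu]_(x in X) _)%R](setUv D) Rintegral_setU//.
  - rewrite [X in _ + X](_ : _ = 0) ?addr0// /Rintegral null_set_integral//.
      by apply/measurable_EFinP; exact: measurable_funTS.
    by apply: (etrans (probE nu mC)); rewrite prob_setC// D1 subrr.
  - by rewrite setUv.
  - by apply/eqP; rewrite setICr.
rewrite (on _ _ mh bh) (on _ _ mg bg); apply: le_Rintegral => //.
  by apply: integrableS (bounded_integrable mh bh).
by apply: integrableS (bounded_integrable mg bg).
Qed.

Context (f : R -> R).
Hypothesis mf : measurable_fun [set: Om] (f : Om -> Om).
Hypothesis inv : invariant_probability f nu.

Lemma invariant_unit : prob nu (unit_itv R) = 1.
Proof. by rewrite /prob; case: inv => -> _. Qed.

Lemma prob_on_unit A : measurable A -> prob nu (unit_itv R `&` A) = prob nu A.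
Proof.
move=> mA; have mu := @measurable_unit R.
have h0 : prob nu (~` unit_itv R) = 0 by rewrite prob_setC// invariant_unit subrr.
rewrite [RHS](prob_split nu mA mu) setIC.
suff -> : prob nu (A `&` ~` unit_itv R) = 0 by rewrite addr0.
apply/eqP; rewrite eq_le prob_ge0 andbT -h0; apply: prob_le => //.
- by apply: measurableI => //; exact: measurableC.
- exact: measurableC.
Qed.

Lemma measurable_preimage A : measurable A -> measurable (f @^-1` A : set Om).
Proof. by move=> mA; rewrite -[X in measurable X]setTI; exact: mf. Qed.

Lemma invariant_prob A : measurable A -> prob nu (f @^-1` A) = prob nu A.
Proof.
move=> mA; rewrite -(prob_on_unit (measurable_preimage mA)) /prob.
by case: inv => _ ->.
Qed.

Lemma expect_shift h M : meas_fun h -> bounded_by M h ->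
  expect (fun x => h (f x)) = expect h.
Proof.
move=> mh bh; rewrite /expect /Rintegral; congr fine.
have ih := bounded_integrable mh bh.
have ip : nu.-integrable setT (EFin \o (fun x => h (f x))).
  apply: (@bounded_integrable _ M); last by move=> x; exact: bh.
  exact: measurableT_comp.
have mE : measurable_fun [set: Om] (EFin \o h) by exact/measurable_EFinP.
have := @integral_pushforward _ _ Om Om R f mf nu setT (EFin \o h) mE.
rewrite preimage_setT => /(_ ip measurableT) /= <-.
apply: eq_measure_integral => A mA _; rewrite /pushforward.
apply: (etrans (probE nu (measurable_preimage mA))).
by rewrite invariant_prob//; apply: esym; exact: probE.
Qed.

Lemma measurable_iterf n : measurable_fun [set: Om] (iter n f : Om -> Om).
Proof.
elim: n => [|n IH]; first exact: measurable_id.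
by rewrite (_ : iter n.+1 f = f \o iter n f)//; exact: measurableT_comp.
Qed.

Lemma expect_iter n h M : meas_fun h -> bounded_by M h ->
  expect (fun x => h (iter n f x)) = expect h.
Proof.
move=> mh bh; elim: n => // n IH; rewrite -IH.
rewrite -(@expect_shift (fun x => h (iter n f x)) M).
- by congr expect; apply/funext => x; rewrite iterSr.
- exact: (measurableT_comp mh (measurable_iterf n)).
- by move=> x; exact: bh.
Qed.

End expectation.

Section entropy_upper_bound.
Context {R : realType} (alpha : R).
Hypothesis alpha01 : 0 < alpha <= 1.
Let alpha0 : 0 < alpha. Proof. by case/andP: alpha01. Qed.
Local Notation f := (intermittent alpha).
Local Notation wm := (word_map alpha01).
Local Notation Om := (measurableTypeR R).

Definition clamp (x : R) : R := Num.max 0 (Num.min 1 x).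
Lemma clamp01 x : 0 <= clamp x <= 1.
Proof. by rewrite /clamp le_max lexx /= ge_max ler01 ge_min lexx. Qed.
Definition clampI x : @I01 R := exist _ (clamp x) (clamp01 x).

Lemma clamp_id x : 0 <= x <= 1 -> clamp x = x.
Proof. by move=> /andP[x0 x1]; rewrite /clamp min_r// max_r. Qed.

Lemma clampI_val (X : @I01 R) : clampI (val X) = X.
Proof. by apply: val_inj => /=; rewrite clamp_id//; exact: (valP X). Qed.

Lemma clamp_lip x y : `|clamp x - clamp y| <= `|x - y|.
Proof.
wlog xy : x y / x <= y.
  by move=> h; have [/h//|/ltW/h] := leP x y; rewrite distrC [X in _ <= X]distrC.
rewrite /clamp; have [x1|x1] := leP 1 x; have [y1|y1] := leP 1 y;
  rewrite ?(max_r ler01) ?subrr ?normr0 ?normr_ge0//; first lra.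
  have [x0|x0] := leP x 0; rewrite !ler0_norm ?subr_le0 ?opprB//; lra.
have [x0|x0] := leP 0 x; have [y0|y0] := leP 0 y; rewrite ?subrr ?normr0 ?normr_ge0//.
- lra.
- by rewrite !ler0_norm ?subr_le0 ?opprB//; lra.
Qed.

Variables (phi : @I01 R -> R) (A : R).
Hypothesis A0 : 0 <= A.
Hypothesis hphi : rholder alpha A phi.

Definition extend (x : Om) : R := phi (clampI x).

Lemma extend_val X : extend (val X) = phi X.
Proof. by rewrite /extend clampI_val. Qed.

Lemma extend_meas : meas_fun extend.
Proof.
apply: continuous_measurable_fun => x; apply/cvgrPdist_lt => e e0.
have e1 : 0 < e / (A + 1) by rewrite divr_gt0// ltr_wpDl.
have [d d0 hd] := powR_lt_eps e1 alpha0.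
apply/nbhs_ballP; exists d => //= y; rewrite /ball /= => xy.
apply: le_lt_trans (hphi _ _) _.
have h : dist (clampI x) (clampI y) `^ alpha < e / (A + 1).
  apply: hd; rewrite dist_ge0 /=; exact: le_lt_trans (clamp_lip x y) xy.
rewrite ltr_pdivlMr ?ltr_wpDl// in h; apply: le_lt_trans h.
by rewrite mulrC ler_wpM2l ?powR_ge0// lerDl.
Qed.

Lemma extend_bound : bounded_by (`|phi I01_0| + A) extend.
Proof.
move=> x; rewrite /extend -[phi (clampI x)](subrK (phi I01_0)) addrC.
rewrite (le_trans (ler_normD _ _))// lerD2l (le_trans (hphi _ _))//.
by rewrite ler_piMr// powR_le1 ?dist_ge0 ?dist_le1// ltW.
Qed.

Variable nu : probability Om R.
Hypothesis inv : invariant_probability f nu.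
Local Notation E := (expect nu).
Let mf := measurable_intermittent alpha.

Lemma birkhoff_shift n (X : @I01 R) :
  birkhoff alpha01 phi (itin alpha n (val X)) (iter n (shift_map alpha01) X) =
  \sum_(j < n) extend (iter j f (val X)).
Proof.
elim: n X => [|n IH] X; first by rewrite big_ord0.
rewrite itinS iterSr big_ord_recl /=; congr (_ + _).
  rewrite -[RHS]/(extend (val X)) extend_val; congr phi.
  exact: etrans (congr1 (branch alpha01 _) (word_map_itin alpha01 n (shift_map alpha01 X))) (branch_label alpha01 X).
rewrite (IH (shift_map alpha01 X)); apply: eq_bigr => j _; rewrite /= /bump /=.
by rewrite -iterSr.
Qed.

Lemma meas_code_itin n : meas_code (itin alpha n : Om -> seq bool).
Proof.
move=> u; rewrite (_ : _ @^-1` _ = [set x | (fun v => v == u) (itin alpha n x)]).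
  exact: (measurable_itin alpha n (fun v => v == u)).
by apply/seteqP; split => x /= /eqP.
Qed.

Lemma itin_words n x : itin alpha n x \in words n.
Proof. by rewrite mem_words size_itin. Qed.

Lemma expect_birkhoff N : N%:R * E extend - A * orbit_sum alpha N <=
  E (fun x => birkhoff alpha01 phi (itin alpha N x) I01_1).
Proof.
set b := extend_bound.
have mit j : meas_fun (fun x => extend (iter j f x)).
  exact: (measurableT_comp extend_meas (measurable_iterf mf j)).
pose F (j : nat) x := extend (iter j f x).
have [e1 e2 e3] := @expect_sum _ nu _ (iota 0 N) F _ mit (fun j x => b (iter j f x)).
have Esum : E (fun x => \sum_(j <- iota 0 N) F j x) = N%:R * E extend.
  rewrite e1 (eq_bigr (fun=> E extend)) => [|j _]; last exact: (expect_iter mf inv j extend_meas b).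
  by rewrite big_const_seq count_predT size_iota iter_addr_0 mulr_natl.
have [e4 e5] := expect_code nu (fun u => birkhoff alpha01 phi u I01_1) (words_uniq N)
   (itin_words N) (meas_code_itin N).
pose C := A * orbit_sum alpha N.
have bc : bounded_by `|- C| ((fun=> - C) : Om -> R) by move=> x.
have e6 : E (fun x => \sum_(j <- iota 0 N) F j x + - C) = N%:R * E extend - C.
  rewrite (expectD nu e2 e3 (measurable_cst _) bc).
  by rewrite Esum expect_cst.
rewrite -/C -e6.
pose M := \sum_(u <- words N) `|birkhoff alpha01 phi u I01_1|.
apply: (@expect_le _ nu (unit_itv R) _ _ (((`|phi I01_0| + A) *+ size (iota 0 N)) + `|- C|) M).
- exact: measurable_unit.
- exact: invariant_unit inv.
- by apply: measurable_funD => //; exact: measurable_cst.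
- exact: (bounded_byD e3 bc).
- exact: e5.
- move=> x; rewrite /M (big_rem (itin alpha N x)) ?itin_words//= lerDl.
  by rewrite sumr_ge0.
- move=> x; rewrite /unit_itv /= in_itv /= => x01.
  pose X : @I01 R := exist _ x x01.
  have := birkhoff_var alpha01 (itin alpha N x) (iter N (shift_map alpha01) X) I01_1 A0 hphi.
  rewrite (birkhoff_shift N X) size_itin -/C.
  have -> : \sum_(j <- iota 0 N) F j x = \sum_(j < N) extend (iter j f x).
    by rewrite -(big_mkord xpredT (fun j => extend (iter j f x))) /index_iota subn0.
  rewrite ler_norml /=; lra.
Qed.

Lemma gibbs_inequality (I J : eqType) (sI : seq I) (sJ : seq J) (r t : I -> J -> R) (P : I -> R) :
  (forall i j, 0 <= r i j) -> (forall i j, 0 < t i j) ->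
  (forall i, P i = \sum_(j <- sJ) r i j) ->
  uniq sJ -> (forall i j, j \notin sJ -> r i j = 0) ->
  \sum_(i <- sI) P i = 1 ->
  - \sum_(i <- sI) P i * ln (P i) + \sum_(i <- sI) \sum_(j <- sJ) r i j * ln (t i j) <=
  ln (\sum_(i <- sI) \sum_(j <- sJ) t i j).
Proof.
move=> r0 t0 PE uJ rJ P1.
pose Z := \sum_(i <- sI) \sum_(j <- sJ) t i j; rewrite -/Z.
have Z0 : 0 < Z.
  rewrite /Z lt_neqAle sumr_ge0 ?andbT => [|i _]; last by apply: sumr_ge0 => j _; exact: ltW.
  apply/eqP => Z0; have zero : forall i, i \in sI -> P i = 0.
    move=> i si; have : \sum_(j <- sJ) t i j = 0.
      apply/eqP; rewrite eq_le sumr_ge0 ?andbT => [|j _]; last exact: ltW.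
      rewrite [leRHS]Z0 (big_rem i)//= lerDl sumr_ge0// => k _.
      by apply: sumr_ge0 => j _; exact: ltW.
    rewrite PE; case: sJ {uJ rJ PE Z Z0} => [|j s]; first by rewrite !big_nil.
    rewrite big_cons => /eqP; rewrite gt_eqF// ltr_pwDl// sumr_ge0// => k _; exact: ltW.
  by move: P1; rewrite big1_seq => [/eqP|i /andP[_ /zero]//]; rewrite eq_sym oner_eq0.
have key i j : r i j * ln (t i j) - r i j * ln (P i) - r i j * ln Z <= t i j / Z - r i j.
  have [jJ|/rJ ->] := boolP (j \in sJ); last first.
    by rewrite !mul0r !subr0 divr_ge0 ?ltW.
  have [r00|rn0] := eqVneq (r i j) 0.
    by rewrite r00 !mul0r !subr0 divr_ge0 ?ltW.
  have rp : 0 < r i j by rewrite lt_neqAle eq_sym rn0 r0.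
  have rP : r i j <= P i by rewrite PE (big_rem j)//= lerDl sumr_ge0.
  have Pp : 0 < P i := lt_le_trans rp rP.
  have h : ln (t i j / (r i j * Z)) <= t i j / (r i j * Z) - 1.
    have := @le_ln1Dx R (t i j / (r i j * Z) - 1).
    rewrite subrKC; apply; rewrite ltrBrDr addNr; apply: divr_gt0 => //; exact: mulr_gt0.
  have hP : ln (r i j) <= ln (P i) by rewrite ler_ln.
  rewrite ln_div ?posrE ?mulr_gt0// lnM ?posrE// in h.
  have := ler_wpM2l (ltW rp) h; have := ler_wpM2l (ltW rp) hP.
  have -> : r i j * (t i j / (r i j * Z) - 1) = t i j / Z - r i j.
    by field; rewrite rn0 gt_eqF.
  by rewrite !mulrBr mulrDr; lra.
have sumP : \sum_(i <- sI) \sum_(j <- sJ) r i j = 1.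
  by rewrite -P1; apply: eq_bigr => i _; rewrite PE.
have : \sum_(i <- sI) \sum_(j <- sJ) (r i j * ln (t i j) - r i j * ln (P i) - r i j * ln Z) <=
   \sum_(i <- sI) \sum_(j <- sJ) (t i j / Z - r i j).
  by apply: ler_sum => i _; apply: ler_sum => j _; exact: key.
have -> : \sum_(i <- sI) \sum_(j <- sJ) (t i j / Z - r i j) = 0.
  under eq_bigr do rewrite sumrB -mulr_suml.
  by rewrite sumrB -mulr_suml -/Z divff ?gt_eqF// sumP subrr.
have -> : \sum_(i <- sI) \sum_(j <- sJ) (r i j * ln (t i j) - r i j * ln (P i) - r i j * ln Z) =
   \sum_(i <- sI) \sum_(j <- sJ) r i j * ln (t i j) - \sum_(i <- sI) P i * ln (P i) - ln Z.
  have EZ : ln Z = \sum_(i <- sI) (\sum_(j <- sJ) r i j) * ln Z.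
    by rewrite -mulr_suml sumP mul1r.
  rewrite [X in _ = _ - X]EZ -!sumrB; apply: eq_bigr => i _.
  by rewrite !sumrB -!mulr_suml -PE.
lra.
Qed.

End entropy_upper_bound.

Section entropy_upper_bound2.
Context {R : realType} (alpha : R).
Hypothesis alpha01 : 0 < alpha <= 1.
Let alpha0 : 0 < alpha. Proof. by case/andP: alpha01. Qed.
Local Notation f := (intermittent alpha).
Local Notation wm := (word_map alpha01).
Local Notation Om := (measurableTypeR R).
Variables (phi : @I01 R -> R) (A : R).
Hypothesis A0 : 0 <= A.
Hypothesis hphi : rholder alpha A phi.
Variable nu : probability Om R.
Hypothesis inv : invariant_probability f nu.
Local Notation E := (expect nu).
Let mf := measurable_intermittent alpha.

Lemma prob_partition (B : set Om) (J : eqType) (s : seq J) (c : Om -> J) :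
  measurable B -> uniq s -> (forall x, c x \in s) -> meas_code c ->
  prob nu B = \sum_(j <- s) prob nu (B `&` c @^-1` [set j]).
Proof.
move=> mB us cs mc.
have mI j : measurable (B `&` c @^-1` [set j]) by exact: measurableI.
have mF j : meas_fun (\1_(B `&` c @^-1` [set j]) : Om -> R) by exact: measurable_indic.
have bF j : bounded_by 1 (\1_(B `&` c @^-1` [set j]) : Om -> R).
  by move=> x; rewrite indicE; case: (_ \in _); rewrite ?normr0 ?normr1.
have [e1 _ _] := expect_sum nu s mF bF.
transitivity (\sum_(j <- s) E (\1_(B `&` c @^-1` [set j]))); last first.
  by apply: eq_bigr => j _; rewrite expect_indic.
rewrite -e1 -expect_indic//; congr expect; apply/funext => x.
rewrite (big_rem (c x))//= big1_seq ?addr0.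
  rewrite !indicE; congr ((nat_of_bool _)%:R); apply/idP/idP; rewrite !inE; first by [].
  by case.
move=> i /andP[_]; rewrite mem_rem_uniq// inE => /andP[/= ic _].
by rewrite indicE memNset// => -[_ /= ci]; rewrite ci eqxx in ic.
Qed.

Variables (k : nat) (xi : R -> 'I_k).
Hypothesis mxi : measurable_labelling xi.

Definition xi_itin N (x : Om) : {ffun 'I_N -> 'I_k} := [ffun j : 'I_N => xi (iter j f x)].

Lemma meas_code_xi : meas_code (xi : Om -> 'I_k).
Proof. exact: mxi. Qed.

Lemma meas_code_xi_itin N : meas_code (@xi_itin N).
Proof.
move=> w; rewrite (_ : _ @^-1` _ = \bigcap_(j in [set: 'I_N]) ((iter j f : Om -> Om) @^-1` (xi @^-1` [set w j]))).
  apply: fin_bigcap_measurable => [|j _]; first exact: finite_finset.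
  rewrite -[X in measurable X]setTI; apply: (measurable_iterf mf j measurableT); exact: mxi.
apply/seteqP; split => x /= h.
  by move=> j _ /=; rewrite -h ffunE.
by apply/ffunP => j; rewrite ffunE; exact: h.
Qed.

Lemma meas_code_pair (I J : eqType) (c : Om -> I) (d : Om -> J) :
  meas_code c -> meas_code d -> meas_code (fun x => (c x, d x)).
Proof.
move=> mc md [i j]; rewrite (_ : _ @^-1` _ = c @^-1` [set i] `&` d @^-1` [set j]).
  exact: measurableI.
by apply/seteqP; split => x /=; [case=> -> ->|case=> -> ->].
Qed.

Lemma expect_pair (I : finType) (c : Om -> I) n (g : I -> seq bool -> R) : meas_code c ->
  E (fun x => g (c x) (itin alpha n x)) = \sum_(i <- index_enum I) \sum_(u <- words n)
    prob nu (c @^-1` [set i] `&` itin alpha n @^-1` [set u]) * g i u /\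
  meas_fun (fun x => g (c x) (itin alpha n x)).
Proof.
move=> mc.
have mp : meas_code (fun x => (c x, itin alpha n x)).
  by apply: (meas_code_pair mc); exact: meas_code_itin.
pose s := [seq (i, v) | i <- index_enum I, v <- words n].
have us : uniq s.
  by apply: allpairs_uniq; [exact: index_enum_uniq|exact: words_uniq|move=> [? ?] [? ?]].
have cs x : (c x, itin alpha n x) \in s.
  by apply/allpairsP; exists (c x, itin alpha n x) => /=; rewrite mem_index_enum itin_words.
have [e1 m1] := expect_code nu (fun z => g z.1 z.2) us cs mp.
split; last exact: m1.
rewrite e1 /s big_allpairs; apply: eq_bigr => i _; apply: eq_bigr => u _.
congr (prob nu _ * _); apply/seteqP; split => x /=; first by case=> -> ->.
by case=> -> ->.
Qed.

Lemma coarse_labelling (e : R) : 0 < e -> exists m (istar : seq bool -> 'I_k),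
  prob nu ([set x | xi x != istar (itin alpha m x)] : set Om) < e.
Proof.
move=> e0; pose e' := e / (k.+1)%:R; have e'0 : 0 < e' by rewrite divr_gt0.
have h (i : 'I_k) : exists nB : nat * (seq bool -> bool),
    prob nu (symdiff alpha nB.1 nB.2 (xi @^-1` [set i])) < e'.
  have [_ /(_ _ e'0)[n [B [hB _]]]] := measurable_approximable alpha01 nu nu (mxi i).
  by exists (n, B).
have [nB hnB] := choice h.
pose m := \max_(i < k) (nB i).1.
pose istar v : 'I_k := odflt (xi 0) [pick i | (nB i).2 (take (nB i).1 v)].
exists m, istar.
pose S i := symdiff alpha (nB i).1 (nB i).2 (xi @^-1` [set i]).
have mS i : measurable (S i) by apply: measurable_symdiff; exact: mxi.
have mm : measurable ([set x | xi x != istar (itin alpha m x)] : set Om).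
  have mc : meas_code (fun x : Om => (xi x, itin alpha m x)).
    by apply: (meas_code_pair meas_code_xi); exact: meas_code_itin.
  rewrite (_ : [set x | _] = \bigcup_(i in [set: 'I_k]) \bigcup_(v in [set` words m])
    (if i != istar v then (fun x : Om => (xi x, itin alpha m x)) @^-1` [set (i, v)] else set0)).
    apply: fin_bigcup_measurable => [|i _]; first exact: finite_finset.
    apply: fin_bigcup_measurable => [|v _]; first exact: finite_seq.
    by case: ifP => _; [exact: mc|exact: measurable0].
  apply/seteqP; split => x /=.
    move=> hx; exists (xi x) => //; exists (itin alpha m x) => /=; first exact: itin_words.
    by rewrite hx.
  by move=> [i _ [v _]]; case: ifP => // iv [-> ->].
rewrite -(prob_on_unit inv mm).
have sub : unit_itv R `&` [set x | xi x != istar (itin alpha m x)] `<=` \big[setU/set0]_(i < k) S i.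
  move=> x [ux /= nx]; apply: contrapT => nS.
  have nSi i : ~ S i x.
    by move=> Si; apply: nS; rewrite (bigD1 i)//=; left.
  have tk i : take (nB i).1 (itin alpha m x) = itin alpha (nB i).1 x.
    by apply: take_itin; rewrite /m; exact: (leq_bigmax i).
  have Bi i : (nB i).2 (itin alpha (nB i).1 x) = (xi x == i).
    apply/idP/eqP => [b|<-]; apply: contrapT => c.
      by apply: (nSi i); split => //; right.
    by apply: (nSi (xi x)); split => //; left.
  move: nx; rewrite /istar; case: pickP => [i|]; first by rewrite tk Bi => /eqP ->; rewrite eqxx.
  by move=> /(_ (xi x)); rewrite tk Bi eqxx.
have mbig n (F : 'I_n -> set Om) : (forall i, measurable (F i)) -> measurable (\big[setU/set0]_(i < n) F i).
  by move=> mF; apply: bigsetU_measurable.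
apply: le_lt_trans (prob_le nu _ _ sub) _.
- by apply: measurableI => //; exact: measurable_unit.
- exact: mbig.
have sum_le n (F : 'I_n -> set Om) : (forall i, measurable (F i)) ->
    prob nu (\big[setU/set0]_(i < n) F i) <= \sum_(i < n) prob nu (F i).
  elim: n F => [|n IH] F mF; first by rewrite !big_ord0 prob0.
  rewrite !big_ord_recr /=; apply: le_trans (probU_le nu (mbig _ _ (fun i => mF _)) (mF _)) _.
  by rewrite lerD2r; exact: IH.
apply: le_lt_trans (sum_le _ _ mS) _.
apply: (@le_lt_trans _ _ (\sum_(i < k) e')).
  by apply: ler_sum => i _; exact/ltW/hnB.
rewrite sumr_const card_ord -[e' *+ k]mulr_natr /e' mulrAC ltr_pdivrMr//.
by rewrite ltr_pM2l// ltr_nat.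
Qed.

Lemma join_entropyE N : join_entropy f nu xi N =
  - \sum_(w : {ffun 'I_N -> 'I_k}) prob nu (@xi_itin N @^-1` [set w]) * ln (prob nu (@xi_itin N @^-1` [set w])).
Proof.
rewrite /join_entropy; congr (- _); apply: eq_bigr => w _.
rewrite -(prob_on_unit inv (meas_code_xi_itin w)) /prob /=.
rewrite (_ : join_cell _ _ _ = unit_itv R `&` @xi_itin N @^-1` [set w])//.
apply/seteqP; split => x [ux] /= h; split => //.
  by apply/ffunP => j; rewrite ffunE.
by move=> j; rewrite -h ffunE.
Qed.

Lemma join_entropy_ge0 N : 0 <= join_entropy f nu xi N.
Proof.
rewrite join_entropyE -sumrN sumr_ge0// => w _.
have p0 := prob_ge0 nu (@xi_itin N @^-1` [set w]).
have p1 := prob_le1 nu (meas_code_xi_itin w).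
by rewrite -mulrN mulr_ge0// oppr_ge0 ln_le0.
Qed.

Lemma join_entropy_upper (p e : R) : 0 < e ->
  (forall e : R, 0 < e -> exists C : R, forall N,
     partition_sum alpha01 phi N I01_1 <= expR (C + N%:R * (p + e))) ->
  exists K : R, forall N,
    join_entropy f nu xi N <= N%:R * (p - E (extend phi) + 4 * e) + K.
Proof.
move=> e0 growth.
have [C hC] := growth _ e0.
have k0 : (0 < k)%N by case: k (xi 0) => // -[].
pose lk := ln (e / k%:R).
pose e1 := e / (`|lk| + 1).
have e10 : 0 < e1 by rewrite divr_gt0// ltr_wpDl.
have [m [istar hmis]] := coarse_labelling e10.
pose lq (i : 'I_k) v := if i == istar v then 0 else lk.
pose L (y : Om) := lq (xi y) (itin alpha m y).
have [mL bL] : meas_fun L /\ bounded_by `|lk| L.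
  split; last by move=> x; rewrite /L /lq; case: ifP => // _; rewrite normr0.
  by have [_ ?] := expect_pair m lq meas_code_xi.
have EL : - e <= E L.
  pose mis : set Om := [set x | xi x != istar (itin alpha m x)].
  have mmis : measurable mis.
    have [_ mg] := expect_pair m (fun i v => (i != istar v)%:R) meas_code_xi.
    rewrite (_ : mis = (fun x => (xi x != istar (itin alpha m x))%:R : R) @^-1` [set 1]).
      rewrite -[X in measurable X]setTI; apply: mg => //.
    apply/seteqP; split => x; rewrite /mis /=; first by move=> ->.
    by case: (_ != _) => // /esym/eqP; rewrite oner_eq0.
  have m1 : meas_fun (\1_mis : Om -> R) by exact: measurable_indic.
  have b1 : bounded_by 1 (\1_mis : Om -> R).
    by move=> x; rewrite indicE; case: (_ \in _); rewrite ?normr0 ?normr1.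
  apply: (@le_trans _ _ (E (fun x => - `|lk| * \1_mis x))).
    rewrite (expectZ nu _ m1 b1) expect_indic// mulNr lerN2.
    apply: (@le_trans _ _ (`|lk| * e1)); first by rewrite ler_wpM2l// ltW.
    by rewrite /e1 mulrA ler_pdivrMr ?ltr_wpDl// mulrDr mulr1 mulrC lerDl ltW.
  apply: (expect_le measurableT (prob_setT nu) _ (bounded_byZ _ b1) mL bL).
    by apply: measurable_funM => //; exact: measurable_cst.
  move=> x _; rewrite /L /lq indicE /mis.
  case: ifP => [/eqP h|/negbT h].
    by rewrite memNset ?mulr0//= h eqxx.
  by rewrite mem_set// mulr1 lerNl; apply: le_trans (ler_norm _) _; rewrite normrN.
have os0 : exists C' : R, forall N, A * orbit_sum alpha N <= e * N%:R + C'.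
  have [C' hC'] := orbit_sum_sublinear alpha01 (divr_gt0 e0 (ltr_wpDl A0 ltr01)).
  exists (A * C') => N; apply: le_trans (ler_wpM2l A0 (hC' N)) _.
  rewrite mulrDr lerD2r mulrA ler_wpM2r// mulrA ler_pdivrMr ?ltr_wpDl//.
  by rewrite mulrDr mulr1 mulrC lerDl ltW.
have [C' hC'] := os0.
exists (m%:R + C + C') => N.
pose tl (w : {ffun 'I_N -> 'I_k}) (u : seq bool) : R :=
  birkhoff alpha01 phi (take N u) I01_1 + \sum_(j < N) lq (w j) (take m (drop j u)).
pose t w u := expR (tl w u).
pose r (w : {ffun 'I_N -> 'I_k}) u := prob nu (@xi_itin N @^-1` [set w] `&` itin alpha (N + m) @^-1` [set u]).
pose P w := prob nu (@xi_itin N @^-1` [set w]).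
have PE w : P w = \sum_(u <- words (N + m)) r w u.
  apply: prob_partition; [exact: meas_code_xi_itin|exact: words_uniq|exact: itin_words|exact: meas_code_itin].
have P1 : \sum_(w <- index_enum {ffun 'I_N -> 'I_k}) P w = 1.
  rewrite -(prob_setT nu) (prob_partition measurableT (index_enum_uniq _) _ (@meas_code_xi_itin N)).
    by apply: eq_bigr => w _; rewrite setTI.
  by move=> x; rewrite mem_index_enum.
have r_out w u : u \notin words (N + m) -> r w u = 0.
  move=> hu; rewrite /r (_ : _ `&` _ = set0) ?prob0//.
  apply/seteqP; split => // x [_ /= E']; by rewrite -E' itin_words in hu.
have G := @gibbs_inequality R _ _ (index_enum {ffun 'I_N -> 'I_k}) (words (N + m)) r t P
  (fun w u => prob_ge0 nu _) (fun w u => expR_gt0 _) PE (words_uniq _) r_out P1.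
rewrite join_entropyE -/(P _).
have Er : \sum_(w <- index_enum {ffun 'I_N -> 'I_k}) \sum_(u <- words (N + m)) r w u * ln (t w u) =
    E (fun x => tl (@xi_itin N x) (itin alpha (N + m) x)).
  have [-> _] := expect_pair (N + m) tl (@meas_code_xi_itin N).
  by apply: eq_bigr => w _; apply: eq_bigr => u _; rewrite /t expRK.
have tlE x : tl (@xi_itin N x) (itin alpha (N + m) x) =
    birkhoff alpha01 phi (itin alpha N x) I01_1 + \sum_(j <- iota 0 N) L (iter j f x).
  rewrite /tl take_itin ?leq_addr//; congr (_ + _).
  rewrite -(subn0 N) -/(index_iota 0 N) big_mkord subn0; apply: eq_bigr => j _.
  rewrite /L ffunE; congr lq.
  have -> : (N + m = j + (N - j + m))%N by rewrite addnA subnKC // ltnW.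
  rewrite itin_cat drop_cat size_itin ltnn subnn drop0.
  by rewrite take_itin// leq_addl.
have EtL : N%:R * E (extend phi) - A * orbit_sum alpha N - N%:R * e <=
    E (fun x => tl (@xi_itin N x) (itin alpha (N + m) x)).
  have [eb mb] := expect_code nu (fun u => birkhoff alpha01 phi u I01_1) (words_uniq N)
    (@itin_words R alpha N) (@meas_code_itin R alpha N).
  have bb : bounded_by (\sum_(u <- words N) `|birkhoff alpha01 phi u I01_1|)
      (fun x => birkhoff alpha01 phi (itin alpha N x) I01_1).
    move=> x; rewrite (big_rem (itin alpha N x)) ?itin_words//= lerDl.
    by rewrite sumr_ge0.
  have mLi j : meas_fun (fun x => L (iter j f x)).
    exact: (measurableT_comp mL (measurable_iterf mf j)).
  have [e3 e4 e5] := @expect_sum _ nu _ (iota 0 N) (fun j x => L (iter j f x)) _ mLi (fun j x => bL _).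
  rewrite (_ : (fun x => tl (@xi_itin N x) (itin alpha (N + m) x)) =
    (fun x => birkhoff alpha01 phi (itin alpha N x) I01_1 + \sum_(j <- iota 0 N) L (iter j f x))).
    2: by apply/funext => x; exact: tlE.
  rewrite (expectD nu mb bb e4 e5) e3.
  rewrite [X in _ <= _ + X](eq_bigr (fun=> E L)) => [|j _]; last exact: (expect_iter mf inv j mL bL).
  rewrite big_const_seq count_predT size_iota iter_addr_0 -[E L *+ N]mulr_natl.
  apply: lerD; first exact: expect_birkhoff.
  by rewrite -mulrN ler_wpM2l.
have Zb : ln (\sum_(w <- index_enum {ffun 'I_N -> 'I_k}) \sum_(u <- words (N + m)) t w u) <=
    N%:R * e + m%:R + (C + N%:R * (p + e)).
  have Z1 : \sum_(w <- index_enum {ffun 'I_N -> 'I_k}) \sum_(u <- words (N + m)) t w u <=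
      expR (N%:R * e + m%:R + (C + N%:R * (p + e))).
    rewrite exchange_big /=.
    have inner u : \sum_(w : {ffun 'I_N -> 'I_k}) t w u <=
        expR (birkhoff alpha01 phi (take N u) I01_1) * expR (N%:R * e).
      under eq_bigr => w _ do rewrite /t /tl expRD.
      rewrite -mulr_sumr ler_wpM2l ?expR_ge0//.
      under eq_bigr => w _ do rewrite expR_sum.
      rewrite -(bigA_distr_bigA (fun (j : 'I_N) i => expR (lq i (take m (drop j u))))).
      rewrite mulrC expRM_natr -[X in _ <= _ ^+ X](card_ord N) -prodr_const.
      apply: ler_prod => j _; rewrite sumr_ge0/= => [|i _]; last exact: expR_ge0.
      apply: le_trans (expR_ge1Dx e); rewrite (bigD1 (istar (take m (drop j u))))//= /lq eqxx expR0 lerD2l.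
      apply: (@le_trans _ _ (\sum_(i < k) e / k%:R)).
        rewrite big_mkcond /=; apply: ler_sum => i _; case: ifP => [/negbTE ->|_].
          by rewrite /lk lnK// posrE divr_gt0// ltr0n.
        by rewrite divr_ge0// ltW.
      by rewrite sumr_const card_ord -[_ *+ k]mulr_natr divfK// pnatr_eq0 -lt0n.
    apply: (@le_trans _ _ (\sum_(u <- words (N + m)) expR (birkhoff alpha01 phi (take N u) I01_1) * expR (N%:R * e))).
      by apply: ler_sum => u _; exact: inner.
    rewrite -mulr_suml sum_words_cat.
    have -> : \sum_(u <- words N) \sum_(v <- words m) expR (birkhoff alpha01 phi (take N (u ++ v)) I01_1) =
        partition_sum alpha01 phi N I01_1 * (2 ^+ m).
      rewrite /partition_sum mulr_suml; apply: eq_big_seq => u; rewrite mem_words => /eqP su.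
      rewrite (eq_bigr (fun=> expR (birkhoff alpha01 phi u I01_1))) => [|v _]; last first.
        by rewrite take_cat su ltnn subnn take0 cats0.
      rewrite big_const_seq count_predT iter_addr_0 -[X in X = _]mulr_natr; congr (_ * _).
      elim: (m) => [|m' IH] /=; first by rewrite expr0.
      by rewrite size_cat !size_map natrD IH exprS; ring.
    rewrite addrAC -addrA expRD mulrC ler_wpM2l ?expR_ge0// addrC addrA expRD.
    have h2 : (2 : R) ^+ m <= expR m%:R.
      rewrite -[m%:R]mul1r expRM_natr lerXn2r ?nnegrE ?expR_ge0//.
      exact: (expR_ge1Dx 1).
    rewrite mulrC addrC -expRD addrC.
    rewrite -addrA expRD; apply: ler_pM => //.
    exact: ltW (partition_sum_gt0 _ _ _ _).
  have Zp : 0 < \sum_(w <- index_enum {ffun 'I_N -> 'I_k}) \sum_(u <- words (N + m)) t w u.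
    have hs : forall w, 0 < \sum_(u <- words (N + m)) t w u.
      move=> w; rewrite (big_rem (itin alpha (N + m) 0)) ?itin_words//=.
      by rewrite ltr_pwDl ?expR_gt0// sumr_ge0// => u _; exact: expR_ge0.
    rewrite (bigD1 (@xi_itin N 0))//= ltr_pwDl ?hs// sumr_ge0// => w _; exact/ltW/hs.
  by rewrite -[leRHS]expRK ler_ln ?posrE ?expR_gt0.
rewrite Er in G.
have := hC' N; have := A0; move: G EtL Zb; rewrite !mulrDr.
set EE := E (fun x => tl _ _); set lnZ := ln _; set H := \sum_(w <- _) _ * _.
rewrite -/H; lra.
Qed.

Lemma limn_le_bound (a : R^nat) (b : R) : (forall n, 0 <= a n) ->
  (forall e : R, 0 < e -> exists K : R, forall n, a n <= n%:R * (b + e) + K) ->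
  limn (fun n => a n / n%:R) <= b.
Proof.
move=> a0 h.
have small (K e : R) : 0 < e -> \forall n \near \oo, `|K| / n%:R <= e.
  move=> e0; exists (Num.truncn (`|K| / e)).+1 => // n /= hn.
  have hn' : `|K| / e < n%:R.
    by apply: lt_le_trans (truncnS_gt _) _; rewrite ler_nat.
  have n0 : 0 < n%:R :> R by apply: le_lt_trans hn'; rewrite divr_ge0// ltW.
  by rewrite ler_pdivrMr// mulrC -ler_pdivrMr// ltW.
have ev e : 0 < e -> \forall n \near \oo, a n / n%:R <= b + e + e.
  move=> e0; have [K hK] := h _ e0.
  near=> n; have n0 : 0 < n%:R :> R by rewrite ltr0n; near: n; exists 1%N.
  have sm : `|K| / n%:R <= e by near: n; exact: small.
  rewrite ler_pdivrMr//; apply: le_trans (hK n) _.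
  rewrite ler_pdivrMr// in sm; have := ler_norm K; lra.
apply/ler_addgt0Pr => e e0; have e20 : 0 < e / 2 by rewrite divr_gt0.
have [cv|ncv] := pselect (cvgn (fun n => a n / n%:R)).
  apply: limr_le => //; apply: filterS (ev _ e20) => n; lra.
rewrite (dvgP ncv).
have [n _ hn] := ev _ e20; have := hn n (leqnn n); rewrite /=.
have : 0 <= a n / n%:R by rewrite divr_ge0.
rewrite /point /=; lra.
Unshelve. all: by end_near. Qed.

Lemma partition_entropy_upper (p : R) :
  (forall e : R, 0 < e -> exists C : R, forall N,
     partition_sum alpha01 phi N I01_1 <= expR (C + N%:R * (p + e))) ->
  partition_entropy f nu xi + E (extend phi) <= p.
Proof.
move=> growth; rewrite -lerBrDr; apply: limn_le_bound => [n|e e0].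
  exact: join_entropy_ge0.
have [K hK] := join_entropy_upper (divr_gt0 e0 (ltr0Sn _ 3)) growth.
exists K => n; apply: le_trans (hK n) _; rewrite lerD2r ler_wpM2l//.
by lra.
Qed.

End entropy_upper_bound2.

Section pressure_upper.
Context {R : realType} (alpha : R).
Hypothesis alpha01 : 0 < alpha <= 1.
Local Notation f := (intermittent alpha).
Local Notation Om := (measurableTypeR R).
Variables (phi : @I01 R -> R) (A : R).
Hypothesis A0 : 0 <= A.
Hypothesis hphi : rholder alpha A phi.
Variable phi0 : R -> R.
Hypothesis phi0E : forall X : @I01 R, phi0 (val X) = phi X.

Lemma integral_expect (nu : probability Om R) : invariant_probability f nu ->
  (\int[nu]_(x in unit_itv R) (phi0 x)%:E = (expect nu (extend phi))%:E)%E.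
Proof.
move=> inv.
have mu := @measurable_unit R.
have me := extend_meas alpha01 A0 hphi.
have be := extend_bound alpha01 A0 hphi.
have ie := bounded_integrable nu me be.
rewrite (eq_integral (EFin \o (extend phi : Om -> R))); last first.
  move=> x; rewrite inE /unit_itv /= in_itv /= => x01; congr EFin.
  pose X : @I01 R := exist _ x x01.
  by rewrite -[x]/(val X) phi0E extend_val.
have h0 : nu (~` unit_itv R) = 0%E.
  by rewrite probability_setC// (proj1 inv) subee.
have -> : (\int[nu]_(x in unit_itv R) (EFin \o extend phi) x =
    \int[nu]_x (EFin \o extend phi) x)%E.
  rewrite -(setUv (unit_itv R)).
  rewrite integral_setU//=; last 3 first.
  - exact: measurableC.
  - by rewrite setUv; case/integrableP: ie.
  - exact/disj_setPCl.
  rewrite [X in (_ + X)%E](_ : _ = 0%E) ?adde0//.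
  apply: null_set_integral => //; first exact: measurableC.
  by apply: measurable_funS (measurableT) _ _ => //; case/integrableP: ie.
by rewrite /expect /Rintegral fineK//; exact: integrable_fin_num.
Qed.

Lemma pressure_ereal_le (p : R) :
  (forall e : R, 0 < e -> exists C : R, forall N,
     partition_sum alpha01 phi N I01_1 <= expR (C + N%:R * (p + e))) ->
  (pressure_ereal f phi0 <= p%:E)%E.
Proof.
move=> growth; apply: ge_ereal_sup => _ [nu [inv ->]].
rewrite (integral_expect inv) -leeBrDr//; apply: ge_ereal_sup => _ [k [xi [mxi ->]]].
rewrite -EFinB lee_fin lerBrDr.
exact: (partition_entropy_upper A0 hphi inv mxi growth).
Qed.

End pressure_upper.

(** * The variational principle: lower bound *)

Section word_measure.
Context {R : realType} (alpha : R).
Hypothesis alpha01 : 0 < alpha <= 1.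
Local Notation f := (intermittent alpha).
Local Notation wm := (word_map alpha01).
Local Notation xs := (zero_orbit alpha).
Local Notation Om := (measurableTypeR R).
Implicit Types (v w : seq bool) (X Y : @I01 R).
Let I0 : @I01 R := I01_0.
Let I1 : @I01 R := I01_1.

Lemma branch_lt b X Y : (val (branch alpha01 b X) < val (branch alpha01 b Y)) = (val X < val Y).
Proof.
have h Z W : (val (branch alpha01 b Z) <= val (branch alpha01 b W)) = (val Z <= val W).
  rewrite -(lift_map_le alpha01 (I01_ge0 _) (I01_ge0 _)) !lift_map_branch.
  by rewrite lerD2r.
by rewrite !ltNge h.
Qed.

Lemma word_map_lt v X Y : (val (wm v X) < val (wm v Y)) = (val X < val Y).
Proof. by elim: v => //= b v IH; rewrite branch_lt. Qed.

Lemma itin_cylinder v X : val (wm v I0) < val X -> val X <= val (wm v I1) ->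
  itin alpha (size v) (val X) = v.
Proof.
elim: v X => [//|b v IH] X /= h1 h2; rewrite itinS.
have lb : label alpha (val X) = b.
  rewrite /label; case: b h1 h2 => /= h1 h2.
    apply: le_lt_trans h1.
    have := branch_le alpha01 true (_ : val I0 <= val (wm v I0)).
    by rewrite /= add0r; apply; exact: I01_ge0.
  apply/negbTE; rewrite -leNgt; apply: le_trans h2 _.
  have E : val (branch alpha01 false I1) = cut_point alpha by rewrite /= addr0.
  by rewrite -E; exact: (branch_le alpha01 false (I01_le1 _ : val (wm v I1) <= val I1)).
rewrite lb; congr (_ :: _).
have E := branch_label alpha01 X; rewrite lb in E.
apply: (IH (shift_map alpha01 X)).
  by rewrite -(branch_lt b) E.
by rewrite leNgt -(branch_lt b) E -leNgt.
Qed.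

Lemma prob_null_sub (mu : probability Om R) (N C : set Om) : measurable N -> measurable C ->
  prob mu N = 0 -> C `<=` N -> prob mu C = 0.
Proof.
by move=> mN mC h CN; apply/eqP; rewrite eq_le prob_ge0 andbT; have := prob_le mu mC mN CN; rewrite h.
Qed.

Variable m : seq bool -> R.
Hypothesis m_ge0 : forall v, 0 <= m v.
Hypothesis m_nil : m [::] = 1.
Hypothesis m_add : forall v, m v = m (rcons v false) + m (rcons v true).
Hypothesis m_decay : forall e : R, 0 < e -> exists n, forall v, (n <= size v)%N -> m v < e.

Fixpoint code n (t : R) : seq bool * R := if n is n'.+1 then
  let: (v, r) := code n' t in let a := m (rcons v false) in
  if r <= a then (rcons v false, r) else (rcons v true, r - a) else ([::], t).

Lemma size_code n t : size (code n t).1 = n.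
Proof. by elim: n => //= n; case: (code n t) => v r /= E; case: ifP; rewrite /= size_rcons E. Qed.

Lemma code_prefix j n t : exists w, size w = j /\ (code (n + j) t).1 = (code n t).1 ++ w.
Proof.
elim: j => [|j [w [sw E]]]; first by exists [::]; rewrite addn0 cats0.
rewrite addnS /=; case: (code (n + j) t) E => v r /= ->; case: ifP => _ /=.
  by exists (rcons w false); rewrite size_rcons sw rcons_cat.
by exists (rcons w true); rewrite size_rcons sw rcons_cat.
Qed.

Lemma code_remainder n t : 0 < t <= 1 -> 0 < (code n t).2 <= m (code n t).1.
Proof.
move=> t01; elim: n => [|n] /=; first by rewrite m_nil.
case: (code n t) => v r /= /andP[r0 rm]; case: (leP r (m (rcons v false))) => h /=.
  by rewrite r0.
by rewrite subr_gt0 h /= lerBlDl -m_add.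
Qed.

Lemma code_zeros n j t : (code (n + j) t).1 = (code n t).1 ++ nseq j false ->
  (code (n + j) t).2 = (code n t).2.
Proof.
elim: j => [|j IH]; first by rewrite addn0.
rewrite addnS /=; have [w [sw E]] := code_prefix j n t.
case: (code (n + j) t) E IH => v r /= -> IH.
have Er : false :: nseq j false = rcons (nseq j false) false.
  by elim: (j) => //= j' ->.
rewrite Er -rcons_cat; by case: ifP => _ /= /rcons_inj[] //.
Qed.

Lemma code_fibre n : exists lo : seq bool -> R, forall v, size v = n ->
  [/\ forall t, (code n t).1 = v -> (code n t).2 = t - lo v,
      measurable ([set t | (code n t).1 = v] : set Om),
      0 <= lo v, lo v + m v <= 1 &
      `]0, 1]%classic `&` [set t | (code n t).1 = v] = `]lo v, lo v + m v]%classic].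
Proof.
elim: n => [|n [lo IH]].
  exists (fun=> 0) => -[]// _; split => //=.
  - by move=> t _; rewrite subr0.
  - by rewrite (_ : [set _ | _] = setT)//; apply/seteqP; split.
  - by rewrite add0r m_nil.
  - by rewrite add0r m_nil; apply/seteqP; split => // t [].
exists (fun w => lo (take n w) + (if last false w then m (rcons (take n w) false) else 0)).
case/lastP => [//|v b]; rewrite size_rcons => -[sv].
rewrite last_rcons -cats1 take_cat sv ltnn subnn take0 cats0 cats1.
have [h1 h2 h3 h4 h5] := IH _ sv.
pose a := m (rcons v false).
have a0 : 0 <= a by exact: m_ge0.
have mv : m v = a + m (rcons v true) by exact: m_add.
have m1 : 0 <= m (rcons v true) by exact: m_ge0.
pose D : set Om := if b then `]a + lo v, +oo[%classic else `]-oo, a + lo v]%classic.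
have DE t : D t <-> (if b then a + lo v < t else t <= a + lo v).
  by rewrite /D; case: (b); rewrite /= in_itv /= ?andbT.
have mD : measurable D by rewrite /D; case: (b); exact: measurable_itv.
have fib : [set t | (code n.+1 t).1 = rcons v b] = [set t | (code n t).1 = v] `&` D.
  apply/seteqP; split => t /=; have := h1 t; case: (code n t) => v' r /= h1t.
    case: ifP => /= E' /rcons_inj[E1 E2]; subst v'; split => //; apply/DE; rewrite -E2 /=;
      by move: E'; rewrite (h1t erefl) -/a lerBlDr // => /negbT; rewrite -ltNge.
  case=> E1 /DE; subst v'; rewrite (h1t erefl) -/a lerBlDr.
  by case: (b) => h; [rewrite leNgt h|rewrite h].
split.
- move=> t /=; have := h1 t; case: (code n t) => v' r /= h1t.
  case: ifP => /= E' /rcons_inj[E1 E2]; subst v'; rewrite -E2.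
    by rewrite addr0 -h1t.
  by rewrite (h1t erefl) -/a; ring.
- by rewrite fib; exact: measurableI.
- by case: (b) => //=; rewrite ?addr0// addr_ge0.
- by case: (b) => /=; rewrite -/a; lra.
- rewrite fib setIA h5; apply/seteqP; split => t /=; rewrite !in_itv /=.
    move=> [/andP[g1 g2] /DE]; case: (b) => /= g3; rewrite -/a; apply/andP; split; lra.
  move=> /andP[]; rewrite DE; case: (b) => /=; rewrite -/a => g1 g2.
    by split; [apply/andP; split; lra|lra].
  by split; [apply/andP; split; lra|lra].
Qed.

Let lam : probability Om R := uniform_prob (@ltr01 R).

Lemma uniform_prob_itv (a b : R) : 0 <= a -> a <= b -> b <= 1 -> lam `]a, b]%classic = (b - a)%:E.
Proof.
move=> a0 ab b1; rewrite /lam /= /uniform_prob.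
rewrite (eq_integral (cst 1%:E)); last first.
  move=> x; rewrite inE /= in_itv /= => /andP[x1 x2]; rewrite /uniform_pdf.
  by rewrite subr0 invr1 (le_trans a0 (ltW x1)) (le_trans x2 b1).
rewrite integral_cst//= mul1e lebesgue_measure_itv /= lte_fin.
by case: ltP => // ba; rewrite (_ : a = b) ?subrr//; apply/eqP; rewrite eq_le ab.
Qed.

Lemma lam_unit : prob lam `]0, 1]%classic = 1.
Proof. by rewrite /prob uniform_prob_itv//= subr0. Qed.

Lemma lam_fibre v : prob lam [set t | (code (size v) t).1 = v] = m v.
Proof.
have [lo /(_ v erefl)[_ h2 h3 h4 h5]] := code_fibre (size v).
have h0 : prob lam (~` `]0, 1]%classic) = 0.
  by rewrite prob_setC ?measurable_itv// lam_unit subrr.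
rewrite (prob_split lam h2 (measurable_itv `]0, 1])) setIC h5.
rewrite (_ : prob lam (_ `&` ~` _) = 0); last first.
  apply: (prob_null_sub _ _ h0); last exact: subIsetr.
    by apply: measurableC; exact: measurable_itv.
  by apply: measurableI => //; apply: measurableC; exact: measurable_itv.
by rewrite addr0 /prob uniform_prob_itv ?lerDl//= addrC addKr.
Qed.

Definition limit_point (t : R) : R := limn (fun n => val (wm (code n t).1 I1)).

Lemma limit_point_cvg t : (fun n => val (wm (code n t).1 I1)) @ \oo --> limit_point t.
Proof.
apply: nonincreasing_is_cvgn.
  move=> i j /subnKC <-; have [w [_ ->]] := code_prefix (j - i) i t.
  by rewrite word_map_cat; apply: word_map_le; exact: I01_le1.
by exists 0 => _ [n _ <-]; exact: I01_ge0.
Qed.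

Lemma limit_point_le t n : limit_point t <= val (wm (code n t).1 I1).
Proof.
apply: limr_le; first exact: limit_point_cvg.
exists n => // j /= /subnKC <-; have [w [_ ->]] := code_prefix (j - n) n t.
by rewrite word_map_cat; apply: word_map_le; exact: I01_le1.
Qed.

Lemma limit_point_ge t n : val (wm (code n t).1 I0) <= limit_point t.
Proof.
apply: limr_ge; first exact: limit_point_cvg.
exists n => // j /= /subnKC <-; have [w [_ ->]] := code_prefix (j - n) n t.
by rewrite word_map_cat; apply: word_map_le; exact: I01_ge0.
Qed.

Lemma limit_point01 t : 0 <= limit_point t <= 1.
Proof.
apply/andP; split; first exact: le_trans (I01_ge0 _) (limit_point_ge t 0).
exact: le_trans (limit_point_le t 0) (I01_le1 _).
Qed.

Lemma itin_limit_point t n : 0 < t <= 1 -> itin alpha n (limit_point t) = (code n t).1.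
Proof.
move=> t01; pose X : @I01 R := exist (fun x : R => 0 <= x <= 1) (limit_point t) (limit_point01 t).
rewrite -{1}(size_code n t) -[limit_point t]/(val X).
apply: itin_cylinder; last exact: limit_point_le.
have [j hj] : exists j, (code (n + j) t).1 != (code n t).1 ++ nseq j false.
  apply: contrapT => nh.
  have h j : (code (n + j) t).1 = (code n t).1 ++ nseq j false.
    by apply/eqP; apply: contrapT => ne; apply: nh; exists j; apply/negP.
  have /andP[r0 _] := code_remainder n t01.
  have [k hk] := m_decay r0.
  have /andP[_] := code_remainder (n + k) t01; rewrite (code_zeros (h k)).
  by rewrite leNgt hk// size_code leq_addl.
apply: lt_le_trans (limit_point_ge t (n + j)).
have [w [sw E]] := code_prefix j n t; rewrite E in hj *.
rewrite word_map_cat word_map_lt.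
have {}hj : w != nseq j false by apply: contra hj => /eqP ->.
have : exists u w', exists i, u = rcons (nseq i false) true /\ w = u ++ w'.
  elim: w j sw hj {E} => [|b w IH] [|j] //= [sw].
  case: b => h; first by exists [:: true], w, 0%N.
  have h' : w != nseq j false by apply: contra h => /eqP ->.
  have [u [w' [i [-> ->]]]] := IH _ sw h'.
  by exists (false :: rcons (nseq i false) true), w', i.+1.
move=> [u [w' [i [-> ->]]]]; rewrite word_map_cat -excursion_word.
have /andP[h _] := excursion_range alpha01 i (wm w' I0).
by apply: lt_le_trans h; have /andP[] := zero_orbit01 alpha01 i.+1.
Qed.

Lemma measurable_limit_point : measurable_fun [set: Om] (limit_point : Om -> Om).
Proof.
apply: (measurable_fun_cvg (h := fun n t => val (wm (code n t).1 I1))); last first.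
  by move=> t _; exact: limit_point_cvg.
move=> n; have mc : meas_code ((fun t => (code n t).1) : Om -> seq bool).
  move=> v; have [<-|/eqP ne] := eqVneq (size v) n.
    by have [lo /(_ v erefl)[_ + _ _ _]] := code_fibre (size v).
  rewrite (_ : _ @^-1` _ = set0)//; apply/seteqP; split => t //= E.
  by apply: ne; rewrite -E size_code.
have cs t : (code n t).1 \in words n by rewrite mem_words size_code.
by have [] := expect_code lam (fun u => val (wm u I1)) (words_uniq n) cs mc.
Qed.

Lemma word_measure_exists : exists nu : probability Om R, nu (unit_itv R) = 1%E /\
  forall v, prob nu [set x | itin alpha (size v) x = v] = m v.
Proof.
pose X : {mfun Om >-> Om} := @mfun_Sub _ _ Om Om _ (mem_set measurable_limit_point).
pose nu : probability Om R := distribution lam X.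
exists nu; split.
  rewrite /nu /= /distribution /pushforward /=.
  rewrite (_ : _ @^-1` _ = setT) ?probability_setT//.
  apply/seteqP; split => t //= _; rewrite /unit_itv /= in_itv /=; exact: limit_point01.
move=> v; rewrite -lam_fibre /prob /nu /= /distribution /pushforward /=.
set A := _ @^-1` _; set B := [set t | _].
have mB : measurable (B : set Om).
  by have [lo /(_ v erefl)[_ + _ _ _]] := code_fibre (size v).
have mA : measurable (A : set Om).
  rewrite -[A]setTI; apply: measurable_limit_point => //.
  exact: (@meas_code_itin _ alpha (size v) v).
have h0 : prob lam (~` `]0, 1]%classic) = 0.
  by rewrite prob_setC ?measurable_itv// lam_unit subrr.
have m1 : measurable (`]0, 1]%classic : set Om) by exact: measurable_itv.
have h0' C : measurable (C : set Om) -> prob lam (C `&` ~` `]0, 1]%classic) = 0.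
  move=> mC; apply: (prob_null_sub _ _ h0); last exact: subIsetr.
    exact: measurableC.
  by apply: measurableI => //; exact: measurableC.
rewrite -!/(prob lam _) (prob_split lam mA m1) (prob_split lam mB m1) !h0'//.
congr (prob lam _ + _); apply/seteqP; split => t [] /= h; rewrite in_itv /= => t01; split => //.
  by rewrite /B /= -itin_limit_point.
by rewrite /A /= itin_limit_point.
Qed.

Hypothesis m_shift : forall v, m v = m (false :: v) + m (true :: v).

Lemma prob_itin_set (nu : probability Om R) n (B : seq bool -> bool) :
  (forall v, prob nu [set x | itin alpha (size v) x = v] = m v) ->
  prob nu [set x | B (itin alpha n x)] = \sum_(v <- words n | B v) m v.
Proof.
move=> h; rewrite (prob_partition nu (measurable_itin alpha n B) (words_uniq n)
  (itin_words alpha n) (@meas_code_itin _ alpha n)).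
rewrite [RHS]big_mkcond; apply: eq_big_seq => v; rewrite mem_words => /eqP sv /=.
case: ifPn => Bv.
  rewrite -h sv; congr (prob nu _); apply/seteqP; split => x /=; first by case.
  by move=> E; rewrite E.
rewrite (_ : _ `&` _ = set0) ?prob0//; apply/seteqP; split => x //= [+ E].
by rewrite E; apply/negP.
Qed.

Lemma word_measure_invariant (nu : probability Om R) : nu (unit_itv R) = 1%E ->
  (forall v, prob nu [set x | itin alpha (size v) x = v] = m v) ->
  invariant_probability f nu.
Proof.
move=> nu1 h; split => // A mA.
have mf := measurable_intermittent alpha.
pose X : {mfun Om >-> Om} := @mfun_Sub _ _ Om Om _ (mem_set mf).
pose nu2 : probability Om R := distribution nu X.
have nu2E C : prob nu2 C = prob nu (f @^-1` C) by [].
have mu := @measurable_unit R.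
have mpre C : measurable (C : set Om) -> measurable (f @^-1` C : set Om).
  by move=> mC; have := measurable_intermittent alpha measurableT mC; rewrite setTI.
have unit1 : prob nu (unit_itv R) = 1 by rewrite /prob nu1.
have on1 C : measurable (C : set Om) -> prob nu (unit_itv R `&` C) = prob nu C.
  move=> mC; rewrite [RHS](prob_split nu mC mu) setIC.
  have h0 : prob nu (~` unit_itv R) = 0 by rewrite prob_setC// unit1 subrr.
  suff -> : prob nu (C `&` ~` unit_itv R) = 0 by rewrite addr0.
  apply: (prob_null_sub _ _ h0); last exact: subIsetr.
    exact: measurableC.
  by apply: measurableI => //; exact: measurableC.
have on2 C : measurable (C : set Om) -> prob nu2 (unit_itv R `&` C) = prob nu2 C.
  move=> mC; have mUC : measurable (unit_itv R `&` C : set Om) by exact: measurableI.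
  rewrite !nu2E -(on1 _ (mpre _ mC)) -(on1 _ (mpre _ mUC)); congr (prob nu _); apply/seteqP; split => x [ux] /=; first by case.
  by move=> fx; split => //; split => //; move: ux; rewrite /unit_itv /= !in_itv /=; exact: intermittent01.
have same n (B : seq bool -> bool) : prob nu2 [set x | B (itin alpha n x)] = prob nu [set x | B (itin alpha n x)].
  rewrite nu2E (prob_itin_set n B h).
  rewrite (_ : _ @^-1` _ = [set x | (fun u => B (behead u)) (itin alpha n.+1 x)]); last first.
    by apply/seteqP; split => x; rewrite /preimage /mkset itinS.
  rewrite (prob_itin_set n.+1 (fun u => B (behead u)) h) big_mkcond sum_wordsS -big_split /=.
  rewrite [RHS]big_mkcond; apply: eq_bigr => v _; case: ifP => _; last by rewrite addr0.
  by rewrite -m_shift.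
have approx (mu' : probability Om R) n (B : seq bool -> bool) (e : R) :
    (forall C, measurable (C : set Om) -> prob mu' (unit_itv R `&` C) = prob mu' C) ->
    prob mu' (symdiff alpha n B A) < e ->
    `|prob mu' A - prob mu' [set x | B (itin alpha n x)]| <= e.
  move=> on he; set C := [set x | _].
  have mC : measurable (C : set Om) by exact: measurable_itin.
  have mS : measurable ((A `&` ~` C) `|` (~` A `&` C) : set Om).
    by apply: measurableU; apply: measurableI => //; exact: measurableC.
  rewrite /symdiff on// in he.
  have mAC : measurable (A `&` ~` C : set Om) by apply: measurableI => //; exact: measurableC.
  have mCA : measurable (~` A `&` C : set Om) by apply: measurableI => //; exact: measurableC.
  have e1 : prob mu' (A `&` ~` C) <= prob mu' ((A `&` ~` C) `|` (~` A `&` C)).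
    by apply: prob_le => // x; left.
  have e2 : prob mu' (~` A `&` C) <= prob mu' ((A `&` ~` C) `|` (~` A `&` C)).
    by apply: prob_le => // x; right.
  rewrite (prob_split mu' mA mC) (prob_split mu' mC mA) [C `&` A]setIC [C `&` ~` A]setIC.
  have := prob_ge0 mu' (A `&` ~` C); have := prob_ge0 mu' (~` A `&` C).
  by rewrite ler_norml; move: e1 e2 he; lra.
have key : prob nu2 A = prob nu A.
  apply/eqP; rewrite -subr_eq0 -normr_le0; apply/ler_addgt0Pr => e e0; rewrite add0r.
  have e2 : 0 < e / 2 by rewrite divr_gt0.
  have [_ /(_ _ e2)[n [B [h1 h2]]]] := measurable_approximable alpha01 nu nu2 mA.
  have := approx _ _ _ _ on1 h1; have := approx _ _ _ _ on2 h2; rewrite same.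
  by rewrite !ler_norml; lra.
have mI : measurable (unit_itv R `&` f @^-1` A : set Om) by apply: measurableI => //; exact: mpre.
transitivity ((prob nu A)%:E); last exact/esym/(probE nu mA).
apply: (etrans (probE nu mI)); congr EFin; rewrite (on1 _ (mpre _ mA)); exact: key.
Qed.

End word_measure.

Section subadditive_sequences.
Context {R : realType}.
Variable a : R^nat.
Hypothesis a_ge0 : forall n, 0 <= a n.
Hypothesis a_sub : forall m n, a (m + n)%N <= a m + a n.

Lemma subadditive_mul k q r : a (q * k + r)%N <= q%:R * a k + a r.
Proof.
elim: q => [|q IH]; first by rewrite mul0n add0n mul0r add0r.
rewrite mulSn -addnA -[q.+1]addn1 natrD; apply: le_trans (a_sub _ _) _; lra.
Qed.

Lemma subadditive_cvg : cvgn (fun n => a n / n%:R).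
Proof.
pose S := [set x | exists2 n, (0 < n)%N & x = a n / n%:R].
have hS : has_inf S.
  split; first by exists (a 1 / 1%:R), 1%N.
  by exists 0 => _ [n _ ->]; rewrite divr_ge0.
pose L := inf S; apply/cvg_ex; exists L; apply/cvgrPdist_le => e e0.
have e2 : 0 < e / 2 by rewrite divr_gt0.
have [_ [k k0 ->] hk] := inf_adherent e2 hS.
pose C := \sum_(r < k) a r.
have hC r : (r < k)%N -> a r <= C.
  by move=> rk; rewrite /C (bigD1 (Ordinal rk))//= lerDl sumr_ge0.
exists (Num.truncn (C / (e / 2))).+1 => // n /= hn.
have n0 : 0 < n%:R :> R by rewrite ltr0n; exact: leq_trans hn.
have low : L <= a n / n%:R by apply: (ge_inf hS.2); exists n => //; rewrite -(ltr0n R).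
rewrite ler0_norm ?subr_le0// opprB lerBlDl.
have Cn : C <= e / 2 * n%:R.
  rewrite mulrC -ler_pdivrMr//; apply: ltW; apply: lt_le_trans (truncnS_gt _) _.
  by rewrite ler_nat.
have k0' : 0 < k%:R :> R by rewrite ltr0n.
rewrite ler_pdivrMr// {1}(divn_eq n k); apply: le_trans (subadditive_mul _ _ _) _.
have hr := hC _ (ltn_pmod n k0).
have qk : (n %/ k)%:R * a k <= n%:R * (a k / k%:R).
  have : ((n %/ k)%N * k)%:R <= n%:R :> R by rewrite ler_nat leq_trunc_div.
  rewrite natrM => h; apply: le_trans (ler_wpM2r _ h); last by rewrite divr_ge0.
  by rewrite -mulrA [k%:R * _]mulrC divfK// gt_eqF.
have h3 : n%:R * (a k / k%:R) <= n%:R * (L + e / 2) by rewrite ler_wpM2l// ltW.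
by move: Cn hr qk h3; rewrite mulrDr mulrDl; lra.
Qed.

Lemma limn_ge_bound (b : R) :
  (forall e : R, 0 < e -> exists K : R, forall n, n%:R * (b - e) - K <= a n) ->
  b <= limn (fun n => a n / n%:R).
Proof.
move=> h; apply/ler_addgt0Pr => e e0; rewrite -lerBlDr.
have e2 : 0 < e / 2 by rewrite divr_gt0.
have [K hK] := h _ e2.
apply: limr_ge; first exact: subadditive_cvg.
exists (Num.truncn (`|K| / (e / 2))).+1 => // n /= hn.
have n0 : 0 < n%:R :> R by rewrite ltr0n; exact: leq_trans hn.
have Kn : `|K| <= e / 2 * n%:R.
  rewrite mulrC -ler_pdivrMr//; apply: ltW; apply: lt_le_trans (truncnS_gt _) _.
  by rewrite ler_nat.
rewrite ler_pdivlMr//; apply: le_trans (hK n); have := ler_norm K; lra.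
Qed.

End subadditive_sequences.

Section block_measure.
Context {R : realType} (alpha : R).
Hypothesis alpha01 : 0 < alpha <= 1.
Local Notation f := (intermittent alpha).
Local Notation wm := (word_map alpha01).
Local Notation Om := (measurableTypeR R).
Variables (phi : @I01 R -> R) (A : R).
Hypothesis A0 : 0 <= A.
Hypothesis hphi : rholder alpha A phi.
Variable n0 : nat.
Local Notation n := n0.+1.
Implicit Types (s v w : seq bool).
Let S v := birkhoff alpha01 phi v I01_1.
Let Z := partition_sum alpha01 phi n I01_1.
Let Z0 : 0 < Z. Proof. exact: partition_sum_gt0. Qed.
Definition block_weight w := expR (S w) / Z.
Local Notation P := block_weight.
Definition block_pressure := (ln Z - A * orbit_sum alpha n) / n%:R.
Local Notation p := block_pressure.
Definition block_marginal s := \sum_(t <- words (n - size s)) P (s ++ t).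

Fixpoint block_prob s v := if v is b :: v' then
  if (size s).+1 == n then P (rcons s b) * block_prob [::] v' else block_prob (rcons s b) v'
  else block_marginal s.
Local Notation q := block_prob.

Definition block_measure v := n%:R^-1 * \sum_(j < n) \sum_(s <- words j) q s v.
Local Notation m := block_measure.

Lemma block_weight_gt0 w : 0 < P w. Proof. by rewrite divr_gt0 ?expR_gt0. Qed.

Lemma sum_words_gt0 k (F : seq bool -> R) : (forall u, 0 < F u) -> 0 < \sum_(u <- words k) F u.
Proof.
move=> F0; rewrite (big_rem (nseq k false)) ?mem_words ?size_nseq//=.
by rewrite ltr_pwDl// sumr_ge0// => u _; exact: ltW.
Qed.

Lemma block_marginal_gt0 s : 0 < block_marginal s.
Proof. by apply: sum_words_gt0 => u; exact: block_weight_gt0. Qed.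

Lemma block_marginal_nil : block_marginal [::] = 1.
Proof. by rewrite /block_marginal subn0 -mulr_suml divff// gt_eqF. Qed.

Lemma block_marginal_full s : size s = n -> block_marginal s = P s.
Proof. by rewrite /block_marginal => ->; rewrite subnn sum_words0 cats0. Qed.

Lemma block_marginal_split s : (size s < n)%N ->
  block_marginal s = block_marginal (rcons s false) + block_marginal (rcons s true).
Proof.
move=> sn; rewrite /block_marginal !size_rcons subSn// sum_wordsS subSS.
by congr (_ + _); apply: eq_bigr => u _; rewrite cat_rcons.
Qed.

Lemma sum_block_marginal j : (j <= n)%N -> \sum_(s <- words j) block_marginal s = 1.
Proof.
move=> jn; rewrite -block_marginal_nil [in RHS]/block_marginal subn0 -[in RHS](subnKC jn) sum_words_cat.
by apply: eq_big_seq => s; rewrite mem_words => /eqP ss; rewrite /block_marginal ss.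
Qed.

Lemma block_marginal_le1 s : (size s <= n)%N -> block_marginal s <= 1.
Proof.
move=> sn; rewrite -(sum_block_marginal sn) (big_rem s) ?mem_words//= lerDl.
by apply: sumr_ge0 => u _; exact/ltW/block_marginal_gt0.
Qed.

Lemma block_prob_gt0 v s : (size s < n)%N -> 0 < q s v.
Proof.
elim: v s => [|b v IH] s sn /=; first exact: block_marginal_gt0.
case: ifPn => h; first by rewrite mulr_gt0 ?block_weight_gt0 ?IH.
by apply: IH; rewrite size_rcons ltn_neqAle h.
Qed.

Lemma block_prob_split v s : (size s < n)%N -> q s v = q s (rcons v false) + q s (rcons v true).
Proof.
elim: v s => [|b v IH] s sn /=.
  rewrite (block_marginal_split sn) block_marginal_nil !mulr1.
  by case: ifP => // /eqP h; rewrite !block_marginal_full ?size_rcons.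
case: ifPn => h; first by rewrite (IH [::])// mulrDr.
by apply: IH; rewrite size_rcons ltn_neqAle h.
Qed.

Lemma block_measure_gt0 v : 0 < m v.
Proof.
rewrite mulr_gt0 ?invr_gt0 ?ltr0n// big_ord_recl ltr_pwDl//.
  by rewrite sum_words0 block_prob_gt0.
apply: sumr_ge0 => j _; rewrite big_seq; apply: sumr_ge0 => s; rewrite mem_words => /eqP ss.
by apply/ltW/block_prob_gt0; rewrite ss.
Qed.

Lemma block_measure_nil : m [::] = 1.
Proof.
rewrite /m (eq_bigr (fun=> 1)) => [|j _]; last exact/sum_block_marginal/ltnW.
by rewrite sumr_const card_ord mulVf// pnatr_eq0.
Qed.

Lemma block_measure_add v : m v = m (rcons v false) + m (rcons v true).
Proof.
rewrite -mulrDr -big_split; congr (_ * _); apply: eq_bigr => j _; rewrite -big_split.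
by apply: eq_big_seq => s; rewrite mem_words => /eqP ss; apply: block_prob_split; rewrite ss.
Qed.

Lemma block_measure_shift v : m v = m (false :: v) + m (true :: v).
Proof.
pose T j u := \sum_(s <- words j) q s u.
have step j : (j.+1 < n)%N -> T j (false :: v) + T j (true :: v) = T j.+1 v.
  move=> jn; rewrite /T sum_words_rcons -big_split; apply: eq_big_seq => s.
  by rewrite mem_words => /eqP ss /=; rewrite ss ltn_eqF.
have last_step : T n0 (false :: v) + T n0 (true :: v) = T 0%N v.
  rewrite {3}/T sum_words0 -[RHS]mul1r -(sum_block_marginal (leqnn n)) sum_words_rcons mulr_suml.
  rewrite /T -big_split; apply: eq_big_seq => s.
  rewrite mem_words => /eqP ss /=; rewrite ss eqxx !block_marginal_full ?size_rcons ?ss//.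
  by rewrite mulrDl.
rewrite -mulrDr -big_split; congr (_ * _).
change (\sum_(j < n) T j v = \sum_(j < n) (T j (false :: v) + T j (true :: v))).
rewrite big_ord_recl [RHS]big_ord_recr [T ord0 v]/= -last_step addrC; congr (_ + _).
apply: eq_bigr => j _; rewrite -[T (lift _ _) v]/(T j.+1 v) -step//.
by rewrite ltnS.
Qed.

Lemma rholder_bound x : `|phi x| <= `|phi I01_0| + A.
Proof. by have := extend_bound alpha01 A0 hphi (val x); rewrite extend_val. Qed.
Local Notation B := (`|phi I01_0| + A).

Lemma birkhoff_bound u x : `|birkhoff alpha01 phi u x| <= (size u)%:R * B.
Proof.
elim: u => [|b u IH] /=; first by rewrite normr0 mul0r.
rewrite -[(size u).+1]add1n natrD mulrDl mul1r; apply: le_trans (ler_normD _ _) _.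
by apply: lerD => //; exact: rholder_bound.
Qed.

Let C0 := n%:R * (B + `|p|).

Lemma expR_shift_ge (k : nat) x : (k <= n)%N -> - (k%:R * B) <= x -> 0 <= C0 + x - k%:R * p.
Proof.
move=> kn hx; have : k%:R * (B + `|p|) <= C0 by rewrite ler_wpM2r ?addr_ge0// ler_nat.
have : k%:R * p <= k%:R * `|p| by rewrite ler_wpM2l// ler_norm.
by rewrite mulrDr; lra.
Qed.

Lemma block_prob_le v s : (size s < n)%N ->
  q s v <= expR (C0 + S (s ++ v) - (size s + size v)%:R * p).
Proof.
elim: v s => [|b v IH] s sn /=.
  rewrite cats0 addn0; apply: le_trans (block_marginal_le1 (ltnW sn)) _.
  rewrite -[leLHS]expR0 ler_expR; apply: expR_shift_ge; first exact: ltnW.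
  by have := birkhoff_bound s I01_1; rewrite ler_norml => /andP[].
case: ifPn => [/eqP h|h]; last first.
  rewrite -cat_rcons addnS -addSn -(size_rcons s b); apply: IH.
  by rewrite size_rcons ltn_neqAle h.
have := IH [::] isT; rewrite /= add0n => IH0.
apply: le_trans (ler_wpM2l (ltW (block_weight_gt0 _)) IH0) _.
rewrite /block_weight -[Z in _ / Z](lnK (Z0 : Z \is Num.pos)) -expRN -!expRD ler_expR.
have E : (size s + (size v).+1 = n + size v)%N by rewrite addnS -addSn h.
rewrite E natrD mulrDl -cat_rcons /S birkhoff_cat.
have sr : size (rcons s b) = n by rewrite size_rcons.
have := birkhoff_var alpha01 (rcons s b) I01_1 (wm v I01_1) A0 hphi; rewrite sr ler_norml => /andP[_ hv].
have -> : n%:R * p = ln Z - A * orbit_sum alpha n by rewrite mulrC divfK// pnatr_eq0.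
by move: hv; set x1 := birkhoff _ _ _ I01_1; set x2 := birkhoff _ _ _ (wm _ _); set x3 := birkhoff _ _ v _; lra.
Qed.

Let cc : R := n%:R^-1 * \sum_(j < n) \sum_(s <- words j) 1.
Let cc0 : 0 <= cc.
Proof. by rewrite mulr_ge0 ?invr_ge0// sumr_ge0// => j _; rewrite sumr_ge0. Qed.

Lemma block_measure_unif v (X : R) : (forall s, (size s < n)%N -> q s v <= X) -> m v <= cc * X.
Proof.
move=> h; rewrite /m /cc -mulrA ler_wpM2l ?invr_ge0// mulr_suml ler_sum// => j _.
rewrite mulr_suml big_seq [leRHS]big_seq; apply: ler_sum => s.
by rewrite mem_words mul1r => /eqP ss; apply: h; rewrite ss.
Qed.

Lemma block_measure_le : exists C : R, forall v, m v <= expR (C + S v - (size v)%:R * p).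
Proof.
pose C1 := C0 + n%:R * B + n%:R * `|p|; exists (ln (cc + 1) + C1) => v.
have c1 : 0 < cc + 1 by rewrite ltr_wpDl.
apply: le_trans (block_measure_unif (X := expR (C1 + S v - (size v)%:R * p)) _) _.
  move=> s sn; apply: le_trans (block_prob_le _ sn) _; rewrite ler_expR.
  have sB : (size s)%:R <= n%:R :> R by rewrite ler_nat ltnW.
  have h1 := birkhoff_bound s (wm v I01_1); rewrite ler_norml in h1; case/andP: h1 => _ h1.
  have B0 : 0 <= B by rewrite addr_ge0.
  have h2 : (size s)%:R * B <= n%:R * B by rewrite ler_wpM2r.
  have h3 : (size s)%:R * `|p| <= n%:R * `|p| by rewrite ler_wpM2r.
  have h4 : - ((size s)%:R * p) <= (size s)%:R * `|p|.
    by rewrite -mulrN ler_wpM2l// -normrN ler_norm.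
  rewrite /S birkhoff_cat natrD mulrDl /C1; lra.
have -> : ln (cc + 1) + C1 + S v - (size v)%:R * p = ln (cc + 1) + (C1 + S v - (size v)%:R * p).
  by rewrite !addrA.
by rewrite expRD lnK// ler_wpM2r ?expR_ge0// lerDl.
Qed.

Lemma block_measure_decay (e : R) : 0 < e ->
  exists k, forall v, (k <= size v)%N -> m v < e.
Proof.
move=> e0; pose c := expR (- (n%:R * B)) / Z.
have c0 : 0 < c by rewrite divr_gt0 ?expR_gt0.
have cP w : size w = n -> c <= P w.
  move=> sw; rewrite /c /P ler_wpM2r ?invr_ge0 ?(ltW Z0)// ler_expR.
  by have := birkhoff_bound w I01_1; rewrite sw ler_norml => /andP[].
have Pk w : size w = n -> P w <= 1 - c.
  move=> sw; rewrite lerBrDr -(sum_block_marginal (leqnn n)).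
  rewrite (big_rem w) ?mem_words ?sw//= block_marginal_full// lerD2l.
  pose w' := map negb w; have sw' : size w' = n by rewrite size_map.
  have ww' : w' != w by case: w sw {sw'} @w' => //= b w _; case: b.
  have hw' : w' \in rem w (words n) by rewrite mem_rem_uniq ?words_uniq// inE ww' mem_words sw' /=.
  rewrite (big_rem w' hw') /=.
  rewrite block_marginal_full//; apply: le_trans (cP _ sw') _; rewrite lerDl sumr_ge0// => u _.
  exact/ltW/block_marginal_gt0.
have k0 : 0 < 1 - c by apply: lt_le_trans (block_weight_gt0 (nseq n false)) (Pk _ _); rewrite size_nseq.
pose l := ln (1 - c) / n%:R.
have nR : 0 < n%:R :> R by rewrite ltr0n.
have l0 : l < 0 by rewrite /l pmulr_llt0 ?invr_gt0// ln_lt0// k0 /= ltrBlDr ltrDl.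
have nl : n%:R * l = ln (1 - c) by rewrite /l mulrC divfK// gt_eqF.
have qb v s : (size s < n)%N -> q s v <= expR ((size s + size v)%:R * l - n%:R * l).
  elim: v s => [|b v IH] s sn /=.
    apply: le_trans (block_marginal_le1 (ltnW sn)) _; rewrite -[leLHS]expR0 ler_expR addn0.
    rewrite -mulrBl; apply: mulr_le0 => //; last exact: ltW.
    by rewrite subr_le0 ler_nat ltnW.
  case: ifPn => [/eqP h|h]; last first.
    rewrite addnS -addSn -(size_rcons s b); apply: IH.
    by rewrite size_rcons ltn_neqAle h.
  have := IH [::] isT; rewrite /= add0n => IH0.
  have E : (size s + (size v).+1 = n + size v)%N by rewrite addnS -addSn h.
  rewrite E natrD mulrDl -addrA expRD nl lnK ?posrE//.
  rewrite nl in IH0; apply: ler_pM; [exact/ltW/block_weight_gt0|exact/ltW/block_prob_gt0| |exact: IH0].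
  by apply: Pk; rewrite size_rcons.
pose e' := e / (cc + 1); have e'0 : 0 < e' by rewrite divr_gt0// ltr_wpDl.
pose k := (Num.truncn ((ln e' + n%:R * l) / l)).+1; exists k => v kv.
apply: le_lt_trans (block_measure_unif (X := expR ((size v)%:R * l - n%:R * l)) _) _.
  move=> s sn; apply: le_trans (qb _ _ sn) _; rewrite ler_expR lerD2r natrD mulrDl gerDr.
  by apply: mulr_ge0_le0 => //; exact: ltW.
have h : expR ((size v)%:R * l - n%:R * l) < e'.
  rewrite -[ltRHS](lnK (e'0 : e' \is Num.pos)) ltr_expR ltrBlDr -ltr_ndivrMr//.
  by apply: lt_le_trans (truncnS_gt _) _; rewrite ler_nat.
apply: le_lt_trans (_ : _ <= (cc + 1) * expR ((size v)%:R * l - n%:R * l)) _.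
  by rewrite ler_wpM2r ?expR_ge0// lerDl.
by rewrite mulrC -ltr_pdivlMr// ltr_wpDl.
Qed.

End block_measure.

Section pressure_lower.
Context {R : realType} (alpha : R).
Hypothesis alpha01 : 0 < alpha <= 1.
Local Notation f := (intermittent alpha).
Local Notation wm := (word_map alpha01).
Local Notation Om := (measurableTypeR R).
Implicit Types (s v w : seq bool).

Definition label2 (x : R) : 'I_2 := if label alpha x then ord_max else ord0.

Lemma label2_measurable : measurable_labelling label2.
Proof.
move=> i.
rewrite (_ : _ @^-1` _ = [set x | (fun u => (if head false u then ord_max else ord0) == i) (itin alpha 1 x)]).
  exact: (measurable_itin alpha 1 (fun u => (if head false u then ord_max else ord0) == i)).
by apply/seteqP; split => x; rewrite /preimage /mkset itinS /= => /eqP.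
Qed.

Definition ffun_word N (w : {ffun 'I_N -> 'I_2}) : seq bool := [seq w i == ord_max | i <- enum 'I_N].

Lemma size_ffun_word N (w : {ffun 'I_N -> 'I_2}) : size (ffun_word w) = N.
Proof. by rewrite size_map size_enum_ord. Qed.

Lemma ffun_word_inj N : injective (@ffun_word N).
Proof.
move=> w w' E; apply/ffunP => i.
have : (w i == ord_max) = (w' i == ord_max).
  by move/eq_in_map: E => /(_ i); apply; rewrite mem_enum.
by case: (w i) (w' i) => [[|[|//]] ?] [[|[|//]] ?] // _; exact: val_inj.
Qed.

Lemma ffun_word_sum N (F : seq bool -> R) :
  \sum_(w : {ffun 'I_N -> 'I_2}) F (ffun_word w) = \sum_(u <- words N) F u.
Proof.
rewrite -(big_map (@ffun_word N) predT F); apply: perm_big; apply: uniq_perm.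
- by rewrite map_inj_uniq ?index_enum_uniq//; exact: ffun_word_inj.
- exact: words_uniq.
move=> u; rewrite mem_words; apply/mapP/eqP => [[w _ ->]|su]; first exact: size_ffun_word.
exists [ffun i : 'I_N => if nth false u i then ord_max else ord0]; first by rewrite mem_index_enum.
apply: (@eq_from_nth _ false) => [|i]; first by rewrite size_ffun_word.
rewrite su => iN; rewrite (nth_map (Ordinal iN)) ?size_enum_ord// ffunE nth_enum_ord//.
by case: (nth false u i).
Qed.

Lemma label2_itin N (w : {ffun 'I_N -> 'I_2}) :
  @xi_itin R alpha _ label2 N @^-1` [set w] = [set x | itin alpha N x = ffun_word w].
Proof.
have E x : itin alpha N x = ffun_word (@xi_itin R alpha _ label2 N x).
  rewrite /itin /mkseq -val_enum_ord -map_comp; apply: eq_map => j /=.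
  by rewrite ffunE /label2; case: (label _ _).
apply/seteqP; split => x; rewrite /preimage /mkset E; first by move=> ->.
exact: ffun_word_inj.
Qed.

Lemma birkhoffN (phi : @I01 R -> R) u x :
  birkhoff alpha01 (fun y => - phi y) u x = - birkhoff alpha01 phi u x.
Proof. by elim: u => [|b u IH] /=; rewrite ?oppr0// IH opprD. Qed.

Lemma expect_birkhoff_upper (phi : @I01 R -> R) (A : R) (nu : probability Om R) N :
  0 <= A -> rholder alpha A phi -> invariant_probability f nu ->
  expect nu (fun x => birkhoff alpha01 phi (itin alpha N x) I01_1) <=
  N%:R * expect nu (extend phi) + A * orbit_sum alpha N.
Proof.
move=> A0 hphi inv.
have hphi' : rholder alpha A (fun y => - phi y).
  by move=> x y; rewrite -opprD normrN.
have := expect_birkhoff alpha01 A0 hphi' inv N.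
have E1 : expect nu (extend (fun y => - phi y)) = - expect nu (extend phi).
  rewrite -mulN1r -(expectZ nu (-1) (extend_meas alpha01 A0 hphi) (extend_bound alpha01 A0 hphi)).
  by congr expect; apply/funext => x; rewrite /extend mulN1r.
have [e2 m2] := expect_code nu (fun u => birkhoff alpha01 phi u I01_1) (words_uniq N)
  (itin_words alpha N) (@meas_code_itin _ alpha N).
have [e3 m3] := expect_code nu (fun u => birkhoff alpha01 (fun y => - phi y) u I01_1) (words_uniq N)
  (itin_words alpha N) (@meas_code_itin _ alpha N).
rewrite E1 e2 e3 (eq_bigr (fun u => - (prob nu (itin alpha N @^-1` [set u]) * birkhoff alpha01 phi u I01_1))).
  by rewrite sumrN mulrN; lra.
by move=> u _; rewrite birkhoffN mulrN.
Qed.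

Section stationary.
Variable m : seq bool -> R.
Hypothesis m_gt0 : forall v, 0 < m v.
Hypothesis m_nil : m [::] = 1.
Hypothesis m_add : forall v, m v = m (rcons v false) + m (rcons v true).
Hypothesis m_shift : forall v, m v = m (false :: v) + m (true :: v).

Lemma stationary_right N v : \sum_(w <- words N) m (v ++ w) = m v.
Proof.
elim: N v => [|N IH] v; first by rewrite sum_words0 cats0.
rewrite sum_wordsS [RHS]m_add -2!IH.
by congr (_ + _); apply: eq_bigr => w _; rewrite cat_rcons.
Qed.

Lemma stationary_left N v : \sum_(w <- words N) m (w ++ v) = m v.
Proof.
elim: N v => [|N IH] v; first by rewrite sum_words0.
rewrite sum_words_rcons [RHS]m_shift -2!IH -big_split.
by apply: eq_bigr => w _; rewrite !cat_rcons.
Qed.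

Definition word_entropy N := - \sum_(v <- words N) m v * ln (m v).

Lemma stationary_le1 v : m v <= 1.
Proof.
have := stationary_right (size v) [::]; rewrite m_nil => <-.
by rewrite (big_rem v) ?mem_words//= lerDl sumr_ge0// => u _; exact: ltW.
Qed.

Lemma word_entropy_ge0 N : 0 <= word_entropy N.
Proof.
rewrite /word_entropy -sumrN sumr_ge0// => v _; rewrite -mulrN mulr_ge0 ?(ltW (m_gt0 _))//.
by rewrite oppr_ge0 ln_le0// stationary_le1.
Qed.

Lemma word_entropy_sub M N : word_entropy (M + N) <= word_entropy M + word_entropy N.
Proof.
have sum1 k : \sum_(w <- words k) m w = 1 by rewrite -m_nil -(stationary_right k [::]).
have := @gibbs_inequality R (seq bool) unit (words (M + N)) [:: tt] (fun i _ => m i)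
  (fun i _ => m (take M i) * m (drop M i)) m (fun i _ => ltW (m_gt0 _))
  (fun i _ => mulr_gt0 (m_gt0 _) (m_gt0 _)).
have h1 i : m i = \sum_(j <- [:: tt]) m i by rewrite big_seq1.
have h3 (i : seq bool) (j : unit) : j \notin [:: tt] -> m i = 0 by case: j.
move=> /(_ h1 isT h3 (sum1 _)).
have tk u v : size u = M -> take M (u ++ v) = u /\ drop M (u ++ v) = v.
  by move=> su; rewrite take_cat drop_cat su ltnn subnn take0 drop0 cats0.
have -> : \sum_(i <- words (M + N)) \sum_(j <- [:: tt]) m (take M i) * m (drop M i) = 1.
  under eq_bigr => i _ do rewrite big_seq1.
  rewrite sum_words_cat -[RHS](sum1 M); apply: eq_big_seq => u; rewrite mem_words => /eqP su.
  rewrite -[RHS]mulr1 -[in RHS](sum1 N) mulr_sumr; apply: eq_bigr => v _.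
  by have [-> ->] := tk u v su.
have -> : \sum_(i <- words (M + N)) \sum_(j <- [:: tt]) m i * ln (m (take M i) * m (drop M i)) =
    - word_entropy M - word_entropy N.
  under eq_bigr => i _ do rewrite big_seq1 lnM ?posrE// mulrDr.
  rewrite big_split /= /word_entropy !opprK; congr (_ + _).
    rewrite sum_words_cat; apply: eq_big_seq => u; rewrite mem_words => /eqP su.
    rewrite -[X in _ = X * _](stationary_right N u) mulr_suml; apply: eq_bigr => v _.
    by have [-> _] := tk u v su.
  rewrite sum_words_cat exchange_big /=; apply: eq_bigr => v _.
  rewrite -[in RHS](stationary_left M v) mulr_suml; apply: eq_big_seq => u; rewrite mem_words => /eqP su.
  by have [_ ->] := tk u v su; rewrite stationary_left.
by rewrite ln1 /word_entropy; lra.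
Qed.

End stationary.

Lemma block_pressure_le (phi : @I01 R -> R) (A : R) (phi0 : R -> R) n0 :
  0 <= A -> rholder alpha A phi -> (forall X : @I01 R, phi0 (val X) = phi X) ->
  ((block_pressure alpha01 phi A n0)%:E <= pressure_ereal f phi0)%E.
Proof.
move=> A0 hphi phi0E; set p := block_pressure _ _ _ _.
pose m := block_measure alpha01 phi n0.
have m_gt0 v : 0 < m v by exact: block_measure_gt0.
have m_nil : m [::] = 1 by exact: block_measure_nil.
have m_add v : m v = m (rcons v false) + m (rcons v true) by exact: block_measure_add.
have m_shift v : m v = m (false :: v) + m (true :: v) by exact: block_measure_shift.
have [nu [nu1 nuE]] := word_measure_exists alpha01 (fun v => ltW (m_gt0 v)) m_nil m_add
  (block_measure_decay alpha01 A0 hphi n0).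
have inv : invariant_probability f nu := word_measure_invariant alpha01 m_shift nu1 nuE.
have [C hC] := block_measure_le alpha01 A0 hphi n0.
have ent : partition_entropy f nu label2 = limn (fun N => word_entropy m N / N%:R).
  rewrite /partition_entropy; congr (limn _); apply/funext => N; congr (_ / _).
  rewrite (join_entropyE inv label2_measurable) /word_entropy -ffun_word_sum; congr (- _).
  apply: eq_bigr => w _; rewrite label2_itin.
  by rewrite -nuE size_ffun_word.
have low : p - expect nu (extend phi) <= partition_entropy f nu label2.
  rewrite ent; apply: limn_ge_bound => [N|M N|e e0]; [exact: word_entropy_ge0|exact: word_entropy_sub|].
  have e1 : 0 < e / (A + 1) by rewrite divr_gt0// ltr_wpDl.
  have [C' hC'] := orbit_sum_sublinear alpha01 e1.
  exists (C + A * C') => N.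
  have up := expect_birkhoff_upper N A0 hphi inv.
  have [e2 _] := expect_code nu (fun u => birkhoff alpha01 phi u I01_1) (words_uniq N)
    (itin_words alpha N) (@meas_code_itin _ alpha N).
  have h : \sum_(v <- words N) m v * (N%:R * p - C - birkhoff alpha01 phi v I01_1) <= word_entropy m N.
    rewrite /word_entropy -sumrN; rewrite big_seq [leRHS]big_seq; apply: ler_sum => v; rewrite mem_words => /eqP sv.
    rewrite -mulrN ler_wpM2l ?(ltW (m_gt0 _))//.
    have := hC v; rewrite -/(m v) -[m v in X in X -> _](lnK (m_gt0 v : m v \is Num.pos)) ler_expR sv.
    by rewrite /p; lra.
  apply: le_trans h.
  have E : \sum_(v <- words N) m v * (N%:R * p - C - birkhoff alpha01 phi v I01_1) =
      N%:R * p - C - expect nu (fun x => birkhoff alpha01 phi (itin alpha N x) I01_1).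
    rewrite e2; under eq_bigr => v _ do rewrite mulrBr.
    rewrite big_split /= sumrN -mulr_suml.
    have -> : \sum_(w <- words N) m w = 1 by rewrite -m_nil -(stationary_right m_add N [::]).
    rewrite mul1r; congr (_ - _); apply: eq_big_seq => v; rewrite mem_words => /eqP sv.
    by congr (_ * _); rewrite -nuE sv.
  rewrite E.
  have h2 : A * orbit_sum alpha N <= N%:R * e + A * C'.
    apply: le_trans (ler_wpM2l A0 (hC' N)) _; rewrite mulrDr lerD2r.
    rewrite mulrA mulrC ler_wpM2l// mulrA ler_pdivrMr ?ltr_wpDl//.
    by rewrite mulrDr mulr1 mulrC lerDl ltW.
  by rewrite mulrBr mulrBr; lra.
apply: (@le_trans _ _ (measure_entropy f nu + \int[nu]_(x in unit_itv R) (phi0 x)%:E)%E).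
  rewrite (integral_expect alpha01 A0 hphi phi0E inv) -leeBlDr// -EFinB.
  apply: le_trans (_ : _ <= (partition_entropy f nu label2)%:E)%E _; first by rewrite lee_fin.
  by apply: ereal_sup_ubound; exists 2, label2; split => //; exact: label2_measurable.
by apply: ereal_sup_ubound; exists nu.
Qed.

End pressure_lower.

(** * Induced operators and growth of the partition sums *)

Section induced_real.
Context {R : realType} (alpha : R).
Hypothesis alpha01 : 0 < alpha <= 1.
Let alpha0 : 0 < alpha. Proof. by case/andP: alpha01. Qed.
Local Notation wm := (word_map alpha01).
Local Notation br := (branch alpha01).
Local Notation exc := (excursion alpha01).
Local Notation xs := (zero_orbit alpha).
Local Notation d := (eta_dist alpha).
Implicit Types (x y : @I01 R) (u v : @I01 R -> R).

Lemma word_map_nseq k x : wm (nseq k false) x = iter k (br false) x.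
Proof. by elim: k => //= k ->. Qed.

Lemma birkhoff_excursion (V : nmodType) (phi : @I01 R -> V) k x :
  birkhoff alpha01 phi (rcons (nseq k false) true) x = \sum_(j < k.+1) phi (exc j x).
Proof.
elim: k => [|k IH]; first by rewrite big_ord_recl big_ord0.
rewrite big_ord_recr -IH /= addrC; congr (_ + phi _).
by rewrite -excursion_word.
Qed.

Lemma birkhoff_zeros (V : nmodType) (phi : @I01 R -> V) k x :
  birkhoff alpha01 phi (nseq k false) x = \sum_(j < k) phi (iter j.+1 (br false) x).
Proof.
elim: k => [|k IH]; first by rewrite big_ord0.
by rewrite big_ord_recr -IH /= addrC word_map_nseq.
Qed.

Lemma birkhoff_zerosS (V : nmodType) (phi : @I01 R -> V) k x :
  birkhoff alpha01 phi (nseq k.+1 false) x =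
  birkhoff alpha01 phi (nseq k false) (br false x) + phi (br false x).
Proof.
rewrite !birkhoff_zeros big_ord_recl addrC; congr (_ + _).
by apply: eq_bigr => j _; rewrite -iterSr.
Qed.

Lemma birkhoff_excursionS (V : nmodType) (phi : @I01 R -> V) k x :
  birkhoff alpha01 phi (rcons (nseq k false) true) x =
  birkhoff alpha01 phi (nseq k false) (br true x) + phi (br true x).
Proof. by rewrite -cats1 birkhoff_cat /= addr0. Qed.

Lemma iter_branch0_range k x : 0 <= val (iter k (br false) x) <= xs k.
Proof.
rewrite I01_ge0 /=; have := word_map_dist alpha01 (nseq k false) x I01_0.
rewrite size_nseq !word_map_nseq /dist.
have -> : iter k (br false) I01_0 = I01_0.
  elim: k => //= k ->; apply: val_inj; rewrite /= addr0; exact: lift_inv0.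
by rewrite subr0 ger0_norm ?I01_ge0.
Qed.

Section potential.
Variable psi : @I01 R -> R.

Definition inner_term k u x := expR (birkhoff alpha01 psi (rcons (nseq k false) true) x) * u (exc k x).
Definition zero_term k u x := expR (birkhoff alpha01 psi (nseq k false) x) * u (iter k (br false) x).
Definition transfer u x := expR (psi (br false x)) * u (br false x) + expR (psi (br true x)) * u (br true x).
Definition induced L u x := \sum_(k < L) inner_term k u x.
Local Notation one := (fun _ : @I01 R => 1 : R).

Lemma zero_termS k u x : zero_term k.+1 u x = expR (psi (br false x)) * zero_term k u (br false x).
Proof. by rewrite /zero_term birkhoff_zerosS expRD iterSr mulrA [X in _ = X * _]mulrC. Qed.

Lemma inner_termE k u x : inner_term k u x = expR (psi (br true x)) * zero_term k u (br true x).
Proof. by rewrite /inner_term /zero_term birkhoff_excursionS expRD mulrA [X in _ = X * _]mulrC. Qed.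

Lemma partition_sum_transfer N x : partition_sum alpha01 psi N x = iter N transfer one x.
Proof.
elim: N x => [|N IH] x; first by rewrite /partition_sum sum_words0 expR0.
by rewrite partition_sumS !IH.
Qed.

Lemma transfer_le u v : (forall x, u x <= v x) -> forall x, transfer u x <= transfer v x.
Proof. by move=> h x; apply: lerD; rewrite ler_wpM2l ?expR_ge0. Qed.

Lemma iter_transfer_le N u v : (forall x, u x <= v x) -> forall x, iter N transfer u x <= iter N transfer v x.
Proof. by move=> h; elim: N => //= N; exact: transfer_le. Qed.

Lemma inner_term_le k u v : (forall x, u x <= v x) -> forall x, inner_term k u x <= inner_term k v x.
Proof. by move=> h x; rewrite ler_wpM2l ?expR_ge0. Qed.

Lemma induced_le L u v : (forall x, u x <= v x) -> forall x, induced L u x <= induced L v x.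
Proof. by move=> h x; apply: ler_sum => k _; exact: inner_term_le. Qed.

Lemma induced_ge0 L u : (forall x, 0 <= u x) -> forall x, 0 <= induced L u x.
Proof. by move=> h x; apply: sumr_ge0 => k _; rewrite mulr_ge0 ?expR_ge0. Qed.

Lemma induced_widen L L' u : (L <= L')%N -> (forall x, 0 <= u x) -> forall x, induced L u x <= induced L' u x.
Proof.
move=> /subnKC <- h x; rewrite /induced big_split_ord /= lerDl.
by apply: sumr_ge0 => k _; rewrite mulr_ge0 ?expR_ge0.
Qed.

Lemma induced_linear L a u v x : induced L (fun y => a * u y + v y) x = a * induced L u x + induced L v x.
Proof.
rewrite /induced mulr_sumr -big_split; apply: eq_bigr => k _.
by rewrite /inner_term mulrDr mulrCA.
Qed.

Lemma iter_induced_ge0 L n x : 0 <= iter n (induced L) one x.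
Proof. by elim: n x => [|n IH] x //=; exact: induced_ge0. Qed.

Lemma iter_induced_widen L L' n x : (L <= L')%N ->
  iter n (induced L) one x <= iter n (induced L') one x.
Proof.
move=> LL; elim: n x => [//|n IH] x /=; apply: le_trans (induced_le _ IH x) _.
by apply: induced_widen => // y; exact: iter_induced_ge0.
Qed.

Variable A : R.
Hypothesis A0 : 0 <= A.
Hypothesis hpsi : rholder alpha A psi.

Lemma rholder_zero x (t : R) : val x <= t -> `|psi x - psi I01_0| <= A * t `^ alpha.
Proof.
move=> xt; apply: le_trans (hpsi _ _) _; rewrite ler_wpM2l// powR_le ?dist_ge0// ?(ltW alpha0)//.
by rewrite /dist subr0 ger0_norm ?I01_ge0.
Qed.

Lemma birkhoff_zeros_near k x :
  `|birkhoff alpha01 psi (nseq k false) x - k%:R * psi I01_0| <= A * orbit_sum alpha k.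
Proof.
rewrite birkhoff_zeros -[k%:R]/(k%:R) mulr_natl -[X in _ *+ X](card_ord k) -sumr_const -sumrB.
apply: le_trans (ler_norm_sum _ _ _) _; rewrite mulr_sumr; apply: ler_sum => j _.
by apply: rholder_zero; have /andP[] := iter_branch0_range j.+1 x.
Qed.

Lemma bounded_induced_growth (K : R) : psi I01_0 <= 0 ->
  (forall L n x, iter n (induced L) one x <= K) ->
  forall e : R, 0 < e -> exists C : R, forall N,
    partition_sum alpha01 psi N I01_1 <= expR (C + N%:R * (0 + e)).
Proof.
move=> psi0 hK e e0.
pose G N x := \sum_(n < N.+1) iter n (induced N.+1) one x.
have G0 N x : 0 <= G N x by apply: sumr_ge0 => n _; exact: iter_induced_ge0.
have Gmon N x : G N x <= G N.+1 x.
  rewrite /G [leRHS]big_ord_recr /=; apply: ler_wpDr; first exact: (iter_induced_ge0 _ N.+1).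
  by apply: ler_sum => n _; exact: iter_induced_widen.
have sumI L x M : induced L (fun y => \sum_(n < M) iter n (induced L) one y) x =
    \sum_(n < M) iter n.+1 (induced L) one x.
  elim: M => [|M IH]; first by rewrite big_ord0 /induced big1// => k _; rewrite /inner_term big_ord0 mulr0.
  rewrite big_ord_recr -IH.
  rewrite (_ : (fun y => _) = (fun y => 1 * (\sum_(n < M) iter n (induced L) one y) + iter M (induced L) one y)).
    by rewrite induced_linear mul1r.
  by apply/funext => y; rewrite big_ord_recr mul1r.
have Gstep N x : \sum_(k < N.+1) inner_term k (G N) x <= G N.+1 x.
  have := sumI N.+1 x N.+1; rewrite /induced => ->.
  rewrite /G [leRHS]big_ord_recl; apply: ler_wpDl => //; apply: ler_sum => n _.
  exact: (iter_induced_widen n.+1 x (leqnSn N.+1)).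
pose Gh N x := \sum_(k < N.+1) zero_term k (G (N - k)%N) x.
have zt_le k u v : (forall x, u x <= v x) -> forall x, zero_term k u x <= zero_term k v x.
  by move=> h x; rewrite ler_wpM2l ?expR_ge0.
have Ghstep N x : transfer (Gh N) x <= Gh N.+1 x.
  rewrite /transfer /Gh [leRHS]big_ord_recl addrC; apply: lerD.
    rewrite /zero_term /= expR0 mul1r subn0; apply: le_trans (Gstep N x).
    rewrite mulr_sumr; apply: ler_sum => k _; rewrite -inner_termE.
    apply: inner_term_le => y; have kN := ltnSE (ltn_ord k).
    rewrite -[in leRHS](subnK kN).
    elim: (nat_of_ord k) (N - k)%N => [|j IH] M; rewrite ?addn0// addnS.
    exact: le_trans (IH M) (Gmon _ _).
  by rewrite mulr_sumr; apply: ler_sum => k _; rewrite -zero_termS.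
have Zle N x : partition_sum alpha01 psi N x <= Gh N x.
  elim: N x => [|N IH] x.
    by rewrite /partition_sum sum_words0 /= /Gh big_ord_recl big_ord0 addr0 /zero_term /= /G big_ord_recl big_ord0 addr0 /= expR0 mulr1.
  rewrite partition_sum_transfer /=; apply: le_trans (Ghstep N x).
  by apply: transfer_le => y; rewrite -partition_sum_transfer.
have GK N M x : (N <= M)%N -> G N x <= M.+1%:R * K.
  move=> NM; have K0 : 0 <= K by apply: le_trans (hK 0%N 0%N x).
  apply: (@le_trans _ _ (\sum_(n < N.+1) K)); first by apply: ler_sum => n _; exact: hK.
  by rewrite sumr_const card_ord -[K *+ _]mulr_natl ler_wpM2r// ler_nat.
have e4 : 0 < e / 4 / (A + 1) by rewrite !divr_gt0// ltr_wpDl.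
have [C hC] := orbit_sum_sublinear alpha01 e4.
have os_mon k N : (k <= N)%N -> orbit_sum alpha k <= orbit_sum alpha N.
  move=> /subnKC <-; rewrite /orbit_sum big_split_ord /= lerDl.
  by apply: sumr_ge0 => j _; exact: powR_ge0.
have zb N k : (k <= N)%N -> birkhoff alpha01 psi (nseq k false) I01_1 <= N%:R * (e / 4) + A * C.
  move=> kN; have := birkhoff_zeros_near k I01_1; rewrite ler_norml => /andP[_ h].
  have h1 : A * orbit_sum alpha k <= A * (e / 4 / (A + 1) * N%:R + C).
    by rewrite ler_wpM2l//; exact: le_trans (os_mon _ _ kN) (hC N).
  have h2 : A * (e / 4 / (A + 1) * N%:R) <= N%:R * (e / 4).
    rewrite mulrA mulrC ler_wpM2l// mulrA ler_pdivrMr ?ltr_wpDl//.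
    by rewrite mulrDr mulr1 mulrC lerDl; lra.
  have h3 : k%:R * psi I01_0 <= 0 by rewrite mulr_ge0_le0.
  by move: h h1 h2 h3; rewrite [A * (_ + _)]mulrDr; lra.
have K0 : 0 <= K by apply: le_trans (hK 0%N 0%N I01_1).
have [D hD] : exists D : R, forall N : nat, N.+1%:R * (N.+1%:R * K) <= expR (D + N%:R * (e / 2)).
  have e40 : 0 < e / 4 by lra.
  pose t := e / 4; pose D1 := ln ((1 + 1 / t) ^+ 2 * (K + 1)).
  have t0 : 0 < t by [].
  have c0 : 0 < (1 + 1 / t) ^+ 2 * (K + 1).
    by apply: mulr_gt0; [rewrite exprn_gt0// addr_gt0// divr_gt0|rewrite ltr_wpDl].
  exists D1 => N; rewrite expRD lnK//.
  have h : N.+1%:R <= (1 + 1 / t) * expR (N%:R * t).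
    have h1 := expR_ge1Dx (N%:R * t).
    have h2 : 1 <= expR (N%:R * t) by rewrite -[leLHS]expR0 ler_expR mulr_ge0// ltW.
    have h3 : N%:R <= 1 / t * expR (N%:R * t).
      by rewrite mul1r mulrC ler_pdivlMr//; lra.
    by rewrite -addn1 natrD mulrDl mul1r; lra.
  have E2 : expR (N%:R * (e / 2)) = expR (N%:R * t) ^+ 2.
    by rewrite -expRM_natr; congr expR; rewrite /t; field.
  rewrite E2 mulrAC -exprMn mulrA -expr2.
  apply: ler_pM => //; last by lra.
  by rewrite lerXn2r ?nnegrE// mulr_ge0 ?expR_ge0// addr_ge0// divr_ge0// ltW.
exists (D + A * C) => N; apply: le_trans (Zle N I01_1) _.
apply: (@le_trans _ _ (\sum_(k < N.+1) expR (N%:R * (e / 4) + A * C) * (N.+1%:R * K))).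
  apply: ler_sum => k _; rewrite /zero_term; apply: ler_pM; rewrite ?expR_ge0//.
    by rewrite ler_expR zb// -ltnS.
  by rewrite GK// leq_subr.
rewrite sumr_const card_ord -[X in X <= _]mulr_natl mulrCA.
apply: le_trans (ler_wpM2l (expR_ge0 _) (hD N)) _.
rewrite -expRD ler_expR add0r.
have : 0 <= N%:R * (e / 4) by rewrite mulr_ge0// divr_ge0// ltW.
by have -> : N%:R * e = 2 * (N%:R * (e / 4)) + N%:R * (e / 2); [field|lra].
Qed.

Definition cone_rate := (2 / dexp alpha * A) / (1 - eta_rate alpha).
Local Notation B := cone_rate.

Lemma dexp_gt0 : 0 < dexp alpha. Proof. by rewrite divr_gt0// exprn_gt0. Qed.

Lemma cone_rateE : 2 / dexp alpha * A + B * eta_rate alpha = B.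
Proof. by have /andP[_ h] := eta_rate01 alpha01; rewrite /B; field; rewrite ?gt_eqF ?dexp_gt0//; lra. Qed.

Lemma cone_rate_ge0 : 0 <= B.
Proof.
have /andP[_ h] := eta_rate01 alpha01; rewrite divr_ge0 ?subr_ge0 ?(ltW h)// mulr_ge0//.
by rewrite divr_ge0// ltW// dexp_gt0.
Qed.

Definition rcone (b : R) u := forall x y, 0 <= u x /\ u x <= expR (b * d x y) * u y.

Lemma rcone_one (b : R) : 0 <= b -> rcone b one.
Proof. by move=> b0 x y; split => //; rewrite mulr1 -[leLHS]expR0 ler_expR mulr_ge0// powR_ge0. Qed.

Lemma birkhoff_excursion_var k x y :
  `|birkhoff alpha01 psi (rcons (nseq k false) true) x - birkhoff alpha01 psi (rcons (nseq k false) true) y|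
  <= 2 / dexp alpha * A * d x y.
Proof.
rewrite !birkhoff_excursion -sumrB; apply: le_trans (ler_norm_sum _ _ _) _.
apply: (@le_trans _ _ (\sum_(j < k.+1) A * dist (exc j x) (exc j y) `^ alpha)).
  by apply: ler_sum => j _; exact: hpsi.
by rewrite -mulr_sumr mulrAC [_ * A]mulrC ler_wpM2l//; exact: excursion_distortion.
Qed.

Lemma inner_term_cone (b : R) k u : 0 <= b -> rcone b u ->
  rcone (2 / dexp alpha * A + b * eta_rate alpha) (inner_term k u).
Proof.
move=> b0 hu x y; have [u0 _] := hu (exc k x) (exc k x).
split; first by rewrite mulr_ge0 ?expR_ge0.
have [_ u1] := hu (exc k x) (exc k y).
have h1 : expR (birkhoff alpha01 psi (rcons (nseq k false) true) x) <=
    expR (2 / dexp alpha * A * d x y) * expR (birkhoff alpha01 psi (rcons (nseq k false) true) y).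
  rewrite -expRD ler_expR; have := birkhoff_excursion_var k x y.
  by rewrite ler_norml => /andP[_]; lra.
have h2 : u (exc k x) <= expR (b * eta_rate alpha * d x y) * u (exc k y).
  have [uy _] := hu (exc k y) (exc k y).
  apply: le_trans u1 _; rewrite ler_wpM2r// ler_expR -mulrA ler_wpM2l//.
  exact: eta_dist_excursion.
rewrite mulrDl expRD /inner_term.
set E1 := expR (_ * d x y) in h1 *; set E2 := expR (b * _ * _) in h2 *.
by rewrite mulrACA; apply: ler_pM => //; exact: expR_ge0.
Qed.

Lemma induced_cone L u : rcone B u -> rcone B (induced L u).
Proof.
move=> hu x y; split.
  by apply: sumr_ge0 => k _; have [] := inner_term_cone k cone_rate_ge0 hu x x.
rewrite /induced mulr_sumr; apply: ler_sum => k _.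
by have [_] := inner_term_cone k cone_rate_ge0 hu x y; rewrite cone_rateE.
Qed.

Lemma iter_induced_cone L n : rcone B (iter n (induced L) one).
Proof. by elim: n => [|n IH] /=; [exact: rcone_one cone_rate_ge0|exact: induced_cone]. Qed.

Lemma growth_bounded_induced :
  (forall e : R, 0 < e -> exists C : R, forall N,
    partition_sum alpha01 psi N I01_1 <= expR (C + N%:R * (0 + e))) ->
  forall L n x, iter n (induced L) one x <= expR B.
Proof.
move=> growth L n y; rewrite leNgt; apply/negP => hy.
have [n0|n0] := posnP n.
  by move: hy; rewrite n0 /= -[ltRHS]expR0 ltr_expR ltNge cone_rate_ge0.
have [L0|L0] := posnP L.
  move: hy; rewrite L0 -(prednK n0) /= /induced big_ord0 => h.
  by have := expR_gt0 B; rewrite ltNge (ltW h).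
pose r := iter n (induced L) one y / expR B.
have r1 : 1 < r by rewrite /r ltr_pdivlMr ?expR_gt0// mul1r.
have hr x : r <= iter n (induced L) one x.
  rewrite /r ler_pdivrMr ?expR_gt0// mulrC.
  have [_ h] := iter_induced_cone L n y x; apply: le_trans h _.
  by rewrite ler_wpM2r ?iter_induced_ge0// ler_expR ler_piMr ?cone_rate_ge0// eta_dist_le1.
pose la := ln r / n%:R; pose a := expR la.
have nR : 0 < n%:R :> R by rewrite ltr0n.
have la0 : 0 < la by rewrite divr_gt0// ln_gt0.
have an : a ^+ n = r.
  by rewrite /a -expRM_natl /la mulrC divfK ?gt_eqF// lnK// posrE (lt_trans ltr01).
have a0 : 0 < a by exact: expR_gt0.
pose b j x := (a ^+ j)^-1 * iter j (induced L) one x.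
pose H x := \sum_(j < n) b j x.
have b_ge0 j x : 0 <= b j x by rewrite mulr_ge0 ?iter_induced_ge0// invr_ge0 exprn_ge0// ltW.
have H1 x : 1 <= H x.
  rewrite /H -(prednK n0) big_ord_recl {1}/b /= invr1 mul1r lerDl.
  by apply: sumr_ge0 => j _.
have indH x : a * H x <= induced L H x.
  have E M : induced L (fun y => \sum_(j < M) b j y) x = a * \sum_(j < M) b j.+1 x.
    elim: M => [|M IH].
      by rewrite !big_ord0 mulr0 /induced big1// => k _; rewrite /inner_term big_ord0 mulr0.
    rewrite [in RHS]big_ord_recr mulrDr -IH.
    rewrite (_ : (fun y => _) = (fun y => (a ^+ M)^-1 * iter M (induced L) one y + \sum_(j < M) b j y)).
      rewrite induced_linear addrC; congr (_ + _); rewrite /b exprS invfM !mulrA divff ?mul1r//.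
      by rewrite gt_eqF.
    by apply/funext => z; rewrite big_ord_recr addrC.
  rewrite /H E ler_pM2l//.
  have : \sum_(j < n) b j x + b n x = b 0%N x + \sum_(j < n) b j.+1 x.
    by rewrite -(big_ord_recr n (fun j => b j x)) big_ord_recl.
  have : b 0%N x = 1 by rewrite /b /= invr1 mul1r.
  have : 1 <= b n x by rewrite /b an mulrC ler_pdivlMr ?mul1r// (lt_trans ltr01).
  lra.
have Hub x : H x <= expR B * H y.
  rewrite /H mulr_sumr; apply: ler_sum => j _; rewrite /b mulrCA ler_wpM2l ?invr_ge0 ?exprn_ge0 ?(ltW a0)//.
  have [_ h] := iter_induced_cone L j x y; apply: le_trans h _.
  by rewrite ler_wpM2r ?iter_induced_ge0// ler_expR ler_piMr ?cone_rate_ge0// eta_dist_le1.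
pose de := la / L.+1%:R.
have LR : 0 < L.+1%:R :> R by rewrite ltr0n.
have de0 : 0 < de by rewrite divr_gt0.
pose w k := expR (- (k%:R * de)).
pose Hh x := \sum_(k < L) w k * zero_term k H x.
have zt0 k x : 0 <= zero_term k H x by rewrite mulr_ge0 ?expR_ge0// (le_trans ler01).
have wS k : w k = expR de * w k.+1.
  by rewrite /w -expRD; congr expR; rewrite -natr1; ring.
have Hh_step x : expR de * Hh x <= transfer Hh x.
  have -> : transfer Hh x = \sum_(k < L) w k * zero_term k.+1 H x + \sum_(k < L) w k * inner_term k H x.
    rewrite /transfer /Hh !mulr_sumr; congr (_ + _); apply: eq_bigr => k _.
      by rewrite zero_termS mulrCA.
    by rewrite inner_termE mulrCA.
  have h1 : expR de * H x <= \sum_(k < L) w k * inner_term k H x.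
    apply: (@le_trans _ _ (w L * induced L H x)).
      apply: (@le_trans _ _ (w L * (a * H x))); last by rewrite ler_wpM2l ?expR_ge0.
      rewrite mulrA ler_wpM2r ?(le_trans ler01)// /w /a -expRD ler_expR.
      by rewrite -[la](divfK (lt0r_neq0 LR)) -/de -natr1; lra.
    rewrite /induced mulr_sumr; apply: ler_sum => k _; rewrite ler_wpM2r//.
      by rewrite mulr_ge0 ?expR_ge0// (le_trans ler01).
    by rewrite ler_expR lerN2 ler_wpM2r ?(ltW de0)// ler_nat ltnW.
  have h2 : \sum_(k < L) w k * zero_term k.+1 H x = expR de * \sum_(k < L) w k.+1 * zero_term k.+1 H x.
    by rewrite mulr_sumr; apply: eq_bigr => k _; rewrite mulrA -wS.
  have h3 : Hh x + w L * zero_term L H x = H x + \sum_(k < L) w k.+1 * zero_term k.+1 H x.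
    rewrite /Hh -(big_ord_recr L (fun k => w k * zero_term k H x)) big_ord_recl; congr (_ + _).
    by rewrite /w mul0r oppr0 expR0 mul1r /zero_term /= expR0 mul1r.
  have h4 : 0 <= w L * zero_term L H x by rewrite mulr_ge0 ?expR_ge0.
  have h5 : 0 <= expR de * (w L * zero_term L H x) by rewrite mulr_ge0 ?expR_ge0.
  have h6 := congr1 (fun t => expR de * t) h3; rewrite /= !mulrDr in h6.
  by rewrite h2; lra.
have Hh_low x : 1 <= Hh x.
  rewrite /Hh -(prednK L0) big_ord_recl /w mul0r oppr0 expR0 mul1r {1}/zero_term /= expR0 mul1r.
  by apply: (le_trans (H1 x)); rewrite lerDl; apply: sumr_ge0 => k _; rewrite mulr_ge0 ?expR_ge0.
have [C' hC'] : exists C' : R, forall x, Hh x <= expR C'.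
  pose CC := \sum_(k < L) expR (k%:R * (`|psi I01_0| + A)) * (expR B * H y).
  have h x : Hh x <= CC.
    apply: ler_sum => k _; apply: (@le_trans _ _ (zero_term k H x)).
      by rewrite ler_piMl// -[leRHS]expR0 ler_expR oppr_le0 mulr_ge0// ltW.
    rewrite /zero_term; apply: ler_pM; rewrite ?expR_ge0 ?(le_trans ler01)// ler_expR.
    by have := birkhoff_bound alpha01 A0 hpsi (nseq k false) x; rewrite size_nseq ler_norml => /andP[].
  have CC0 : 0 < CC by apply: lt_le_trans (le_trans (Hh_low y) (h y)).
  by exists (ln CC) => x; rewrite lnK.
have iterS N x : expR (N%:R * de) * Hh x <= iter N transfer Hh x.
  elim: N x => [|N IH] x; first by rewrite mul0r expR0 mul1r.
  rewrite -natr1 mulrDl mul1r expRD -mulrA.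
  apply: le_trans (ler_wpM2l (expR_ge0 _) (Hh_step x)) _.
  apply: le_trans (transfer_le IH x); rewrite /transfer mulrDr.
  by rewrite le_eqVlt; apply/orP; left; apply/eqP; ring.
have [C hC] := growth _ (divr_gt0 de0 (ltr0Sn R 1)).
have main N : N%:R * (de / 2) <= C + C'.
  have h1 : expR (N%:R * de) <= expR C' * partition_sum alpha01 psi N I01_1.
    rewrite -[leLHS]mulr1; apply: le_trans (ler_wpM2l (expR_ge0 _) (Hh_low I01_1)) _.
    apply: le_trans (iterS N I01_1) _.
    have sc M x : iter M transfer (fun=> expR C') x = expR C' * iter M transfer one x.
      elim: M x => [|M IH] x /=; first by rewrite mulr1.
      by rewrite /transfer !IH; ring.
    by rewrite partition_sum_transfer -sc; apply: iter_transfer_le.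
  have := le_trans h1 (ler_wpM2l (expR_ge0 _) (hC N)).
  rewrite -expRD ler_expR add0r.
  have -> : N%:R * de = N%:R * (de / 2) + N%:R * (de / 2) by field.
  lra.
have de2 : 0 < de / 2 by exact: divr_gt0.
have := truncnS_gt ((C + C') / (de / 2)); rewrite ltr_pdivrMr// => h.
by have := lt_le_trans h (main _); rewrite ltxx.
Qed.

End potential.
End induced_real.

(** * Stability of the frozen phase *)

Section pressure_growth.
Context {R : realType} (alpha : R).
Hypothesis alpha01 : 0 < alpha <= 1.
Let alpha0 : 0 < alpha. Proof. by case/andP: alpha01. Qed.
Local Notation f := (intermittent alpha).
Implicit Types (x y : @I01 R) (phi psi : @I01 R -> R) (p : R).

Definition growth_le phi p := forall e : R, 0 < e -> exists C : R, forall N,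
  partition_sum alpha01 phi N I01_1 <= expR (C + N%:R * (p + e)).

Lemma birkhoff_subc phi (c : R) u x :
  birkhoff alpha01 (fun y => phi y - c) u x = birkhoff alpha01 phi u x - (size u)%:R * c.
Proof.
by elim: u => [|b u IH] /=; rewrite ?mul0r ?subr0// IH -natr1 mulrDl mul1r; ring.
Qed.

Lemma partition_sum_subc phi (c : R) N x :
  partition_sum alpha01 (fun y => phi y - c) N x = partition_sum alpha01 phi N x * expR (- (N%:R * c)).
Proof.
rewrite /partition_sum mulr_suml; apply: eq_big_seq => u; rewrite mem_words => /eqP su.
by rewrite birkhoff_subc su expRD.
Qed.

Lemma growth_subc phi (p c : R) : growth_le phi p <-> growth_le (fun y => phi y - c) (p - c).
Proof.
split=> h e e0; have [C hC] := h e e0; exists C => N.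
  rewrite partition_sum_subc; apply: le_trans (ler_wpM2r (expR_ge0 _) (hC N)) _.
  by rewrite -expRD ler_expR; lra.
have := hC N; rewrite partition_sum_subc -ler_pdivlMr ?expR_gt0// -expRN -expRD opprK => h1.
by apply: le_trans h1 _; rewrite ler_expR; lra.
Qed.

Lemma growth_shift phi psi (p c : R) : (forall x, psi x <= phi x + c) -> growth_le phi p -> growth_le psi (p + c).
Proof.
move=> hc h e e0; have [C hC] := h e e0; exists C => N.
have hb u x : birkhoff alpha01 psi u x <= birkhoff alpha01 phi u x + (size u)%:R * c.
  elim: u => [|b u IH] /=; first by rewrite mul0r addr0.
  by have := hc (word_map alpha01 (b :: u) x); move: IH; rewrite -natr1 mulrDl mul1r /=; lra.
apply: (@le_trans _ _ (partition_sum alpha01 phi N I01_1 * expR (N%:R * c))).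
  rewrite /partition_sum mulr_suml !big_seq; apply: ler_sum => u; rewrite mem_words => /eqP su.
  by rewrite -expRD ler_expR -su.
apply: le_trans (ler_wpM2r (expR_ge0 _) (hC N)) _.
by rewrite -expRD ler_expR; lra.
Qed.

Variables (phi : @I01 R -> R) (A : R) (phi0 : R -> R).
Hypothesis A0 : 0 <= A.
Hypothesis hphi : rholder alpha A phi.
Hypothesis phi0E : forall X : @I01 R, phi0 (val X) = phi X.
Local Notation P := (pressure f phi0).

Lemma growth_trivial : growth_le phi (`|phi I01_0| + A + 1).
Proof.
move=> e e0; exists 0 => N; rewrite add0r.
apply: (@le_trans _ _ (expR (N%:R * (`|phi I01_0| + A + 1)))); last first.
  by rewrite ler_expR ler_wpM2l// lerDl ltW.
elim: N I01_1 => [|N IH] x; first by rewrite /partition_sum sum_words0 mul0r.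
rewrite partition_sumS -natr1 mulrDl mul1r expRD [leRHS]mulrC.
set B := `|_| + A.
have hb y : expR (phi y) <= expR B.
  by rewrite ler_expR; have := rholder_bound alpha01 A0 hphi y; rewrite ler_norml => /andP[].
have h1 b : expR (phi (branch alpha01 b x)) * partition_sum alpha01 phi N (branch alpha01 b x) <=
    expR B * expR (N%:R * (B + 1)).
  by apply: ler_pM => //; exact/ltW/partition_sum_gt0.
apply: (@le_trans _ _ (2 * (expR B * expR (N%:R * (B + 1))))).
  by have := h1 false; have := h1 true; lra.
have h2 : 2 * expR B <= expR (B + 1).
  rewrite (expRD B 1) [leLHS]mulrC; apply: ler_wpM2l; first exact: expR_ge0.
  by have := expR_ge1Dx (1 : R); lra.
by rewrite mulrA; apply: ler_wpM2r => //; exact: expR_ge0.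
Qed.

Lemma pressure_fin : pressure_ereal f phi0 = P%:E.
Proof.
rewrite /pressure fineK//; rewrite fin_numE; apply/andP; split.
  by have := block_pressure_le alpha01 0 A0 hphi phi0E; case: pressure_ereal.
have := pressure_ereal_le A0 hphi phi0E growth_trivial; by case: pressure_ereal.
Qed.

Lemma pressure_le_growth p : growth_le phi p -> P <= p.
Proof. by move=> h; have := pressure_ereal_le A0 hphi phi0E h; rewrite pressure_fin lee_fin. Qed.

Lemma pressure_growth : growth_le phi P.
Proof.
move=> e e0; have e1 : 0 < e / (A + 1) by rewrite divr_gt0// ltr_wpDl.
have [C hC] := orbit_sum_sublinear alpha01 e1.
exists (A * C + `|P| + `|A * C|) => -[|N].
  rewrite /partition_sum sum_words0 /= expR0 -[leLHS]expR0 ler_expR mul0r addr0.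
  by have := ler_norm (- (A * C)); rewrite normrN; have := normr_ge0 P; lra.
have := block_pressure_le alpha01 N A0 hphi phi0E; rewrite pressure_fin lee_fin /block_pressure.
rewrite ler_pdivrMr ?ltr0n// => h.
rewrite -[leLHS](lnK (partition_sum_gt0 alpha01 phi N.+1 I01_1 : _ \is Num.pos)) ler_expR.
have h1 : A * orbit_sum alpha N.+1 <= A * (e / (A + 1) * N.+1%:R + C) by rewrite ler_wpM2l.
have h2 : A * (e / (A + 1) * N.+1%:R) <= N.+1%:R * e.
  rewrite mulrA mulrC ler_wpM2l// mulrA ler_pdivrMr ?ltr_wpDl//.
  by rewrite mulrDr mulr1 mulrC lerDl ltW.
have := normr_ge0 P; have := normr_ge0 (A * C).
by move: h h1 h2; rewrite [A * (_ + C)]mulrDr [N.+1%:R * (P + e)]mulrDr [P * _]mulrC; lra.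
Qed.

Lemma pressure_ge_fixpoint : phi I01_0 <= P.
Proof.
suff h (e : R) : 0 < e -> phi I01_0 <= P + e by apply/ler_addgt0Pr.
move=> e0; have e2 : 0 < e / 4 by rewrite divr_gt0.
have e1 : 0 < e / 4 / (A + 1) by rewrite divr_gt0// ltr_wpDl.
have [C hC] := orbit_sum_sublinear alpha01 e1.
have [C' hC'] := pressure_growth e2.
have main N : N%:R * (phi I01_0) <= C' + A * C + N%:R * (P + e / 2).
  have := birkhoff_zeros_near alpha01 A0 hphi N I01_1; rewrite ler_norml => /andP[h _].
  have h1 : A * orbit_sum alpha N <= A * (e / 4 / (A + 1) * N%:R + C) by rewrite ler_wpM2l.
  have h2 : A * (e / 4 / (A + 1) * N%:R) <= N%:R * (e / 4).
    rewrite mulrA mulrC ler_wpM2l// mulrA ler_pdivrMr ?ltr_wpDl//.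
    by rewrite mulrDr mulr1 mulrC lerDl ltW.
  have := partition_sum_ge_word alpha01 phi (nseq N false) I01_1; rewrite size_nseq => h3.
  have := le_trans h3 (hC' N); rewrite ler_expR.
  by move: h h1 h2; rewrite [A * (_ + C)]mulrDr !mulrDr; lra.
have := main (Num.truncn ((C' + A * C) / (e / 2))).+1; set n := (Num.truncn _).+1.
have n0 : 0 < n%:R :> R by rewrite ltr0n.
have : C' + A * C < n%:R * (e / 2).
  by rewrite -ltr_pdivrMr ?divr_gt0//; exact: truncnS_gt.
move=> h1 h2; have : n%:R * phi I01_0 <= n%:R * (P + e).
  by move: h1 h2; rewrite !mulrDr; lra.
by rewrite ler_pM2l.
Qed.

End pressure_growth.

Section phase_stability.
Context {R : realType} (alpha : R).
Hypothesis alpha01 : 0 < alpha <= 1.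
Let alpha0 : 0 < alpha. Proof. by case/andP: alpha01. Qed.
Local Notation wm := (word_map alpha01).
Local Notation br := (branch alpha01).
Local Notation exc := (excursion alpha01).
Local Notation xs := (zero_orbit alpha).
Implicit Types (x y : @I01 R).
Local Notation one := (fun _ : @I01 R => 1 : R).
Variables (psi : @I01 R -> R) (A : R).
Hypothesis A0 : 0 <= A.
Hypothesis hpsi : rholder alpha A psi.
Hypothesis psi_0 : psi I01_0 = 0.

(* A word of complete excursions is encoded by their lengths, outermost last
   applied; [exc_sum w x] is the Birkhoff sum along it. *)
Fixpoint exc_sum (phi : @I01 R -> R) (w : seq nat) x : R :=
  if w is k :: w' then \sum_(j < k.+1) phi (exc j x) + exc_sum phi w' (exc k x) else 0.

Fixpoint exc_lists (L n : nat) : seq (seq nat) :=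
  if n is n'.+1 then [seq k :: w | k <- iota 0 L, w <- exc_lists L n'] else [:: [::]].

Lemma iter_induced_expand phi L n x : iter n (induced alpha01 phi L) one x =
  \sum_(w <- exc_lists L n) expR (exc_sum phi w x).
Proof.
elim: n x => [|n IH] x; first by rewrite big_seq1 expR0.
rewrite /= big_allpairs_dep.
have <- : index_iota 0 L = iota 0 L by rewrite /index_iota subn0.
rewrite big_mkord /induced; apply: eq_bigr => k _.
rewrite /inner_term IH mulr_sumr; apply: eq_bigr => w _ /=.
by rewrite expRD birkhoff_excursion.
Qed.

Fixpoint gain (c : R) (w : seq nat) : R :=
  if w is k :: w' then (1 + c * k.+1%:R) * gain c w' else 1.

Lemma exc_range_alpha j x : val (exc j x) `^ alpha <= 4 / alpha / j.+1%:R.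
Proof.
have /andP[_ h] := excursion_range alpha01 j x.
apply: le_trans (zero_orbit_pow alpha01 j).
by rewrite powR_le ?I01_ge0// ltW.
Qed.

Lemma psi_exc j x : `|psi (exc j x)| <= A * (4 / alpha / j.+1%:R).
Proof.
have := hpsi (exc j x) I01_0; rewrite psi_0 subr0 => h; apply: le_trans h _.
rewrite ler_wpM2l// /dist subr0 ger0_norm ?I01_ge0//; exact: exc_range_alpha.
Qed.

Lemma harmonic_double k k' : (k < k' <= k.*2.+1)%N ->
  \sum_(k.+1 <= j < k'.+1) (j.+1%:R : R)^-1 <= 1.
Proof.
move=> /andP[h1 h2]; apply: (@le_trans _ _ (\sum_(k.+1 <= j < k'.+1) (k.+1%:R : R)^-1)).
  apply: ler_sum_nat => j /andP[hj _]; rewrite lef_pV2 ?posrE ?ltr0n// ler_nat; lia.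
rewrite big_const_nat iter_addr_0 -[X in X <= _]mulr_natr mulrC ler_pdivrMr ?ltr0n// mul1r ler_nat; lia.
Qed.

Variable beta : R.
Hypothesis beta01 : 0 < beta < 1.
Let bpsi x := beta * psi x.
Let hb : rholder alpha (beta * A) bpsi.
Proof.
have /andP[b0 _] := beta01.
by move=> x y; rewrite /bpsi -mulrBr normrM gtr0_norm// -mulrA ler_pM2l.
Qed.
Let bA0 : 0 <= beta * A. Proof. by have /andP[b0 _] := beta01; rewrite mulr_ge0// ltW. Qed.
Let B := cone_rate alpha (beta * A).
Let c := expR (- (beta * A * (4 / alpha)) - B).

Lemma exc_gain w L x : all (fun k => (k.*2.+1 < L)%N) w ->
  expR (exc_sum bpsi w x) * gain c w <= iter (size w) (induced alpha01 bpsi L) one x.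
Proof.
elim: w x => [|k w IH] x /=; first by rewrite expR0 mulr1.
move=> /andP[kL hw]; set u := iter (size w) _ _.
have u_cone : rcone alpha B u by exact: iter_induced_cone.
have uk : expR (exc_sum bpsi w (exc k x)) * gain c w <= u (exc k x) by exact: IH.
pose W j := expR (\sum_(i < j.+1) bpsi (exc i x)).
have W0 j : 0 < W j by exact: expR_gt0.
have termE j : inner_term alpha01 bpsi j u x = W j * u (exc j x).
  by rewrite /inner_term birkhoff_excursion.
have u0 y : 0 <= u y by have [] := u_cone y y.
have alt j : (k < j <= k.*2.+1)%N -> c * (W k * u (exc k x)) <= W j * u (exc j x).
  move=> hj; have /andP[kj j2] := hj.
  have hW : expR (- (beta * A * (4 / alpha))) * W k <= W j.
    rewrite /W -expRD ler_expR -!(big_mkord xpredT (fun i => bpsi (exc i x))).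
    rewrite (@big_cat_nat _ _ _ k.+1 0 j.+1)//=; last by lia.
    rewrite [leLHS]addrC lerD2l lerNl -sumrN.
    apply: (@le_trans _ _ (\sum_(k.+1 <= i < j.+1) beta * A * (4 / alpha) * (i.+1%:R)^-1)).
      apply: ler_sum_nat => i _; rewrite -!mulrA -mulrN ler_wpM2l//; first by have /andP[/ltW] := beta01.
      apply: le_trans (ler_norm _) _; rewrite normrN.
      by apply: le_trans (psi_exc i x) _; rewrite !mulrA.
    by rewrite -mulr_sumr ler_piMr ?harmonic_double// mulr_ge0// divr_ge0// ltW.
  have hu : expR (- B) * u (exc k x) <= u (exc j x).
    rewrite expRN mulrC ler_pdivrMr ?expR_gt0// mulrC.
    have [_ h] := u_cone (exc k x) (exc j x); apply: le_trans h _.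
    rewrite ler_wpM2r// ler_expR ler_piMr ?eta_dist_le1//; exact: cone_rate_ge0.
  rewrite /c expRD mulrACA; apply: ler_pM => //; rewrite mulr_ge0 ?expR_ge0//; exact: ltW.
have -> : induced alpha01 bpsi L u x = \sum_(j < L) W j * u (exc j x).
  by apply: eq_bigr => j _; exact: termE.
rewrite -(big_mkord xpredT (fun j => W j * u (exc j x))).
rewrite (@big_cat_nat _ _ _ k 0 L)//=; last by lia.
rewrite (@big_ltn _ _ _ k L); last by lia.
rewrite (@big_cat_nat _ _ _ k.*2.+2 k.+1 L)//=; try lia.
have s1 : 0 <= \sum_(0 <= i < k) W i * u (exc i x) by apply: sumr_ge0 => i _; rewrite mulr_ge0// ltW.
have s3 : 0 <= \sum_(k.*2.+2 <= i < L) W i * u (exc i x) by apply: sumr_ge0 => i _; rewrite mulr_ge0// ltW.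
have s2 : c * k.+1%:R * (W k * u (exc k x)) <= \sum_(k.+1 <= i < k.*2.+2) W i * u (exc i x).
  apply: (@le_trans _ _ (\sum_(k.+1 <= i < k.*2.+2) c * (W k * u (exc k x)))); last first.
    by apply: ler_sum_nat => i hi; apply: alt.
  rewrite big_const_nat iter_addr_0 -[leRHS]mulr_natr (_ : k.*2.+2 - k.+1 = k.+1)%N; last by lia.
  by rewrite mulrAC.
apply: (@le_trans _ _ ((1 + c * k.+1%:R) * (W k * u (exc k x)))).
  rewrite expRD -/(W k) (_ : _ * _ * _ = (1 + c * k.+1%:R) * (W k * (expR (exc_sum bpsi w (exc k x)) * gain c w))); last by ring.
  rewrite ler_wpM2l ?addr_ge0 ?mulr_ge0 ?expR_ge0// ler_wpM2l//; exact: ltW.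
by move: s1 s2 s3; lra.
Qed.

Lemma ln_gain w : ln (gain c w) = \sum_(k <- w) ln (1 + c * k.+1%:R) /\ 0 < gain c w.
Proof.
elim: w => [|k w [E g0]] /=; first by rewrite ln1 big_nil.
have h : 0 < 1 + c * k.+1%:R by rewrite ltr_wpDr// mulr_ge0// expR_ge0.
by rewrite big_cons lnM// E mulr_gt0.
Qed.

Hypothesis growth : growth_le alpha01 bpsi 0.

Lemma exc_sum_gain w x : exc_sum bpsi w x + ln (gain c w) <= B.
Proof.
pose L := (\max_(k <- w) k.*2.+1).+1.
have hw : all (fun k => (k.*2.+1 < L)%N) w.
  by apply/allP => k kw; rewrite /L ltnS; exact: leq_bigmax_seq.
have h := le_trans (exc_gain x hw) (growth_bounded_induced bA0 hb growth L (size w) x).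
have [_ g0] := ln_gain w.
by rewrite -ler_expR expRD lnK.
Qed.

Lemma exc_alpha_gain : exists2 D : R, 0 < D & forall k x,
  \sum_(j < k.+1) val (exc j x) `^ alpha <= D * ln (1 + c * k.+1%:R).
Proof.
have c0 : 0 < c by exact: expR_gt0.
have l0 : 0 < ln (1 + c) by rewrite ln_gt0// ltrDl.
have c1 : c <= 1.
  rewrite -[leRHS]expR0 ler_expR.
  have := cone_rate_ge0 alpha01 bA0; rewrite -/B.
  have : 0 <= beta * A * (4 / alpha) by rewrite mulr_ge0// divr_ge0// ltW.
  by lra.
pose D0 := 4 / alpha; have D00 : 0 < D0 by rewrite divr_gt0.
(* 1/(j+1) is at most (1/c)(1+c) (ln (1+c(j+1)) - ln (1+cj)) *)
pose E := (1 + c) / c; have E0 : 0 < E by rewrite divr_gt0// addr_gt0.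
exists (D0 * E); first by rewrite mulr_gt0.
move=> k x; elim: k => [|k IH].
  rewrite big_ord_recl big_ord0 addr0; apply: le_trans (exc_range_alpha 0 x) _.
  rewrite divr1 -/D0 -mulrA ler_peMr// ?(ltW D00)// mulr1 /E.
  have : c / (1 + c) <= ln (1 + c).
    have := le_ln1Dx (x := - (c / (1 + c))) _.
    rewrite ltrNl opprK ltr_pdivrMr ?addr_gt0// mul1r ltrDr => /(_ ltr01).
    have -> : 1 - c / (1 + c) = (1 + c)^-1 by field; rewrite gt_eqF// addr_gt0.
    by rewrite lnV ?posrE ?addr_gt0//; lra.
  by rewrite ler_pdivrMr ?addr_gt0// => h; rewrite mulrAC ler_pdivlMr// mul1r mulrC.
rewrite big_ord_recr; apply: le_trans (lerD IH (exc_range_alpha k.+1 x)) _.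
rewrite -/D0 -lerBrDl -mulrBr.
have p1 : 0 < 1 + c * k.+1%:R by rewrite ltr_wpDr// mulr_ge0// ltW.
have p2 : 0 < 1 + c * k.+2%:R by rewrite ltr_wpDr// mulr_ge0// ltW.
have h : c / (1 + c * k.+2%:R) <= ln (1 + c * k.+2%:R) - ln (1 + c * k.+1%:R).
  rewrite -ln_div//.
  have := le_ln1Dx (x := - (c / (1 + c * k.+2%:R))) _.
  rewrite ltrNl opprK ltr_pdivrMr// mul1r.
  have hh : c < 1 + c * k.+2%:R by rewrite -natr1 mulrDr mulr1 addrA ltrDr.
  move=> /(_ hh).
  have -> : 1 - c / (1 + c * k.+2%:R) = (1 + c * k.+1%:R) / (1 + c * k.+2%:R).
    have e2 : (k.+2%:R : R) = k.+1%:R + 1 by rewrite natr1.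
    rewrite -{1}(divff (lt0r_neq0 p2)) -mulrBl; congr (_ / _).
    by rewrite e2; ring.
  by rewrite !ln_div ?posrE//; lra.
rewrite -[leRHS]mulrA; apply: ler_wpM2l; first exact: ltW.
apply: le_trans (ler_wpM2l (ltW E0) h); rewrite /E mulrA divfK ?gt_eqF//.
rewrite ler_pdivlMr// mulrC ler_pdivrMr ?ltr0n//.
have : (1 : R) <= k.+2%:R by rewrite ler1n.
by lra.
Qed.

Lemma growth_stable : exists2 del : R, 0 < del & forall (psi' : @I01 R -> R) (A' : R),
  0 <= A' -> rholder alpha A' psi' -> psi' I01_0 = 0 ->
  (forall x, psi' x <= psi x + del * val x `^ alpha) -> growth_le alpha01 psi' 0.
Proof.
have [D D0 hD] := exc_alpha_gain.
have /andP[b0 b1] := beta01.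
pose del := (1 - beta) / (beta * D).
have del0 : 0 < del by rewrite divr_gt0 ?subr_gt0 ?mulr_gt0.
exists del => // psi' A' A'0 h' psi'0 hle.
have sumle w x : exc_sum psi' w x <= exc_sum psi w x + del * D * ln (gain c w).
  have [E _] := ln_gain w; rewrite E {E}; elim: w x => [|k w IH] x /=.
    by rewrite big_nil mulr0 addr0.
  rewrite big_cons mulrDr.
  have h1 : \sum_(j < k.+1) psi' (exc j x) <= \sum_(j < k.+1) psi (exc j x) + del * D * ln (1 + c * k.+1%:R).
    apply: (@le_trans _ _ (\sum_(j < k.+1) (psi (exc j x) + del * val (exc j x) `^ alpha))).
      by apply: ler_sum => j _.
    rewrite big_split /= lerD2l -mulr_sumr -mulrA; apply: ler_wpM2l; [exact: ltW|exact: hD].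
  by move: h1 (IH (exc k x)); lra.
have bE w x : exc_sum bpsi w x = beta * exc_sum psi w x.
  by elim: w x => [|k w IH] x /=; rewrite ?mulr0// IH mulrDr mulr_sumr.
have key w x : exc_sum psi' w x <= exc_sum bpsi w x + (1 - beta) / beta * B.
  have h1 := exc_sum_gain w x; have h2 := sumle w x.
  have dD : del * D = (1 - beta) / beta by rewrite /del; field; rewrite !gt_eqF.
  have q0 : 0 <= (1 - beta) / beta by rewrite divr_ge0 ?subr_ge0 ?(ltW b0) ?(ltW b1).
  have h3 := ler_wpM2l q0 h1.
  have h4 : (1 - beta) / beta * exc_sum bpsi w x = (1 - beta) * exc_sum psi w x.
    by rewrite bE mulrA divfK ?gt_eqF.
  move: h2 h3; rewrite dD mulrDr h4 bE; lra.
pose K := (1 - beta) / beta * B.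
apply: (@bounded_induced_growth _ _ alpha01 psi' A' A'0 h' (expR (K + B))) => [|L n x].
  by rewrite psi'0.
apply: le_trans (_ : _ <= expR K * iter n (induced alpha01 bpsi L) one x) _.
  rewrite !iter_induced_expand mulr_sumr; apply: ler_sum => t _.
  by rewrite -expRD ler_expR addrC; exact: key.
rewrite expRD ler_wpM2l ?expR_ge0//; exact: growth_bounded_induced bA0 hb growth L n x.
Qed.

End phase_stability.

(** * Perturbation of bounded operators *)

Ltac nonneg := repeat first [by [] | apply: addr_ge0 | apply: mulr_ge0 | apply: exprn_ge0
  | apply: expR_ge0 | apply: cn_ge0 | apply: ler01 | apply: normr_ge0].

Section bounded_operators.
Context {R : realType}.
Local Notation K := R[i].
Variables (V : lmodType K) (nb : R -> V -> Prop).
Implicit Types (T S : V -> V) (u v w : V) (c C e th : R).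

(* [nb C v] says that the norm of [v] is at most [C]. *)
Definition norm_bound_spec := [/\
  [/\ forall C u, nb C u -> 0 <= C, forall C C' u, nb C u -> C <= C' -> nb C' u &
      forall C C' u v, nb C u -> nb C' v -> nb (C + C') (u + v)],
  forall C (a : K) u, nb C u -> nb (cn a * C) (a *: u),
  forall u, exists C, nb C u,
  forall u, (forall e, 0 < e -> nb e u) -> u = 0 &
  forall (v : nat -> V) C th, 0 <= th < 1 -> (forall k, nb (C * th ^+ k) (v k)) ->
    exists s, forall L, nb (C * th ^+ L / (1 - th)) (s - \sum_(k < L) v k)].
Hypothesis nbP : norm_bound_spec.

Let nb_ge0 C u : nb C u -> 0 <= C. Proof. by case: nbP => -[h _ _] _ _ _ _; exact: h. Qed.
Lemma nb_le C C' u : nb C u -> C <= C' -> nb C' u.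
Proof. by case: nbP => -[_ h _] _ _ _ _; exact: h. Qed.
Lemma nbD C C' u v : nb C u -> nb C' v -> nb (C + C') (u + v).
Proof. by case: nbP => -[_ _ h] _ _ _ _; exact: h. Qed.
Lemma nbZ C (a : K) u : nb C u -> nb (cn a * C) (a *: u).
Proof. by case: nbP => _ h _ _ _; exact: h. Qed.
Lemma nb_ex u : exists C, nb C u. Proof. by case: nbP => _ _ h _ _; exact: h. Qed.
Lemma nb_eq0 u : (forall e, 0 < e -> nb e u) -> u = 0.
Proof. by case: nbP => _ _ _ h _; exact: h. Qed.
Lemma nbN C u : nb C u -> nb C (- u).
Proof. by move=> h; rewrite -scaleN1r -[C]mul1r -[1](cn1 (R := R)) -cnN; exact: nbZ. Qed.
Lemma nbB C C' u v : nb C u -> nb C' v -> nb (C + C') (u - v).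
Proof. by move=> h h'; apply: nbD => //; exact: nbN. Qed.
Lemma nb0 : nb 0 0.
Proof. by have [C h] := nb_ex 0; rewrite -(scale0r (0 : V)) -[X in nb X _](mul0r C) -(cn0 (R := R)); exact: nbZ. Qed.

Lemma geometric_small c th e : 0 <= th < 1 -> 0 < e -> exists L0 : nat, forall L, (L0 <= L)%N -> c * th ^+ L <= e.
Proof.
move=> /andP[t0 t1] e0.
have h : `|th| < 1 by rewrite ger0_norm.
have e1 : 0 < e / (`|c| + 1) by rewrite divr_gt0// ltr_wpDl.
have /cvgrPdist_lt/(_ _ e1)[L0 _ hL] := cvg_expr h.
exists L0 => L LL; have := hL L LL; rewrite /= sub0r normrN ger0_norm ?exprn_ge0// => hh.
apply: (@le_trans _ _ (`|c| * th ^+ L)); first by rewrite ler_wpM2r ?exprn_ge0// ler_norm.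
apply: le_trans (ler_wpM2l (normr_ge0 c) (ltW hh)) _.
by rewrite mulrA ler_pdivrMr ?ltr_wpDl// mulrDr mulr1 mulrC lerDl ltW.
Qed.

Lemma nb_geometric0 u c th : 0 <= th < 1 -> (forall L, nb (c * th ^+ L) u) -> u = 0.
Proof.
move=> t01 h; apply: nb_eq0 => e e0; have [L0 hL] := geometric_small c t01 e0.
by apply: nb_le (h L0) _; exact: hL.
Qed.

Definition lin T := forall (a : K) u v, T (a *: u + v) = a *: T u + T v.
Definition bop c T := [/\ lin T, 0 <= c & forall C u, nb C u -> nb (c * C) (T u)].

Lemma linD T : lin T -> {morph T : u v / u + v}.
Proof. by move=> h u v; have := h 1 u v; rewrite !scale1r. Qed.
Lemma lin0 T : lin T -> T 0 = 0.
Proof. by move=> h; apply: (addrI (T 0)); rewrite -linD// !addr0. Qed.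
Lemma linZ T a u : lin T -> T (a *: u) = a *: T u.
Proof. by move=> h; have := h a u 0; rewrite !addr0 lin0// addr0. Qed.
Lemma linN T u : lin T -> T (- u) = - T u.
Proof. by move=> h; rewrite -scaleN1r linZ// scaleN1r. Qed.
Lemma linB T u v : lin T -> T (u - v) = T u - T v.
Proof. by move=> h; rewrite linD// linN. Qed.
Lemma lin_sum T n (F : nat -> V) : lin T -> T (\sum_(k < n) F k) = \sum_(k < n) T (F k).
Proof. by move=> h; elim: n => [|n IH]; rewrite ?big_ord0 ?lin0// !big_ord_recr linD// IH. Qed.

Lemma bop_lin c T : bop c T -> lin T. Proof. by case. Qed.
Lemma bop_ge0 c T : bop c T -> 0 <= c. Proof. by case. Qed.
Lemma bop_nb c T C u : bop c T -> nb C u -> nb (c * C) (T u). Proof. by case=> _ _; exact. Qed.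

Lemma bop_le c c' T : bop c T -> c <= c' -> bop c' T.
Proof.
move=> [h1 h2 h3] cc; split=> //; first exact: le_trans cc.
by move=> C u h; apply: nb_le (h3 _ _ h) _; rewrite ler_wpM2r//; exact: nb_ge0 h.
Qed.
Lemma bop_id : bop 1 (fun u => u).
Proof. by split=> // C u; rewrite mul1r. Qed.
Lemma bop_comp c c' T S : bop c T -> bop c' S -> bop (c * c') (fun u => T (S u)).
Proof.
move=> [h1 h2 h3] [h1' h2' h3']; split; [by move=> a u v; rewrite h1' h1|exact: mulr_ge0|].
by move=> C u h; rewrite -mulrA; apply: h3; exact: h3'.
Qed.
Lemma bop_add c c' T S : bop c T -> bop c' S -> bop (c + c') (fun u => T u + S u).
Proof.
move=> [h1 h2 h3] [h1' h2' h3']; split; [|exact: addr_ge0|].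
  by move=> a u v; rewrite h1' h1 scalerDr addrACA.
by move=> C u h; rewrite mulrDl; apply: nbD; [exact: h3|exact: h3'].
Qed.
Lemma bop_sum n (F : nat -> V -> V) (C : nat -> R) : (forall k, bop (C k) (F k)) ->
  bop (\sum_(k < n) C k) (fun u => \sum_(k < n) F k u).
Proof.
move=> h; elim: n => [|n IH].
  split; [by move=> a u v; rewrite !big_ord0 scaler0 addr0|by rewrite big_ord0|].
  by move=> C' u _; rewrite !big_ord0 mul0r; exact: nb0.
rewrite big_ord_recr (_ : (fun u => _) = (fun u => \sum_(k < n) F k u + F n u)); first exact: bop_add.
by apply/funext => u; rewrite big_ord_recr.
Qed.
Lemma bop_iter c T n : bop c T -> bop (c ^+ n) (iter n T).
Proof.
move=> h; elim: n => [|n IH]; first by rewrite expr0; exact: bop_id.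
by rewrite exprS; exact: bop_comp.
Qed.

Lemma geometric_operator_sum (T : nat -> V -> V) c th : 0 <= th < 1 ->
  (forall k, bop (c * th ^+ k) (T k)) ->
  exists S, [/\ bop (c / (1 - th)) S &
    forall L, bop (c * th ^+ L / (1 - th)) (fun u => S u - \sum_(k < L) T k u)].
Proof.
move=> t01 hT; have /andP[t0 t1] := t01.
have d0 : 0 < 1 - th by rewrite subr_gt0.
have c0 : 0 <= c by have := bop_ge0 (hT 0%N); rewrite expr0 mulr1.
have ex u : exists s, exists2 C, 0 <= C & forall L, nb (C * th ^+ L) (s - \sum_(k < L) T k u).
  have [C hC] := nb_ex u; have C0 := nb_ge0 hC.
  have [_ _ _ _ compl] := nbP.
  have [k|s hs] := compl (fun k => T k u) (c * C) th t01.
    by rewrite mulrAC; exact: bop_nb.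
  exists s, (c * C / (1 - th)); first by rewrite divr_ge0 ?mulr_ge0// ltW.
  by move=> L; rewrite mulrAC; exact: hs.
have [S hS] := choice ex.
have uniq u s C : (forall L, nb (C * th ^+ L) (s - \sum_(k < L) T k u)) -> s = S u.
  move=> hs; have [C' C'0 hC'] := hS u; apply/eqP; rewrite -subr_eq0; apply/eqP.
  apply: (@nb_geometric0 _ (C + C') th t01) => L; rewrite mulrDl.
  rewrite (_ : s - S u = (s - \sum_(k < L) T k u) - (S u - \sum_(k < L) T k u)); first exact: nbB.
  by rewrite opprB addrA subrK.
have linS : lin S.
  move=> a u v; apply/esym; have [C C0 hC] := hS u; have [C' C'0 hC'] := hS v.
  apply: (uniq _ _ (cn a * C + C')) => L.
  rewrite (_ : _ - _ = a *: (S u - \sum_(k < L) T k u) + (S v - \sum_(k < L) T k v)).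
    by rewrite mulrDl -mulrA; apply: nbD => //; exact: nbZ.
  rewrite scalerBr -addrA [RHS]addrA; rewrite (eq_bigr (fun k : 'I_L => a *: T k u + T k v)) => [|k _].
    by rewrite big_split /= -scaler_sumr opprD !addrA; congr (_ - _); rewrite addrAC.
  by rewrite (bop_lin (hT k)).
have app L C u : nb C u -> nb (c * th ^+ L / (1 - th) * C) (S u - \sum_(k < L) T k u).
  move=> hC; have C0 := nb_ge0 hC; have [_ _ _ _ compl] := nbP.
  have [k|s hs] := compl (fun k => T k u) (c * C) th t01.
    by rewrite mulrAC; exact: bop_nb.
  have <- : s = S u.
    by apply: (uniq _ _ (c * C / (1 - th))) => L'; rewrite mulrAC; exact: hs.
  by rewrite (_ : _ * C = c * C * th ^+ L / (1 - th)); [exact: hs|ring].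
exists S; split.
  split=> // [|C u h]; first by rewrite divr_ge0// ltW.
  by have := app 0%N C u h; rewrite big_ord0 subr0 expr0 mulr1.
move=> L; split; [|by rewrite divr_ge0 ?(ltW d0)// mulr_ge0// exprn_ge0|exact: app].
have hsum := bop_lin (@bop_sum L T (fun k => c * th ^+ k) hT).
by move=> a u v; rewrite linS hsum scalerBr opprD addrACA.
Qed.

Lemma neumann T c th : 0 <= th < 1 -> lin T -> (forall n, bop (c * th ^+ n) (iter n T)) ->
  exists S, [/\ bop (c / (1 - th)) S, forall u, S u - T (S u) = u, forall u, S u - S (T u) = u &
    forall L, bop (c * th ^+ L / (1 - th)) (fun u => S u - \sum_(k < L) iter k T u)].
Proof.
move=> t01 linT hT; have /andP[t0 t1] := t01.
have [S [hS happ]] := geometric_operator_sum t01 hT.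
have d0 : 0 < 1 - th by rewrite subr_gt0.
have bT : bop (c * th) T by have := hT 1%N; rewrite expr1.
have c0 : 0 <= c by have := bop_ge0 (hT 0%N); rewrite expr0 mulr1.
exists S; split=> // u.
- have [C hC] := nb_ex u; have C0 := nb_ge0 hC.
  apply/eqP; rewrite -subr_eq0; apply/eqP.
  apply: (@nb_geometric0 _ ((c * th) * (c / (1 - th) * C) + c / (1 - th) * C) th t01) => L.
  have E : S u - T (S u) - u = (S u - \sum_(k < L.+1) iter k T u) - T (S u - \sum_(k < L) iter k T u).
    rewrite (linB _ _ linT) (lin_sum L (fun k => iter k T u) linT) big_ord_recl /=.
    rewrite opprB opprD addrA; rewrite (eq_bigr (fun k : 'I_L => T (iter k T u)))//.
    by rewrite !addrA subrK addrAC.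
  rewrite E mulrDl addrC; apply: nbB.
    apply: nb_le (bop_nb (happ L.+1) hC) _.
    rewrite (_ : _ * C = c / (1 - th) * C * th ^+ L * th); last by rewrite exprS; ring.
    by rewrite ler_piMr ?(ltW t1)// !mulr_ge0 ?exprn_ge0 ?invr_ge0 ?(ltW d0).
  apply: nb_le (bop_nb bT (bop_nb (happ L) hC)) _.
  by rewrite le_eqVlt; apply/orP; left; apply/eqP; ring.
- have [C hC] := nb_ex u; have C0 := nb_ge0 hC.
  apply/eqP; rewrite -subr_eq0; apply/eqP.
  apply: (@nb_geometric0 _ (c / (1 - th) * C + c / (1 - th) * (c * th * C)) th t01) => L.
  have E : S u - S (T u) - u = (S u - \sum_(k < L.+1) iter k T u) - (S (T u) - \sum_(k < L) iter k T (T u)).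
    rewrite big_ord_recl /= (eq_bigr (fun k : 'I_L => iter k T (T u))) => [|k _]; last by rewrite -iterSr.
    by rewrite opprB opprD !addrA subrK addrAC.
  rewrite E mulrDl; apply: nbB.
    apply: nb_le (bop_nb (happ L.+1) hC) _.
    rewrite (_ : _ * C = c / (1 - th) * C * th ^+ L * th); last by rewrite exprS; ring.
    by rewrite ler_piMr ?(ltW t1)// !mulr_ge0 ?exprn_ge0 ?invr_ge0 ?(ltW d0).
  apply: nb_le (bop_nb (happ L) (bop_nb bT hC)) _.
  by rewrite le_eqVlt; apply/orP; left; apply/eqP; ring.
Qed.

Definition resolvent (Q S : V -> V) := (forall u, S u - Q (S u) = u) /\ (forall u, S u - S (Q u) = u).

Lemma resolvent_uniq (Q S S' : V -> V) : lin S -> resolvent Q S -> resolvent Q S' -> S =1 S'.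
Proof.
by move=> lS [_ h2] [h1 _] u; rewrite -{1}(h1 u) linB.
Qed.

Lemma resolvent_perturb (Q0 Q S0 : V -> V) r e : lin Q0 -> bop r S0 -> resolvent Q0 S0 ->
  bop e (fun u => Q u - Q0 u) -> e * r <= 1 / 2 ->
  exists2 S, bop (2 * r) S & resolvent Q S.
Proof.
move=> lQ hS [h1 h2] hE er; pose E u := Q u - Q0 u.
pose T u := E (S0 u).
have hT : bop (e * r) T by exact: bop_comp.
have r0 := bop_ge0 hS.
have t01 : 0 <= (1 / 2 : R) < 1 by lra.
have itT n : bop (1 * (1 / 2) ^+ n) (iter n T).
  rewrite mul1r; apply: bop_le (bop_iter n hT) _; apply: lerXn2r => //; rewrite nnegrE; [exact: bop_ge0 hT|lra].
have [S1 [hS1 k1 k2 _]] := neumann t01 (bop_lin hT) itT.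
exists (fun u => S0 (S1 u)).
  by apply: bop_le (bop_comp hS hS1) _; rewrite (_ : 1 / (1 - 1 / 2) = 2 :> R) 1?mulrC//; field.
have lE : lin E := bop_lin hE.
have QE u : Q u = Q0 u + E u by rewrite /E addrC subrK.
split=> u.
  rewrite QE opprD addrA h1; exact: k1.
have E1 : S1 (Q0 u + E u) = S1 u - (u - Q0 u).
  pose w := u - Q0 u; have hu : S0 w = u by rewrite /w linB ?h2//; exact: bop_lin hS.
  have hTw : T w = E u by rewrite /T hu.
  have := k2 w; rewrite hTw => hw.
  have -> : Q0 u + E u = u - (w - E u) by rewrite /w; rewrite opprB addrC addrA opprB addrCA addrA; rewrite [u + _]addrC addrA addrK addrC.
  by rewrite (linB _ _ (bop_lin hS1)) (linB _ _ (bop_lin hS1)) hw.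
by rewrite QE E1 (linB _ _ (bop_lin hS)) opprB addrC subrK (linB _ _ (bop_lin hS)) h2.
Qed.

Variables (ev : V -> K) (one : V) (kap : K).
Hypothesis ev_lin : forall (a : K) u v, ev (a *: u + v) = a * ev u + ev v.
Hypothesis ev_le : forall C u, nb C u -> cn (ev u) <= C.
Hypothesis nb_one : nb 1 one.
Hypothesis ev_one : ev one = 1.
Implicit Types (M : V -> V).

Lemma evD u v : ev (u + v) = ev u + ev v.
Proof. by have := ev_lin 1 u v; rewrite scale1r mul1r. Qed.
Lemma ev_0 : ev 0 = 0. Proof. by apply: (addrI (ev 0)); rewrite -evD !addr0. Qed.
Lemma evZ a u : ev (a *: u) = a * ev u.
Proof. by have := ev_lin a u 0; rewrite !addr0 ev_0 addr0. Qed.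
Lemma evN u : ev (- u) = - ev u. Proof. by rewrite -scaleN1r evZ mulN1r. Qed.
Lemma evB u v : ev (u - v) = ev u - ev v. Proof. by rewrite evD evN. Qed.

(* Subtracting the rank one operator [kap ev(M _) one] removes the leading eigenvalue. *)
Definition deflate M u := M u - (kap * ev (M u)) *: one.

Lemma deflate_lin M : lin M -> lin (deflate M).
Proof.
move=> h a u v; by rewrite /deflate h ev_lin mulrDr scalerDl mulrCA scalerBr scalerA opprD addrACA.
Qed.

Lemma deflate_diff M M' e : bop e (fun u => M' u - M u) ->
  bop ((1 + cn kap) * e) (fun u => deflate M' u - deflate M u).
Proof.
move=> h; have e0 := bop_ge0 h; have l := bop_lin h.
have E u : deflate M' u - deflate M u = (M' u - M u) - (kap * ev (M' u - M u)) *: one.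
  rewrite /deflate evB mulrBr scalerBl opprB [in RHS]opprB addrACA [RHS]addrACA.
  by congr (_ + _); exact: addrC.
split; [move=> a u v; rewrite !E; exact: (deflate_lin l)|by rewrite mulr_ge0// addr_ge0// cn_ge0|].
move=> C u hu; rewrite E mulrDl mul1r mulrDl; have hn := bop_nb h hu.
apply: nbB => //; rewrite -[X in nb X _]mulr1; apply: nb_le (nbZ _ nb_one) _.
by rewrite !mulr1 cnM -mulrA ler_wpM2l ?cn_ge0//; exact: ev_le.
Qed.

Definition lead M S := kap * ev (M (S one)) - 1.

Lemma lead_diff M M' S S' : lin M -> lin S -> resolvent (deflate M) S -> resolvent (deflate M') S' ->
  lead M' S' - lead M S =
  kap * ev (M (S (M' (S' one) - M (S' one)))) - kap * lead M S * ev (M' (S' one) - M (S' one)).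
Proof.
move=> lM lS [h1 h2] [h1' h2']; set G' := S' one; set N := M' G' - M G'.
have E : G' = S one + S N - (kap * ev N) *: S one.
  have E1 : G' - deflate M G' = (G' - deflate M' G') + (N - (kap * ev N) *: one).
    rewrite /deflate {2}/N evB mulrBr scalerBl !opprB -addrA; congr (_ + _); rewrite /N.
    set a := M' G'; set b := M G'; set s := _ *: one; set s' := _ *: one.
    by rewrite [(s' - a) + _]addrA [(s' - a) + (a - b)]addrA subrK addrC addrA subrK.
  rewrite (h1' one) in E1.
  rewrite -{1}(h2 G') -linB// E1 linD// linB// linZ//.
  by rewrite addrA.
have key : kap * ev (M' G') = kap * ev N + kap * ev (M G').
  by rewrite -mulrDr /N -evD subrK.
rewrite /lead -/G' key [in X in _ + kap * ev (M X)]E.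
rewrite linB// linD// linZ// evB evD evZ; ring.
Qed.

Lemma resolvent_diff M M' S S' u : lin S -> lin S' -> resolvent M S -> resolvent M' S' ->
  S' u - S u = S' (M' (S u) - M (S u)).
Proof.
move=> lS lS' [h1 _] [_ h2'].
have -> : S' u = S' (S u) - S' (M (S u)) by rewrite -(linB _ _ lS') h1.
have := h2' (S u); rewrite (linB _ _ lS').
set a := S' (S u); set b := S' (M _); set c := S' (M' _) => <-.
by rewrite opprB addrC addrA subrK.
Qed.

Definition lead_dual M S v := kap * ev (M (S v)) - kap * lead M S * ev v.

Lemma lead_dual_le M S m s C v : bop m M -> bop s S -> nb C v ->
  cn (lead_dual M S v) <= (cn kap * (m * s) + cn kap * cn (lead M S)) * C.
Proof.
move=> hM hS hv; apply: le_trans (cnB _ _) _; rewrite mulrDl !cnM -!mulrA; apply: lerD.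
  by rewrite ler_wpM2l ?cn_ge0//; exact: ev_le (bop_nb hM (bop_nb hS hv)).
by rewrite ler_wpM2l ?cn_ge0// ler_wpM2l ?cn_ge0//; exact: ev_le.
Qed.

Lemma lead_dual_lin M S (a : K) u v : lin M -> lin S ->
  lead_dual M S (a *: u + v) = a * lead_dual M S u + lead_dual M S v.
Proof. by move=> lM lS; rewrite /lead_dual lS lM !ev_lin; ring. Qed.

Lemma lead_dualB M S u v : lin M -> lin S ->
  lead_dual M S (u - v) = lead_dual M S u - lead_dual M S v.
Proof. by move=> lM lS; rewrite -scaleN1r addrC lead_dual_lin// mulN1r addrC. Qed.

Lemma lead_expansion M M' D S S' m s eta del nu : bop m M -> bop s S -> bop s S' ->
  resolvent (deflate M) S -> resolvent (deflate M') S' ->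
  bop eta (fun u => M' u - M u - D u) -> bop del D -> bop nu (fun u => M' u - M u) ->
  cn (lead M' S' - lead M S - lead_dual M S (D (S one))) <=
  (cn kap * (m * s) + cn kap * cn (lead M S)) * (eta * s + del * (s * ((1 + cn kap) * nu * s))).
Proof.
move=> hM hS hS' r r' heta hD hnu.
have lM := bop_lin hM; have lS := bop_lin hS; have lS' := bop_lin hS'.
rewrite (lead_diff lM lS r r'); set G' := S' one; set G := S one.
rewrite -/(lead_dual M S (M' G' - M G')).
have -> : lead_dual M S (M' G' - M G') - lead_dual M S (D G) =
    lead_dual M S ((M' G' - M G' - D G') + D (G' - G)).
  rewrite -lead_dualB//; congr lead_dual.
  by rewrite (linB _ _ (bop_lin hD)) addrA subrK.
apply: lead_dual_le => //; apply: nbD.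
  by apply: (bop_nb heta); have := bop_nb hS' nb_one; rewrite mulr1.
apply: (bop_nb hD); rewrite /G' /G (resolvent_diff _ lS lS' r r').
apply: (bop_nb hS'); apply: (bop_nb (deflate_diff hnu)).
by have := bop_nb hS nb_one; rewrite mulr1.
Qed.

Lemma lead_base_diff (m0 m1 s : R) : 0 <= m0 -> 0 <= m1 -> 0 <= s -> exists2 C, 0 <= C &
  forall M0 M M1 S0 S e, bop m0 M0 -> bop m0 M -> bop m1 M1 -> bop s S0 -> bop s S ->
  resolvent (deflate M0) S0 -> resolvent (deflate M) S -> lead M0 S0 = 0 ->
  bop e (fun u => M u - M0 u) ->
  cn (lead M S) <= C * e /\
  cn (lead_dual M S (M1 (S one)) - lead_dual M0 S0 (M1 (S0 one))) <= C * e.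
Proof.
move=> m00 m10 s0; have k0 := cn_ge0 kap.
pose C1 := cn kap * (s + m0 * (s * (1 + cn kap) * s)).
have C10 : 0 <= C1 by rewrite mulr_ge0// addr_ge0// !mulr_ge0// addr_ge0.
pose l := cn kap * (m0 * s) + cn kap * (cn kap * (m0 * s) + 1).
have l0 : 0 <= l by rewrite addr_ge0 ?mulr_ge0// addr_ge0 ?mulr_ge0.
pose C2 := (C1 + cn kap * C1) * (m1 * s) + l * (m1 * (s * (1 + cn kap) * s)).
have C20 : 0 <= C2.
  by rewrite /C2; nonneg.
exists (C1 + C2); first exact: addr_ge0.
move=> M0 M M1 S0 S e hM0 hM hM1 hS0 hS r0 r L0 hE; have e0 := bop_ge0 hE.
have lM0 := bop_lin hM0; have lM := bop_lin hM; have lS := bop_lin hS; have lS0 := bop_lin hS0.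
have SS C u : nb C u -> nb (s * (1 + cn kap) * s * e * C) (S u - S0 u).
  move=> hu; rewrite (resolvent_diff _ lS0 lS r0 r).
  rewrite (_ : _ * C = s * ((1 + cn kap) * e * (s * C))); last by ring.
  by apply: (bop_nb hS); apply: (bop_nb (deflate_diff hE)); exact: (bop_nb hS0).
have dualE C v : nb C v -> cn (kap * ev (M (S v)) - kap * ev (M0 (S0 v))) <= C1 * e * C.
  move=> hv; have -> : kap * ev (M (S v)) - kap * ev (M0 (S0 v)) =
      kap * ev ((M (S v) - M0 (S v)) + M0 (S v - S0 v)).
    by rewrite (linB _ _ lM0) evD !evB; ring.
  rewrite cnM /C1 -!mulrA ler_wpM2l//; apply: le_trans (ev_le (nbD (bop_nb hE (bop_nb hS hv)) (bop_nb hM0 (SS _ _ hv)))) _.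
  by rewrite le_eqVlt; apply/orP; left; apply/eqP; ring.
have F1 : cn (lead M S) <= C1 * e.
  have := dualE _ _ nb_one; rewrite mulr1; apply: le_trans; rewrite le_eqVlt; apply/orP; left; apply/eqP.
  by congr cn; rewrite -[LHS]subr0 -L0 /lead; ring.
split; first by apply: le_trans F1 _; rewrite ler_wpM2r// lerDl.
have n1 : nb s (S one) by have := bop_nb hS nb_one; rewrite mulr1.
have n0 : nb s (S0 one) by have := bop_nb hS0 nb_one; rewrite mulr1.
have -> : lead_dual M S (M1 (S one)) - lead_dual M0 S0 (M1 (S0 one)) =
   lead_dual M S (M1 (S one - S0 one)) + ((kap * ev (M (S (M1 (S0 one)))) - kap * ev (M0 (S0 (M1 (S0 one)))))
     - kap * lead M S * ev (M1 (S0 one))).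
  rewrite (linB _ _ (bop_lin hM1)) lead_dualB//.
  by rewrite /lead_dual L0; ring.
have v1 := bop_nb hM1 n0.
have lM' : cn kap * (m0 * s) + cn kap * cn (lead M S) <= l.
  rewrite lerD2l ler_wpM2l// /lead; apply: le_trans (cnB _ _) _; rewrite cn1 lerD2r cnM ler_wpM2l//.
  exact: ev_le (bop_nb hM n1).
have a1 := lead_dual_le hM hS (bop_nb hM1 (SS _ _ nb_one)).
have a2 := dualE _ _ v1; have a3 := ev_le v1.
apply: le_trans (cnD _ _) _; apply: (@le_trans _ _ (l * (m1 * (s * (1 + cn kap) * s * e * 1)) + (C1 * e * (m1 * s) + cn kap * (C1 * e) * (m1 * s)))).
  apply: lerD.
    apply: le_trans a1 _; rewrite ler_wpM2r// !mulr_ge0// addr_ge0//.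
  apply: le_trans (cnB _ _) _; apply: lerD => //; rewrite !cnM; apply: ler_pM; rewrite ?cn_ge0 ?mulr_ge0 ?cn_ge0//.
  by rewrite ler_wpM2l.
have : 0 <= C1 * e by rewrite mulr_ge0.
by rewrite /C2; lra.
Qed.

End bounded_operators.

Section complex_geometric_series.
Context {R : realType}.
Local Notation K := R[i].
Implicit Types (z q : K).

Lemma real_geometric_series (a : R^nat) (C th : R) : 0 <= th < 1 ->
  (forall k, `|a k| <= C * th ^+ k) -> exists s : R, forall e : R, 0 < e ->
  exists L0 : nat, forall L, (L0 <= L)%N -> `|s - \sum_(k < L) a k| <= e.
Proof.
move=> /andP[t0 t1] ha.
have cv : cvgn (series (fun k => a k)).
  have cg : cvgn (series (geometric C th)) by apply: is_cvg_geometric_series; rewrite ger0_norm.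
  apply: normed_cvg; apply: (@series_le_cvg _ _ (geometric C th)) => // k.
  - exact: normr_ge0.
  - by apply: le_trans (ha k).
exists (limn (series a)) => e e0.
move/cvgrPdist_le: cv => /(_ _ e0)[L0 _ hL]; exists L0 => L LL.
by have := hL L LL; rewrite /= /series /= big_mkord.
Qed.

Lemma geometric_tail (th : R) L M : 0 <= th < 1 -> \sum_(L <= k < M) th ^+ k <= th ^+ L / (1 - th).
Proof.
move=> /andP[t0 t1]; have d0 : 0 < 1 - th by rewrite subr_gt0.
have [LM|/ltnW ML] := leqP L M; last by rewrite big_geq// divr_ge0 ?exprn_ge0// ltW.
rewrite ler_pdivlMr// mulr_suml.
have -> : \sum_(L <= k < M) th ^+ k * (1 - th) = th ^+ L - th ^+ M.
  rewrite -[RHS]opprB -telescope_sumr// -sumrN; apply: eq_bigr => k _.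
  by rewrite exprS; ring.
by rewrite lerBlDr lerDl exprn_ge0.
Qed.

Lemma complex_geometric_series (v : nat -> K) (C th : R) : 0 <= th < 1 ->
  (forall k, cn (v k) <= C * th ^+ k) -> exists s, forall L, cn (s - \sum_(k < L) v k) <= C * th ^+ L / (1 - th).
Proof.
move=> t01 hv; have C0 : 0 <= C by have := le_trans (cn_ge0 _) (hv 0%N); rewrite expr0 mulr1.
have hRe k : `|Re (v k)| <= C * th ^+ k.
  by apply: le_trans (Re_le_cn _) (hv k).
have hIm k : `|Im (v k)| <= C * th ^+ k.
  by apply: le_trans (Im_le_cn _) (hv k).
have [s1 h1] := real_geometric_series t01 hRe; have [s2 h2] := real_geometric_series t01 hIm.
exists (s1 +i* s2)%C => L; apply/ler_addgt0Pr => e e0.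
have e2 : 0 < e / 2 by rewrite divr_gt0.
have [L1 k1] := h1 _ e2; have [L2 k2] := h2 _ e2.
pose M := maxn L (maxn L1 L2).
have -> : (s1 +i* s2)%C - \sum_(k < L) v k = ((s1 +i* s2)%C - \sum_(k < M) v k) + \sum_(L <= k < M) v k.
  rewrite -!(big_mkord xpredT v) [\sum_(0 <= i < M) v i](@big_cat_nat _ _ _ L)//=; last exact: leq_maxl.
  by rewrite opprD addrA subrK.
rewrite addrC; apply: le_trans (cnD _ _) _; rewrite addrC addrC; apply: lerD.
  apply: (@le_trans _ _ (\sum_(L <= k < M) C * th ^+ k)).
    elim: M => [|M IH]; first by rewrite !big_geq// cn0.
    have [LM|ML] := leqP L M; last by rewrite !big_geq// cn0.
    by rewrite !big_nat_recr//=; apply: le_trans (cnD _ _) _; exact: lerD.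
  by rewrite -mulr_sumr -mulrA ler_wpM2l// geometric_tail.
apply: le_trans (cn_le_ReIm _) _; rewrite [e]splitr; apply: lerD.
  rewrite raddfB raddf_sum /=; apply: k1; rewrite /M; lia.
rewrite raddfB raddf_sum /=; apply: k2; rewrite /M; lia.
Qed.

End complex_geometric_series.

Section lipschitz_functions.
Variables (R : realType) (X : Type) (d : X -> X -> R).
Local Notation K := R[i].

Definition lip_bound (C : R) (u : X -> K) :=
  (forall x, cn (u x) <= C) /\ (forall x y, cn (u x - u y) <= C * d x y).

Definition lip_pred : {pred X -> K^o} := fun u => `[< (forall x y, 0 <= d x y) -> exists C, lip_bound C u >].

Lemma lip_boundD C C' u v : lip_bound C u -> lip_bound C' v -> lip_bound (C + C') (fun x => u x + v x).
Proof.
move=> [h1 h2] [h1' h2']; split=> [x|x y]; first exact: le_trans (cnD _ _) (lerD _ _).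
by rewrite opprD addrACA mulrDl; apply: le_trans (cnD _ _) (lerD _ _).
Qed.

Lemma lip_boundZ C (a : K) u : lip_bound C u -> lip_bound (cn a * C) (fun x => a * u x).
Proof.
move=> [h1 h2]; split=> [x|x y]; first by rewrite cnM ler_wpM2l ?cn_ge0.
by rewrite -mulrBr cnM -mulrA ler_wpM2l ?cn_ge0.
Qed.

Lemma lip_pred_submod : submod_closed lip_pred.
Proof.
split=> [|a u v /asboolP hu /asboolP hv].
  apply/asboolP => d0; exists 0; split=> [x|x y]; rewrite /= ?subrr ?cn0//.
  by rewrite mul0r.
apply/asboolP => d0; have [C hC] := hu d0; have [C' hC'] := hv d0.
by exists (cn a * C + C'); apply: lip_boundD => //; exact: lip_boundZ.
Qed.

HB.instance Definition _ := GRing.isSubmodClosed.Build K (X -> K^o) lip_pred lip_pred_submod.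
Record lip_fun := LipFun {lip_val :> X -> K^o; lip_valP : lip_val \in lip_pred}.
HB.instance Definition _ := [isSub for lip_val].
HB.instance Definition _ := [Choice of lip_fun by <:].
HB.instance Definition _ := [SubChoice_isSubLmodule of lip_fun by <:].

Lemma lip_funE (a : K) (u v : lip_fun) x :
  [/\ (a *: u + v) x = a * u x + v x, (u + v) x = u x + v x, (- u) x = - u x, (a *: u) x = a * u x & (0 : lip_fun) x = 0].
Proof. by []. Qed.

Lemma lip_ext (u v : lip_fun) : (forall x, u x = v x) -> u = v.
Proof. by move=> h; apply: val_inj; apply/funext. Qed.

Hypothesis d_ge0 : forall x y, 0 <= d x y.

Lemma lip_mkP C u : lip_bound C u -> (u : X -> K^o) \in lip_pred.
Proof. by move=> h; apply/asboolP => _; exists C. Qed.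

Definition lip_nb (C : R) (u : lip_fun) : Prop := 0 <= C /\ lip_bound C u.

Lemma lip_funB (u v : lip_fun) x : (u - v) x = u x - v x. Proof. by []. Qed.

Lemma lip_fun_sum n (F : nat -> lip_fun) x : (\sum_(k < n) F k) x = \sum_(k < n) F k x.
Proof. by elim: n => [|n IH]; rewrite ?big_ord0// !big_ord_recr -IH. Qed.

Lemma lip_nb_spec : norm_bound_spec lip_nb.
Proof.
split.
- split=> [C u []|C C' u [C0 [h1 h2]] CC|C C' u v [C0 hu] [C'0 hv]] //.
    split; first exact: le_trans CC.
    split=> [x|x y]; first exact: le_trans CC.
    by apply: le_trans (h2 x y) _; rewrite ler_wpM2r.
  by split; [exact: addr_ge0|exact: lip_boundD].
- by move=> C a u [C0 hu]; split; [rewrite mulr_ge0// cn_ge0|exact: lip_boundZ].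
- move=> u; have /asboolP/(_ d_ge0)[C [h1 h2]] := lip_valP u.
  exists (Num.max 0 C); split; first by rewrite le_max lexx.
  split=> [x|x y]; first by rewrite le_max h1 orbT.
  by apply: le_trans (h2 x y) _; rewrite ler_wpM2r// le_max lexx orbT.
- move=> u h; apply: lip_ext => x; apply/eqP; rewrite -cn_eq0 eq_le cn_ge0 andbT.
  by apply/ler_addgt0Pr => e e0; rewrite add0r; have [_ []] := h e e0.
move=> v C th t01 hv.
have C0 : 0 <= C by have [] := hv 0%N; rewrite expr0 mulr1.
have /andP[t0 t1] := t01; have d0 : 0 < 1 - th by rewrite subr_gt0.
have pw x : exists s, forall L, cn (s - \sum_(k < L) v k x) <= C * th ^+ L / (1 - th).
  have h k : cn (v k x) <= C * th ^+ k by have [_ []] := hv k.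
  exact: (@complex_geometric_series R (fun k => v k x : K) C th t01 h).
have [s hs] := choice pw.
have hd x y L : cn ((s x - \sum_(k < L) v k x) - (s y - \sum_(k < L) v k y)) <= C * th ^+ L / (1 - th) * d x y.
  have [k|t ht] := @complex_geometric_series R (fun k => v k x - v k y) (C * d x y) th t01.
    by rewrite mulrAC; have [_ []] := hv k.
  have E : t = s x - s y.
    apply/eqP; rewrite -subr_eq0 -cn_eq0 eq_le cn_ge0 andbT; apply/ler_addgt0Pr => e e0; rewrite add0r.
    have [M hM] := geometric_small ((C * d x y + (C + C)) / (1 - th)) t01 e0.
    apply: le_trans (hM M (leqnn M)).
    rewrite (_ : t - (s x - s y) = (t - \sum_(k < M) (v k x - v k y)) - ((s x - \sum_(k < M) v k x) - (s y - \sum_(k < M) v k y))).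
      apply: le_trans (cnB _ _) _.
      rewrite (_ : (C * d x y + (C + C)) / (1 - th) * th ^+ M = C * d x y * th ^+ M / (1 - th) + (C * th ^+ M / (1 - th) + C * th ^+ M / (1 - th))); last by ring.
      by apply: lerD; [exact: ht|apply: le_trans (cnB _ _) (lerD _ _)].
    by rewrite sumrB; ring.
  have := ht L; rewrite E sumrB.
  rewrite (_ : C * d x y * th ^+ L / (1 - th) = C * th ^+ L / (1 - th) * d x y); last by ring.
  by apply: le_trans; rewrite le_eqVlt; apply/orP; left; apply/eqP; congr cn; ring.
have hs_lip : lip_bound (C / (1 - th)) s.
  split=> [x|x y].
    by have := hs x 0%N; rewrite big_ord0 subr0 expr0 mulr1.
  by have := hd x y 0%N; rewrite !big_ord0 !subr0 expr0 mulr1.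
exists (LipFun (lip_mkP hs_lip)) => L; split; first by rewrite divr_ge0 ?(ltW d0)// mulr_ge0// exprn_ge0.
split=> [x|x y]; rewrite !lip_funB !lip_fun_sum; [exact: hs|exact: hd].
Qed.

End lipschitz_functions.

Section implicit_solution.
Context {R : realType}.
Local Notation K := R[i].
Implicit Types (z q : K).

Lemma complex_implicit (F : K -> K -> K) (rho sig : R) (b0 : K) : 0 < rho -> 0 < sig -> b0 != 0 ->
  (forall z q q', cn z < rho -> cn q <= sig -> cn q' <= sig ->
     cn (F z q' - F z q + b0 * (q' - q)) <= cn b0 / 2 * cn (q' - q)) ->
  (forall e : R, 0 < e -> exists2 del : R, 0 < del & forall z, cn z < del -> cn (F z 0) <= e) ->
  (forall z q, cn z < rho -> cn q < sig -> exists a b, forall e : R, 0 < e ->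
     exists2 del : R, 0 < del & forall z' q', cn (z' - z) < del -> cn (q' - q) < del ->
       cn (F z' q' - F z q - a * (z' - z) - b * (q' - q)) <= e * (cn (z' - z) + cn (q' - q))) ->
  exists2 rho1 : R, 0 < rho1 <= rho & exists g : K -> K, forall z, cn z < rho1 ->
    [/\ cderiv g z, F z (g z) = 0 & forall q, cn q <= sig -> F z q = 0 -> q = g z].
Proof.
move=> r0 s0 b00 f1 f2 f3.
have B0 : 0 < cn b0 by rewrite cn_gt0.
have e0 : 0 < cn b0 * sig / 8 by rewrite divr_gt0// mulr_gt0.
have [del d0 hdel] := f2 _ e0.
pose rho1 := Num.min rho del.
have r1 : 0 < rho1 by rewrite lt_min r0.
have low z q q' : cn z < rho -> cn q <= sig -> cn q' <= sig ->
    cn b0 / 2 * cn (q' - q) <= cn (F z q' - F z q).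
  move=> hz hq hq'; have := f1 z q q' hz hq hq'.
  have : cn (b0 * (q' - q)) <= cn (F z q' - F z q + b0 * (q' - q)) + cn (F z q' - F z q).
    by rewrite -{1}[b0 * _](addrK (F z q' - F z q)) [b0 * _ + _]addrC; exact: cnB.
  by rewrite cnM; lra.
have up z q q' : cn z < rho -> cn q <= sig -> cn q' <= sig ->
    cn (F z q' - F z q) <= 2 * cn b0 * cn (q' - q).
  move=> hz hq hq'; have := f1 z q q' hz hq hq'.
  have : cn (F z q' - F z q) <= cn (F z q' - F z q + b0 * (q' - q)) + cn (b0 * (q' - q)).
    by rewrite -{1}[F z q' - _](addrK (b0 * (q' - q))); exact: cnB.
  have : 0 <= cn b0 * cn (q' - q) by nonneg.
  by rewrite cnM; lra.
have ex z : cn z < rho1 -> exists q, cn q <= sig / 2 /\ F z q = 0.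
  rewrite lt_min => /andP[hz hz'].
  pose T q := q + F z q / b0.
  have hT q q' : cn q <= sig -> cn q' <= sig -> cn (T q' - T q) <= 1 / 2 * cn (q' - q).
    move=> hq hq'; have h := f1 z q q' hz hq hq'.
    have -> : T q' - T q = (F z q' - F z q + b0 * (q' - q)) / b0 by rewrite /T; field.
    by rewrite cnM cnV ler_pdivrMr//; lra.
  pose qn n := iter n T 0.
  have q1 : cn (T 0) <= sig / 8.
    rewrite /T add0r cnM cnV ler_pdivrMr//; have := hdel z hz'; lra.
  have hq n : cn (qn n) <= sig / 4 * (1 - (1 / 2) ^+ n) /\ cn (qn n.+1 - qn n) <= sig / 8 * (1 / 2) ^+ n.
    elim: n => [|n [IH1 IH2]].
      by rewrite /= !expr0 subrr mulr0 cn0 mulr1 subr0; split.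
    have h0 : 0 <= (1 / 2 : R) ^+ n by apply: exprn_ge0; lra.
    have h1 : cn (qn n.+1) <= sig / 4 * (1 - (1 / 2) ^+ n.+1).
      rewrite -[qn n.+1](subrK (qn n)); apply: le_trans (cnD _ _) _.
      by rewrite exprS; move: IH1 IH2; lra.
    have s4 m : sig / 4 * (1 - (1 / 2) ^+ m) <= sig.
      have : 0 <= sig / 4 * (1 / 2 : R) ^+ m by apply: mulr_ge0; [lra|apply: exprn_ge0; lra].
      by lra.
    split=> //; apply: le_trans (hT _ _ (le_trans IH1 (s4 _)) (le_trans h1 (s4 _))) _.
    by rewrite exprS; move: IH2; lra.
  have t01 : 0 <= (1 / 2 : R) < 1 by lra.
  have [k|s hs] := @complex_geometric_series R (fun k => qn k.+1 - qn k) (sig / 8) (1 / 2) t01.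
    by have [] := hq k.
  have sumE L : \sum_(k < L) (qn k.+1 - qn k) = qn L.
    by rewrite -(big_mkord xpredT (fun k => qn k.+1 - qn k)) telescope_sumr//= subr0.
  have hs' L : cn (s - qn L) <= sig / 4 * (1 / 2) ^+ L.
    rewrite (_ : sig / 4 * _ = sig / 8 * (1 / 2) ^+ L / (1 - 1 / 2)); last by field.
    by have := hs L; rewrite sumE.
  have ssig : cn s <= sig / 2.
    by have := hs' 0%N; rewrite /= subr0 expr0; lra.
  exists s; split=> //; apply/eqP; rewrite -cn_eq0 eq_le cn_ge0 andbT.
  apply/ler_addgt0Pr => e e00; rewrite add0r.
  have [M hM] := geometric_small (cn b0 * sig) t01 e00; apply: le_trans (hM M (leqnn M)).
  have qM : cn (qn M) <= sig.
    have [h _] := hq M; apply: le_trans h _.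
    have : 0 <= sig / 4 * (1 / 2 : R) ^+ M by apply: mulr_ge0; [lra|apply: exprn_ge0; lra].
    by lra.
  have ss : cn s <= sig by apply: le_trans ssig _; lra.
  have h1 := up z _ _ hz qM ss.
  have h2 : cn (F z (qn M)) <= cn b0 * (sig / 8 * (1 / 2) ^+ M).
    have [_ h] := hq M; rewrite /= /T addrAC subrr add0r cnM cnV ler_pdivrMr// in h.
    by rewrite mulrC.
  have h3 : 2 * cn b0 * cn (s - qn M) <= 2 * cn b0 * (sig / 4 * (1 / 2) ^+ M).
    by rewrite ler_wpM2l// mulr_ge0// ltW.
  have h4 : 0 <= cn b0 * sig * (1 / 2 : R) ^+ M.
    by apply: mulr_ge0; [apply: mulr_ge0; exact: ltW|apply: exprn_ge0; lra].
  rewrite -[F z s](subrK (F z (qn M))); apply: le_trans (cnD _ _) _.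
  by move: h1 h2 h3 h4; lra.
have exg z : exists q, cn z < rho1 -> cn q <= sig / 2 /\ F z q = 0.
  have [hz|hz] := ltP (cn z) rho1; last by exists 0.
  by have [q hq] := ex z hz; exists q.
have [g hg] := choice exg.
exists rho1; first by rewrite r1 ge_min lexx.
exists g => z hz; have [gz1 gz2] := hg z hz.
have hzr : cn z < rho by move: hz; rewrite lt_min => /andP[].
have gz3 : cn (g z) < sig by apply: le_lt_trans gz1 _; lra.
split=> //; last first.
  move=> q hq Fq; apply/eqP; rewrite -subr_eq0 -cn_eq0 eq_le cn_ge0 andbT.
  have := low z (g z) q hzr (ltW gz3) hq; rewrite Fq gz2 subrr cn0.
  by rewrite pmulr_rle0// divr_gt0.
have [a [b hab]] := f3 z (g z) hzr gz3.
have [del1 del10 h1] := hab 1 ltr01.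
pose Lz := 2 * (cn a + 1) / cn b0.
have Lz0 : 0 <= Lz by rewrite divr_ge0 ?(ltW B0)//; nonneg.
have lipg z' : cn z' < rho1 -> cn (z' - z) < del1 -> cn (g z' - g z) <= Lz * cn (z' - z).
  move=> hz' hd; have [g1 g2] := hg z' hz'.
  have hz'r : cn z' < rho by move: hz'; rewrite lt_min => /andP[].
  have g3 : cn (g z') <= sig by apply: le_trans g1 _; lra.
  have l1 := low z' (g z) (g z') hz'r (ltW gz3) g3.
  have := h1 z' (g z) hd; rewrite subrr cn0 => /(_ del10); rewrite mulr0 subr0 addr0 mul1r gz2 subr0 => k1.
  have k2 : cn (F z' (g z)) <= cn (F z' (g z) - a * (z' - z)) + cn (a * (z' - z)).
    by rewrite -{1}[F z' (g z)](subrK (a * (z' - z))); exact: cnD.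
  rewrite g2 sub0r cnN in l1; rewrite cnM in k2.
  rewrite /Lz mulrAC ler_pdivlMr//; move: l1 k1 k2; lra.
have bn : cn b0 / 2 <= cn b.
  apply/ler_addgt0Pr => e e1; have [del2 del20 h2] := hab e e1.
  pose t := Num.min (del2 / 2) ((sig - cn (g z)) / 2).
  have t0 : 0 < t by rewrite lt_min !divr_gt0// subr_gt0.
  have td : t < del2 by apply: (@le_lt_trans _ _ (del2 / 2)); [rewrite ge_min lexx|lra].
  have ts : cn (g z) + t <= sig.
    have : t <= (sig - cn (g z)) / 2 by rewrite ge_min lexx orbT.
    by move: gz3; lra.
  have ct : cn (rc t) = t by rewrite cn_rc gtr0_norm.
  have := h2 z (g z + rc t); rewrite subrr cn0 addrAC subrr add0r ct => /(_ del20 td).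
  rewrite mulr0 subr0 add0r gz2 subr0 => k1.
  have q1 : cn (g z + rc t) <= sig by apply: le_trans (cnD _ _) _; rewrite ct.
  have := low z (g z) (g z + rc t) hzr (ltW gz3) q1; rewrite gz2 subr0 addrAC subrr add0r ct => k2.
  have k3 : cn (F z (g z + rc t)) <= cn (F z (g z + rc t) - b * rc t) + cn (b * rc t).
    by rewrite -{1}[F z _](subrK (b * rc t)); exact: cnD.
  rewrite cnM ct in k3; rewrite -(ler_pM2r t0) mulrDl; move: k1 k2 k3; lra.
have b_gt0 : 0 < cn b by apply: lt_le_trans bn; rewrite divr_gt0.
have bne : b != 0 by rewrite -cn_gt0.
exists (- (a / b)) => e e1.
have e2 : 0 < e * cn b / (1 + Lz) by rewrite divr_gt0 ?mulr_gt0// ltr_pwDl.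
have [del2 del20 h2] := hab _ e2.
pose dl := Num.min (Num.min del1 (rho1 - cn z)) (Num.min del2 (del2 / (Lz + 1))).
exists dl; first by rewrite !lt_min del10 subr_gt0 hz del20 divr_gt0// ltr_wpDl.
move=> w; rewrite !lt_min => /andP[/andP[w1 w2] /andP[w3 w4]].
have hw : cn w < rho1.
  rewrite -[w](subrK z); apply: le_lt_trans (cnD _ _) _; lra.
have lg := lipg w hw w1.
have gd : cn (g w - g z) < del2.
  apply: le_lt_trans lg _; rewrite ltr_pdivlMr ?ltr_wpDl// in w4.
  by have := cn_ge0 (w - z); move: w4; lra.
have [_ gw2] := hg w hw.
have := h2 w (g w) w3 gd; rewrite gw2 gz2 subrr sub0r => k.
have -> : g w - g z - - (a / b) * (w - z) = - (- (a * (w - z)) - b * (g w - g z)) / b by field.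
rewrite cnM cnV cnN ler_pdivrMr//; apply: le_trans k _.
rewrite mulrAC ler_pdivrMr ?ltr_pwDl//.
have h5 : 0 <= e * cn b by rewrite mulr_ge0// ltW.
have := ler_wpM2l h5 lg; rewrite [e * cn (w - z) * cn b]mulrAC; lra.
Qed.

End implicit_solution.

(** * Weighted induced operators *)

Section lipschitz_products.
Context {R : realType} {X : Type} (d : X -> X -> R).
Hypothesis d01 : forall x y, 0 <= d x y <= 1.
Local Notation K := R[i].
Implicit Types (u v : X -> K) (C t : R).

Lemma lip_bound_ge0 C u (x : X) : lip_bound d C u -> 0 <= C.
Proof. by move=> [h _]; exact: le_trans (cn_ge0 _) (h x). Qed.

Lemma lip_bound_le C C' u : lip_bound d C u -> C <= C' -> lip_bound d C' u.
Proof.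
move=> [h1 h2] CC; split=> [x|x y]; first exact: le_trans CC.
by apply: le_trans (h2 x y) _; rewrite ler_wpM2r//; case/andP: (d01 x y).
Qed.

Lemma lip_bound_ext C u v : u =1 v -> lip_bound d C u -> lip_bound d C v.
Proof. by move=> /funext ->. Qed.

Lemma lip_boundM C C' u v : lip_bound d C u -> lip_bound d C' v ->
  lip_bound d (2 * (C * C')) (fun x => u x * v x).
Proof.
move=> hu hv; have [h1 h2] := hu; have [h1' h2'] := hv.
have pos (x : X) : 0 <= C * C' by rewrite mulr_ge0 ?(lip_bound_ge0 x hu) ?(lip_bound_ge0 x hv).
split=> [x|x y].
  rewrite cnM; apply: (@le_trans _ _ (C * C')); first by apply: ler_pM => //; exact: cn_ge0.
  by have p0 := pos x; clear pos; lra.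
have -> : u x * v x - u y * v y = (u x - u y) * v x + u y * (v x - v y) by ring.
apply: le_trans (cnD _ _) _; rewrite !cnM.
have k1 : cn (u x - u y) * cn (v x) <= C * d x y * C' by apply: ler_pM => //; exact: cn_ge0.
have k2 : cn (u y) * cn (v x - v y) <= C * (C' * d x y) by apply: ler_pM => //; exact: cn_ge0.
by clear pos; lra.
Qed.

Lemma lip_bound_exp1 t v : lip_bound d t v -> lip_bound d (5 * t * expR (2 * t)) (fun x => cexp (v x) - 1).
Proof.
move=> hv; have [h1 h2] := hv; split=> [x|x y].
  have t0 := lip_bound_ge0 x hv.
  apply: le_trans (cexp_bound1 _) _; apply: ler_pM; rewrite ?expR_ge0//; first by nonneg.
    by rewrite ler_wpM2l.
  by rewrite ler_expR; have := h1 x; lra.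
have t0 := lip_bound_ge0 x hv; have /andP[d0 d1] := d01 x y.
have dt : cn (v x - v y) <= t by apply: le_trans (h2 x y) _; rewrite ler_piMr.
have -> : cexp (v x) - 1 - (cexp (v y) - 1) = cexp (v y) * (cexp (v x - v y) - 1).
  by rewrite mulrBr mulr1 -cexpD [v y + _]addrC subrK opprB addrA subrK.
rewrite cnM; apply: (@le_trans _ _ (expR t * (5 * (t * d x y) * expR t))).
  apply: ler_pM; rewrite ?cn_ge0//.
    by rewrite cn_cexp ler_expR; apply: le_trans (ler_norm _) (le_trans (Re_le_cn _) (h1 y)).
  apply: le_trans (cexp_bound1 _) _; apply: ler_pM; rewrite ?expR_ge0//; first by nonneg.
    by rewrite ler_wpM2l.
  by rewrite ler_expR.
rewrite (_ : 2 * t = t + t) ?expRD; last by ring.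
by rewrite le_eqVlt; apply/orP; left; apply/eqP; ring.
Qed.

Lemma lip_bound_exp2 t v : lip_bound d t v -> lip_bound d (10 * t ^+ 2 * expR (2 * t)) (fun x => cexp (v x) - 1 - v x).
Proof.
move=> hv; have [h1 h2] := hv; split=> [x|x y].
  have t0 := lip_bound_ge0 x hv.
  apply: le_trans (cexp_bound2 _) _; apply: ler_pM; rewrite ?expR_ge0//; first by nonneg.
    apply: ler_pM; rewrite ?exprn_ge0 ?cn_ge0//; first by lra.
    by rewrite lerXn2r ?nnegrE ?cn_ge0.
  by rewrite ler_expR; have := h1 x; lra.
have t0 := lip_bound_ge0 x hv; have /andP[d0 d1] := d01 x y.
have dt : cn (v x - v y) <= t by apply: le_trans (h2 x y) _; rewrite ler_piMr.
have [k1 _] := lip_bound_exp1 hv.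
have -> : cexp (v x) - 1 - v x - (cexp (v y) - 1 - v y) =
    cexp (v y) * (cexp (v x - v y) - 1 - (v x - v y)) + (cexp (v y) - 1) * (v x - v y).
  have : cexp (v x) = cexp (v y) * cexp (v x - v y) by rewrite -cexpD [v y + _]addrC subrK.
  by move=> ->; ring.
apply: le_trans (cnD _ _) _; rewrite (cnM (cexp _)) (cnM (cexp _ - 1)).
have a1 : cn (cexp (v y)) <= expR t.
  by rewrite cn_cexp ler_expR; apply: le_trans (ler_norm _) (le_trans (Re_le_cn _) (h1 y)).
have a2 : cn (cexp (v x - v y) - 1 - (v x - v y)) <= 5 * (t * (t * d x y)) * expR t.
  apply: le_trans (cexp_bound2 _) _; apply: ler_pM; rewrite ?expR_ge0 ?ler_expR//; first by nonneg.
  by rewrite ler_wpM2l// expr2; apply: ler_pM => //; exact: cn_ge0.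
have a3 : cn (cexp (v y) - 1) * cn (v x - v y) <= 5 * t * expR (2 * t) * (t * d x y).
  by apply: ler_pM; rewrite ?cn_ge0.
have a4 : cn (cexp (v y)) * cn (cexp (v x - v y) - 1 - (v x - v y)) <= expR t * (5 * (t * (t * d x y)) * expR t).
  by apply: ler_pM; rewrite ?cn_ge0.
apply: le_trans (lerD a4 a3) _.
rewrite (_ : 2 * t = t + t) ?expRD; last by ring.
by rewrite le_eqVlt; apply/orP; left; apply/eqP; ring.
Qed.

Definition to_lip u : lip_fun d := if pselect ((u : X -> K^o) \in lip_pred d) is left h then LipFun h else 0.

Lemma to_lipE C u x : lip_bound d C u -> to_lip u x = u x.
Proof. by move=> h; rewrite /to_lip; case: pselect => // -[]; exact: lip_mkP h. Qed.

Lemma to_lip_nb C u : 0 <= C -> lip_bound d C u -> lip_nb C (to_lip u).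
Proof.
move=> C0 h; split=> //; apply: (lip_bound_ext _ h) => x; by rewrite (to_lipE _ h).
Qed.

End lipschitz_products.

Section weighted_operators.
Context {R : realType} (alpha : R).
Hypothesis alpha01 : 0 < alpha <= 1.
Local Notation K := R[i].
Local Notation X := (@I01 R).
Local Notation d := (eta_dist alpha).
Local Notation exc := (excursion alpha01).
Local Notation V := (lip_fun (d : X -> X -> R)).
Local Notation nb := (@lip_nb R X d).
Local Notation bop := (@bop R V nb).
Implicit Types (x y : X) (u v : V) (w : nat -> X -> K) (c C th : R) (S : V -> V).

Lemma eta_dist01 x y : 0 <= (d x y : R) <= 1.
Proof. by rewrite powR_ge0 eta_dist_le1. Qed.

Lemma eta_dist_ge0 x y : 0 <= (d x y : R). Proof. by case/andP: (eta_dist01 x y). Qed.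

Lemma nbS : norm_bound_spec nb. Proof. exact: lip_nb_spec eta_dist_ge0. Qed.

Lemma lip_bound_excursion k C (u : X -> K) : lip_bound d C u -> lip_bound d C (fun x => u (exc k x)).
Proof.
move=> hu; have [h1 h2] := hu; split=> // x y; apply: le_trans (h2 _ _) _.
rewrite ler_wpM2l ?(lip_bound_ge0 x hu)//; apply: le_trans (eta_dist_excursion alpha01 k x y) _.
by rewrite ler_piMl ?eta_dist_ge0// ltW//; case/andP: (eta_rate01 alpha01).
Qed.

Variable th : R.
Hypothesis th01 : 0 <= th < 1.

Definition weight_decay c w := forall k, lip_bound d (c * th ^+ k) (w k).

Definition is_weighted w S := lin S /\ exists c, forall L C u, nb C u ->
  lip_bound d (c * th ^+ L * C) (fun x => S u x - \sum_(k < L) w k x * u (exc k x)).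

Lemma weighted_ex c w : 0 <= c -> weight_decay c w -> exists S, is_weighted w S /\ bop (2 * c / (1 - th)) S.
Proof.
move=> c0 hw; pose T k u : V := to_lip d (fun x => w k x * u (exc k x)).
have ex u : exists C, nb C u by have [_ _ h _ _] := nbS; exact: h.
have hT k C u : nb C u -> lip_bound d (2 * (c * th ^+ k * C)) (fun x => w k x * u (exc k x)).
  move=> [C0 hu]; apply: lip_boundM => //.
  exact: lip_bound_excursion.
have TE k u x : T k u x = w k x * u (exc k x).
  by have [C hC] := ex u; rewrite /T (to_lipE _ (hT k C u hC)).
have /andP[t0 t1] := th01.
have bT k : bop (2 * c * th ^+ k) (T k).
  split; first by move=> a u v; apply: lip_ext => x; rewrite TE; have [-> _ _ _ _] := lip_funE a (T k u) (T k v) x; rewrite !TE; have [-> _ _ _ _] := lip_funE a u v (exc k x); ring.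
    by nonneg.
  move=> C u hC; have [C0 _] := hC; apply: to_lip_nb; first by nonneg.
  by apply: (lip_bound_le eta_dist01 (hT k C u hC)); rewrite !mulrA.
have [S [hS happ]] := geometric_operator_sum nbS th01 bT.
exists S; split=> //; split; first exact: bop_lin hS.
exists (2 * c / (1 - th)) => L C u hC.
have [_ h] := bop_nb (happ L) hC.
apply: (lip_bound_ext _ (lip_bound_le eta_dist01 h _)).
  move=> x; have := congr1 (fun t => S u x - t) (lip_fun_sum L (fun k => T k u) x) => h1.
  by apply: (etrans h1); congr (_ - _); apply: eq_bigr => k _; exact: TE.
by rewrite le_eqVlt; apply/orP; left; apply/eqP; ring.
Qed.

Lemma weighted_uniq w S S' : is_weighted w S -> is_weighted w S' -> S = S'.
Proof.
move=> [_ [c hc]] [_ [c' hc']]; apply/funext => u; apply: lip_ext => x.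
have [C hC] : exists C, nb C u by have [_ _ h _ _] := nbS; exact: h.
apply/eqP; rewrite -subr_eq0 -cn_eq0 eq_le cn_ge0 andbT; apply/ler_addgt0Pr => e e0; rewrite add0r.
have [L hL] := geometric_small ((c + c') * C) th01 e0; apply: le_trans (hL L (leqnn L)).
have [h _] := hc L C u hC; have [h' _] := hc' L C u hC.
have -> : S u x - S' u x = (S u x - \sum_(k < L) w k x * u (exc k x)) - (S' u x - \sum_(k < L) w k x * u (exc k x)).
  by ring.
apply: le_trans (cnB _ _) _.
rewrite (_ : (c + c') * C * _ = c * th ^+ L * C + c' * th ^+ L * C); last by ring.
exact: lerD.
Qed.

Lemma weighted_bop w c S : 0 <= c -> is_weighted w S -> weight_decay c w -> bop (2 * c / (1 - th)) S.
Proof.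
move=> c0 hS hw; have [S' [hS' hb]] := weighted_ex c0 hw.
by rewrite (weighted_uniq hS hS').
Qed.

Lemma weighted_lin (a : K) w w' S S' : is_weighted w S -> is_weighted w' S' ->
  is_weighted (fun k x => a * w k x + w' k x) (fun u => a *: S u + S' u).
Proof.
move=> [lS [c hc]] [lS' [c' hc']]; split.
  by move=> b u v; rewrite lS lS' scalerDr !scalerA mulrC scalerDr scalerA addrACA.
exists (cn a * c + c') => L C u hC.
have := lip_boundD (lip_boundZ a (hc L C u hC)) (hc' L C u hC) => h.
apply: (lip_bound_ext _ (lip_bound_le eta_dist01 h _)).
  move=> x; have [-> _ _ _ _] := lip_funE a (S u) (S' u) x.
  rewrite mulrBr mulr_sumr addrACA -opprD -big_split /=; congr (_ - _).
  by apply: eq_bigr => k _; ring.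
by rewrite le_eqVlt; apply/orP; left; apply/eqP; ring.
Qed.

Lemma weighted_ext w w' S : (forall k x, w k x = w' k x) -> is_weighted w S -> is_weighted w' S.
Proof. by move=> h; rewrite (_ : w = w')//; apply/funext => k; apply/funext => x. Qed.

Lemma weighted_sub w w' S S' : is_weighted w S -> is_weighted w' S' ->
  is_weighted (fun k x => w k x - w' k x) (fun u => S u - S' u).
Proof.
move=> h h'; have := weighted_lin (-1) h' h.
rewrite (_ : (fun u => -1 *: S' u + S u) = (fun u => S u - S' u)); last first.
  by apply/funext => u; rewrite scaleN1r addrC.
by apply: weighted_ext => k x; rewrite mulN1r addrC.
Qed.

Definition potential (e : R) (chi : X -> K) :=
  (forall x, cn (chi x) <= e) /\ (forall x y, cn (chi x - chi y) <= e * dist x y `^ alpha).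

Definition exc_birkhoff (chi : X -> K) k x : K := \sum_(j < k.+1) chi (exc j x).

Definition dist_const : R := 2 / dexp alpha.

Lemma dist_const_ge1 : 1 <= dist_const.
Proof.
have /andP[a0 a1] := alpha01.
have e0 : 0 < dexp alpha by exact: (dexp_gt0 alpha01).
rewrite /dist_const ler_pdivlMr// mul1r /dexp.
have : alpha ^+ 2 <= 1 by rewrite expr_le1// ltW.
by lra.
Qed.

Lemma exc_birkhoff_bound e chi k : potential e chi ->
  lip_bound d (k.+1%:R * (e * dist_const)) (exc_birkhoff chi k).
Proof.
move=> [h1 h2]; have D1 := dist_const_ge1.
have e0 : 0 <= e by exact: le_trans (cn_ge0 _) (h1 I01_0).
split=> [x|x y].
  apply: le_trans (cn_sum _ _ _) _; apply: (@le_trans _ _ (\sum_(j < k.+1) e)).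
    by apply: ler_sum => j _.
  by rewrite sumr_const card_ord -[e *+ _]mulr_natl ler_wpM2l// ler_peMr.
rewrite /exc_birkhoff -sumrB; apply: le_trans (cn_sum _ _ _) _.
apply: (@le_trans _ _ (\sum_(j < k.+1) e * dist (exc j x) (exc j y) `^ alpha)).
  by apply: ler_sum => j _.
rewrite -mulr_sumr; apply: le_trans (ler_wpM2l e0 (excursion_distortion alpha01 k x y)) _.
rewrite -/dist_const [leLHS]mulrA; apply: ler_wpM2r; first exact: eta_dist_ge0.
rewrite ler_peMl ?ler1n//.
by apply: mulr_ge0 => //; lra.
Qed.

Lemma exc_birkhoff_lin (a : K) chi chi' k x :
  exc_birkhoff (fun y => a * chi y + chi' y) k x = a * exc_birkhoff chi k x + exc_birkhoff chi' k x.
Proof. by rewrite /exc_birkhoff big_split /= mulr_sumr. Qed.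

End weighted_operators.

(** * The leading eigenvalue at the pressure *)

Lemma deflated_cone_ineq (R : realType) (b2 b3 c dd s mx my : R) : 0 < b2 -> 0 <= b3 -> b3 <= b2 ->
  c = (b2 - b3) / (b2 * expR (b2 + b3)) -> 0 <= dd <= 1 -> 0 <= my ->
  mx <= expR (b3 * dd) * my -> s <= expR b3 * my ->
  mx - c * s <= expR (b2 * dd) * (my - c * s).
Proof.
move=> b20 b30 b32 cE /andP[d0 d1] my0 h1 hs.
have c0 : 0 <= c by rewrite cE divr_ge0 ?subr_ge0// mulr_ge0 ?expR_ge0// ltW.
have bd : 0 <= b2 * dd by rewrite mulr_ge0// ltW.
have k3 : 0 <= (b2 - b3) * dd by rewrite mulr_ge0// subr_ge0.
have k1 : 1 <= expR (b3 * dd) by rewrite -[leLHS]expR0 ler_expR mulr_ge0.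
have k2 := expR_ge1Dx ((b2 - b3) * dd).
have E2 : expR (b2 * dd) = expR (b3 * dd) * expR ((b2 - b3) * dd) by rewrite -expRD; congr expR; ring.
have E21 : expR (b2 * dd) - 1 <= b2 * dd * expR b2.
  have h := expR_ge1Dx (- (b2 * dd)); rewrite expRN in h.
  have h2 := ler_wpM2r (ltW (expR_gt0 (b2 * dd))) h.
  rewrite mulVf ?gt_eqF ?expR_gt0// in h2.
  have h3 : b2 * dd * expR (b2 * dd) <= b2 * dd * expR b2.
    by rewrite ler_wpM2l// ler_expR ler_piMr// ltW.
  by lra.
have E20 : 0 <= expR (b2 * dd) - 1 by rewrite subr_ge0 -[leLHS]expR0 ler_expR.
set x2 := expR (b2 * dd) in E2 E21 E20 *; set x3 := expR (b3 * dd) in k1 E2 h1 *.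
have E32 : (b2 - b3) * dd <= x2 - x3.
  have : 1 * ((b2 - b3) * dd) <= x3 * (expR ((b2 - b3) * dd) - 1) by apply: ler_pM => //; lra.
  by rewrite E2; lra.
have k5 : c * s * (x2 - 1) <= (b2 - b3) * dd * my.
  apply: (@le_trans _ _ (c * (expR b3 * my) * (x2 - 1))).
    by rewrite ler_wpM2r// ler_wpM2l.
  apply: (@le_trans _ _ (c * (expR b3 * my) * (b2 * dd * expR b2))).
    by rewrite ler_wpM2l// mulr_ge0// mulr_ge0// expR_ge0.
  rewrite cE expRD le_eqVlt; apply/orP; left; apply/eqP; field.
  by rewrite !gt_eqF ?expR_gt0.
have k6 : (b2 - b3) * dd * my <= (x2 - x3) * my by rewrite ler_wpM2r.
by move: h1 k5 k6; rewrite !mulrBr !mulrBl; lra.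
Qed.

Section real_base_operator.
Context {R : realType} (alpha : R).
Hypothesis alpha01 : 0 < alpha <= 1.
Local Notation K := R[i].
Local Notation X := (@I01 R).
Local Notation d := (eta_dist alpha).
Local Notation exc := (excursion alpha01).
Local Notation V := (lip_fun (d : X -> X -> R)).
Local Notation nb := (@lip_nb R X d).
Local Notation bop := (@bop R V nb).
Local Notation rate := (eta_rate alpha).
Implicit Types (x y : X) (u v : V).

Lemma rc_sum n (F : nat -> R) : rc (\sum_(k < n) F k) = \sum_(k < n) rc (F k).
Proof. by elim: n => [|n IH]; rewrite ?big_ord0// !big_ord_recr rcD IH. Qed.

Definition ev0 u : K := u I01_0.
Definition one_lip : V := to_lip d (fun=> 1).

Lemma one_bound : lip_bound d 1 (fun _ : X => 1 : K).
Proof. by split=> [x|x y]; rewrite ?cn1// subrr cn0 mul1r eta_dist_ge0. Qed.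
Lemma one_lipE x : one_lip x = 1. Proof. exact: (to_lipE _ one_bound). Qed.
Lemma one_lip_nb : nb 1 one_lip. Proof. exact: (to_lip_nb ler01 one_bound). Qed.
Lemma ev0_lin (a : K) u v : ev0 (a *: u + v) = a * ev0 u + ev0 v. Proof. by []. Qed.
Lemma ev0_le C u : nb C u -> cn (ev0 u) <= C. Proof. by move=> [_ [h _]]; exact: h. Qed.

Definition Vreal u := forall x, Im (u x) = 0.
Definition Vpos u := forall x, Im (u x) = 0 /\ 0 <= Re (u x).
Definition Vcone (b : R) u := forall x y,
  [/\ Im (u x) = 0, 0 <= Re (u x) & Re (u x) <= expR (b * d x y) * Re (u y)].

Lemma Vcone_pos b u : Vcone b u -> Vpos u.
Proof. by move=> h x; have [] := h x x. Qed.

Lemma Vcone_le b b' u : b <= b' -> Vcone b u -> Vcone b' u.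
Proof.
move=> bb h x y; have [h1 h2 h3] := h x y; split=> //; apply: le_trans h3 _.
by rewrite ler_wpM2r ?(Vcone_pos h y).2// ler_expR ler_wpM2r// eta_dist_ge0.
Qed.

Lemma le_eps (a b : R) : (forall e : R, 0 < e -> a <= b + e) -> a <= b.
Proof. by move=> h; apply/ler_addgt0Pr. Qed.

Lemma expR_sub1 (t : R) : 0 <= t -> expR t - 1 <= t * expR t.
Proof.
move=> t0; have h := expR_ge1Dx (- t); rewrite expRN in h.
have h2 := ler_wpM2r (ltW (expR_gt0 t)) h.
by rewrite mulVf ?gt_eqF ?expR_gt0// in h2; lra.
Qed.

Lemma Vcone_nb b T u : 0 <= b -> Vcone b u -> (forall x, Re (u x) <= T) -> nb ((1 + b * expR b) * T) u.
Proof.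
move=> b0 hu hT; have p x := Vcone_pos hu x.
have T0 : 0 <= T := le_trans (p I01_0).2 (hT I01_0).
have cnE x : cn (u x) = Re (u x).
  by rewrite [u x]ReIm_decomp (p x).1 mulr0 addr0 cn_rc ger0_norm ?(p x).2.
have E0 : 0 <= b * expR b by rewrite mulr_ge0 ?expR_ge0.
have one_side x y : Re (u x) - Re (u y) <= b * expR b * T * d x y.
  have [_ _ h] := hu x y; have /andP[d0 d1] := eta_dist01 alpha01 x y.
  have bd : 0 <= b * d x y by rewrite mulr_ge0.
  have h1 := expR_sub1 bd.
  have h2 : expR (b * d x y) - 1 <= b * d x y * expR b.
    by apply: le_trans h1 _; rewrite ler_wpM2l// ler_expR ler_piMr.
  have h3 : (expR (b * d x y) - 1) * Re (u y) <= b * d x y * expR b * T.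
    apply: (@le_trans _ _ (b * d x y * expR b * Re (u y))); first by rewrite ler_wpM2r// (p y).2.
    by rewrite ler_wpM2l// mulr_ge0 ?expR_ge0.
  by move: h h3; rewrite mulrBl mul1r; lra.
split; first by rewrite mulr_ge0// addr_ge0.
split=> [x|x y].
  by rewrite cnE mulrDl mul1r; apply: le_trans (hT x) _; rewrite lerDl mulr_ge0.
apply: (@le_trans _ _ (b * expR b * T * d x y)); last first.
  by rewrite ler_wpM2r ?eta_dist_ge0// mulrDl mul1r lerDr.
rewrite [u x - u y]ReIm_decomp !ReE_add !ImE_add !ReE_opp !ImE_opp (p x).1 (p y).1 subrr mulr0 addr0 cn_rc.
rewrite ler_norml one_side andbT lerNl opprB.
by rewrite [d x y]eta_dist_sym; exact: one_side.
Qed.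

Lemma lip_funZ (a : K) u x : (a *: u) x = a * u x. Proof. by []. Qed.

Section deflation.
Variables (M : V -> V) (b2 b3 c KB : R).
Hypothesis linM : lin M.
Hypothesis M_pos : forall u, Vpos u -> Vpos (M u).
Hypothesis M_mono : forall (r t : R) u v, 0 <= r -> 0 <= t -> Vpos u -> Vpos v ->
  (forall x, r * Re (u x) <= t * Re (v x)) -> forall x, r * Re (M u x) <= t * Re (M v x).
Hypothesis M_cone : forall u, Vcone b2 u -> Vcone b3 (M u).
Hypothesis M_iter : forall n (C : R) u, Vpos u -> (forall x, Re (u x) <= C) ->
  forall x, Re (iter n M u x) <= C * KB.
Hypotheses (b2_ge1 : 1 <= b2) (b3_ge0 : 0 <= b3) (b32 : b3 <= b2) (KB0 : 0 <= KB).
Hypothesis cE : c = (b2 - b3) / (b2 * expR (b2 + b3)).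
Hypotheses (c_gt0 : 0 < c) (c_expR : c * expR b3 < 1).
Local Notation Q := (deflate ev0 one_lip (rc c) M).
Definition deflated_rate : R := 1 - c * expR (- b3).
Let b2_gt0 : 0 < b2. Proof. exact: lt_le_trans ltr01 b2_ge1. Qed.

Lemma deflated_rate01 : 0 <= deflated_rate < 1.
Proof.
rewrite /deflated_rate subr_ge0 ltrBlDr ltrDl mulr_gt0 ?expR_gt0// andbT.
apply: (@le_trans _ _ (c * expR b3)); last exact/ltW/c_expR.
rewrite ler_pM2l// ler_expR; have := b3_ge0; lra.
Qed.

Lemma operator_iter_pos n u : Vpos u -> Vpos (iter n M u).
Proof. by move=> hu; elim: n => //= n; exact: M_pos. Qed.

Lemma deflateE u x : Q u x = M u x - rc c * M u I01_0.
Proof.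
rewrite /deflate lip_funB; congr (_ - _).
have [_ _ _ -> _] := lip_funE (rc c * ev0 (M u)) one_lip one_lip x.
by rewrite one_lipE mulr1.
Qed.

Lemma deflate_Re u x : Vpos (M u) -> Re (Q u x) = Re (M u x) - c * Re (M u I01_0) /\ Im (Q u x) = 0.
Proof.
move=> h; rewrite deflateE ReE_add ReE_opp ImE_add ImE_opp.
have -> : rc c * M u I01_0 = rc (c * Re (M u I01_0)).
  by rewrite [M u I01_0 in LHS]ReIm_decomp (h I01_0).1 mulr0 addr0 rcM.
by rewrite (h x).1 /= subr0.
Qed.

Lemma deflate_cone u : Vcone b2 u -> Vcone b2 (Q u) /\
  forall x, Re (Q u x) <= deflated_rate * Re (M u x).
Proof.
move=> hu; have hm := M_cone hu.
pose m x := Re (M u x).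
have m0 x : 0 <= m x by have [] := hm x x.
have mle x y : m x <= expR (b3 * d x y) * m y by have [] := hm x y.
have mle1 x y : m x <= expR b3 * m y.
  apply: le_trans (mle x y) _; apply: ler_wpM2r; first exact: m0.
  rewrite ler_expR; apply: ler_piMr; first exact: b3_ge0.
  by case/andP: (eta_dist01 alpha01 x y).
have ReQ x : Re (Q u x) = m x - c * m I01_0.
  by case: (deflate_Re x (Vcone_pos hm)).
have ImQ x : Im (Q u x) = 0.
  by case: (deflate_Re x (Vcone_pos hm)).
have cs y : c * m I01_0 <= c * expR b3 * m y by rewrite -mulrA ler_pM2l.
split=> [x y|x]; last first.
  rewrite ReQ /deflated_rate mulrBl mul1r lerD2l lerN2 -mulrA ler_pM2l// mulrC expRN ler_pdivrMr ?expR_gt0// mulrC.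
  exact: mle1.
split=> //; rewrite !ReQ.
  rewrite subr_ge0; apply: le_trans (cs x) _; rewrite ler_piMl//; exact: ltW.
exact: (deflated_cone_ineq b2_gt0 b3_ge0 b32 cE (eta_dist01 alpha01 x y) (m0 y) (mle x y) (mle1 _ y)).
Qed.

Lemma dominated_iter (T : V -> V) (r : R) n u : 0 <= r ->
  (forall v, Vcone b2 v -> Vcone b2 (T v) /\ forall x, Re (T v x) <= r * Re (M v x)) ->
  Vcone b2 u -> Vcone b2 (iter n T u) /\
  forall x, Re (iter n T u x) <= r ^+ n * Re (iter n M u x).
Proof.
move=> r0 hT hu; elim: n => [|n [IH1 IH2]].
  by split=> // x; rewrite expr0 mul1r.
have [h1 h2] := hT _ IH1; rewrite !iterS; split=> // x; apply: le_trans (h2 x) _.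
rewrite exprS -mulrA; apply: ler_wpM2l => //.
have r0n : 0 <= r ^+ n by exact: exprn_ge0.
rewrite -[leLHS]mul1r.
apply: (M_mono ler01 r0n (Vcone_pos IH1) (operator_iter_pos n (Vcone_pos hu))) => y.
by rewrite mul1r.
Qed.

Lemma deflate_iter n u : Vcone b2 u -> Vcone b2 (iter n Q u) /\
  forall x, Re (iter n Q u x) <= deflated_rate ^+ n * Re (iter n M u x).
Proof.
have /andP[r0 _] := deflated_rate01.
exact: dominated_iter r0 deflate_cone.
Qed.

Let K1 := (1 + b2 * expR b2) * KB.

Lemma deflate_iter_nb n (C : R) u : Vcone b2 u -> (forall x, Re (u x) <= C) ->
  nb (K1 * C * deflated_rate ^+ n) (iter n Q u).
Proof.
move=> hu hC; have [h1 h2] := deflate_iter n hu; have /andP[r0 _] := deflated_rate01.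
rewrite (_ : _ * _ = (1 + b2 * expR b2) * (deflated_rate ^+ n * (C * KB))); last by rewrite /K1; ring.
apply: (Vcone_nb (ltW b2_gt0) h1) => x; apply: le_trans (h2 x) _; rewrite ler_wpM2l ?exprn_ge0//.
exact: (M_iter n (Vcone_pos hu) hC).
Qed.

Let linQ : lin Q. Proof. exact: deflate_lin ev0_lin _ linM. Qed.

Lemma one_cone : Vcone b2 one_lip.
Proof.
by move=> x y; rewrite !one_lipE /=; split=> //; rewrite mulr1 -[leLHS]expR0 ler_expR mulr_ge0 ?eta_dist_ge0// ltW.
Qed.

Lemma shift_cone (g : X -> R) (C : R) : 0 <= C -> (forall x, `|g x| <= C) ->
  (forall x y, `|g x - g y| <= C * d x y) ->
  let u := to_lip d (fun x => rc (g x + 2 * C)) in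
  [/\ forall x, u x = rc (g x + 2 * C), Vcone b2 u & forall x, Re (u x) <= 3 * C].
Proof.
move=> C0 h1 h2 u.
have lb : lip_bound d (3 * C) (fun x => rc (g x + 2 * C)).
  split=> [x|x y].
    rewrite cn_rc; apply: le_trans (ler_normD _ _) _; rewrite (ger0_norm (mulr_ge0 _ C0))//.
    by have := h1 x; lra.
  rewrite -rcB cn_rc opprD addrACA subrr addr0; apply: le_trans (h2 x y) _.
  by rewrite ler_wpM2r ?eta_dist_ge0//; lra.
have uE x : u x = rc (g x + 2 * C) by exact: (to_lipE _ lb).
have gl x : - C <= g x /\ g x <= C by have := h1 x; rewrite ler_norml => /andP[].
split=> // [x y|x]; rewrite !uE /=; last by have [] := gl x; lra.
have [a1 a2] := gl x; have [a3 a4] := gl y.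
split=> //; first by lra.
have /andP[d0 d1] := eta_dist01 alpha01 x y.
have k1 : 1 + b2 * d x y <= expR (b2 * d x y) by exact: expR_ge1Dx.
have k2 : g x <= g y + C * d x y by have := h2 x y; rewrite ler_norml => /andP[_]; lra.
have k3 : d x y <= b2 * d x y by rewrite ler_peMl.
have k4 : (1 + d x y) * (g y + 2 * C) <= expR (b2 * d x y) * (g y + 2 * C).
  by apply: ler_wpM2r; lra.
have k5 : C * d x y <= d x y * (g y + 2 * C) by rewrite mulrC ler_wpM2l//; lra.
by move: k4; rewrite mulrDl mul1r; lra.
Qed.

Lemma deflate_power_bop n : bop (10 * K1 * deflated_rate ^+ n) (iter n Q).
Proof.
have /andP[r0 _] := deflated_rate01.
have K10 : 0 <= K1 by apply: mulr_ge0 => //; rewrite addr_ge0// mulr_ge0 ?expR_ge0// ltW.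
have linQn : lin (iter n Q) by elim: (n) => [|m IH] // a u v; rewrite /= IH linQ.
split=> //; first by apply: mulr_ge0; [apply: mulr_ge0|apply: exprn_ge0].
move=> C u hC; have [C0 [h1 h2]] := hC.
have r1 x : `|Re (u x)| <= C by apply: le_trans (Re_le_cn _) (h1 x).
have r2 x y : `|Re (u x) - Re (u y)| <= C * d x y.
  by rewrite -ReE_opp -ReE_add; apply: le_trans (Re_le_cn _) (h2 x y).
have i1 x : `|Im (u x)| <= C by apply: le_trans (Im_le_cn _) (h1 x).
have i2 x y : `|Im (u x) - Im (u y)| <= C * d x y.
  by rewrite -ImE_opp -ImE_add; apply: le_trans (Im_le_cn _) (h2 x y).
have [E1 c1 s1] := shift_cone C0 r1 r2; set f1 := to_lip _ _ in E1 c1 s1.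
have [E2 c2 s2] := shift_cone C0 i1 i2; set f2 := to_lip _ _ in E2 c2 s2.
have uE : u = f1 + ic *: f2 - (rc (2 * C) * (1 + ic)) *: one_lip.
  apply: lip_ext => x.
  transitivity (f1 x + ic * f2 x - rc (2 * C) * (1 + ic) * one_lip x); last by [].
  by rewrite one_lipE E1 E2 [u x in LHS]ReIm_decomp !rcD; ring.
have n1 := deflate_iter_nb n c1 s1; have n2 := deflate_iter_nb n c2 s2.
have n3 : nb (K1 * 1 * deflated_rate ^+ n) (iter n Q one_lip).
  by apply: (deflate_iter_nb n one_cone) => x; rewrite one_lipE.
have -> : iter n Q u = iter n Q f1 + ic *: iter n Q f2 - (rc (2 * C) * (1 + ic)) *: iter n Q one_lip.
  by rewrite {1}uE (linB _ _ linQn) (linD linQn) (linZ _ _ linQn) (linZ _ _ linQn).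
have n4 := nbB (nbS alpha01) (nbD (nbS alpha01) n1 (nbZ (nbS alpha01) ic n2)) (nbZ (nbS alpha01) (rc (2 * C) * (1 + ic)) n3).
apply: (nb_le (nbS alpha01) n4).
have c4 : cn (rc (2 * C) * (1 + ic)) <= 4 * C.
  rewrite cnM cn_rc ger0_norm; last by rewrite mulr_ge0.
  have : cn (1 + ic : K) <= 2 by apply: le_trans (cnD _ _) _; rewrite cn1 cn_ic; lra.
  have C20 : 0 <= 2 * C by lra.
  by move=> /(ler_wpM2l C20); lra.
rewrite cn_ic mul1r mulr1.
have P0 : 0 <= K1 * deflated_rate ^+ n by apply: mulr_ge0 => //; exact: exprn_ge0.
by have := ler_wpM2r P0 c4; lra.
Qed.

Lemma neumann_cone (T R0 : V -> V) (cc r : R) u : 0 <= r < 1 ->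
  (forall v, Vcone b2 v -> forall k, Vcone b2 (iter k T v)) ->
  (forall L, bop (cc * r ^+ L / (1 - r)) (fun v => R0 v - \sum_(k < L) iter k T v)) ->
  Vcone b2 u -> Vcone b2 (R0 u) /\ forall x, Re (u x) <= Re (R0 u x).
Proof.
move=> r01 hT h4 hu.
have [C hC] : exists C, nb C u by have [_ _ h _ _] := nbS alpha01; exact: h.
pose cR := cc / (1 - r) * C.
have app L x : cn (R0 u x - \sum_(k < L) iter k T u x) <= cR * r ^+ L.
  have [_ [h _]] := bop_nb (h4 L) hC; have h' := h x; rewrite lip_funB in h'.
  have E : (\sum_(k < L) iter k T u) x = \sum_(k < L) iter k T u x := lip_fun_sum L (fun k => iter k T u) x.
  rewrite E in h'; apply: le_trans h' _; rewrite le_eqVlt; apply/orP; left; apply/eqP; rewrite /cR; ring.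
have ReS L x : Re (\sum_(k < L) iter k T u x) = \sum_(k < L) Re (iter k T u x).
  by elim: L => [|L IH]; rewrite ?big_ord0// !big_ord_recr ReE_add IH.
have ImS L x : Im (\sum_(k < L) iter k T u x) = 0.
  elim: L => [|L IH]; first by rewrite big_ord0.
  by rewrite big_ord_recr ImE_add IH (Vcone_pos (hT u hu L) x).1 addr0.
have close e : 0 < e -> exists L, (0 < L)%N /\ forall x, `|Re (R0 u x) - \sum_(k < L) Re (iter k T u x)| <= e.
  move=> e0; have [L hL] := geometric_small cR r01 e0.
  exists L.+1; split=> // x; apply: le_trans (hL L.+1 (leqnSn _)); apply: le_trans (app L.+1 x).
  by apply: le_trans (Re_le_cn _); rewrite ReE_add ReE_opp ReS.
have low x : Re (u x) <= Re (R0 u x).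
  apply: le_eps => e e0; have [L' [L0 hL]] := close e e0; case: L' L0 hL => // L _ hL.
  have := hL x; rewrite ler_norml => /andP[k _].
  have : 0 <= \sum_(i < L) Re (iter i.+1 T u x).
    by apply: sumr_ge0 => i _; exact: (Vcone_pos (hT u hu i.+1) x).2.
  by move: k; rewrite big_ord_recl /=; lra.
split=> // x y; split.
- apply/eqP; rewrite -normr_le0; apply: le_eps => e e0; rewrite add0r.
  have [L hL] := geometric_small cR r01 e0; apply: le_trans (hL L (leqnn L)).
  apply: le_trans (app L x); apply: le_trans (Im_le_cn _).
  by rewrite ImE_add ImE_opp ImS subr0.
- by apply: le_trans (low x); exact: (Vcone_pos hu x).2.
set E := expR _; have E0 : 0 < E by exact: expR_gt0.
apply: le_eps => e e0; have e1 : 0 < e / (E + 1) by rewrite divr_gt0// addr_gt0.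
have [L [_ hL]] := close _ e1.
have := hL x; have := hL y; rewrite !ler_norml => /andP[k1 _] /andP[_ k2].
have k3 : \sum_(k < L) Re (iter k T u x) <= E * \sum_(k < L) Re (iter k T u y).
  by rewrite mulr_sumr; apply: ler_sum => k _; have [] := (hT u hu k) x y.
have k4 : E * \sum_(k < L) Re (iter k T u y) <= E * (Re (R0 u y) + e / (E + 1)).
  by rewrite ler_pM2l//; lra.
have k5 : e / (E + 1) + E * (e / (E + 1)) = e by field; rewrite gt_eqF// addr_gt0.
by move: k4; rewrite mulrDr; lra.
Qed.

Lemma deflated_resolvent : exists R0 : V -> V, exists s,
  [/\ bop s R0, resolvent Q R0 & forall u, Vcone b2 u -> Vcone b2 (R0 u) /\ forall x, Re (u x) <= Re (R0 u x)].
Proof.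
have [R0 [h1 h2 h3 h4]] := neumann (nbS alpha01) deflated_rate01 linQ deflate_power_bop.
exists R0, (10 * K1 / (1 - deflated_rate)); split=> // u hu.
apply: (neumann_cone deflated_rate01 _ h4 hu) => v hv k.
by have [] := deflate_iter k hv.
Qed.

End deflation.

Variables (psi : X -> R) (A th : R).
Hypothesis A0 : 0 <= A.
Hypothesis hpsi : rholder alpha A psi.
Hypothesis th01 : 0 < th < 1.
Let th01' : 0 <= th < 1. Proof. by case/andP: th01 => /ltW -> ->. Qed.
Local Notation B := (cone_rate alpha A).
Local Notation one := (fun _ : X => 1 : R).
Local Notation iterm := (inner_term alpha01 psi).

Definition real_weight k x : K := rc (expR (birkhoff alpha01 psi (rcons (nseq k false) true) x)).
Definition coef_sum (a : nat -> R) L (g : X -> R) x := \sum_(k < L) a k * iterm k g x.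

Let is_weighted w S := is_weighted alpha01 th w S.

Section coefficients.
Variables (a : nat -> R) (S : V -> V).
Hypothesis a0 : forall k, 0 <= a k.
Hypothesis hS : is_weighted (fun k x => rc (a k) * real_weight k x) S.

Lemma weighted_approx u : Vreal u -> (forall x, Im (S u x) = 0) /\
  forall e : R, 0 < e -> exists L0 : nat, forall L, (L0 <= L)%N -> forall x,
    `|Re (S u x) - coef_sum a L (fun y => Re (u y)) x| <= e.
Proof.
move=> hu; have [_ [c hc]] := hS.
have [C hC] : exists C, nb C u by have [_ _ h _ _] := nbS alpha01; exact: h.
have sumE L x : \sum_(k < L) rc (a k) * real_weight k x * u (exc k x) = rc (coef_sum a L (fun y => Re (u y)) x).
  rewrite /coef_sum (rc_sum L (fun k => a k * iterm k (fun y => Re (u y)) x)); apply: eq_bigr => k _.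
  rewrite /inner_term !rcM -mulrA; congr (_ * (_ * _)).
  by rewrite [u _]ReIm_decomp hu mulr0 addr0 /=.
have est L x : cn (S u x - rc (coef_sum a L (fun y => Re (u y)) x)) <= c * C * th ^+ L.
  by have [h _] := hc L C u hC; have := h x; rewrite sumE mulrAC.
split=> [x|e e0].
  apply/eqP; rewrite -normr_le0; apply: le_eps => e e0; rewrite add0r.
  have [L hL] := geometric_small (c * C) th01' e0; apply: le_trans (hL L (leqnn L)).
  by apply: le_trans (est L x); apply: le_trans (Im_le_cn _); rewrite ImE_add ImE_opp /= subr0.
have [L0 hL] := geometric_small (c * C) th01' e0; exists L0 => L LL x.
apply: le_trans (hL L LL); apply: le_trans (est L x).
by apply: le_trans (Re_le_cn _); rewrite ReE_add ReE_opp.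
Qed.

Lemma weighted_ge u L x : Vpos u -> coef_sum a L (fun y => Re (u y)) x <= Re (S u x).
Proof.
move=> hu; have [_ h] := weighted_approx (fun x => (hu x).1).
apply: le_eps => e e0; have [L0 hL] := h e e0.
have := hL (maxn L L0) (leq_maxr _ _) x; rewrite ler_norml => /andP[k1 _].
suff : coef_sum a L (fun y => Re (u y)) x <= coef_sum a (maxn L L0) (fun y => Re (u y)) x by lra.
rewrite -[in leRHS](subnKC (leq_maxl L L0)) /coef_sum big_split_ord /= lerDl sumr_ge0// => k _.
by rewrite mulr_ge0// mulr_ge0 ?expR_ge0// (hu _).2.
Qed.

Lemma weighted_pos u : Vpos u -> Vpos (S u).
Proof.
move=> hu x; have [h _] := weighted_approx (fun x => (hu x).1); split=> //.
by have := weighted_ge 0 x hu; rewrite /coef_sum big_ord0.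
Qed.

Lemma weighted_cone b u : 0 <= b -> Vcone b u ->
  Vcone (2 / dexp alpha * A + b * rate) (S u).
Proof.
move=> b0 hu x y; have hp := Vcone_pos hu; have [k1 k2] := weighted_pos hp x; split=> //.
have [_ h] := weighted_approx (fun x => (hp x).1).
set E := expR _; have E0 : 0 < E by exact: expR_gt0.
apply: le_eps => e e0; have e1 : 0 < e / (E + 1) by rewrite divr_gt0// addr_gt0.
have [L hL] := h _ e1.
have := hL L (leqnn L) x; have := hL L (leqnn L) y; rewrite !ler_norml => /andP[_ k3] /andP[_ k4].
have rcu : rcone alpha b (fun z => Re (u z)) by move=> z t; have [] := hu z t.
have k5 : coef_sum a L (fun z => Re (u z)) x <= E * coef_sum a L (fun z => Re (u z)) y.
  rewrite /coef_sum mulr_sumr; apply: ler_sum => k _; rewrite [E * _]mulrCA ler_wpM2l//.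
  by have [_] := inner_term_cone alpha01 A0 hpsi k b0 rcu x y.
have k7 := weighted_ge L y hp.
have k6 : E * coef_sum a L (fun z => Re (u z)) y <= E * Re (S u y) by rewrite ler_pM2l.
have k8 : e / (E + 1) <= e by rewrite ler_pdivrMr ?addr_gt0// mulrDr mulr1 lerDr mulr_ge0// ltW.
by lra.
Qed.

Lemma weighted_mono u v : Vpos u -> Vpos (v - u) -> forall x, Re (S u x) <= Re (S v x).
Proof.
move=> hu hv x; have := (weighted_pos hv x).2.
have -> : S (v - u) = S v - S u by rewrite (linB _ _ hS.1).
by rewrite lip_funB ReE_add ReE_opp subr_ge0.
Qed.
Lemma weighted_mono_scale (r t : R) u v : 0 <= r -> 0 <= t -> Vpos u -> Vpos v ->
  (forall x, r * Re (u x) <= t * Re (v x)) -> forall x, r * Re (S u x) <= t * Re (S v x).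
Proof.
move=> r0 t0 hu hv h x.
have hu' : Vpos (rc r *: u).
  move=> y; rewrite lip_funZ ImE_mul ReE_mul /= (hu y).1 !mulr0 mul0r addr0 subr0.
  by split=> //; rewrite mulr_ge0// (hu y).2.
have hv' : Vpos (rc t *: v - rc r *: u).
  move=> y; rewrite lip_funB !lip_funZ ImE_add ImE_opp !ImE_mul ReE_add ReE_opp !ReE_mul /= (hu y).1 (hv y).1.
  by rewrite !mulr0 !mul0r !addr0 !subr0 subr_ge0; split=> //; exact: h.
have := weighted_mono hu' hv' x; rewrite !(linZ _ _ hS.1) !lip_funZ !ReE_mul /=.
by rewrite !mul0r !subr0.
Qed.
End coefficients.

Variable M : V -> V.
Hypothesis hM : is_weighted real_weight M.
Let hM1 : is_weighted (fun k x => rc 1 * real_weight k x) M.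
Proof. by apply: (weighted_ext _ hM) => k x; rewrite mul1r. Qed.
Let ones : forall k : nat, (0 : R) <= (fun _ => 1) k. Proof. by []. Qed.
Let linM : lin M. Proof. by case: hM. Qed.

Lemma coef_sum1 L g x : coef_sum (fun=> 1) L g x = induced alpha01 psi L g x.
Proof. by apply: eq_bigr => k _; rewrite mul1r. Qed.

Hypothesis growth : growth_le alpha01 psi 0.

Let operator_iter_pos n u : Vpos u -> Vpos (iter n M u).
Proof. by move=> hu; elim: n => //= n; exact: (weighted_pos ones hM1). Qed.

Lemma operator_iter_le n (C : R) u : Vpos u -> (forall x, Re (u x) <= C) ->
  forall x, Re (iter n M u x) <= C * expR B.
Proof.
move=> hu hC.
have C0 : 0 <= C := le_trans (hu I01_0).2 (hC I01_0).
have bnd L m x : iter m (induced alpha01 psi L) one x <= expR B.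
  exact: growth_bounded_induced A0 hpsi growth L m x.
have key m (e : R) : 0 < e -> exists L0 : nat, forall L, (L0 <= L)%N -> forall x,
    Re (iter m M u x) <= C * iter m (induced alpha01 psi L) one x + e.
  elim: m e => [|m IH] e e0.
    by exists 0%N => L _ x /=; rewrite mulr1; apply: le_trans (hC x) _; rewrite lerDl ltW.
  have e1 : 0 < e / 2 / expR B by rewrite !divr_gt0// expR_gt0.
  have e2 : 0 < e / 2 by rewrite divr_gt0.
  have [L1 h1] := IH _ e1.
  have hp := operator_iter_pos m hu.
  have [_ h] := weighted_approx hM1 (fun x => (hp x).1).
  have [L2 h2] := h _ e2; exists (maxn L1 L2) => L LL x.
  have l1 : (L1 <= L)%N by apply: leq_trans LL; exact: leq_maxl.
  have l2 : (L2 <= L)%N by apply: leq_trans LL; exact: leq_maxr.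
  have := h2 L l2 x; rewrite coef_sum1 ler_norml => /andP[_ k1].
  have k2 := induced_le alpha01 psi L (h1 L l1) x.
  have k3 : induced alpha01 psi L (fun y => C * iter m (induced alpha01 psi L) one y + e / 2 / expR B) x =
      C * iter m.+1 (induced alpha01 psi L) one x + e / 2 / expR B * induced alpha01 psi L one x.
    rewrite induced_linear; congr (_ + _); rewrite /induced mulr_sumr; apply: eq_bigr => k _.
    by rewrite /inner_term; ring.
  have k4 : e / 2 / expR B * induced alpha01 psi L one x <= e / 2.
    by rewrite mulrAC ler_pdivrMr ?expR_gt0// ler_pM2l//; exact: (bnd L 1%N x).
  by move: k1 k2; rewrite k3 /=; lra.
move=> x; apply: le_eps => e e0; have [L hL] := key n e e0.
apply: le_trans (hL L (leqnn L) x) _; rewrite lerD2r ler_wpM2l//; exact: bnd.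
Qed.

Local Notation B2 := (B + 1).
Local Notation B3 := (B + rate).
Definition defl : R := (1 - rate) / (B2 * expR (B2 + B3)).
Local Notation Q := (deflate ev0 one_lip (rc defl) M).

Let B0 : 0 <= B. Proof. exact: cone_rate_ge0. Qed.
Let rate01 : 0 < rate < 1. Proof. exact: eta_rate01. Qed.
Let B2_gt0 : 0 < B2. Proof. by rewrite ltr_wpDl. Qed.

Lemma defl_gt0 : 0 < defl.
Proof. by have /andP[_ h] := rate01; rewrite divr_gt0 ?subr_gt0// mulr_gt0 ?expR_gt0. Qed.

Lemma defl_expR : defl * expR B3 < 1.
Proof.
have /andP[h0 h1] := rate01; rewrite /defl expRD mulrA mulrAC ltr_pdivrMr; last first.
  by rewrite !mulr_gt0 ?expR_gt0.
rewrite mul1r ltr_pM2r ?expR_gt0//.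
have e1 : 1 <= expR B2 by rewrite -[leLHS]expR0 ler_expR ltW.
have : 1 * 1 <= B2 * expR B2 by apply: ler_pM => //; rewrite lerDr.
by lra.
Qed.

Lemma base_cone u : Vcone B2 u -> Vcone B3 (M u).
Proof.
move=> hu; have := weighted_cone ones hM1 (ltW B2_gt0) hu.
by rewrite (_ : 2 / dexp alpha * A + B2 * rate = B3)//; have := cone_rateE alpha01 A; lra.
Qed.

Lemma base_resolvent : exists R0 : V -> V, exists s,
  [/\ bop s R0, resolvent Q R0 & forall u, Vcone B2 u -> Vcone B2 (R0 u) /\ forall x, Re (u x) <= Re (R0 u x)].
Proof.
have /andP[r0 r1] := rate01.
apply: (deflated_resolvent linM (weighted_pos ones hM1) (weighted_mono_scale ones hM1) base_cone operator_iter_le).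
- by rewrite lerDr.
- by rewrite addr_ge0// ltW.
- by rewrite lerD2l ltW.
- exact: expR_ge0.
- by rewrite /defl; congr (_ / _); ring.
- exact: defl_gt0.
- exact: defl_expR.
Qed.

Lemma weighted_sum_le (L : nat) (t : R) : 0 <= t < 1 ->
  \sum_(k < L) k.+1%:R * t ^+ k <= 1 / (1 - t) ^+ 2.
Proof.
move=> /andP[t0 t1]; have d0 : 0 < 1 - t by rewrite subr_gt0.
rewrite ler_pdivlMr ?exprn_gt0//.
have E : (\sum_(k < L) k.+1%:R * t ^+ k) * (1 - t) ^+ 2 = 1 - t ^+ L * (L.+1%:R - L%:R * t).
  elim: L => [|L IH]; first by rewrite big_ord0 expr0; ring.
  rewrite big_ord_recr mulrDl IH [t ^+ L.+1]exprS /= -[L.+2]addn2 -[L.+1]addn1 !natrD; ring.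
rewrite E lerBlDr lerDl mulr_ge0 ?exprn_ge0// subr_ge0.
have h : L%:R * t <= L%:R by rewrite ler_piMr// ltW.
by apply: le_trans h _; rewrite ler_nat.
Qed.

Lemma induced_subc (eps : R) L g x : induced alpha01 (fun y => psi y - (- eps)) L g x =
  \sum_(k < L) expR (k.+1%:R * eps) * iterm k g x.
Proof.
apply: eq_bigr => k _; rewrite /inner_term birkhoff_subc size_rcons size_nseq.
by rewrite mulrN opprK addrC expRD mulrA.
Qed.

Hypothesis psi_neg : psi I01_0 < 0.
Hypothesis minimal : forall p : R, p < 0 -> ~ growth_le alpha01 psi p.
Variable c0 : R.
Hypothesis decay : forall k x, expR (birkhoff alpha01 psi (rcons (nseq k false) true) x) <= c0 * th ^+ k.

Lemma subinvariant_growth (G : X -> R) (Cg f : R) : (forall x, 1 <= G x <= Cg) -> 0 < f ->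
  (forall L x, induced alpha01 psi L G x <= G x - f) -> exists2 p : R, p < 0 & growth_le alpha01 psi p.
Proof.
move=> hG f0 hI; have /andP[t0 t1] := th01.
have Cg1 : 1 <= Cg by have /andP[a b] := hG I01_0; exact: le_trans a b.
have c00 : 0 < c0 by have := lt_le_trans (expR_gt0 _) (decay 0 I01_0); rewrite expr0 mulr1.
pose t := (1 + th) / 2.
have tt : th < t < 1 by rewrite /t; apply/andP; split; lra.
have /andP[tt0 tt1] := tt.
have l0 : 0 < ln (t / th) by rewrite ln_gt0// ltr_pdivlMr// mul1r.
pose e3 := f * (1 - t) ^+ 2 / (t / th * c0 * Cg).
have tth : 0 < t / th by rewrite divr_gt0// (lt_trans t0).
have Cg0 : 0 < Cg by exact: lt_le_trans Cg1.
have p0 : 0 < t / th * c0 * Cg := mulr_gt0 (mulr_gt0 tth c00) Cg0.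
have e30 : 0 < e3 by rewrite divr_gt0// mulr_gt0// exprn_gt0// subr_gt0.
pose eps := Num.min (- psi I01_0) (Num.min (ln (t / th)) e3).
have eps0 : 0 < eps by rewrite !lt_min oppr_gt0 psi_neg l0.
have eps1 : eps <= - psi I01_0 by rewrite ge_min lexx.
have eps2 : expR eps <= t / th.
  by rewrite -[leRHS]lnK ?posrE// ler_expR /eps !ge_min lexx orbT.
have eps3 : eps <= e3 by rewrite /eps !ge_min lexx !orbT.
exists (- eps); first by rewrite oppr_lt0.
apply/(growth_subc alpha01 psi (- eps) (- eps)); rewrite subrr.
have hpsi' : rholder alpha A (fun y => psi y - (- eps)).
  by move=> x y; rewrite opprD addrACA subrr addr0; exact: hpsi.
have pw k : expR (k.+1%:R * eps) * th ^+ k <= t / th * t ^+ k.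
  have -> : expR (k.+1%:R * eps) = expR eps * expR eps ^+ k by rewrite -exprS -expRM_natl.
  rewrite -mulrA -exprMn; apply: ler_pM; rewrite ?expR_ge0 ?exprn_ge0 ?mulr_ge0 ?expR_ge0 ?(ltW t0)//.
  rewrite lerXn2r ?nnegrE ?mulr_ge0 ?expR_ge0 ?(ltW t0)//; first by lra.
  by rewrite -ler_pdivlMr.
have step L x : induced alpha01 (fun y => psi y - (- eps)) L G x <= G x.
  rewrite induced_subc.
  have h1 k : expR (k.+1%:R * eps) * iterm k G x <= iterm k G x + eps * (t / th * c0 * Cg) * (k.+1%:R * t ^+ k).
    have ke : 0 <= k.+1%:R * eps by rewrite mulr_ge0// ltW.
    have := expR_sub1 ke; set E := expR _ => a1.
    have a2 : 0 <= iterm k G x by rewrite mulr_ge0 ?expR_ge0// (le_trans ler01)//; case/andP: (hG (exc k x)).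
    have a3 : iterm k G x <= c0 * th ^+ k * Cg.
      apply: ler_pM; rewrite ?expR_ge0 ?decay//; last by case/andP: (hG (exc k x)).
      by apply: le_trans ler01 _; case/andP: (hG (exc k x)).
    have a4 : (E - 1) * iterm k G x <= k.+1%:R * eps * E * (c0 * th ^+ k * Cg).
      apply: (@le_trans _ _ (k.+1%:R * eps * E * iterm k G x)); first by rewrite ler_wpM2r.
      by rewrite ler_wpM2l// mulr_ge0// expR_ge0.
    have a5 : k.+1%:R * eps * E * (c0 * th ^+ k * Cg) <= eps * (t / th * c0 * Cg) * (k.+1%:R * t ^+ k).
      rewrite (_ : _ * (c0 * th ^+ k * Cg) = (k.+1%:R * eps * c0 * Cg) * (E * th ^+ k)); last by ring.
      rewrite (_ : eps * _ * _ = (k.+1%:R * eps * c0 * Cg) * (t / th * t ^+ k)); last by ring.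
      by rewrite ler_wpM2l ?pw// !mulr_ge0// ?ltW// (lt_le_trans ltr01).
    by move: a4; rewrite mulrBl mul1r; lra.
  apply: (@le_trans _ _ (\sum_(k < L) (iterm k G x + eps * (t / th * c0 * Cg) * (k.+1%:R * t ^+ k)))).
    by apply: ler_sum => k _; exact: h1.
  rewrite big_split /= -mulr_sumr.
  have b1 := hI L x; rewrite /induced in b1.
  have t01' : 0 <= t < 1 by rewrite tt1 andbT; apply: le_trans (ltW t0) (ltW tt0).
  have b2 := weighted_sum_le L t01'.
  have b3 : eps * (t / th * c0 * Cg) * \sum_(k < L) k.+1%:R * t ^+ k <= f.
    apply: (@le_trans _ _ (e3 * (t / th * c0 * Cg) * (1 / (1 - t) ^+ 2))).
      apply: ler_pM => //; [by rewrite mulr_ge0 ?ltW|by apply: sumr_ge0 => k _; rewrite mulr_ge0// exprn_ge0//; case/andP: t01'|by rewrite ler_pM2r].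
    rewrite /e3 divfK ?gt_eqF// mul1r mulfK// gt_eqF// exprn_gt0// subr_gt0//.
  by lra.
apply: (bounded_induced_growth A0 hpsi' (K := Cg)); first by lra.
move=> L n x; apply: (@le_trans _ _ (G x)); last by case/andP: (hG x).
elim: n x => [|n IH] x /=; first by case/andP: (hG x).
by apply: le_trans (step L x); exact: induced_le.
Qed.

Lemma base_lead : exists R0 : V -> V, exists s,
  [/\ bop s R0, resolvent Q R0, lead ev0 one_lip (rc defl) M R0 = 0 &
    forall M1, is_weighted (fun k x => rc k.+1%:R * real_weight k x) M1 ->
      lead_dual ev0 one_lip (rc defl) M R0 (M1 (R0 one_lip)) != 0].
Proof.
have [R0 [s [hb hr hc]]] := base_resolvent.
have B21 : 1 <= B2 by rewrite lerDr.
have [cG lG] := hc _ (one_cone B21); set G := R0 one_lip in cG lG.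
have pG := Vcone_pos cG.
pose g x := Re (G x).
have g1 x : 1 <= g x by have := lG x; rewrite one_lipE.
have [Cg hCg] : exists Cg, forall x, g x <= Cg.
  have [C hC] : exists C, nb C G by have [_ _ h _ _] := nbS alpha01; exact: h.
  by exists C => x; have [_ [h _]] := hC; apply: le_trans (h x); apply: le_trans (ler_norm _) (Re_le_cn _).
have Cg1 : 1 <= Cg := le_trans (g1 I01_0) (hCg I01_0).
have c0' := defl_gt0.
pose F := lead ev0 one_lip (rc defl) M R0.
have pMG := weighted_pos ones hM1 pG.
have FE : F = rc (defl * Re (M G I01_0) - 1).
  rewrite /F /lead -/G /ev0 [M G I01_0]ReIm_decomp (pMG I01_0).1 mulr0 addr0.
  by rewrite rcB rcM.
set fr := defl * _ - 1 in FE.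
have MG x : Re (M G x) = g x + fr.
  have := hr.1 one_lip; rewrite -/G => /(congr1 (fun v : V => Re (v x))).
  rewrite lip_funB ReE_add ReE_opp deflateE ReE_add ReE_opp ReE_mul /= mul0r subr0 one_lipE /=.
  by rewrite /fr /g; lra.
have fr0 : fr = 0.
  apply/eqP; rewrite eq_le; apply/andP; split; rewrite leNgt; apply/negP => f0.
    pose de := fr / Cg; have de0 : 0 < de by rewrite divr_gt0// (lt_le_trans ltr01).
    have it n x : (1 + n%:R * de) * g x <= Re (iter n M G x).
      elim: n x => [|n IH] x; first by rewrite mul0r addr0 mul1r.
      have q0 : 0 <= 1 + n%:R * de by rewrite addr_ge0// mulr_ge0// ltW.
      have := weighted_mono_scale ones hM1 q0 ler01 pG (operator_iter_pos n pG) _ x.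
      rewrite mul1r MG => h; apply: le_trans (h _); last by move=> y; rewrite mul1r; exact: IH.
      have k1 : de * g x <= fr by rewrite /de mulrAC ler_pdivrMr ?(lt_le_trans ltr01)// ler_pM2l.
      have k2 : fr <= (1 + n%:R * de) * fr by rewrite ler_peMl ?(ltW f0)// lerDl mulr_ge0// ltW.
      by rewrite -natr1 !mulrDl mul1r; lra.
    have up n := operator_iter_le n pG hCg I01_0.
    have := truncnS_gt (Cg * expR B / de); set n := (Num.truncn _).+1.
    rewrite ltr_pdivrMr// => k.
    have := le_trans (it n I01_0) (up n).
    have k2 : 1 + n%:R * de <= (1 + n%:R * de) * g I01_0.
      by rewrite ler_peMr// addr_ge0// mulr_ge0// ltW.
    by lra.
  have hI L x : induced alpha01 psi L g x <= g x - (- fr).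
    by have := weighted_ge ones hM1 L x pG; rewrite coef_sum1 MG opprK.
  have hg x : 1 <= g x <= Cg by rewrite g1 hCg.
  have f0' : 0 < - fr by rewrite oppr_gt0.
  by have [p p0] := subinvariant_growth hg f0' hI; exact: minimal.
have F0 : lead ev0 one_lip (rc defl) M R0 = 0 by rewrite -/F FE fr0.
exists R0, s; split=> // M1 hM1'.
have k0 k : 0 <= k.+1%:R :> R by [].
rewrite /lead_dual F0 mulr0 mul0r subr0 -/G.
have r01 := rate01; have /andP[r0 r1] := r01.
have cv : Vcone B2 (M1 G).
  apply: (@Vcone_le (2 / dexp alpha * A + B2 * rate)); last first.
    exact: (weighted_cone k0 hM1' (ltW B2_gt0) cG).
  by have := cone_rateE alpha01 A; rewrite mulrDl mul1r; lra.
have [cR lR] := hc _ cv.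
have v0 x : 0 < Re (M1 G x).
  apply: lt_le_trans (weighted_ge k0 hM1' 1 x (Vcone_pos cG)).
  rewrite /coef_sum big_ord_recl big_ord0 addr0 mul1r mulr_gt0 ?expR_gt0//.
  by apply: lt_le_trans ltr01 _; exact: g1.
have m0 : 0 < Re (M (R0 (M1 G)) I01_0).
  apply: lt_le_trans (weighted_ge ones hM1 1 I01_0 (Vcone_pos cR)).
  rewrite /coef_sum big_ord_recl big_ord0 addr0 mul1r mulr_gt0 ?expR_gt0//.
  by apply: lt_le_trans (lR _); exact: v0.
rewrite mulf_neq0//; apply/eqP => /(congr1 (@complex.Re R)) /=.
  by move=> h; rewrite h ltxx in c0'.
by rewrite /ev0 => h; rewrite h ltxx in m0.
Qed.

End real_base_operator.

(** * Analyticity of the pressure *)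

Ltac lemono := first [by [] | exact: lexx | apply: ler_pM; [by nonneg|by nonneg|lemono|lemono]].

Section perturbed_weights.
Context {R : realType} (alpha : R).
Hypothesis alpha01 : 0 < alpha <= 1.
Local Notation K := R[i].
Local Notation X := (@I01 R).
Local Notation d := (eta_dist alpha).
Local Notation exc := (excursion alpha01).
Local Notation D1 := (dist_const alpha).
Variables (psi : X -> R) (A s : R).
Hypothesis A0 : 0 <= A.
Hypothesis hpsi : rholder alpha A psi.
Hypothesis s0 : 0 < s.
Hypothesis psi_s : psi I01_0 = - s.
Implicit Types (chi : X -> K) (e a : R).

Let th0 : R := expR (- (s / 2)).
Definition family_rate : R := expR (- (s / 4)).
Local Notation th := family_rate.
Local Notation rw := (real_weight alpha01 psi).

Lemma family_rate01 : 0 < th < 1.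
Proof. by rewrite expR_gt0 -[ltRHS]expR0 ltr_expR oppr_lt0 divr_gt0. Qed.

Lemma lip_bound_weaken C C' (u : X -> K) : lip_bound d C u -> C <= C' -> lip_bound d C' u.
Proof. by move=> h; exact: (lip_bound_le (eta_dist01 alpha01) h). Qed.

Lemma real_weight_bound : exists2 c : R, 0 <= c & forall k, lip_bound d (c * th0 ^+ k) (rw k).
Proof.
have e1 : 0 < s / 2 / (A + 1) by rewrite !divr_gt0// ltr_wpDl.
have [C hC] := orbit_sum_sublinear alpha01 e1.
pose Bs := `|psi I01_0| + A.
pose c1 := expR (A * C + Bs).
have sup k x : expR (birkhoff alpha01 psi (rcons (nseq k false) true) x) <= c1 * th0 ^+ k.
  rewrite /c1 /th0 -expRM_natl -expRD ler_expR birkhoff_excursionS.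
  have := birkhoff_zeros_near alpha01 A0 hpsi k (branch alpha01 true x).
  rewrite psi_s ler_norml => /andP[_ h1].
  have := rholder_bound alpha01 A0 hpsi (branch alpha01 true x); rewrite ler_norml -/Bs => /andP[_ h2].
  have h3 : A * orbit_sum alpha k <= A * (s / 2 / (A + 1) * k%:R + C) by rewrite ler_wpM2l.
  have h4 : A * (s / 2 / (A + 1) * k%:R) <= k%:R * (s / 2).
    rewrite mulrA mulrC ler_wpM2l// mulrA ler_pdivrMr ?ltr_wpDl//.
    by rewrite mulrDr mulr1 mulrC lerDl divr_ge0// ltW.
  by move: h1 h3 h4; rewrite [A * (_ + C)]mulrDr mulrN mulrN; lra.
pose A1 := D1 * A.
have A10 : 0 <= A1 by rewrite mulr_ge0//; have := dist_const_ge1 alpha01; lra.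
exists (c1 * (1 + 5 * A1 * expR A1)).
  by rewrite mulr_ge0 ?expR_ge0// addr_ge0// mulr_ge0 ?expR_ge0// mulr_ge0.
move=> k; have p0 : 0 <= 5 * A1 * expR A1 by rewrite mulr_ge0 ?expR_ge0// mulr_ge0.
have q0 : 0 <= c1 * th0 ^+ k by rewrite mulr_ge0 ?exprn_ge0 ?expR_ge0.
have q1 : 0 <= c1 * th0 ^+ k * (5 * A1 * expR A1) by rewrite mulr_ge0.
split=> [x|x y].
  rewrite cn_rc ger0_norm ?expR_ge0//; apply: le_trans (sup k x) _.
  by lra.
set Sx := birkhoff alpha01 psi (rcons (nseq k false) true).
have hv : `|Sx x - Sx y| <= A1 * d x y.
  by have := birkhoff_excursion_var alpha01 A0 hpsi k x y.
have /andP[d0 d1] := eta_dist01 alpha01 x y.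
have hv1 : `|Sx x - Sx y| <= A1 by apply: le_trans hv _; rewrite ler_piMr.
have -> : rw k x - rw k y = rc (expR (Sx y)) * (cexp (rc (Sx x - Sx y)) - 1).
  rewrite cexp_rc mulrBr mulr1 -rcM -expRD; congr (rc (expR _) - _).
  by rewrite -/(Sx x); ring.
rewrite cnM cn_rc ger0_norm ?expR_ge0//.
apply: (@le_trans _ _ (c1 * th0 ^+ k * (5 * (A1 * d x y) * expR A1))).
  apply: ler_pM; rewrite ?expR_ge0 ?cn_ge0//; first exact: sup.
  apply: le_trans (cexp_bound1 _) _; rewrite cn_rc; apply: ler_pM; rewrite ?expR_ge0 ?ler_expR//.
  by apply: ler_wpM2l.
rewrite (_ : _ * (5 * (A1 * d x y) * expR A1) = c1 * th0 ^+ k * (5 * A1 * expR A1) * d x y); last by ring.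
by rewrite ler_wpM2r//; lra.
Qed.

Lemma absorb_cube : exists2 C : R, 0 <= C & forall k,
  k.+1%:R ^+ 3 * expR (k.+1%:R * (s / 8)) * th0 ^+ k <= C * th ^+ k.
Proof.
exists ((24 / s) ^+ 3 * expR (s / 4)); first by rewrite mulr_ge0 ?expR_ge0// exprn_ge0// divr_ge0// ltW.
move=> k; pose y := k.+1%:R * (s / 24).
have y1 : k.+1%:R <= 24 / s * expR y.
  have := expR_ge1Dx y; have -> : k.+1%:R = 24 / s * y by rewrite /y; field; rewrite gt_eqF.
  by move=> h; rewrite ler_wpM2l ?divr_ge0 ?ltW//; lra.
have y3 : k.+1%:R ^+ 3 <= (24 / s) ^+ 3 * expR (3 * y).
  rewrite expRM_natl -exprMn; apply: lerXn2r => //; rewrite nnegrE//.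
  by rewrite mulr_ge0 ?expR_ge0// divr_ge0// ltW.
apply: (@le_trans _ _ ((24 / s) ^+ 3 * expR (3 * y) * expR (k.+1%:R * (s / 8)) * th0 ^+ k)).
  by rewrite ler_wpM2r ?exprn_ge0 ?expR_ge0// ler_wpM2r ?expR_ge0.
rewrite (_ : _ * th0 ^+ k = (24 / s) ^+ 3 * (expR (3 * y) * expR (k.+1%:R * (s / 8)) * th0 ^+ k)); last by ring.
rewrite -[leRHS]mulrA; apply: ler_wpM2l; first by rewrite exprn_ge0// divr_ge0// ltW.
rewrite /th0 /th -!expRM_natl -!expRD ler_expR /y -natr1 le_eqVlt; apply/orP; left; apply/eqP; by field.
Qed.

Definition pert_weight chi k x : K := rw k x * cexp (exc_birkhoff alpha01 chi k x).

Definition pert_small : R := s / (32 * D1).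

Lemma D1_ge1 : 1 <= D1. Proof. exact: dist_const_ge1. Qed.
Lemma pert_small_gt0 : 0 < pert_small.
Proof. by rewrite divr_gt0// mulr_gt0//; have := D1_ge1; lra. Qed.

Lemma pert_exp e (k : nat) : 0 <= e -> e <= pert_small ->
  expR (2 * (k.+1%:R * (e * D1))) <= expR (k.+1%:R * (s / 16)).
Proof.
move=> e0; rewrite /pert_small ler_pdivlMr; last by rewrite mulr_gt0//; have := D1_ge1; lra.
move=> h; rewrite ler_expR mulrCA; apply: ler_wpM2l => //; lra.
Qed.

Lemma pert_weight_bound : exists2 c : R, 0 <= c & forall chi e k, potential alpha e chi -> e <= pert_small ->
  lip_bound d (c * (k.+1%:R * expR (k.+1%:R * (s / 16)) * th0 ^+ k)) (pert_weight chi k).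
Proof.
have [c0 c00 hc] := real_weight_bound.
exists (2 * c0 * (1 + 5 * s)); first by rewrite !mulr_ge0// addr_ge0// mulr_ge0// ltW.
move=> chi e k hchi he.
have e0 : 0 <= e by case: hchi => h _; exact: le_trans (cn_ge0 _) (h I01_0).
have hv := exc_birkhoff_bound alpha01 k hchi.
have h1 := lip_bound_exp1 (eta_dist01 alpha01) hv.
set t := k.+1%:R * (e * D1) in hv h1.
have Ek := pert_exp k e0 he; rewrite -/t in Ek.
have k1 : 1 <= k.+1%:R :> R by rewrite ler1n.
set n := k.+1%:R in k1 *; set E := expR (n * _) in Ek *.
have E1 : 1 <= E by rewrite -[leLHS]expR0 ler_expR mulr_ge0// ?divr_ge0 ?(ltW s0)//; lra.
have D0 : 0 < D1 by have := D1_ge1; lra.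
have ts : t <= n * s.
  have p32 : 0 < 32 * D1 by lra.
  move: he; rewrite /pert_small ler_pdivlMr// => he.
  apply: ler_wpM2l => //; have := s0; lra.
have t0 : 0 <= t by rewrite mulr_ge0// mulr_ge0// ltW.
have h2 : lip_bound d ((1 + 5 * s) * (n * E)) (fun x => cexp (exc_birkhoff alpha01 chi k x)).
  have := lip_boundD (one_bound alpha01) h1 => h3.
  apply: (lip_bound_ext _ (lip_bound_weaken h3 _)) => [x|]; first by rewrite addrC subrK.
  have a1 : 5 * t * expR (2 * t) <= 5 * (n * s) * E.
    by apply: ler_pM; rewrite ?expR_ge0//; [nonneg|apply: ler_wpM2l].
  have a2 : 1 * 1 <= n * E by apply: ler_pM.
  by rewrite mulrDl; lra.
apply: (lip_bound_weaken (lip_boundM (hc k) h2)).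
by rewrite le_eqVlt; apply/orP; left; apply/eqP; ring.
Qed.

Lemma pow_abs (n E t C Ca : R) (m : nat) : 1 <= n -> 0 <= E -> 0 <= t -> (m <= 3)%N ->
  n ^+ 3 * E * t <= Ca -> 0 <= C -> C * (n ^+ m * E * t) <= C * Ca.
Proof.
move=> n1 E0 t0 m3 h C0; rewrite ler_wpM2l//; apply: le_trans h.
have n0 : 0 <= n by lra.
have h := ler_weXn2l n1 m3.
by lemono.
Qed.

Lemma pert_estimates : exists2 C : R, 0 <= C &
 [/\ forall chi e, potential alpha e chi -> e <= pert_small -> weight_decay alpha th C (pert_weight chi : nat -> X -> K),
  forall chi e e' psi', potential alpha e chi -> e <= pert_small -> potential alpha e' psi' -> e' <= pert_small ->
    weight_decay alpha th (C * e') (fun k x => pert_weight chi k x * (cexp (exc_birkhoff alpha01 psi' k x) - 1)),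
  forall chi e e' psi', potential alpha e chi -> e <= pert_small -> potential alpha e' psi' -> e' <= pert_small ->
    weight_decay alpha th (C * e' ^+ 2) (fun k x => pert_weight chi k x *
      (cexp (exc_birkhoff alpha01 psi' k x) - 1 - exc_birkhoff alpha01 psi' k x)),
  forall chi e a psi', potential alpha e chi -> e <= pert_small -> potential alpha a psi' ->
    weight_decay alpha th (C * a) (fun k x => exc_birkhoff alpha01 psi' k x * pert_weight chi k x) &
  forall chi e a psi', potential alpha e chi -> e <= pert_small -> potential alpha a psi' ->
    weight_decay alpha th (C * (a * e)) (fun k x => exc_birkhoff alpha01 psi' k x * (pert_weight chi k x - rw k x))].
Proof.
have [c c0 hc] := pert_weight_bound; have [c' c'0 hc'] := real_weight_bound.
have [Ca Ca0 hCa] := absorb_cube.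
have D10 : 0 <= D1 by have := D1_ge1; lra.
have th00 k : 0 <= th0 ^+ k by rewrite exprn_ge0// expR_ge0.
have ge0 e chi : potential alpha e chi -> 0 <= e by case=> h _; exact: le_trans (cn_ge0 _) (h I01_0).
have n1 k : 1 <= k.+1%:R :> R by rewrite ler1n.
have n0 k : 0 <= k.+1%:R :> R by [].
pose E16 k := expR (k.+1%:R * (s / 16)); pose E8 k := expR (k.+1%:R * (s / 8)).
have E16E k : E16 k * E16 k = E8 k by rewrite /E16 /E8 -expRD; congr expR; field.
have E16_0 k : 0 <= E16 k by exact: expR_ge0.
have E16_1 k : 1 <= E16 k by rewrite -[leLHS]expR0 ler_expR mulr_ge0// divr_ge0// ltW.
have E16_8 k : E16 k <= E8 k by rewrite -E16E ler_peMl.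
have E8_0 k : 0 <= E8 k by exact: expR_ge0.
have fin k (C0 : R) (m : nat) : (m <= 3)%N -> 0 <= C0 ->
    C0 * (k.+1%:R ^+ m * E8 k * th0 ^+ k) <= C0 * Ca * th ^+ k.
  by move=> m3 C00; rewrite -[leRHS]mulrA; apply: pow_abs => //; exact: hCa.
have p2 : 0 <= D1 ^+ 2 by exact: exprn_ge0.
pose C := (c + 10 * c * D1 + 20 * c * D1 ^+ 2 + 2 * D1 * c + 20 * D1 ^+ 2 * c') * Ca.
have C_ge0 : 0 <= C by rewrite /C; nonneg.
have big (x y : R) : 0 <= y -> 0 <= x -> x <= c + 10 * c * D1 + 20 * c * D1 ^+ 2 + 2 * D1 * c + 20 * D1 ^+ 2 * c' ->
    x * y * Ca <= C * y.
  by move=> y0 x0 h; rewrite /C mulrAC ler_wpM2r// ler_wpM2r.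
have q1 : 0 <= c * D1 by rewrite mulr_ge0.
have q2 : 0 <= c * D1 ^+ 2 by rewrite mulr_ge0.
have q3 : 0 <= D1 ^+ 2 * c' by rewrite mulr_ge0.
exists C => //; split.
- move=> chi e hchi he k; apply: (lip_bound_weaken (hc chi e k hchi he)).
  apply: (@le_trans _ _ (c * (k.+1%:R ^+ 1 * E8 k * th0 ^+ k))).
    by rewrite expr1; have := E16_8 k; rewrite /E16 => h; lemono.
  apply: le_trans (fin k c 1%N isT c0) _; rewrite ler_wpM2r ?exprn_ge0 ?expR_ge0//.
  by have := big c 1 ler01 c0; rewrite !mulr1; apply; lra.
- move=> chi e e' psi' hchi he hpsi' he' k; have e'0 := ge0 _ _ hpsi'.
  have h1 := lip_bound_exp1 (eta_dist01 alpha01) (exc_birkhoff_bound alpha01 k hpsi').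
  apply: (lip_bound_weaken (lip_boundM (hc chi e k hchi he) h1)).
  have Ek := pert_exp k e'0 he'.
  apply: (@le_trans _ _ (10 * c * D1 * e' * (k.+1%:R ^+ 2 * E8 k * th0 ^+ k))).
    apply: (@le_trans _ _ (2 * (c * (k.+1%:R * E16 k * th0 ^+ k) * (5 * (k.+1%:R * (e' * D1)) * E16 k)))).
      by lemono.
    by rewrite -E16E le_eqVlt; apply/orP; left; apply/eqP; ring.
  have z0 : 0 <= 10 * c * D1 * e' by nonneg.
  apply: le_trans (fin k _ 2%N isT z0) _; rewrite ler_wpM2r ?exprn_ge0 ?expR_ge0//.
  by apply: big; [nonneg|nonneg|lra].
- move=> chi e e' psi' hchi he hpsi' he' k; have e'0 := ge0 _ _ hpsi'.
  have h1 := lip_bound_exp2 (eta_dist01 alpha01) (exc_birkhoff_bound alpha01 k hpsi').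
  apply: (lip_bound_weaken (lip_boundM (hc chi e k hchi he) h1)).
  have Ek := pert_exp k e'0 he'.
  apply: (@le_trans _ _ (20 * c * D1 ^+ 2 * e' ^+ 2 * (k.+1%:R ^+ 3 * E8 k * th0 ^+ k))).
    apply: (@le_trans _ _ (2 * (c * (k.+1%:R * E16 k * th0 ^+ k) * (10 * (k.+1%:R * (e' * D1)) ^+ 2 * E16 k)))).
      by lemono.
    by rewrite -E16E le_eqVlt; apply/orP; left; apply/eqP; ring.
  have z0 : 0 <= 20 * c * D1 ^+ 2 * e' ^+ 2 by nonneg.
  apply: le_trans (fin k _ 3%N isT z0) _; rewrite ler_wpM2r ?exprn_ge0 ?expR_ge0//.
  by apply: big; [nonneg|nonneg|lra].
- move=> chi e a psi' hchi he hpsi' k; have a0 := ge0 _ _ hpsi'.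
  apply: (lip_bound_weaken (lip_boundM (exc_birkhoff_bound alpha01 k hpsi') (hc chi e k hchi he))).
  apply: (@le_trans _ _ (2 * D1 * c * a * (k.+1%:R ^+ 2 * E8 k * th0 ^+ k))).
    apply: (@le_trans _ _ (2 * D1 * c * a * (k.+1%:R ^+ 2 * E16 k * th0 ^+ k))).
      by rewrite /E16 le_eqVlt; apply/orP; left; apply/eqP; ring.
    by have := E16_8 k => h; lemono.
  have z0 : 0 <= 2 * D1 * c * a by nonneg.
  apply: le_trans (fin k _ 2%N isT z0) _; rewrite ler_wpM2r ?exprn_ge0 ?expR_ge0//.
  by apply: big; [nonneg|nonneg|lra].
- move=> chi e a psi' hchi he hpsi' k; have a0 := ge0 _ _ hpsi'; have e0 := ge0 _ _ hchi.
  have h1 := lip_bound_exp1 (eta_dist01 alpha01) (exc_birkhoff_bound alpha01 k hchi).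
  have h2 := lip_boundM (exc_birkhoff_bound alpha01 k hpsi') (lip_boundM (hc' k) h1).
  apply: (lip_bound_ext _ (lip_bound_weaken h2 _)) => [x|]; first by rewrite /pert_weight mulrBr mulr1.
  have Ek := pert_exp k e0 he.
  apply: (@le_trans _ _ (20 * D1 ^+ 2 * c' * (a * e) * (k.+1%:R ^+ 2 * E8 k * th0 ^+ k))).
    apply: (@le_trans _ _ (2 * (k.+1%:R * (a * D1) * (2 * (c' * th0 ^+ k * (5 * (k.+1%:R * (e * D1)) * E16 k)))))).
      by lemono.
    apply: (@le_trans _ _ (20 * D1 ^+ 2 * c' * (a * e) * (k.+1%:R ^+ 2 * E16 k * th0 ^+ k))).
      by rewrite le_eqVlt; apply/orP; left; apply/eqP; ring.
    by have := E16_8 k => h; lemono.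
  have z0 : 0 <= 20 * D1 ^+ 2 * c' * (a * e) by nonneg.
  apply: le_trans (fin k _ 2%N isT z0) _; rewrite ler_wpM2r ?exprn_ge0 ?expR_ge0//.
  by apply: big; [nonneg|nonneg|lra].
Qed.

End perturbed_weights.

Section potential_calculus.
Context {R : realType} (alpha : R).
Local Notation K := R[i].
Local Notation X := (@I01 R).
Local Notation pot := (potential alpha).
Implicit Types (chi : X -> K) (e a : R).

Lemma pot_ge0 e chi : pot e chi -> 0 <= e.
Proof. by move=> [h _]; exact: le_trans (cn_ge0 _) (h I01_0). Qed.

Lemma pot_le e e' chi : pot e chi -> e <= e' -> pot e' chi.
Proof.
move=> [h1 h2] ee; split=> [x|x y]; first exact: le_trans ee.
by apply: le_trans (h2 x y) _; apply: ler_wpM2r => //; exact: powR_ge0.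
Qed.

Lemma potD e e' chi chi' : pot e chi -> pot e' chi' -> pot (e + e') (fun x => chi x + chi' x).
Proof.
move=> [h1 h2] [h1' h2']; split=> [x|x y].
  by apply: le_trans (cnD _ _) _; exact: lerD.
rewrite opprD addrACA mulrDl; apply: le_trans (cnD _ _) _; exact: lerD.
Qed.

Lemma potZ (c : K) e chi : pot e chi -> pot (cn c * e) (fun x => c * chi x).
Proof.
move=> [h1 h2]; split=> [x|x y]; first by rewrite cnM ler_wpM2l// cn_ge0.
by rewrite -mulrBr cnM -mulrA ler_wpM2l// cn_ge0.
Qed.

Lemma pot_cst (c : K) : pot (cn c) (fun=> c).
Proof. by split=> [//|x y]; rewrite subrr cn0 mulr_ge0 ?cn_ge0 ?powR_ge0. Qed.

Lemma pot_ext e chi chi' : chi =1 chi' -> pot e chi -> pot e chi'.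
Proof. by move=> /funext ->. Qed.
End potential_calculus.

Section operator_family.
Context {R : realType} (alpha : R).
Local Notation K := R[i].
Local Notation X := (@I01 R).
Local Notation pot := (potential alpha).
Variables (V : lmodType K) (nb : R -> V -> Prop).
Hypothesis nbP : norm_bound_spec nb.
Variables (ev : V -> K) (one : V) (kap : K).
Hypothesis ev_lin : forall (a : K) u v, ev (a *: u + v) = a * ev u + ev v.
Hypothesis ev_le : forall C u, nb C u -> cn (ev u) <= C.
Hypothesis nb_one : nb 1 one.
Local Notation bop := (bop nb).
Local Notation defl_ := (deflate ev one kap).
Local Notation lead_ := (lead ev one kap).
Local Notation dual_ := (lead_dual ev one kap).
Implicit Types (chi : X -> K) (e a : R).

Variables (M : (X -> K) -> V -> V) (Dm : (X -> K) -> (X -> K) -> V -> V) (m C eps : R).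
Hypothesis C0 : 0 <= C.
Hypothesis eps0 : 0 < eps.
Hypothesis M_bop : forall chi e, pot e chi -> e <= eps -> bop m (M chi).
Hypothesis M_diff1 : forall chi e e' psi, pot e chi -> e <= eps -> pot e' psi -> e' <= eps ->
  bop (C * e') (fun u => M (fun x => chi x + psi x) u - M chi u).
Hypothesis M_diff2 : forall chi e e' psi, pot e chi -> e <= eps -> pot e' psi -> e' <= eps ->
  bop (C * e' ^+ 2) (fun u => M (fun x => chi x + psi x) u - M chi u - Dm chi psi u).
Hypothesis Dm_bop : forall chi e a psi, pot e chi -> e <= eps -> pot a psi -> bop (C * a) (Dm chi psi).
Hypothesis Dm_diff : forall chi e a psi, pot e chi -> e <= eps -> pot a psi ->
  bop (C * (a * e)) (fun u => Dm chi psi u - Dm (fun=> 0) psi u).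
Hypothesis Dm_lin : forall chi e a a' psi psi' (c : K) u, pot e chi -> e <= eps -> pot a psi -> pot a' psi' ->
  Dm chi (fun x => c * psi x + psi' x) u = c *: Dm chi psi u + Dm chi psi' u.

Local Notation zero := (fun _ : X => 0 : K).
Local Notation unit := (fun _ : X => 1 : K).
Variables (S0 : V -> V) (s0 : R).
Hypothesis S0_bop : bop s0 S0.
Hypothesis S0_res : resolvent (defl_ (M zero)) S0.
Hypothesis lead0 : lead_ (M zero) S0 = 0.
Let b0 : K := dual_ (M zero) S0 (Dm zero unit (S0 one)).
Hypothesis b0_neq0 : b0 != 0.

Definition good_resolvent chi (S : V -> V) := bop (2 * s0) S /\ resolvent (defl_ (M chi)) S.

Let s00 : 0 <= s0. Proof. exact: bop_ge0 S0_bop. Qed.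
Let pot0 : pot 0 zero. Proof. by have := @pot_cst R alpha (0 : K); rewrite cn0. Qed.
Let pot1 : pot 1 unit. Proof. by have := @pot_cst R alpha (1 : K); rewrite cn1. Qed.
Let m0 : 0 <= m. Proof. exact: bop_ge0 (M_bop pot0 (ltW eps0)). Qed.
Let linM chi e : pot e chi -> e <= eps -> lin (M chi).
Proof. by move=> h1 h2; exact: bop_lin (M_bop h1 h2). Qed.
Let M0_diff chi e : pot e chi -> e <= eps -> bop (C * e) (fun u => M chi u - M zero u).
Proof.
move=> h he; have := M_diff1 pot0 (ltW eps0) h he.
by rewrite (_ : (fun x => 0 + chi x) = chi)//; apply/funext => x; rewrite add0r.
Qed.

Lemma good_resolvent_near : exists2 eps1 : R, 0 < eps1 <= eps &
  forall chi e, pot e chi -> e <= eps1 -> exists S, good_resolvent chi S.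
Proof.
have k0 : 0 <= (1 + cn kap) * C * s0 by nonneg.
exists (Num.min eps (1 / (2 * ((1 + cn kap) * C * s0 + 1)))).
  by rewrite ge_min lexx /= andbT lt_min eps0 /= divr_gt0// mulr_gt0// ltr_wpDl.
move=> chi e h; rewrite le_min => /andP[h1 h2].
have e0 := pot_ge0 h.
have hd := deflate_diff nbP kap ev_lin ev_le nb_one (M0_diff h h1).
have [|S hS r] := resolvent_perturb nbP (deflate_lin one kap ev_lin (linM pot0 (ltW eps0))) S0_bop S0_res hd.
  rewrite (_ : _ * s0 = e * ((1 + cn kap) * C * s0)); last by ring.
  move: h2; rewrite ler_pdivlMr; last by rewrite mulr_gt0// ltr_wpDl.
  have : 0 <= e * ((1 + cn kap) * C * s0) by exact: mulr_ge0.
  by lra.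
by exists S.
Qed.

Lemma good_lead_uniq chi S S' : good_resolvent chi S -> resolvent (defl_ (M chi)) S' ->
  lead_ (M chi) S' = lead_ (M chi) S.
Proof. by move=> [h r] r'; rewrite /lead (resolvent_uniq (bop_lin h) r r'). Qed.

Let L := cn kap * (m * (2 * s0)) + cn kap * (cn kap * (m * (2 * s0)) + 1).
Let L0 : 0 <= L. Proof. by rewrite /L; have := m0; have := s00 => h h'; nonneg. Qed.

Lemma dual_factor chi e S : pot e chi -> e <= eps -> good_resolvent chi S ->
  0 <= cn kap * (m * (2 * s0)) + cn kap * cn (lead_ (M chi) S) <= L.
Proof.
move=> h he [hS _]; have := s00; have := m0 => h1 h2; apply/andP; split; first by nonneg.
rewrite lerD2l; apply: ler_wpM2l; first exact: cn_ge0.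
apply: le_trans (cnB _ _) _; rewrite cn1 lerD2r cnM; apply: ler_wpM2l; first exact: cn_ge0.
have := ev_le (bop_nb (M_bop h he) (bop_nb hS nb_one)).
by rewrite mulr1.
Qed.

Lemma lead_step chi psi psi0 r e e' a del S S' :
  pot e chi -> e <= eps -> pot e' psi -> e' <= eps ->
  pot a psi0 -> pot del (fun x => psi x - psi0 x) -> r = (fun x => chi x + psi x) ->
  good_resolvent chi S -> good_resolvent r S' ->
  cn (lead_ (M r) S' - lead_ (M chi) S - dual_ (M chi) S (Dm chi psi0 (S one))) <=
  L * ((C * e' ^+ 2 + C * del) * (2 * s0) + C * a * (2 * s0 * ((1 + cn kap) * (C * e') * (2 * s0)))).
Proof.
move=> hchi he hpsi he' hpsi0 hdel -> gS gS'; have [hS rS] := gS; have [hS' rS'] := gS'.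
have e'0 := pot_ge0 hpsi; have a0 := pot_ge0 hpsi0; have d0 := pot_ge0 hdel.
have hM := M_bop hchi he.
have hn := M_diff1 hchi he hpsi he'.
have heta : bop (C * e' ^+ 2 + C * del)
    (fun u => M (fun x => chi x + psi x) u - M chi u - Dm chi psi0 u).
  have h1 := M_diff2 hchi he hpsi he'; have h2 := Dm_bop hchi he hdel.
  have := bop_add nbP h1 h2; congr (bop _ _); apply/funext => u.
  have E : Dm chi psi u = Dm chi psi0 u + Dm chi (fun x => psi x - psi0 x) u.
    rewrite -{1}[Dm chi psi0 u]scale1r -(Dm_lin 1 u hchi he hpsi0 hdel); congr (Dm _ _ u).
    by apply/funext => x; rewrite mul1r addrC subrK.
  by rewrite E [X in _ - X]addrC opprD addrA [_ - _ - _ + _]addrAC subrK.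
have h := lead_expansion nbP ev_lin ev_le nb_one hM hS hS' rS rS' heta (Dm_bop hchi he hpsi0) hn.
have /andP[f0 fL] := dual_factor hchi he gS.
apply: le_trans h _; apply: ler_wpM2r => //.
by have := s00 => h; nonneg.
Qed.

Lemma dual_Dm_lin chi e S (c : K) psi psi' a a' : pot e chi -> e <= eps -> good_resolvent chi S ->
  pot a psi -> pot a' psi' ->
  dual_ (M chi) S (Dm chi (fun x => c * psi x + psi' x) (S one)) =
  c * dual_ (M chi) S (Dm chi psi (S one)) + dual_ (M chi) S (Dm chi psi' (S one)).
Proof.
move=> hc he [hS _] p1 p2; rewrite (Dm_lin c _ hc he p1 p2) (lead_dual_lin one kap ev_lin)//.
- exact: (linM hc he).
- exact: bop_lin hS.
Qed.

Lemma dual_Dm_cst chi e S (c : K) : pot e chi -> e <= eps -> good_resolvent chi S ->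
  dual_ (M chi) S (Dm chi (fun=> c) (S one)) = c * dual_ (M chi) S (Dm chi unit (S one)).
Proof.
move=> hc he gS.
have E0 : dual_ (M chi) S (Dm chi zero (S one)) = 0.
  have := dual_Dm_lin 1 hc he gS pot0 pot0.
  rewrite (_ : (fun x => _) = zero); last by apply/funext => x; rewrite mulr0 addr0.
  by rewrite mul1r => /eqP; rewrite -subr_eq0 opprD addrA subrr sub0r oppr_eq0 => /eqP.
have := dual_Dm_lin c hc he gS pot1 pot0.
rewrite (_ : (fun x => _) = (fun=> c)); last by apply/funext => x; rewrite mulr1 addr0.
by rewrite E0 addr0.
Qed.

Lemma dual_unit_near : exists2 K1 : R, 0 <= K1 & forall chi e S, pot e chi -> e <= eps -> good_resolvent chi S ->
  cn (lead_ (M chi) S) <= K1 * e /\ cn (dual_ (M chi) S (Dm chi unit (S one)) - b0) <= K1 * e.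
Proof.
have s20 : 0 <= 2 * s0 by rewrite mulr_ge0.
have [C1 C10 hC1] := lead_base_diff nbP kap ev_lin ev_le nb_one m0 C0 s20.
have k0 := cn_ge0 kap; have m0' := m0; have s0' := s00.
pose K2 := cn kap * (m * s0) * C * s0.
have K20 : 0 <= K2 by rewrite /K2; nonneg.
exists (C1 * C + K2); first by nonneg.
move=> chi e S h he gS; have [hS rS] := gS; have e0 := pot_ge0 h.
have hM0 := M_bop pot0 (ltW eps0); have hM := M_bop h he.
have hM1 : bop C (Dm chi unit) by have := Dm_bop h he pot1; rewrite mulr1.
have S02 : bop (2 * s0) S0 by apply: (bop_le nbP S0_bop); rewrite ler_peMl// ler1n.
have [k1 k2] := hC1 _ _ _ _ _ _ hM0 hM hM1 S02 hS S0_res rS lead0 (M0_diff h he).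
have K2e : 0 <= K2 * e by exact: mulr_ge0.
split; first by rewrite mulrDl -mulrA; lra.
have l0 : lin (M zero) by exact: bop_lin hM0.
have lS0 := bop_lin S0_bop.
have E : dual_ (M zero) S0 (Dm chi unit (S0 one)) - b0 = dual_ (M zero) S0 (Dm chi unit (S0 one) - Dm zero unit (S0 one)).
  by rewrite (lead_dualB one kap ev_lin _ _ l0 lS0).
have k3 : cn (dual_ (M zero) S0 (Dm chi unit (S0 one)) - b0) <= K2 * e.
  rewrite E; apply: le_trans (lead_dual_le one kap ev_le hM0 S0_bop (bop_nb (Dm_diff h he pot1) (bop_nb S0_bop nb_one))) _.
  by rewrite lead0 cn0 mulr0 addr0 mul1r mulr1 le_eqVlt; apply/orP; left; apply/eqP; rewrite /K2; ring.
set t1 := dual_ (M chi) S _ in k2 *; set t2 := dual_ _ _ _ in k2 k3.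
have -> : t1 - b0 = (t1 - t2) + (t2 - b0) by rewrite addrA subrK.
by apply: le_trans (cnD _ _) _; rewrite mulrDl -mulrA; lra.
Qed.

Let pot_opp q : pot (cn q) (fun=> - q).
Proof. by have := @pot_cst R alpha (- q); rewrite cnN. Qed.

Lemma lead_differentiable chi e0 S D a e : pot e0 chi -> e0 <= eps -> good_resolvent chi S ->
  pot a D -> 0 < e -> exists e1 del : R, [/\ 0 < e1, 0 < del &
    forall (dz dq : K) p r S', cn dz < del -> cn dq < del -> pot (e1 * cn dz) (fun x => p x - dz * D x) ->
      r = (fun x => chi x + (p x - dq)) -> good_resolvent r S' ->
      cn (lead_ (M r) S' - lead_ (M chi) S - dual_ (M chi) S (Dm chi D (S one)) * dz
          - - dual_ (M chi) S (Dm chi unit (S one)) * dq) <= e * (cn dz + cn dq)].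
Proof.
move=> hc etae gS hD ep; have a0 := pot_ge0 hD; have s0' := s00; have L0' := L0; have k0 := cn_ge0 kap.
pose du psi := dual_ (M chi) S (Dm chi psi (S one)).
pose t := a + 2.
pose K4 := L * (C * t ^+ 2 * (2 * s0) + C * t * (2 * s0 * ((1 + cn kap) * (C * t) * (2 * s0)))).
pose K5 := L * (C * (2 * s0)).
have t0 : 0 <= t by rewrite /t; lra.
have K40 : 0 <= K4 by rewrite /K4; nonneg.
have K50 : 0 <= K5 by rewrite /K5; nonneg.
have e10 : 0 < Num.min 1 (e / 2 / (K5 + 1)) by rewrite lt_min ltr01 divr_gt0 ?divr_gt0// ltr_wpDl.
set e1 := Num.min 1 _ in e10.
have e11 : e1 <= 1 by rewrite ge_min lexx.
have e1K : K5 * e1 <= e / 2.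
  have : e1 <= e / 2 / (K5 + 1) by rewrite ge_min lexx orbT.
  by rewrite ler_pdivlMr ?ltr_wpDl//; lra.
have t1 : 0 < 2 * t by rewrite /t; lra.
exists e1, (Num.min (eps / (2 * t)) (e / 4 / (K4 + 1))); split=> //.
  by rewrite lt_min divr_gt0// divr_gt0 ?divr_gt0// ltr_wpDl.
move=> dz dq p r S'; rewrite !lt_min => /andP[hz4 hz5] /andP[hq4 hq5] p1 rE gS'.
pose h := cn dz + cn dq; rewrite -/h -/(du D) -/(du unit).
have nz := cn_ge0 dz; have nq := cn_ge0 dq.
have h0 : 0 <= h by rewrite addr_ge0.
have p2 := potZ dz hD.
have ta : a * cn dz + 2 * cn dz + cn dq <= t * h.
  have : 0 <= a * cn dq by exact: mulr_ge0.
  by rewrite /t /h; lra.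
have e1z : e1 * cn dz <= 1 * cn dz by apply: ler_wpM2r.
have hpsi : pot (t * h) (fun x => p x - dq).
  apply: (pot_ext _ (pot_le (potD (potD p1 p2) (pot_opp dq)) _)) => [x|]; first by rewrite subrK.
  by lra.
have hpsi0 : pot (t * h) (fun x => dz * D x + - dq).
  by apply: (pot_le (potD p2 (pot_opp dq))); lra.
have hdel : pot (e1 * cn dz) (fun x => p x - dq - (dz * D x + - dq)).
  by apply: (pot_ext _ p1) => x; ring.
have th_eps : t * h <= eps.
  move: hz4 hq4; rewrite !ltr_pdivlMr// => hz4 hq4; rewrite /h mulrDr.
  have k1 : t * cn dz <= eps / 2 by lra.
  have k2 : t * cn dq <= eps / 2 by lra.
  by lra.
have h1 := lead_step hc etae hpsi th_eps hpsi0 hdel rE gS gS'.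
have E2 : dual_ (M chi) S (Dm chi (fun x => dz * D x + - dq) (S one)) =
    du D * dz + - du unit * dq.
  rewrite (dual_Dm_lin dz hc etae gS hD (pot_opp dq)) (dual_Dm_cst (- dq) hc etae gS) -/(du D) -/(du unit).
  by ring.
have -> : lead_ (M r) S' - lead_ (M chi) S - du D * dz - - du unit * dq = lead_ (M r) S' - lead_ (M chi) S - (du D * dz + - du unit * dq) by ring.
rewrite -E2; apply: le_trans h1 _.
rewrite (_ : L * _ = K4 * h * h + K5 * (e1 * cn dz)); last by rewrite /K4 /K5; ring.
have a1 : K4 * h <= e / 2.
  have kp : 0 < K4 + 1 by rewrite ltr_wpDl.
  have := ltW hz5; have := ltW hq5; rewrite !ler_pdivlMr// => a1 a2.
  by rewrite /h; lra.
have a2 : K4 * h * h <= e / 2 * h by apply: ler_wpM2r.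
have a3 : K5 * e1 * cn dz <= e / 2 * cn dz by apply: ler_wpM2r.
have a4 : e / 2 * cn dz <= e / 2 * h by apply: ler_wpM2l; [rewrite divr_ge0// ltW|rewrite /h lerDl].
by lra.
Qed.

Lemma lead_family (F : K -> X -> K) (rho : R) : 0 < rho ->
  (forall x, F 0 x = 0) ->
  (forall z, cn z < rho -> exists D a, pot a D /\ forall e, 0 < e -> exists2 del : R, 0 < del & forall w,
     cn (w - z) < del -> pot (e * cn (w - z)) (fun x => F w x - F z x - (w - z) * D x)) ->
  exists rho1 sig : R, [/\ 0 < rho1, 0 < sig & exists g : K -> K, forall z, cn z < rho1 ->
    cderiv g z /\ forall q S, cn q <= sig -> resolvent (defl_ (M (fun x => F z x - q))) S ->
      lead_ (M (fun x => F z x - q)) S = 0 -> q = g z].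
Proof.
move=> rho0 F0 dF.
have [eps1 /andP[eps10 eps1e] hgood] := good_resolvent_near.
have [K1 K10 hK1] := dual_unit_near.
have B0 : 0 < cn b0 by rewrite cn_gt0.
have s0' := s00; have L0' := L0; have k0 := cn_ge0 kap.
pose K3 := L * (C * (2 * s0) + C * (2 * s0 * ((1 + cn kap) * C * (2 * s0)))).
have K30 : 0 <= K3 by rewrite /K3; nonneg.
pose eta := Num.min (eps1 / 2) (cn b0 / (2 * (2 * K1 + 2 * K3 + 1))).
have kk : 0 < 2 * (2 * K1 + 2 * K3 + 1) by lra.
have eta0 : 0 < eta by rewrite lt_min !divr_gt0.
have eta1 : eta + eta <= eps1.
  have : eta <= eps1 / 2 by rewrite ge_min lexx.
  by lra.
have etae : eta + eta <= eps by lra.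
have eta2 : (2 * K1 + 2 * K3) * eta <= cn b0 / 2.
  have h : eta <= cn b0 / (2 * (2 * K1 + 2 * K3 + 1)) by rewrite ge_min lexx orbT.
  by move: h; rewrite ler_pdivlMr//; lra.
have [r1 /andP[r10 r1rho] hr1] : exists2 r1 : R, 0 < r1 <= rho & forall e : R, 0 < e -> exists2 del : R, 0 < del <= r1 & forall z, cn z < del -> pot (Num.min e eta) (F z).
  have z0 : cn (0 : K) < rho by rewrite cn0.
  have [D [a [hD hd]]] := dF 0 z0; have a0 := pot_ge0 hD.
  have [d1 d10 hd1] := hd 1 ltr01.
  have small e : 0 < e -> exists2 del : R, 0 < del & forall z, cn z < del -> pot e (F z).
    move=> e0; exists (Num.min d1 (e / (a + 1))).
      by rewrite lt_min d10 divr_gt0// ltr_wpDl.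
    move=> z; rewrite lt_min => /andP[h1 h2].
    have := hd1 z; rewrite subr0 mul1r => /(_ h1) h3.
    have h4 := potD h3 (potZ z hD).
    apply: (pot_ext _ (pot_le h4 _)) => [x|]; first by rewrite F0 subr0 subrK.
    by move: h2; rewrite ltr_pdivlMr ?ltr_wpDl// => h2; have := cn_ge0 z; lra.
  exists rho; first by rewrite rho0 lexx.
  move=> e e0; have [|del del0 hdel] := small (Num.min e eta); first by rewrite lt_min e0.
  exists (Num.min del rho); first by rewrite ge_min lexx orbT lt_min del0 rho0.
  by move=> z; rewrite lt_min => /andP[h1 _]; exact: hdel.
have [r2 /andP[r20 r21] hr2] := hr1 eta eta0; rewrite minxx in hr2.
pose chi z q x := F z x - q.
have hq q : pot (cn q) (fun=> - q) by have := @pot_cst R alpha (- q); rewrite cnN.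
have hchi z q : cn z < r2 -> cn q <= eta -> pot (eta + eta) (chi z q).
  move=> hz hq1; have := potD (hr2 z hz) (pot_le (hq q) hq1).
  exact.
have hchi_e z q : cn z < r2 -> cn q <= eta -> pot eps (chi z q).
  by move=> hz hq1; exact: (pot_le (hchi z q hz hq1) etae).
have [Sx hSx] : exists Sx : K -> K -> V -> V, forall z q, cn z < r2 -> cn q <= eta -> good_resolvent (chi z q) (Sx z q).
  have : forall zq : K * K, exists S, cn zq.1 < r2 -> cn zq.2 <= eta -> good_resolvent (chi zq.1 zq.2) S.
    move=> [z q] /=; have [h1|h1] := pselect (cn z < r2 /\ cn q <= eta).
      by have [S hS] := hgood _ _ (hchi z q h1.1 h1.2) eta1; exists S.
    by exists S0 => h2 h3; case: h1.
  by move=> /choice[Sx hSx]; exists (fun z q => Sx (z, q)) => z q; exact: (hSx (z, q)).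
pose G z q := lead_ (M (chi z q)) (Sx z q).
have f1 z q q' : cn z < r2 -> cn q <= eta -> cn q' <= eta ->
    cn (G z q' - G z q + b0 * (q' - q)) <= cn b0 / 2 * cn (q' - q).
  move=> hz h h'; pose dq := q' - q.
  have hc := hchi z q hz h; have gS := hSx z q hz h; have gS' := hSx z q' hz h'.
  have hp := hq dq.
  have dq_eta : cn dq <= 2 * eta by apply: le_trans (cnB _ _) _; lra.
  have dq_eps : cn dq <= eps by lra.
  have hdel : pot 0 (fun x => - dq - - dq).
    by apply: (pot_ext _ pot0) => x; rewrite subrr.
  have E : chi z q' = (fun x => chi z q x + - dq).
    by apply/funext => x; rewrite /chi /dq; ring.
  have h1 := lead_step hc etae hp dq_eps hp hdel E gS gS'.
  have [_ h2] := hK1 _ _ _ hc etae gS.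
  have E2 := dual_Dm_cst (- dq) hc etae gS.
  move: h1; rewrite E2 -/(G z q) -/(G z q') => h1.
  set t := dual_ _ _ _ in h1 h2.
  have -> : G z q' - G z q + b0 * (q' - q) = (G z q' - G z q - - dq * t) + (- dq) * (t - b0).
    by rewrite -/dq; ring.
  apply: le_trans (cnD _ _) _; apply: le_trans (lerD h1 (lexx _)) _.
  rewrite cnM cnN.
  have n0 := cn_ge0 dq.
  have a1 : L * ((C * cn dq ^+ 2 + C * 0) * (2 * s0) + C * cn dq * (2 * s0 * ((1 + cn kap) * (C * cn dq) * (2 * s0)))) = K3 * cn dq * cn dq.
    by rewrite /K3; ring.
  rewrite a1 -/dq.
  have a2 : K3 * cn dq * cn dq <= K3 * (2 * eta) * cn dq.
    by apply: ler_wpM2r => //; apply: ler_wpM2l.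
  have a3 : cn dq * cn (t - b0) <= cn dq * (K1 * (eta + eta)) by apply: ler_wpM2l.
  have a4 : (2 * K1 + 2 * K3) * eta * cn dq <= cn b0 / 2 * cn dq by apply: ler_wpM2r.
  by lra.
have f2 e : 0 < e -> exists2 del : R, 0 < del & forall z, cn z < del -> cn (G z 0) <= e.
  move=> e0; have e1 : 0 < e / (K1 + 1) by rewrite divr_gt0// ltr_wpDl.
  have [del /andP[del0 _] hdel] := hr1 _ e1.
  exists (Num.min del r2); first by rewrite lt_min del0 r20.
  move=> z; rewrite lt_min => /andP[h1 h2].
  have q0 : cn (0 : K) <= eta by rewrite cn0 ltW.
  have hp : pot (Num.min (e / (K1 + 1)) eta) (chi z 0).
    by apply: (pot_ext _ (hdel z h1)) => x; rewrite /chi subr0.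
  have he : Num.min (e / (K1 + 1)) eta <= eps by rewrite ge_min; apply/orP; right; lra.
  have [k1 _] := hK1 _ _ _ hp he (hSx z 0 h2 q0).
  apply: le_trans k1 _; apply: (@le_trans _ _ (K1 * (e / (K1 + 1)))).
    by apply: ler_wpM2l => //; rewrite ge_min lexx.
  rewrite mulrA ler_pdivrMr ?ltr_wpDl// [e * _]mulrC; apply: ler_wpM2r; [exact: ltW|by rewrite lerDl].
have f3 z q : cn z < r2 -> cn q < eta -> exists a b : K, forall e : R, 0 < e ->
    exists2 del : R, 0 < del & forall z' q', cn (z' - z) < del -> cn (q' - q) < del ->
    cn (G z' q' - G z q - a * (z' - z) - b * (q' - q)) <= e * (cn (z' - z) + cn (q' - q)).
  move=> hz hq0; have hq1 := ltW hq0.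
  have zrho : cn z < rho by apply: lt_le_trans hz _; apply: le_trans r21 _.
  have [D [a [hD hd]]] := dF z zrho; have a0 := pot_ge0 hD.
  have hc := hchi z q hz hq1; have gS := hSx z q hz hq1.
  exists (dual_ (M (chi z q)) (Sx z q) (Dm (chi z q) D (Sx z q one))).
  exists (- dual_ (M (chi z q)) (Sx z q) (Dm (chi z q) unit (Sx z q one))) => e e0.
  have [e1 [d2 [e10 d20 hd2]]] := lead_differentiable hc etae gS hD e0.
  have [d1 d10 hd1] := hd _ e10.
  exists (Num.min (Num.min d1 d2) (Num.min (r2 - cn z) (eta - cn q))).
    by rewrite !lt_min d10 d20 !subr_gt0 hz hq0.
  move=> z' q'; rewrite !lt_min => /andP[/andP[hz1 hz2] /andP[hz3 _]] /andP[/andP[_ hq2] /andP[_ hq3]].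
  apply: (hd2 _ _ (fun x => F z' x - F z x) _ _ hz2 hq2 (hd1 z' hz1)).
    by apply/funext => x; rewrite /chi; ring.
  apply: hSx.
    by have := cnD (z' - z) z; rewrite subrK => h; apply: le_lt_trans h _; rewrite -ltrBrDr.
  by have := cnD (q' - q) q; rewrite subrK => h; apply: le_trans h _; rewrite -lerBrDr ltW.
have [rho1 /andP[rho10 rho1r] [g hg]] := complex_implicit r20 eta0 b0_neq0 f1 f2 f3.
exists rho1, eta; split=> //; exists g => z hz; have [k1 _ k3] := hg z hz; split=> // q S hq1 rS hl.
apply: k3 => //; rewrite -hl /G; symmetry; apply: good_lead_uniq rS.
by apply: hSx => //; exact: lt_le_trans hz _.
Qed.
End operator_family.

Section pressure_analyticity.
Context {R : realType} (alpha : R).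
Hypothesis alpha01 : 0 < alpha <= 1.
Local Notation K := R[i].
Local Notation X := (@I01 R).
Local Notation d := (eta_dist alpha).
Local Notation V := (lip_fun (d : X -> X -> R)).
Local Notation pot := (potential alpha).
Local Notation growth_le := (growth_le alpha01).
Variables (A rho : R) (F : K -> X -> K) (phi : R -> X -> R) (P : R -> R).
Hypothesis A0 : 0 <= A.
Hypothesis rho0 : 0 < rho.
Hypothesis F_real : forall t, `|t| < rho -> forall x, F (rc t) x = rc (phi t x).
Hypothesis phi_holder : forall t, `|t| < rho -> rholder alpha A (phi t).
Hypothesis F_diff : forall z, cn z < rho -> exists D a, pot a D /\
  forall e : R, 0 < e -> exists2 del : R, 0 < del & forall w, cn (w - z) < del ->
    pot (e * cn (w - z)) (fun x => F w x - F z x - (w - z) * D x).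
Hypothesis P_growth : forall t, `|t| < rho -> growth_le (phi t) (P t).
Hypothesis P_minimal : forall t, `|t| < rho -> forall p, p < P t -> ~ growth_le (phi t) p.
Hypothesis gap : phi 0 I01_0 < P 0.

Let t00 : `|0 : R| < rho. Proof. by rewrite normr0. Qed.
Let rc0 : rc 0 = 0 :> K. Proof. by []. Qed.
Let psi x := phi 0 x - P 0.
Let s := P 0 - phi 0 I01_0.
Let s0 : 0 < s. Proof. by rewrite subr_gt0. Qed.
Let psi_s : psi I01_0 = - s. Proof. by rewrite opprB. Qed.
Let holder_subc (f : X -> R) c : rholder alpha A f -> rholder alpha A (fun x => f x - c).
Proof. by move=> h x y; rewrite opprB addrA subrK. Qed.
Let hpsi : rholder alpha A psi. Proof. by apply: holder_subc; exact: phi_holder. Qed.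
Local Notation th := (family_rate s).
Local Notation eps := (pert_small alpha s).
Local Notation W := (pert_weight alpha01 psi).
Local Notation S_ := (exc_birkhoff alpha01).
Let th1 : 0 < th < 1. Proof. exact: family_rate01. Qed.
Let th01 : 0 <= th < 1. Proof. by case/andP: th1 => /ltW -> ->. Qed.

Lemma F_near e : 0 < e -> exists2 del : R, 0 < del & forall z, cn z < del -> pot e (fun x => F z x - F 0 x).
Proof.
move=> e0; have z0 : cn (0 : K) < rho by rewrite cn0.
have [D [a [hD hd]]] := F_diff z0; have a0 := pot_ge0 hD.
have [d1 d10 hd1] := hd 1 ltr01.
exists (Num.min d1 (e / (a + 1))).
  by rewrite lt_min d10 divr_gt0// ltr_wpDl.
move=> z; rewrite lt_min => /andP[h1 h2].
have := hd1 z; rewrite subr0 mul1r => /(_ h1) h3.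
have h4 := potD h3 (potZ z hD).
apply: (pot_ext _ (pot_le h4 _)) => [x|]; first by rewrite subrK.
by move: h2; rewrite ltr_pdivlMr ?ltr_wpDl// => h2; have := cn_ge0 z; lra.
Qed.

Lemma P_close t c : `|t| < rho -> pot c (fun x => F (rc t) x - F 0 x) -> `|P t - P 0| <= c.
Proof.
move=> ht [h _].
have hc x : `|phi t x - phi 0 x| <= c.
  by have := h x; rewrite F_real// -rc0 F_real// -rcB cn_rc.
have up : P t <= P 0 + c.
  rewrite leNgt; apply/negP => /(P_minimal ht); apply; apply: growth_shift (P_growth t00) => x.
  by have := hc x; rewrite ler_norml => /andP[_]; rewrite lerBlDl.
have lo : P 0 <= P t + c.
  rewrite leNgt; apply/negP => /(P_minimal t00); apply; apply: growth_shift (P_growth ht) => x.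
  by have := hc x; rewrite ler_norml => /andP[]; lra.
by rewrite ler_norml; lra.
Qed.

Lemma S_cst (c : K) k x : S_ (fun=> c) k x = rc k.+1%:R * c.
Proof.
have E n : rc n%:R = n%:R :> K by elim: n => [//|n IH]; rewrite -!natr1 rcD IH.
by rewrite E mulr_natl /exc_birkhoff sumr_const card_ord.
Qed.

Lemma S_rc (f : X -> R) k x : S_ (fun y => rc (f y)) k x = rc (birkhoff alpha01 f (rcons (nseq k false) true) x).
Proof. by rewrite birkhoff_excursion (rc_sum _ (fun j => f (excursion alpha01 j x))). Qed.

Lemma S_add chi psi' k x : S_ (fun y => chi y + psi' y) k x = S_ chi k x + S_ psi' k x.
Proof. by rewrite /exc_birkhoff big_split. Qed.

Theorem pressure_analytic : real_analytic_at P 0.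
Proof.
have [C C0 [ea eb ec ed ee]] := pert_estimates alpha01 A0 hpsi s0 psi_s.
have eps0 : 0 < eps := pert_small_gt0 alpha01 s0.
have pot0 : pot 0 (fun=> 0) by have := @pot_cst R alpha 0; rewrite cn0.
have pot1 : pot 1 (fun=> 1) by have := @pot_cst R alpha 1; rewrite cn1.
have /choice[Mop hM'] : forall chi, exists S : V -> V, (exists2 e, pot e chi & e <= eps) ->
    is_weighted alpha01 th (W chi) S.
  move=> chi; have [[e h he]|h] := pselect (exists2 e, pot e chi & e <= eps).
    by have [S [hS _]] := weighted_ex alpha01 th01 C0 (ea chi e h he); exists S.
  by exists id.
have hM chi e : pot e chi -> e <= eps -> is_weighted alpha01 th (W chi) (Mop chi).
  by move=> h he; apply: hM'; exists e.
have /choice[Dop' hD'] : forall p : (X -> K) * (X -> K), exists S : V -> V,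
    (exists2 e, pot e p.1 & e <= eps) -> (exists a, pot a p.2) ->
    is_weighted alpha01 th (fun k x => S_ p.2 k x * W p.1 k x) S.
  move=> [chi psi']; have [[[e h he] [a h']]|h] := pselect ((exists2 e, pot e chi & e <= eps) /\ exists a, pot a psi').
    have Ca : 0 <= C * a by rewrite mulr_ge0// (pot_ge0 h').
    by have [S [hS _]] := weighted_ex alpha01 th01 Ca (ed chi e a psi' h he h'); exists S.
  by exists id => h1 h2; case: h.
pose Dop chi psi' := Dop' (chi, psi').
have hD chi e a psi' : pot e chi -> e <= eps -> pot a psi' ->
    is_weighted alpha01 th (fun k x => S_ psi' k x * W chi k x) (Dop chi psi').
  by move=> h he h'; apply: (hD' (chi, psi')); [exists e|exists a].
pose C' := 2 * C / (1 - th).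
have t1 : 0 < 1 - th by rewrite subr_gt0; case/andP: th1.
have C'0 : 0 <= C' by rewrite /C'; apply: divr_ge0; [exact: mulr_ge0|exact: ltW].
pose ep := eps / 2.
have ep0 : 0 < ep by rewrite divr_gt0.
have epe e : e <= ep -> e <= eps by rewrite /ep; lra.
have wb w S (c : R) : 0 <= c -> is_weighted alpha01 th w S -> weight_decay alpha th (C * c) w -> bop (@lip_nb R X d) (C' * c) S.
  move=> c0 hS hw; have := weighted_bop th01 (mulr_ge0 C0 c0) hS hw.
  by rewrite (_ : 2 * (C * c) / (1 - th) = C' * c)//; rewrite /C'; field; rewrite gt_eqF.
have W_add chi psi' k x : W (fun y => chi y + psi' y) k x = W chi k x * cexp (S_ psi' k x).
  by rewrite /pert_weight S_add cexpD mulrA.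
have hMD chi e e' psi' : pot e chi -> e <= ep -> pot e' psi' -> e' <= ep ->
    is_weighted alpha01 th (W (fun x => chi x + psi' x)) (Mop (fun x => chi x + psi' x)).
  by move=> h he h' he'; apply: hM (potD h h') _; rewrite /ep in he he'; lra.
have M_bop chi e : pot e chi -> e <= ep -> bop (@lip_nb R X d) C' (Mop chi).
  move=> h /epe he; rewrite -[C']mulr1; apply: wb (hM chi e h he) _ => //.
  by rewrite mulr1; exact: ea h he.
have M_diff1 chi e e' psi' : pot e chi -> e <= ep -> pot e' psi' -> e' <= ep ->
    bop (@lip_nb R X d) (C' * e') (fun u => Mop (fun x => chi x + psi' x) u - Mop chi u).
  move=> h he h' he'; apply: wb (pot_ge0 h') _ (eb chi e e' psi' h (epe _ he) h' (epe _ he')).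
  apply: weighted_ext (weighted_sub (hMD chi e e' psi' h he h' he') (hM chi e h (epe _ he))) => k x.
  by rewrite W_add mulrBr mulr1.
have M_diff2 chi e e' psi' : pot e chi -> e <= ep -> pot e' psi' -> e' <= ep ->
    bop (@lip_nb R X d) (C' * e' ^+ 2) (fun u => Mop (fun x => chi x + psi' x) u - Mop chi u - Dop chi psi' u).
  move=> h he h' he'; apply: wb (exprn_ge0 2 (pot_ge0 h')) _ (ec chi e e' psi' h (epe _ he) h' (epe _ he')).
  apply: weighted_ext (weighted_sub (weighted_sub (hMD chi e e' psi' h he h' he') (hM chi e h (epe _ he)))
    (hD chi e e' psi' h (epe _ he) h')) => k x.
  by rewrite W_add; ring.
have Dm_bop chi e a psi' : pot e chi -> e <= ep -> pot a psi' -> bop (@lip_nb R X d) (C' * a) (Dop chi psi').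
  move=> h he h'; exact: wb (pot_ge0 h') (hD chi e a psi' h (epe _ he) h') (ed chi e a psi' h (epe _ he) h').
have W0 k x : W (fun=> 0) k x = real_weight alpha01 psi k x.
  by rewrite /pert_weight S_cst mulr0 cexp0 mulr1.
have Dm_diff chi e a psi' : pot e chi -> e <= ep -> pot a psi' ->
    bop (@lip_nb R X d) (C' * (a * e)) (fun u => Dop chi psi' u - Dop (fun=> 0) psi' u).
  move=> h he h'; apply: wb (mulr_ge0 (pot_ge0 h') (pot_ge0 h)) _ (ee chi e a psi' h (epe _ he) h').
  apply: weighted_ext (weighted_sub (hD chi e a psi' h (epe _ he) h') (hD _ 0 a psi' pot0 (ltW eps0) h')) => k x.
  by rewrite W0 mulrBr.
have Dm_lin chi e a a' psi1 psi2 (c : K) u : pot e chi -> e <= ep -> pot a psi1 -> pot a' psi2 ->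
    Dop chi (fun x => c * psi1 x + psi2 x) u = c *: Dop chi psi1 u + Dop chi psi2 u.
  move=> h he h1 h2.
  have k1 := hD chi e _ _ h (epe _ he) (potD (potZ c h1) h2).
  have k2 := weighted_lin c (hD chi e a psi1 h (epe _ he) h1) (hD chi e a' psi2 h (epe _ he) h2).
  have k3 : is_weighted alpha01 th (fun k x => S_ (fun x => c * psi1 x + psi2 x) k x * W chi k x)
      (fun u => c *: Dop chi psi1 u + Dop chi psi2 u).
    by apply: weighted_ext k2 => k x; rewrite exc_birkhoff_lin; ring.
  by have := weighted_uniq th01 k1 k3 => ->.
have decay0 f chi e : pot e chi -> e <= eps -> (forall k x, W chi k x = real_weight alpha01 f k x) ->
    forall k x, expR (birkhoff alpha01 f (rcons (nseq k false) true) x) <= C * th ^+ k.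
  move=> h he E k x; have [h1 _] := ea chi e h he k; have := h1 x.
  by rewrite E cn_rc ger0_norm ?expR_ge0.
have growth0 t : `|t| < rho -> growth_le (fun x => phi t x - P t) 0.
  by move=> ht; rewrite -(subrr (P t)) -growth_subc; exact: P_growth.
have minimal0 t : `|t| < rho -> forall p, p < 0 -> ~ growth_le (fun x => phi t x - P t) p.
  move=> ht p p0; rewrite -[p](addrK (P t)) -growth_subc; apply: P_minimal => //.
  by rewrite gtrDr.
have M0 : is_weighted alpha01 th (real_weight alpha01 psi) (Mop (fun=> 0)).
  by apply: weighted_ext (hM _ 0 pot0 (ltW eps0)).
have psi0 : psi I01_0 < 0 by rewrite psi_s oppr_lt0.
have [S0 [r0 [hS0 res0 lead0 dual0]]] := base_lead A0 hpsi th1 M0 (growth0 _ t00) psi0 (minimal0 _ t00)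
  (decay0 psi _ 0 pot0 (ltW eps0) W0).
have b0 : lead_dual (@ev0 R alpha) (one_lip alpha) (rc (defl alpha A)) (Mop (fun=> 0)) S0
    (Dop (fun=> 0) (fun=> 1) (S0 (one_lip alpha))) != 0.
  apply: dual0; apply: weighted_ext (hD _ 0 1 _ pot0 (ltW eps0) pot1) => k x.
  by rewrite S_cst mulr1 W0.
have F0 x : F 0 x - F 0 x = 0 by rewrite subrr.
have dF z : cn z < rho -> exists D a, pot a D /\ forall e : R, 0 < e -> exists2 del : R, 0 < del & forall w,
     cn (w - z) < del -> pot (e * cn (w - z)) (fun x => (F w x - F 0 x) - (F z x - F 0 x) - (w - z) * D x).
  move=> /F_diff[D [a [h1 h2]]]; exists D, a; split=> // e /h2[del del0 h3]; exists del => // w /h3.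
  by apply: pot_ext => x; rewrite [in RHS]opprB addrA subrK.
have [rho1 [sig [rho10 sig0 [g hg]]]] := lead_family (nbS alpha01) (@ev0_lin R alpha) (@ev0_le R alpha)
  (one_lip_nb alpha01) C'0 ep0 M_bop M_diff1 M_diff2 Dm_bop Dm_diff Dm_lin hS0 res0 lead0 b0 rho0 F0 dF.
pose c := Num.min (eps / 2) (Num.min (s / 4) sig).
have c0 : 0 < c by rewrite !lt_min sig0 (divr_gt0 eps0)// (divr_gt0 s0).
have c1 : c <= eps / 2 by rewrite ge_min lexx.
have c2 : c <= s / 4 by rewrite !ge_min lexx orbT.
have c3 : c <= sig by rewrite !ge_min lexx !orbT.
have [del del0 hdel] := F_near c0.
pose r := Num.min rho (Num.min rho1 del).
have key t : `|t| < r -> g (rc t) + rc (P 0) = rc (P t).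
  rewrite !lt_min => /and3P[ht ht1 ht2].
  have ht3 : cn (rc t) < rho1 by rewrite cn_rc.
  have hF : pot c (fun x => F (rc t) x - F 0 x) by apply: hdel; rewrite cn_rc.
  have hP := P_close ht hF.
  have [_ uniq] := hg _ ht3.
  pose q : K := rc (P t - P 0).
  pose chi x := F (rc t) x - F 0 x - q.
  have qc : cn q <= c by rewrite cn_rc.
  have hchi : pot eps chi.
    have := potD hF (pot_cst alpha (- q)); rewrite cnN => h.
    by apply: (pot_le h); lra.
  pose f x := phi t x - P t.
  have E k x : W chi k x = real_weight alpha01 f k x.
    rewrite /pert_weight /real_weight.
    have -> : chi = (fun y => rc (f y - psi y)).
      by apply/funext => y; rewrite /chi /q /f /psi F_real// -rc0 F_real// -!rcB; congr rc; ring.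
    rewrite S_rc cexp_rc -rcM -expRD; congr (rc (expR _)).
    by rewrite !birkhoff_excursion -big_split /=; apply: eq_bigr => j _; rewrite addrC subrK.
  have hf : rholder alpha A f by apply: holder_subc; exact: phi_holder.
  have f0 : f I01_0 < 0.
    have [h1 _] := hF; have := h1 I01_0; rewrite F_real// -rc0 F_real// -rcB cn_rc.
    have c2' := c2; have s0' := s0; move: hP; rewrite !ler_norml => /andP[a1 a2] /andP[a3 a4].
    by rewrite /f; move: c2' s0'; rewrite /s; lra.
  have Mt : is_weighted alpha01 th (real_weight alpha01 f) (Mop chi).
    by apply: weighted_ext (hM chi eps hchi (lexx _)).
  have [S1 [r1 [hS1 res1 lead1 _]]] := base_lead A0 hf th1 Mt (growth0 _ ht) f0 (minimal0 _ ht)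
    (decay0 f chi eps hchi (lexx _) E).
  have -> : g (rc t) = q by symmetry; apply: uniq res1 lead1; exact: le_trans qc c3.
  by rewrite -rcD subrK.
apply: (@cderiv_real_analytic_at R (fun z => g z + rc (P 0)) P r).
- by rewrite !lt_min rho0 rho10.
- move=> z; rewrite !lt_min => /and3P[_ h _]; have [h1 _] := hg z h.
  by apply: cderivD h1 _; exact: cderiv_cst.
- exact: key.
Qed.
End pressure_analyticity.

(** * Power series and holomorphic families of potentials *)

Section power_series_identity.
Context {R : realType}.

Lemma power_series_zero (b : nat -> R) (r : R) : 0 < r ->
  (forall h, 0 <= h -> h < r -> pseries b h @ \oo --> (0 : R)) -> forall n, b n = 0.
Proof.
move=> r0 hb; pose r1 := r / 2.
have r10 : 0 < r1 by rewrite divr_gt0.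
have [M [M0 hM]] : exists M : R, 0 <= M /\ forall k, `|b k| <= M / r1 ^+ k.
  have hc : pseries b r1 @ \oo --> (0 : R) by apply: hb; [exact: ltW|rewrite /r1; lra].
  have h0 : (fun k => b k * r1 ^+ k) @ \oo --> (0 : R).
    by apply: cvg_series_cvg_0; apply/cvg_ex; exists 0.
  have [M [_ hM]] : bounded_fun (fun k => b k * r1 ^+ k) by apply: cvg_seq_bounded; apply/cvg_ex; exists 0.
  exists (`|M| + 1); split; first by rewrite addr_ge0.
  move=> k; rewrite ler_pdivlMr ?exprn_gt0//.
  have := hM (`|M| + 1); rewrite ltr_pwDr ?ler_norm// => /(_ isT k I).
  by rewrite /= normrM [`|r1 ^+ k|]ger0_norm// exprn_ge0// ltW.
move=> n; elim/ltn_ind: n => n IH.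
apply/eqP; rewrite -normr_le0; apply/ler_addgt0Pr => e e0; rewrite add0r.
pose h := Num.min (r1 / 2) (e * r1 ^+ n.+1 / (2 * (M + 1))).
have M1 : 0 < 2 * (M + 1) by rewrite mulr_gt0// ltr_wpDl.
have h0 : 0 < h by rewrite lt_min !divr_gt0//= mulr_gt0// exprn_gt0.
have hr1 : h <= r1 / 2 by rewrite ge_min lexx.
have he : h * (2 * (M + 1)) <= e * r1 ^+ n.+1.
  by rewrite -ler_pdivlMr// ge_min lexx orbT.
pose q : R := h / r1.
have q0 : 0 <= q by rewrite divr_ge0// ltW.
have q1 : q <= 1 / 2 by rewrite ler_pdivrMr//; lra.
have part N : `|\sum_(0 <= k < (n.+1 + N)%N) b k * h ^+ k - b n * h ^+ n| <= M * (2 * q ^+ n.+1 - q ^+ (n.+1 + N) * 2).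
  elim: N => [|N IHN].
    rewrite addn0 big_nat_recr//= big_nat big1 ?add0r ?subrr ?normr0; last first.
      by move=> k /andP[_ kn]; rewrite IH// mul0r.
    by rewrite [_ * 2]mulrC subrr mulr0.
  rewrite addnS big_nat_recr//= -addrA [_ - b n * _]addrC addrA.
  apply: le_trans (ler_normD _ _) _; apply: le_trans (lerD IHN (lexx _)) _.
  have k1 : `|b (n.+1 + N)%N * h ^+ (n.+1 + N)| <= M * q ^+ (n.+1 + N).
    rewrite normrM [`|h ^+ _|]ger0_norm ?exprn_ge0 ?(ltW h0)//.
    apply: le_trans (ler_wpM2r _ (hM _)) _; first by rewrite exprn_ge0// ltW.
    by rewrite /q [(h / r1) ^+ _]expr_div_n [leLHS]mulrAC [leRHS]mulrA.
  have k2 : M * (q ^+ (n.+1 + N) * (q * 2)) <= M * (q ^+ (n.+1 + N) * 1).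
    by apply: ler_wpM2l => //; apply: ler_wpM2l; [exact: exprn_ge0|lra].
  by rewrite [q ^+ (n.+1 + N).+1]exprSr; lra.
have hr : h < r by rewrite /r1 in hr1; lra.
have lim0 : pseries b h @ \oo --> (0 : R) by apply: hb => //; exact: ltW.
have bound : `|0 - b n * h ^+ n| <= M * (2 * q ^+ n.+1).
  have lim1 : (fun N => `|pseries b h N - b n * h ^+ n|) @ \oo --> `|0 - b n * h ^+ n|.
    by apply: cvg_norm; apply: cvgB lim0 _; exact: cvg_cst.
  apply: (cvgr_to_le lim1); exists n.+1 => //= N nN.
  have := part (N - n.+1)%N; rewrite subnKC// /pseries /series /= => h3; apply: le_trans h3 _.
  by apply: ler_wpM2l => //; rewrite gerBl mulr_ge0// exprn_ge0.
move: bound; rewrite sub0r normrN normrM [`|h ^+ _|]ger0_norm ?exprn_ge0 ?(ltW h0)// => bound.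
have hn : 0 < h ^+ n by rewrite exprn_gt0.
have rn : 0 < r1 ^+ n.+1 by rewrite exprn_gt0.
rewrite -(ler_pM2r hn); apply: le_trans bound _.
rewrite /q expr_div_n exprS -(ler_pM2r rn).
rewrite (_ : M * _ * _ = 2 * M * h * h ^+ n); last by field; rewrite gt_eqF.
rewrite (_ : e * h ^+ n * r1 ^+ n.+1 = e * r1 ^+ n.+1 * h ^+ n); last by ring.
by rewrite ler_pM2r//; lra.
Qed.

Lemma real_analytic_affine (g : R -> R) (t c : R) : real_analytic_at g t ->
  (forall h, 0 <= h -> g (t + h) = (1 + h) * c) ->
  exists2 r : R, 0 < r & forall h, `|h| < r -> g (t + h) = (1 + h) * c.
Proof.
move=> [a [r r0 ha]] hg; exists r => //.
pose l k : R := if (k < 2)%N then c else 0.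
have lin h : pseries l h @ \oo --> (1 + h) * c.
  have E : \forall N \near \oo, pseries l h N = (1 + h) * c.
    exists 2%N => //= N; elim: N => // -[//|N] IH N2; have [N1|N1] := leqP 2 N.+1.
      by have := IH N1; rewrite /pseries /series /= => IH1; rewrite big_nat_recr//= IH1 /l ltnNge N1 /= mul0r addr0.
    move: N1 N2; case: N {IH} => // _ _.
    by rewrite /pseries /series /= !big_nat_recr//= big_nil /l /= expr0 expr1; ring.
  exact: (@cvg_near_cst _ _ _ _ _ _ E).
have diff h s : `|h| < r -> pseries a h @ \oo --> s -> pseries (fun k => a k - l k) h @ \oo --> s - (1 + h) * c.
  move=> hr hs; have := cvgB hs (lin h).
  have -> : pseries (fun k => a k - l k) h = pseries a h - pseries l h.
    by apply/funext => N; rewrite /pseries /series /= fctE -sumrB; apply: eq_bigr => k _; rewrite mulrBl.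
  exact.
have b0 : forall k, a k - l k = 0.
  apply: (power_series_zero r0) => h h0 hr.
  have hr' : `|h| < r by rewrite ger0_norm.
  have := diff h _ hr' (ha h hr'); by rewrite hg// subrr.
move=> h hr; have := ha h hr.
have -> : a = l by apply/funext => k; apply/eqP; rewrite -subr_eq0 b0.
by move=> h1; exact: (cvg_unique _ h1 (lin h)).
Qed.

Lemma real_analytic_shift (g : R -> R) t : real_analytic_at (fun h => g (t + h)) 0 -> real_analytic_at g t.
Proof.
by move=> [a [r r0 h]]; exists a, r => // x hx; have := h x hx; rewrite add0r.
Qed.

End power_series_identity.

Section holder_norm_bounds.
Context {R : realType} (alpha : R) (V : normedZmodType R).

Lemma holder_norm_le (f : R -> V) (e : R) : (holder_norm alpha f <= e%:E)%E ->
  (forall x, 0 <= x <= 1 -> `|f x| <= e) /\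
  (forall x y, 0 <= x <= 1 -> 0 <= y <= 1 -> `|f x - f y| <= e * `|x - y| `^ alpha).
Proof.
rewrite /holder_norm.
set S1 := (X in (ereal_sup X + _)%E); set S2 := (X in (_ + ereal_sup X)%E) => he.
have in1 x : 0 <= x <= 1 -> (`|f x|%:E <= ereal_sup S1)%E.
  by move=> hx; apply: ereal_sup_ubound; exists x => //; rewrite /unit_itv /= in_itv.
have in2 x y : 0 <= x <= 1 -> 0 <= y <= 1 -> x != y -> ((`|f x - f y| / `|x - y| `^ alpha)%:E <= ereal_sup S2)%E.
  by move=> hx hy xy; apply: ereal_sup_ubound; exists (x, y) => //; split; rewrite // /unit_itv /= in_itv.
have i0 : 0 <= (0 : R) <= 1 by rewrite lexx ler01.
have i1 : 0 <= (1 : R) <= 1 by rewrite lexx ler01.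
have p1 : (0 <= ereal_sup S1)%E by apply: le_trans (in1 0 i0); rewrite lee_fin.
have p2 : (0 <= ereal_sup S2)%E.
  by apply: le_trans (in2 0 1 i0 i1 _); rewrite ?lee_fin ?divr_ge0 ?powR_ge0// eq_sym oner_neq0.
split=> [x hx|x y hx hy].
  by rewrite -lee_fin; apply: le_trans he; apply: le_trans (in1 x hx) _; rewrite leeDl.
have [->|xy] := eqVneq x y.
  rewrite !subrr normr0 mulr_ge0 ?powR_ge0// -lee_fin; apply: le_trans he.
  exact: adde_ge0.
have h : ((`|f x - f y| / `|x - y| `^ alpha)%:E <= e%:E)%E.
  by apply: le_trans he; apply: le_trans (in2 x y hx hy xy) _; rewrite leeDr.
by move: h; rewrite lee_fin ler_pdivrMr// powR_gt0// normr_gt0 subr_eq0.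
Qed.
End holder_norm_bounds.

Section holomorphic_family.
Context {R : realType} (alpha : R).
Local Notation K := R[i].
Local Notation X := (@I01 R).
Local Notation pot := (potential alpha).

Lemma holder_norm_potential (f : R -> Rcomplex R) e : (holder_norm alpha f <= e%:E)%E -> pot e (fun x : X => f (val x)).
Proof.
move=> /holder_norm_le[h1 h2]; split=> [x|x y].
  by rewrite cn_Rcomplex; exact: h1 (valP x).
by rewrite cn_Rcomplex; exact: h2 (valP x) (valP y).
Qed.

Lemma holder_potential (f : R -> Rcomplex R) : holder alpha f -> exists a, pot a (fun x : X => f (val x)).
Proof.
rewrite /holder => h; exists (fine (holder_norm alpha f)); apply: holder_norm_potential.
have i0 : 0 <= (0 : R) <= 1 by rewrite lexx ler01.
case: (holder_norm alpha f) h => [r|//|] _; first by [].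
by rewrite leNye.
Qed.

Lemma cnormE (z : cplx R) : `|z| = (cn z)%:C. Proof. by case: z. Qed.

Lemma nbhs_cplx (z : cplx R) (U : set (cplx R)) : nbhs z U -> exists2 del : R, 0 < del & forall w, cn (w - z) < del -> U w.
Proof.
move=> /nbhs_ballP[[e1 e2]] /= ; rewrite ltcE /= => /andP[/eqP e20 e0] h.
exists e1 => // w hw; apply: h; rewrite -ball_normE /= distrC cnormE ltcE /= e20 eqxx.
exact: hw.
Qed.

Lemma holomorphic_diff (U : set (cplx R)) (Phi : cplx R -> R -> Rcomplex R) : holomorphic_holder alpha U Phi ->
  forall z, U z -> exists (D : X -> K) (a : R), pot a D /\ forall e : R, 0 < e -> exists2 del : R, 0 < del &
    forall w : K, cn (w - z) < del -> pot (e * cn (w - z)) (fun x => Phi w (val x) - Phi z (val x) - (w - z) * D x).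
Proof.
move=> hol z Uz; have [_ [D hD lim]] := hol z Uz.
have [a ha] := holder_potential hD.
exists (fun x => D (val x)), a; split=> // e e0.
have nb0 : nbhs (0%:E : \bar R) [set y | (y < e%:E)%E] by exact: (@nbhs_open_ereal_lt _ _ (fun=> e)).
have /nbhs_cplx[del del0 hdel] := lim _ nb0.
exists del => // w hw; have [wz|wz] := eqVneq w z.
  rewrite wz subrr cn0 mulr0; have := pot_cst alpha (0 : K); rewrite cn0; apply: pot_ext => x.
  by rewrite mul0r subrr subr0.
have h1 := hdel w hw wz.
have h2 := potZ (w - z) (holder_norm_potential (ltW h1)).
rewrite mulrC; apply: pot_ext h2 => x.
have wz0 : w - z != 0 by rewrite subr_eq0.
rewrite mulrBr; congr (_ - _).
have cancel (b c : K) : c != 0 -> c * (b / c) = b by move=> c0; rewrite mulrC divfK.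
exact: cancel.
Qed.
End holomorphic_family.

(** * The phase transition *)

Section freezing.
Context {R : realType} (alpha : R).
Hypothesis alpha01 : 0 < alpha <= 1.
Local Notation K := R[i].
Local Notation X := (@I01 R).
Local Notation pot := (potential alpha).
Local Notation T := (intermittent alpha).
Local Notation growth_le := (growth_le alpha01).

Lemma family_data (I : set R) (phi : R -> R -> R) : open I -> I 0 -> real_analytic_family alpha I phi ->
  exists (rho A : R) (F : K -> X -> K), [/\ 0 < rho, 0 <= A,
    forall t, `|t| < rho -> forall x, F (rc t) x = rc (phi t (val x)),
    forall t, `|t| < rho -> rholder alpha A (fun x => phi t (val x)) &
    forall z, cn z < rho -> exists D a, pot a D /\ forall e : R, 0 < e -> exists2 del : R, 0 < del &
      forall w : K, cn (w - z) < del -> pot (e * cn (w - z)) (fun x => F w x - F z x - (w - z) * D x)].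
Proof.
move=> oI I0 [_ [U [Phi [oU IU hol PhiE]]]].
have [r1 /= r10 h1] : nbhs_ball (0 : R) I by apply/nbhs_ballP; exact: open_nbhs_nbhs.
have [r2 r20 h2] : exists2 del : R, 0 < del & forall w : cplx R, cn (w - 0%:C) < del -> U w.
  by apply: nbhs_cplx; apply: open_nbhs_nbhs; split=> //; exact: IU.
have U0 z : cn z < r2 -> U z by move=> hz; apply: h2; rewrite (_ : z - 0%:C = z)//; exact: subr0.
pose F (z : K) (x : X) : K := Phi z (val x).
have dF z : cn z < r2 -> exists D a, pot a D /\ forall e : R, 0 < e -> exists2 del : R, 0 < del &
    forall w : K, cn (w - z) < del -> pot (e * cn (w - z)) (fun x => F w x - F z x - (w - z) * D x).
  by move=> /U0 Uz; exact: (holomorphic_diff hol Uz).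
have Ir t : `|t| < r1 -> I t by move=> ht; apply: h1; rewrite -ball_normE /= sub0r normrN.
have F_real t : `|t| < r1 -> forall x, F (rc t) x = rc (phi t (val x)).
  by move=> /Ir ht x; apply: PhiE => //; rewrite /unit_itv /= in_itv /=; exact: (valP x).
have [a0 ha0] : exists a, pot a (F 0).
  have [h _] := hol _ (IU 0 I0); exact: holder_potential h.
have [r3 r30 h3] := F_near r20 dF ltr01.
pose rho := Num.min r1 (Num.min r2 r3).
exists rho, (1 + a0), F; split.
- by rewrite !lt_min r10 r20.
- by rewrite addr_ge0// (pot_ge0 ha0).
- by move=> t; rewrite lt_min => /andP[h _]; exact: F_real.
- move=> t; rewrite !lt_min => /and3P[k1 k2 k3] x y.
  have k4 : cn (rc t) < r3 by rewrite cn_rc.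
  have [_ h] := potD (h3 _ k4) ha0.
  by have := h x y; rewrite !subrK !F_real// -rcB cn_rc.
- by move=> z; rewrite !lt_min => /and3P[_ h _]; exact: dF.
Qed.

Section one_potential.
Variables (A : R) (f : X -> R) (f0 : R -> R).
Hypothesis A0 : 0 <= A.
Hypothesis hf : rholder alpha A f.
Hypothesis f0E : forall x : X, f0 (val x) = f x.
Local Notation P := (pressure_temp T f0).
Local Notation c := (f I01_0).

Lemma rholder_scale b : 0 <= b -> rholder alpha (b * A) (fun x => b * f x).
Proof. by move=> b0 x y; rewrite -mulrBr normrM ger0_norm// -mulrA ler_wpM2l. Qed.

Let bA b : 0 <= b -> 0 <= b * A. Proof. by move=> b0; exact: mulr_ge0. Qed.
Let bE b (x : X) : b * f0 (val x) = b * f x. Proof. by rewrite f0E. Qed.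

Lemma temp_growth b : 0 <= b -> growth_le (fun x => b * f x) (P b).
Proof. by move=> b0; exact: (pressure_growth alpha01 (bA b0) (rholder_scale b0) (bE b)). Qed.

Lemma temp_le_growth b p : 0 <= b -> growth_le (fun x => b * f x) p -> P b <= p.
Proof. by move=> b0; exact: (pressure_le_growth (bA b0) (rholder_scale b0) (bE b)). Qed.

Lemma temp_ge_fixpoint b : 0 <= b -> b * c <= P b.
Proof.
by move=> b0; exact: (pressure_ge_fixpoint alpha01 (bA b0) (rholder_scale b0) (bE b)).
Qed.

Lemma temp_analytic b : 0 < b -> b * c < P b -> real_analytic_at P b.
Proof.
move=> b0 gap; apply: real_analytic_shift.
pose B := `|c| + A.
have B0 : 0 <= B by exact: addr_ge0.
have hB : pot B (fun x => rc (f x)).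
  split=> [x|x y]; first by rewrite cn_rc; exact: (rholder_bound alpha01 A0 hf).
  rewrite -rcB cn_rc; apply: le_trans (hf x y) _.
  by apply: ler_wpM2r; [exact: powR_ge0|rewrite lerDr].
have pos t : `|t| < b -> 0 <= b + t by rewrite ltr_norml => /andP[h _]; lra.
apply: (@pressure_analytic R alpha alpha01 (2 * b * A) b (fun z x => (rc b + z) * rc (f x)) (fun t x => (b + t) * f x)).
- by rewrite !mulr_ge0// ltW.
- exact: b0.
- by move=> t _ x; rewrite -rcD -rcM.
- move=> t ht x y; apply: le_trans (rholder_scale (pos t ht) x y) _.
  apply: ler_wpM2r; first exact: powR_ge0.
  by apply: ler_wpM2r => //; move: ht; rewrite ltr_norml => /andP[_ h]; lra.
- move=> z _; exists (fun x => rc (f x)), B; split=> // e e0; exists 1 => // w _.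
  have := pot_cst alpha (0 : K); rewrite cn0 => h.
  apply: (pot_ext _ (pot_le h _)) => [x|]; first by ring.
  by rewrite mulr_ge0 ?cn_ge0// ltW.
- by move=> t /pos; exact: temp_growth.
- by move=> t /pos ht p hp /(temp_le_growth ht); rewrite leNgt hp.
- by rewrite addr0.
Qed.

Lemma temp_frozen b : P 1 = c -> 1 <= b -> P b = b * c.
Proof.
move=> P1 b1; have b0 : 0 <= b by exact: le_trans b1.
apply: le_anti; rewrite temp_ge_fixpoint// andbT; apply: temp_le_growth => //.
rewrite (growth_subc _ _ _ (b * c)) subrr.
have : growth_le (fun x => f x - c) 0.
  have := temp_growth ler01; rewrite (growth_subc _ _ _ c) P1 subrr.
  by rewrite (_ : (fun y => 1 * f y - c) = (fun x => f x - c))//; apply/funext => y; rewrite mul1r.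
set psi := fun x => f x - c.
have -> : (fun y => b * f y - b * c) = (fun y => b * psi y) by apply/funext => y; rewrite -mulrBr.
move=> g e e0; have eb : 0 < e / b by rewrite divr_gt0//; lra.
have [C hC] := g _ eb; exists (b * C) => N.
have birk u : birkhoff alpha01 (fun y => b * psi y) u I01_1 = b * birkhoff alpha01 psi u I01_1.
  by elim: u => [|a u IH] /=; [rewrite mulr0|rewrite IH -mulrDr].
pose Z := partition_sum alpha01 psi N I01_1.
have hZ : Z <= expR (C + N%:R * (e / b)) by have := hC N; rewrite add0r.
have S_Z u : u \in words N -> expR (birkhoff alpha01 psi u I01_1) <= Z.
  move=> hu; rewrite /Z /partition_sum (big_rem u)//= lerDl.
  by apply: sumr_ge0 => v _; exact: expR_ge0.
have Z0 : 0 <= Z by apply: sumr_ge0 => v _; exact: expR_ge0.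
set E := C + _ in hZ.
apply: (@le_trans _ _ (expR ((b - 1) * E) * Z)).
  rewrite /Z /partition_sum mulr_sumr big_seq [leRHS]big_seq; apply: ler_sum => u hu.
  rewrite birk (_ : b * _ = (b - 1) * birkhoff alpha01 psi u I01_1 + birkhoff alpha01 psi u I01_1); last by ring.
  rewrite expRD ler_wpM2r ?expR_ge0// ler_expR ler_wpM2l ?subr_ge0//.
  by rewrite -ler_expR; exact: le_trans (S_Z u hu) hZ.
apply: (@le_trans _ _ (expR ((b - 1) * E) * expR E)); first by rewrite ler_wpM2l ?expR_ge0.
rewrite -expRD ler_expR /E le_eqVlt; apply/orP; left; apply/eqP; field.
by rewrite gt_eqF//; lra.
Qed.
End one_potential.

Lemma pressure_family_frozen (rho A b : R) (F : K -> X -> K) (phi : R -> R -> R) :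
  0 < rho -> 0 <= A -> (forall t, `|t| < rho -> forall x, F (rc t) x = rc (phi t (val x))) ->
  (forall t, `|t| < rho -> rholder alpha A (fun x : X => phi t (val x))) ->
  (forall z, cn z < rho -> exists D a, pot a D /\ forall e : R, 0 < e -> exists2 del : R, 0 < del &
      forall w : K, cn (w - z) < del -> pot (e * cn (w - z)) (fun x => F w x - F z x - (w - z) * D x)) ->
  0 < b < 1 -> pressure_temp T (phi 0) b = b * phi 0 0 ->
  real_analytic_at (fun t => pressure T (phi t)) 0.
Proof.
move=> rho0 A0 F_real hphi dF b01 Pb; have /andP[b0 b1] := b01.
have rho00 : `|0 : R| < rho by rewrite normr0.
pose c t := phi t 0; pose psi t (x : X) := phi t (val x) - c t.
have hpsi t : `|t| < rho -> rholder alpha A (psi t).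
  by move=> ht x y; rewrite /psi opprB addrA subrK; exact: hphi.
have psi0 t : psi t I01_0 = 0 by rewrite /psi subrr.
have grow : growth_le (fun x => b * psi 0 x) 0.
  have := temp_growth A0 (hphi 0 rho00) (fun=> erefl) (ltW b0).
  rewrite Pb (growth_subc _ _ _ (b * phi 0 0)) subrr.
  rewrite (_ : (fun y => b * phi 0 (\val y) - _) = (fun x => b * psi 0 x))//.
  by apply/funext => y; rewrite -mulrBr.
have [del del0 hdel] := growth_stable A0 (hpsi 0 rho00) (psi0 0) b01 grow.
have [r r0 hr] := F_near rho0 dF del0.
have frozen t : `|t| < Num.min rho r -> pressure T (phi t) = c t.
  rewrite lt_min => /andP[ht htr].
  have g : growth_le (psi t) 0.
    apply: (hdel _ A A0 (hpsi t ht) (psi0 t)) => x.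
    have htr' : cn (rc t) < r by rewrite cn_rc.
    have [_ h] := hr _ htr'.
    have := h x I01_0; rewrite !F_real// -!rcB cn_rc /dist /= subr0.
    have /andP[x0 _] := valP x; rewrite (ger0_norm x0) ler_norml => /andP[_].
    by rewrite /psi /c; lra.
  apply: le_anti; rewrite (pressure_ge_fixpoint alpha01 A0 (hphi t ht) (fun=> erefl)) andbT.
  apply: (pressure_le_growth A0 (hphi t ht) (fun=> erefl)).
  by rewrite (growth_subc _ _ _ (c t)) subrr.
apply: (@cderiv_real_analytic_at R (fun z => F z I01_0) _ (Num.min rho r)).
- by rewrite lt_min rho0.
- move=> z; rewrite lt_min => /andP[hz _]; have [D [a [_ hD]]] := dF z hz.
  exists (D I01_0) => e e0; have [d d0 hd] := hD e e0; exists d => // w hw.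
  by have [h _] := hd w hw; rewrite [D _ * _]mulrC; exact: h.
- move=> t ht; rewrite frozen//; apply: F_real.
  by move: ht; rewrite lt_min => /andP[].
Qed.
End freezing.

Close Scope complex_scope.

Theorem corollary3 (R : realType) (alpha : R) (I : set R) (phi : R -> R -> R)
    (alpha_gt0 : 0 < alpha) (alpha_le1 : alpha <= 1)
    (I_open : open I) (I_itv : is_interval I) (I0 : I 0)
    (phi_analytic : real_analytic_family alpha I phi)
    (phase_transition :
      ~ real_analytic_at
          (fun tau => pressure (intermittent alpha) (phi tau)) 0) :
  phase_transition_in_temperature (intermittent alpha) (phi 0) /\
  beta_crit (intermittent alpha) (phi 0) = 1%:E.
Proof.
have alpha01 : 0 < alpha <= 1 by rewrite alpha_gt0.
have [rho [A [F [rho0 A0 F_real hphi dF]]]] := family_data I_open I0 phi_analytic.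
have rho00 : `|0 : R| < rho by rewrite normr0.
have h0 := hphi 0 rho00.
pose c := phi 0 0.
set P := pressure_temp (intermittent alpha) (phi 0).
have P_ge b : 0 <= b -> b * c <= P b by exact: (temp_ge_fixpoint alpha01 A0 h0 (fun=> erefl)).
have P1 : P 1 = c.
  apply: le_anti; rewrite -[X in _ && (X <= _)]mul1r P_ge// andbT leNgt; apply/negP => gap.
  have P1E : P 1 = pressure (intermittent alpha) (phi 0).
    by congr pressure; apply/funext => x; rewrite mul1r.
  apply: phase_transition.
  apply: (pressure_analytic (alpha01 := alpha01) A0 rho0 F_real hphi dF).
  - by move=> t ht; exact: (pressure_growth alpha01 A0 (hphi t ht) (fun=> erefl)).
  - move=> t ht p hp /(pressure_le_growth A0 (hphi t ht) (fun=> erefl)).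
    by rewrite leNgt hp.
  - by rewrite -P1E.
have P_gap b : 0 < b < 1 -> b * c < P b.
  move=> b01; have /andP[b0 _] := b01; rewrite lt_neqAle P_ge ?ltW// andbT eq_sym; apply/eqP => Pb.
  exact/phase_transition/(pressure_family_frozen alpha01 rho0 A0 F_real hphi dF b01 Pb).
have P_frozen b : 1 <= b -> P b = b * c by exact: (temp_frozen alpha01 A0 h0 (fun=> erefl) P1).
have not_analytic : ~ real_analytic_at P 1.
  move=> han; have [|r r0 hr] := real_analytic_affine (c := c) han.
    by move=> h h0'; apply: P_frozen; rewrite lerDl.
  pose h := Num.min (r / 2) (1 / 2).
  have hp : 0 < h by rewrite lt_min !divr_gt0.
  have h1 : h <= r / 2 by rewrite ge_min lexx.
  have h2 : h <= 1 / 2 by rewrite ge_min lexx orbT.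
  have b01 : 0 < 1 - h < 1 by apply/andP; split; lra.
  have E : P (1 - h) = (1 - h) * c.
    by apply: hr; rewrite normrN (ger0_norm (ltW hp)) (le_lt_trans h1)// ltr_pdivrMr//; lra.
  by have := P_gap _ b01; rewrite E ltxx.
have analytic b : 0 < b -> ~ real_analytic_at P b -> b = 1.
  move=> b0 nan; apply: contrapT => /eqP b1; apply: nan.
  have [bl|bg] : b < 1 \/ 1 < b by apply/orP; rewrite -neq_lt.
    by apply: (temp_analytic alpha01 (f0 := phi 0) A0 h0 (fun=> erefl) b0); apply: P_gap; rewrite b0.
  apply: real_analytic_shift.
  apply: (@cderiv_real_analytic_at R (fun z => (rc b + z) * rc c) _ (b - 1)).
  - by rewrite subr_gt0.
  - move=> z _; apply: cderivM; last exact: cderiv_cst.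
    by apply: cderivD; [exact: cderiv_cst|exact: cderiv_id].
  - move=> t; rewrite ltr_norml => /andP[ht _].
    by rewrite P_frozen -?rcD -?rcM//; lra.
have ptt : phase_transition_in_temperature (intermittent alpha) (phi 0).
  by move=> /(_ 1 ltr01); exact: not_analytic.
split=> //; rewrite /beta_crit asboolT//; congr EFin.
have ex : is_phase_transition_parameter (intermittent alpha) (phi 0) 1 by split=> //.
by have [b0 bn _] := xgetPex 0 (ex_intro _ 1 ex); exact: analytic.
Qed.
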